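(* Let $\Omega\subset\mathbb{R}^N$ be an appropriately smooth open domain, $T>0$, $Q_T=\Omega\times(0,T)$. Let $a(s,x,t)\ge0$ be such that $a(\cdot,x,t)$ is a $C^1(\overline{Q_T})$ function of $(x,t)$ with $a(s,x,t)=0$ for $x\in\partial\Omega$ (all $s,t$), and $a(s,x,t)$ is bounded when $s$ is bounded; let $f_i\in C^1(\overline\Omega)$, $i=1,\dots,N$, and let $c(x,t)$, $g(x,t)$ be bounded. Suppose that there exist constants $\delta_2>0$ and $C_0$ such that $$\left|\sqrt{a(s,x,t)}-\sqrt{a(s,y,t)}\right|\le C_0|x-y|^{2+\delta_2}\qquad\text{for all } x,y\in\Omega \text{ and all } s,t,$$ that $a_{x_i}(s,x,t)=0$ for $x\in\partial\Omega$, $i=1,\dots,N$ (all $s,t$), and that $f_i(x)=0$ for $x\in\partial\Omega$, $i=1,\dots,N$. If $u$ and $v$ are two entropy solutions (in the sense defined in the context) of $$\frac{\partial u}{\partial t}-\frac{\partial}{\partial x_i}\left(a(u,x,t)\frac{\partial u}{\partial x_i}\right)-f_i(x)\frac{\partial u}{\partial x_i}+c(x,t)u=g(x,t),\qquad (x,t)\in Q_T,$$ (summation over repeated $i$) with initial values $u_0,v_0\in L^\infty(\Omega)$ respectively, then there is a constant $C$ such that for almost every $t\in(0,T)$ $$\int_\Omega|u(x,t)-v(x,t)|\,dx\le C\int_\Omega|u_0(x)-v_0(x)|\,dx.$$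
   Context: Notation: for small $\eta>0$, $h_\eta(s)=\frac{2}{\eta}\left(1-\frac{|s|}{\eta}\right)_+$, $S_\eta(s)=\int_0^s h_\eta(\tau)\,d\tau$, $I_\eta(u-k)=\int_0^{u-k}S_\eta(s)\,ds$, $A_\eta(u,x,t,k)=\int_k^u a(s,x,t)S_\eta(s-k)\,ds$. $a_{x_i}(s,x,t)$ denotes the partial derivative of $a$ in its argument $x_i$, $f_{ix_i}=\partial f_i/\partial x_i$; repeated indices $i$ are summed from $1$ to $N$. $C_0^k$ denotes compactly supported $C^k$ functions. $BV(Q_T)$ is the space of $L^1(Q_T)$ functions whose distributional derivatives (in $x$ and $t$) are finite measures. For $u\in BV(Q_T)$, $\Gamma_u$ is the set of jump points of $u$, $\nu$ is the normal to $\Gamma_u$ at $X=(x,t)$, and $u^+(X),u^-(X)$ are the approximate limits of $u$ at $X\in\Gamma_u$ with respect to $(\nu,Y-X)>0$ and $(\nu,Y-X)<0$; off the jump set $u^+=u^-$ is the approximate limit. For continuous $p(s,x,t)$, the composite mean value is $\widehat{p}(u,x,t)=\int_0^1 p(\tau u^++(1-\tau)u^-,x,t)\,d\tau$; $\widehat{\sqrt{a(u,x,t)}}$ is the composite mean value of $\sqrt{a}$. Definition (entropy solution). A function $u\in BV(Q_T)\cap L^\infty(Q_T)$ is an entropy solution of the equation with initial value $u_0$ if: 1. There exist $g^i\in L^2(Q_T)$, $i=1,\dots,N$, such that for every $\varphi\in C_0^1(Q_T)$, $\iint_{Q_T}\varphi g^i\,dxdt=\iint_{Q_T}\varphi\,\widehat{\sqrt{a(u,x,t)}}\,\frac{\partial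 u}{\partial x_i}$, where $\partial u/\partial x_i$ is a measure. 2. For every $\varphi\in C_0^2(Q_T)$ with $\varphi\ge0$, every $k\in\mathbb{R}$ and every small $\eta>0$, $$\iint_{Q_T}\Big[I_\eta(u-k)\varphi_t-f_i(x)I_\eta(u-k)\varphi_{x_i}+A_\eta(u,x,t,k)\Delta\varphi-\sum_{i=1}^N S_\eta'(u-k)|g^i|^2\varphi\Big]dxdt$$ $$+\iint_{Q_T}\int_k^u a_{x_i}(s,x,t)S_\eta(s-k)\,ds\,\varphi_{x_i}\,dxdt-\iint_{Q_T}f_{ix_i}(x)(u-k)\varphi S_\eta(u-k)\,dxdt$$ $$+\iint_{Q_T}f_{ix_i}(x)\int_k^u(s-k)h_\eta(s-k)\,ds\,\varphi\,dxdt-\iint_{Q_T}[c(x,t)u-g(x,t)]\varphi S_\eta(u-k)\,dxdt\ \ge 0.$$ 3. $\lim_{t\to0}\int_\Omega|u(x,t)-u_0(x)|\,dx=0$. *)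

(* Defs.v *)
From HB Require Import structures.
From mathcomp Require Import all_boot all_order all_algebra.
From mathcomp Require Import all_classical all_reals all_analysis.

Set Implicit Arguments.
Unset Strict Implicit.
Unset Printing Implicit Defensive.

Import Order.TTheory GRing.Theory Num.Theory.
Import numFieldNormedType.Exports.

Local Open Scope classical_set_scope.
Local Open Scope ring_scope.

Definition rV_display : measure_display. Proof. exact. Qed.

(** [lebesgue_measure] lives on the type alias [measurableTypeR R], which carries
    no topology; this is the same set function on [R] itself. *)
Section lebesgue_R.
Context {R : realType}.

Definition lebesgue_R : set R -> \bar R := @lebesgue_measure R.

Let lebesgue_R0 : lebesgue_R set0 = 0%E.
Proof. exact: (@measure0 _ _ _ (@lebesgue_measure R)). Qed.

Let lebesgue_R_ge0 A : (0 <= lebesgue_R A)%E.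
Proof. exact: (@measure_ge0 _ _ _ (@lebesgue_measure R)). Qed.

Let lebesgue_R_sigma_additive : semi_sigma_additive lebesgue_R.
Proof. exact: (@measure_semi_sigma_additive _ _ _ (@lebesgue_measure R)). Qed.

HB.instance Definition _ := isMeasure.Build _ _ _
  lebesgue_R lebesgue_R0 lebesgue_R_ge0 lebesgue_R_sigma_additive.

Let lebesgue_R_sigma_finite : sigma_finite setT lebesgue_R.
Proof. exact: (sigma_finiteT (@lebesgue_measure R)). Qed.

HB.instance Definition _ := @Measure_isSigmaFinite.Build _ _ _
  lebesgue_R lebesgue_R_sigma_finite.

End lebesgue_R.

(** The sigma-algebra generated by the coordinates is the Borel one. *)
Section measurable_rV.
Context {R : realType} (n : nat).

Let coords : 'I_n -> 'rV[R]_n -> R := fun i x => x 0 i.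

Let rV_set0 : g_sigma_preimage coords set0.
Proof. exact: sigma_algebra0. Qed.

Let rV_setC A : g_sigma_preimage coords A -> g_sigma_preimage coords (~` A).
Proof. exact: sigma_algebraC. Qed.

Let rV_bigcup (F : _^nat) : (forall i, g_sigma_preimage coords (F i)) ->
  g_sigma_preimage coords (\bigcup_i (F i)).
Proof. exact: sigma_algebra_bigcup. Qed.

HB.instance Definition _ := @isMeasurable.Build rV_display
  'rV[R]_n (g_sigma_preimage coords) rV_set0 rV_setC rV_bigcup.

Lemma measurable_fun_rVP d (T : measurableType d) (f : T -> 'rV[R]_n) :
  measurable_fun [set: T] f <->
  forall i, measurable_fun [set: T] (fun t => f t 0 i).
Proof.
apply: (@iff_trans _ (g_sigma_preimage
    (fun i => coords i \o f) `<=` measurable)).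
  rewrite g_sigma_preimage_comp; split=> [mf A [/= C preC <-]|prefS].
    exact: mf.
  by move=> _ A mA; apply: prefS; exists A.
split=> [fS i|mf].
- move=> _ A mA.
  apply: fS; apply: sub_sigma_algebra => /=.
  rewrite -bigcup_seq/=; exists i => /=; first by rewrite mem_index_enum.
  by exists A.
- apply: smallest_sub; first exact: sigma_algebra_measurable.
  rewrite -bigcup_seq/=; apply: bigcup_sub => i _.
  by move=> A [B mB <-]; exact: mf.
Qed.

End measurable_rV.

Section lebesgue_rV.
Context {R : realType}.
Local Open Scope ereal_scope.

Definition rV_cons n (z : R * 'rV[R]_n) : 'rV[R]_n.+1 :=
  \row_i oapp (z.2 0%R) z.1 (unlift ord0 i).

Lemma rV_cons0 n (z : R * 'rV[R]_n) : rV_cons z 0%R ord0 = z.1.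
Proof. by rewrite mxE unlift_none. Qed.

Lemma rV_consS n (z : R * 'rV[R]_n) j : rV_cons z 0%R (lift ord0 j) = z.2 0%R j.
Proof. by rewrite mxE liftK. Qed.

Lemma measurable_coord n (i : 'I_n) :
  measurable_fun setT (fun x : 'rV[R]_n => x 0%R i).
Proof. by have /measurable_fun_rVP := @measurable_id _ 'rV[R]_n setT; exact. Qed.

Lemma measurable_rV_cons n : measurable_fun setT (@rV_cons n).
Proof.
apply/measurable_fun_rVP => i; case: (unliftP ord0 i) => [j ->|->].
- apply: (eq_measurable_fun (fun z : R * 'rV[R]_n => z.2 0%R j)).
    by move=> z _; rewrite rV_consS.
  exact: (measurableT_comp (measurable_coord j) measurable_snd).
- apply: (eq_measurable_fun fst) => [z _|]; last exact: measurable_fst.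
  by rewrite rV_cons0.
Qed.

Section step.
Variables (n : nat) (m : {sigma_finite_measure set 'rV[R]_n -> \bar R}).

Definition lebesgue_step : set 'rV[R]_n.+1 -> \bar R :=
  pushforward (lebesgue_R \x m) (@rV_cons n).

Let step0 : lebesgue_step set0 = 0.
Proof. by rewrite /lebesgue_step /pushforward preimage_set0 measure0. Qed.

Let step_ge0 A : 0 <= lebesgue_step A.
Proof. by rewrite /lebesgue_step /pushforward measure_ge0. Qed.

Let step_sigma_additive : semi_sigma_additive lebesgue_step.
Proof.
have mc A : measurable A -> measurable (@rV_cons n @^-1` A).
  by move=> mA; rewrite -[X in measurable X]setTI; exact: measurable_rV_cons.
move=> F mF tF mUF; rewrite /lebesgue_step /pushforward preimage_bigcup.
apply: measure_semi_sigma_additive.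
- by move=> k; exact: mc.
- apply/trivIsetP => /= i j _ _ ij; rewrite -preimage_setI.
  by move/trivIsetP : tF => /(_ _ _ _ _ ij) ->//; rewrite preimage_set0.
- by rewrite -preimage_bigcup; exact: mc.
Qed.

HB.instance Definition _ := isMeasure.Build _ _ _
  lebesgue_step step0 step_ge0 step_sigma_additive.

Let step_sigma_finite : sigma_finite setT lebesgue_step.
Proof.
have /sigma_finiteP[F [TF ndF Foo]] := sigma_finiteT (@lebesgue_R R).
have /sigma_finiteP[G [TG ndG Goo]] := sigma_finiteT m.
pose tl (x : 'rV[R]_n.+1) : R * 'rV[R]_n :=
  (x 0%R ord0, \row_j x 0%R (lift ord0 j))%R.
have tlK z : tl (rV_cons z) = z.
  case: z => x y; rewrite /tl rV_cons0; congr pair.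
  by apply/rowP => j; rewrite mxE rV_consS.
have mtl : measurable_fun setT tl.
  apply/measurable_fun_pairP; split; first exact: measurable_coord.
  apply/measurable_fun_rVP => i.
  by under eq_fun do rewrite mxE; exact: measurable_coord.
exists (fun k => tl @^-1` (F k `*` G k)).
  rewrite -preimage_bigcup (_ : \bigcup_k _ = setT) ?preimage_setT//.
  rewrite -setXTT TF TG predeqE => -[x y]; split.
    by move=> [k _ []/= ? ?]; split; exists k.
  move=> [/= [k _ Fkx] [l _ Gly]]; exists (maxn k l) => //; split.
  - by move: x Fkx; exact/subsetPset/ndF/leq_maxl.
  - by move: y Gly; exact/subsetPset/ndG/leq_maxr.
move=> k; have [mF Fk] := Foo k; have [mG Gk] := Goo k; split.
  by rewrite -[X in measurable X]setTI; apply: mtl => //; exact: measurableX.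
rewrite /lebesgue_step /pushforward -comp_preimage.
rewrite (_ : tl \o _ = id); last by apply/funext => z /=; rewrite tlK.
by rewrite preimage_id product_measure1E// lte_mul_pinfty// ge0_fin_numE.
Qed.

HB.instance Definition _ := @Measure_isSigmaFinite.Build _ _ _
  lebesgue_step step_sigma_finite.

End step.

Fixpoint lebesgue_rV (n : nat) : {sigma_finite_measure set 'rV[R]_n -> \bar R} :=
  if n is k.+1 then lebesgue_step (lebesgue_rV k) else \d_(0%R : 'rV[R]_0).

(** The recursion does give Lebesgue measure: boxes have the expected volume. *)
Lemma lebesgue_rV_box n (A : 'I_n -> set R) : (forall i, measurable (A i)) ->
  lebesgue_rV n [set x | forall i, A i (x 0%R i)] =
  \prod_(i < n) lebesgue_R (A i).
Proof.
elim: n A => [|n IH] A mA.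
  rewrite big_ord0 /= diracE mem_set//=; by case.
rewrite big_ord_recl -IH//=.
rewrite /lebesgue_step /pushforward /=.
rewrite -product_measure1E//.
- congr (product_measure1 _ _ _).
  apply/seteqP; split => -[x y]/=.
  + move=> H; split => [|i]/=; first by have := H ord0; rewrite rV_cons0.
    by have := H (lift ord0 i); rewrite rV_consS.
  + move=> [/= Hx Hy] i.
    by case: (unliftP ord0 i) => [j|] ->; rewrite ?rV_consS ?rV_cons0.
- rewrite [X in measurable X](_ : _ =
      \bigcap_(i in [set: 'I_n]) [set x : 'rV[R]_n | A (lift ord0 i) (x 0%R i)]).
    apply: fin_bigcap_measurable => // i _.
    rewrite -[X in measurable X]setTI.
    exact: measurable_coord.
  by apply/seteqP; split => x /= H i; [move=> _|]; exact: H.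
Qed.

End lebesgue_rV.

Section calculus.
Context {R : realType} {V : normedModType R}.
Implicit Types (D : set V) (f : V -> R).

(** [C^k] on an open set; in finite dimension, existence and continuity of the
    iterated partial derivatives amounts to that of all iterated directional
    derivatives. *)
Fixpoint Ck (k : nat) D f : Prop :=
  (forall x, D x -> {for x, continuous f}) /\
  (if k is k'.+1 then
     forall v, (forall x, D x -> derivable f x v) /\ Ck k' D ('D_v f)
   else True).

(** Compactly supported [C^k] functions on the open set [D], extended by zero. *)
Definition C0k (k : nat) D f : Prop :=
  Ck k setT f /\
  exists K, [/\ compact K, K `<=` D & forall x, ~ K x -> f x = 0].

Definition C0infty D f : Prop := forall k, C0k k D f.

(** Continuous extension to [closure D] of the derivative along [v]. *)
Definition closure_derive D v f (x : V) : R :=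
  lim ('D_v f y @[y --> within D (nbhs x)]).

(** [C^1(closure D)]: the function and its first derivatives are continuous up
    to the boundary and bounded, the boundedness being automatic when [D] is
    relatively compact. *)
Definition C1_closure D f : Prop :=
  [/\ Ck 1 D f,
      {within closure D, continuous f},
      (exists M, forall x, D x -> `|f x| <= M) &
      forall v, {within closure D, continuous (closure_derive D v f)} /\
        exists M, forall x, D x -> `|'D_v f x| <= M].

Definition boundary (D : set V) : set V := closure D `\` interior D.

(** Connected open sets that are, near each boundary point, the positivity set
    of a [C^1] function with nonvanishing derivative. *)
Definition smooth_domain D : Prop :=
  [/\ open D, connected D, D !=set0 &
      forall x, boundary D x -> exists (U : set V) (psi : V -> R),
        [/\ nbhs x U, Ck 1 setT psi, exists v, 'D_v psi x != 0 &
            forall y, U y -> (D y <-> 0 < psi y)]].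

End calculus.

Section integration.
Context {R : realType}.

Definition oriented_int (p q : R) (F : R -> R) : R :=
  if p <= q then \int[lebesgue_measure]_(s in `[p, q]) F s
  else - \int[lebesgue_measure]_(s in `[q, p]) F s.

Context d {T : measurableType d}.

Definition Lp_on (mu : {measure set T -> \bar R}) (p : \bar R) (D : set T)
  (f : T -> R) : Prop := (f \_ D) \in Lfun mu p.

Definition bounded_measurable (D : set T) (f : T -> R) : Prop :=
  measurable_fun D f /\ exists M, forall x, D x -> `|f x| <= M.

Definition hahn_pos (m : {charge set T -> \bar R}) : set T :=
  projT1 (cid (Hahn_decomposition m)).

Definition hahn_neg (m : {charge set T -> \bar R}) : set T :=
  projT1 (cid (projT2 (cid (Hahn_decomposition m)))).

Definition hahn_posneg (m : {charge set T -> \bar R}) :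
    hahn_decomposition m (hahn_pos m) (hahn_neg m) :=
  projT2 (cid (projT2 (cid (Hahn_decomposition m)))).

Definition charge_int (m : {charge set T -> \bar R}) (D : set T)
    (F : T -> R) : R :=
  \int[jordan_pos (hahn_posneg m)]_(x in D) F x -
  \int[jordan_neg (hahn_posneg m)]_(x in D) F x.

End integration.

Section spacetime.
Context {R : realType} {N : nat}.
Local Notation X := ('rV[R]_N * R)%type.
Implicit Types (x y nu : X) (Q : set X) (u phi : X -> R).

Definition lebesgue_xt : {measure set X -> \bar R} :=
  [the {measure set X -> \bar R} of (lebesgue_rV N \x lebesgue_R)%E].

Definition cylinder (Omega : set 'rV[R]_N) (T : R) : set X :=
  Omega `*` `]0, T[.

(** The norms of the library on ['rV_N] and on products are maximum norms. *)
Definition enorm (z : 'rV[R]_N) : R := Num.sqrt (\sum_i (z 0 i) ^+ 2).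

Definition xt_dot x y : R := (\sum_i x.1 0 i * y.1 0 i) + x.2 * y.2.

Definition xt_ball x (r : R) : set X :=
  [set y | Num.sqrt (xt_dot (y - x) (y - x)) < r].

Definition ei (i : 'I_N) : 'rV[R]_N := delta_mx 0 i.
Definition dx (i : 'I_N) phi : X -> R := 'D_((ei i, 0) : X) phi.
Definition dt phi : X -> R := 'D_((0, 1) : X) phi.
Definition laplacian phi x : R := \sum_i dx i (dx i phi) x.

Definition distr_derivative Q (v : X) u (m : {charge set X -> \bar R}) : Prop :=
  forall phi, C0infty Q phi ->
    \int[lebesgue_xt]_(x in Q) (u x * 'D_v phi x) =
    - charge_int m Q phi.

Definition BV Q u : Prop :=
  [/\ Lp_on lebesgue_xt 1%E Q u,
      forall i, exists m, distr_derivative Q (ei i, 0) u m &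
      exists m, distr_derivative Q (0, 1) u m].

(** [l] is the approximate limit of [u] at [x] with respect to [E]: the part of
    [E] where [u] is at distance at least [e] from [l] has density 0 at [x]. *)
Definition approx_limit (E : set X) u x (l : R) : Prop :=
  forall e : R, 0 < e ->
    fine (lebesgue_xt (xt_ball x r `&` E `&` [set y | e <= `|u y - l|])) /
    fine (lebesgue_xt (xt_ball x r)) @[r --> 0^'+] --> (0 : R).

Definition half_space x nu : set X := [set y | 0 < xt_dot nu (y - x)].

Definition jump_at u x nu (up um : R) : Prop :=
  [/\ xt_dot nu nu = 1, approx_limit (half_space x nu) u x up,
      approx_limit (half_space x (- nu)) u x um & up != um].

Definition jump_set u : set X :=
  [set x | exists nu up um, jump_at u x nu up um].

Definition is_traces u x (w : R * R) : Prop :=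
  (exists nu, jump_at u x nu w.1 w.2) \/
  (~ jump_set u x /\ w.1 = w.2 /\ approx_limit setT u x w.1).

(** The pair [(u^+ x, u^- x)]. At a jump point it is determined up to the swap
    coming from the orientation of the normal; the value [(0, 0)] is used where
    neither a jump nor an approximate limit exists, which for a function of
    bounded variation is a null set for its derivative. *)
Definition traces u x : R * R := xget (0, 0) (is_traces u x).

(** Invariant under the swap of [u^+] and [u^-]. *)
Definition composite_mean (p : R -> X -> R) u x : R :=
  \int[lebesgue_measure]_(tau in `[0, 1])
    p (tau * (traces u x).1 + (1 - tau) * (traces u x).2) x.

Definition h_eta (eta s : R) : R := 2 / eta * Num.max 0 (1 - `|s| / eta).
Definition S_eta (eta s : R) : R := oriented_int 0 s (h_eta eta).
Definition I_eta (eta w : R) : R := oriented_int 0 w (S_eta eta).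
Definition A_eta (eta : R) (a : R -> X -> R) (w : R) x (k : R) : R :=
  oriented_int k w (fun s => a s x * S_eta eta (s - k)).

Definition divf (f : 'I_N -> 'rV[R]_N -> R) (z : 'rV[R]_N) : R :=
  \sum_i 'D_(ei i) (f i) z.

Definition entropy_ineq Q (a : R -> X -> R) (f : 'I_N -> 'rV[R]_N -> R)
    (c g : X -> R) u (G : 'I_N -> X -> R) phi (k eta : R) : Prop :=
  0 <=
    \int[lebesgue_xt]_(x in Q)
      (I_eta eta (u x - k) * dt phi x
       - \sum_i f i x.1 * I_eta eta (u x - k) * dx i phi x
       + A_eta eta a (u x) x k * laplacian phi x
       - \sum_i derive1 (S_eta eta) (u x - k) * `|G i x| ^+ 2 * phi x)
  + \int[lebesgue_xt]_(x in Q)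
      (\sum_i oriented_int k (u x) (fun s => dx i (a s) x * S_eta eta (s - k))
              * dx i phi x)
  - \int[lebesgue_xt]_(x in Q)
      (divf f x.1 * (u x - k) * phi x * S_eta eta (u x - k))
  + \int[lebesgue_xt]_(x in Q)
      (divf f x.1
       * oriented_int k (u x) (fun s => (s - k) * h_eta eta (s - k)) * phi x)
  - \int[lebesgue_xt]_(x in Q)
      ((c x * u x - g x) * phi x * S_eta eta (u x - k)).

(** "Every small [eta]" means every [eta] below a threshold that does not depend
    on the test function nor on [k]. *)
Definition entropy_solution (Omega : set 'rV[R]_N) (T : R)
    (a : R -> X -> R) (f : 'I_N -> 'rV[R]_N -> R) (c g : X -> R)
    (u0 : 'rV[R]_N -> R) u : Prop :=
  let Q := cylinder Omega T in
  [/\ BV Q u, Lp_on lebesgue_xt +oo%E Q u,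
      exists G : 'I_N -> X -> R,
        [/\ forall i, Lp_on lebesgue_xt 2%:E Q (G i),
            forall i m, distr_derivative Q (ei i, 0) u m ->
              forall phi, C0k 1 Q phi ->
              \int[lebesgue_xt]_(x in Q) (phi x * G i x) =
              charge_int m Q (fun x =>
                phi x * composite_mean (fun s y => Num.sqrt (a s y)) u x) &
            exists eta0 : R, 0 < eta0 /\
              forall phi, C0k 2 Q phi -> (forall x, 0 <= phi x) ->
              forall k eta : R, 0 < eta < eta0 ->
              entropy_ineq Q a f c g u G phi k eta] &
      (\int[lebesgue_rV N]_(x in Omega) `|u (x, t) - u0 x|%:E)%E
        @[t --> 0^'+] --> 0%E].

End spacetime.

(* Main.v *)
(** The square root of [a] is Hoelder continuous in [x] with an exponent above 1, so [a] does
    not depend on [x] inside the connected cylinder; vanishing on the lateral boundary, it is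
    identically 0 unless [Omega] is the whole space. In the entropy inequality take [k] above,
    then below, the range of the solution, where [S_eta eta (u - k)] is constant. Letting
    [eta] tend to 0 gives an identity that is linear in the test function. For two solutions,
    [w := u - v] therefore satisfies
      [int w * (Phi_t - f . grad Phi - (c + div f) * Phi + b * laplacian Phi) = 0],
    where [b >= 0] is a difference quotient of a primitive of [a]. Cutoffs near the lateral
    boundary disappear in the limit because [f] vanishes there while [b = 0], and a cutoff
    near [t = 0] produces the initial distance [y0].

    The estimate then follows by duality. The adjoint problem, with [b] replaced by a Lipschitz
    approximation bounded below by [eps], is solved by an explicit finite difference scheme
    interpolated by B-splines. The discrete energy estimate bounds [eps * |laplacian Phi|^2]
    in L1 uniformly in [eps], which absorbs the error made on [b], and the discrete maximum
    principle bounds [Phi]. Hence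
      [int_(al < t < be) |w| <= (be - al) * (C * y0 + K * int_(t <= be) |w|)],
    and the theorem is a consequence of Gronwall's argument and Lebesgue differentiation. *)

Require Import Defs.
From HB Require Import structures.
From mathcomp Require Import all_boot all_order all_algebra.
From mathcomp Require Import all_classical all_reals all_analysis.
From mathcomp Require Import ring lra measurable_realfun.

Set Implicit Arguments.
Unset Strict Implicit.
Unset Printing Implicit Defensive.

Import Order.TTheory GRing.Theory Num.Theory.
Import numFieldNormedType.Exports.

Local Open Scope classical_set_scope.
Local Open Scope ring_scope.

(** * Finite differences *)

(** The obstacle is that the diffusion [b] of the adjoint problem, a quotient by [w], is merely
    bounded and measurable and may vanish, so that problem offers no regularity beyond its energy.
    Two features make the energy enough. The equation is not in divergence form: testing it with the
    Laplacian of [Phi] produces the dissipation [b * |laplacian Phi| ^+ 2] without differentiating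
    [b], so the bound involves neither [eps] nor the Lipschitz constant of the approximation. And
    all scales hang on one parameter [s]: with [eps = s ^+ 2] and an approximation of [b] within
    [s ^+ 4] in L1 weighted by [|w|], Young's inequality with weight [s ^+ 3] makes the error in the
    diffusion of order [s]. The kernel width [delta] is fixed after the Lipschitz constant, the box
    after [delta], the mesh last. An explicit scheme turns existence into a recursion, and both
    estimates into statements about finite sums. The zeroth-order coefficient is kept out of the
    scheme; it supplies the integral of [|w|] over the past. *)

Section finite_differences.
Context {R : realFieldType} {G : finType} {N : nat}.
Variables (s s' : 'I_N -> G -> G) (h : R).
Hypothesis sK : forall i, cancel (s i) (s' i).
Hypothesis s'K : forall i, cancel (s' i) (s i).
Hypothesis sC : forall i j k, s i (s j k) = s j (s i k).
Hypothesis h_gt0 : 0 < h.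
Implicit Types (phi psi : G -> R) (i j : 'I_N) (k : G).

Definition fwd i psi k := (psi (s i k) - psi k) / h.
(** The transport term uses central differences because they are skew-adjoint: [ctr_skew] then costs
    only the Lipschitz constant of [f], and [max_step] only the condition [|f| * h <= 2 * b]. *)
Definition ctr i psi k := (psi (s i k) - psi (s' i k)) / (2 * h).
Definition diff2 i psi k := (psi (s i k) - 2 * psi k + psi (s' i k)) / h ^+ 2.
Definition dlap psi k := \sum_i diff2 i psi k.
(** The discrete Dirichlet energy without the cell volume; the factor [h ^+ N] is supplied in
    [nz_energy] and [psi_energy]. *)
Definition dir psi := \sum_i \sum_k fwd i psi k ^+ 2.

Lemma s'C i j k : s i (s' j k) = s' j (s i k).
Proof. by apply: (can_inj (sK j)); rewrite -sC !s'K. Qed.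

Lemma sum_shift i psi : \sum_k psi (s i k) = \sum_k psi k.
Proof.
rewrite [RHS](reindex (s i))//; exists (s' i) => k _; [exact: sK|exact: s'K].
Qed.

Lemma sum_shift' i psi : \sum_k psi (s' i k) = \sum_k psi k.
Proof.
rewrite [RHS](reindex (s' i))//; exists (s i) => k _; [exact: s'K|exact: sK].
Qed.

Lemma sum_by_parts i phi psi :
  \sum_k fwd i phi k * fwd i psi k = - \sum_k phi k * diff2 i psi k.
Proof.
have E k : fwd i phi k * fwd i psi k =
    (phi (s i k) * (psi (s i k) - psi (s' i (s i k))) -
     phi k * (psi (s i k) - psi k)) / h ^+ 2.
  by rewrite sK /fwd; field; rewrite gt_eqF.
rewrite (eq_bigr _ (fun k _ => E k)) -mulr_suml sumrB
  (sum_shift i (fun k => phi k * (psi k - psi (s' i k)))) -sumrB.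
rewrite mulr_suml -sumrN; apply: eq_bigr => k _; rewrite /diff2.
by field; rewrite gt_eqF.
Qed.

Lemma dirD tau phi psi : dir (fun k => psi k + tau * phi k) =
  dir psi - 2 * tau * (\sum_k phi k * dlap psi k) + tau ^+ 2 * dir phi.
Proof.
have E i : \sum_k fwd i (fun k => psi k + tau * phi k) k ^+ 2 =
   \sum_k fwd i psi k ^+ 2 - 2 * tau * (\sum_k phi k * diff2 i psi k) +
   tau ^+ 2 * \sum_k fwd i phi k ^+ 2.
  rewrite -[in RHS](opprK (\sum_k phi k * _)) -sum_by_parts.
  rewrite mulrN opprK !mulr_sumr -!big_split; apply: eq_bigr => k _ /=.
  by rewrite /fwd; field; rewrite gt_eqF.
rewrite /dir (eq_bigr _ (fun i _ => E i)) big_split sumrB /= -!mulr_sumr.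
congr (_ - _ * _ + _); rewrite exchange_big /=; apply: eq_bigr => k _.
by rewrite -mulr_sumr.
Qed.

(** The inverse inequality of the grid. Together with the bound on the time step it absorbs the term
    in [tau ^+ 2] that an explicit step adds to the energy. *)
Lemma dir_le psi : dir psi <= 4 * N%:R / h ^+ 2 * \sum_k psi k ^+ 2.
Proof.
have E i : \sum_k fwd i psi k ^+ 2 <= 4 / h ^+ 2 * \sum_k psi k ^+ 2.
  apply: (@le_trans _ _ (\sum_k (2 / h ^+ 2 * psi (s i k) ^+ 2 + 2 / h ^+ 2 * psi k ^+ 2))).
    apply: ler_sum => k _; rewrite /fwd exprMn exprVn -mulrDr.
    rewrite mulrC -mulrA [2 * _]mulrC -mulrA ler_pM2l ?invr_gt0 ?exprn_gt0//.
    by have := sqr_ge0 (psi (s i k) + psi k); nra.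
  rewrite big_split /= -!mulr_sumr (sum_shift i (fun k => psi k ^+ 2)).
  by lra.
rewrite /dir; apply: le_trans (ler_sum _ (fun i _ => E i)) _.
rewrite sumr_const card_ord -mulr_natr.
by rewrite le_eqVlt; apply/orP; left; apply/eqP; ring.
Qed.

(** A central difference is the mean of two neighbouring forward differences, so convexity of the
    square suffices. *)
Lemma ctr_le i psi : \sum_k ctr i psi k ^+ 2 <= \sum_k fwd i psi k ^+ 2.
Proof.
apply: (@le_trans _ _ (\sum_k (2^-1 * fwd i psi k ^+ 2 + 2^-1 * fwd i psi (s' i k) ^+ 2))).
  apply: ler_sum => k _.
  have -> : ctr i psi k = 2^-1 * (fwd i psi k + fwd i psi (s' i k)).
    by rewrite /ctr /fwd s'K; field; rewrite gt_eqF.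
  by have := sqr_ge0 (fwd i psi k - fwd i psi (s' i k)); nra.
rewrite big_split /= -!mulr_sumr (sum_shift' i (fun k => fwd i psi k ^+ 2)).
by lra.
Qed.

Lemma fwd_ctr i j psi k : fwd j (ctr i psi) k = ctr i (fwd j psi) k.
Proof.
rewrite /fwd /ctr !(sC j i) s'C; field; by rewrite gt_eqF.
Qed.

(** Shifting the index in the half of the sum that contains [psi (s' i k)] leaves products
    [psi k * psi (s i k)] weighted by a difference of [f]. *)
Lemma ctr_skew (f : G -> R) L i psi : 0 <= L ->
  (forall k, `|f (s i k) - f k| <= L * h) ->
  `|\sum_k f k * ctr i psi k * psi k| <= L / 2 * \sum_k psi k ^+ 2.
Proof.
move=> L0 fL.
have -> : \sum_k f k * ctr i psi k * psi k =
    \sum_k (f k - f (s i k)) * psi k * psi (s i k) / (2 * h).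
  have E k : f k * ctr i psi k * psi k =
      f k * psi k * psi (s i k) / (2 * h) - f (s i (s' i k)) * psi (s i (s' i k)) * psi (s' i k) / (2 * h).
    by rewrite s'K /ctr; field; rewrite gt_eqF.
  rewrite (eq_bigr _ (fun k _ => E k)) sumrB.
  rewrite (sum_shift' i (fun k => f (s i k) * psi (s i k) * psi k / (2 * h))).
  rewrite -sumrB; apply: eq_bigr => k _.
  by field; rewrite gt_eqF.
apply: le_trans (ler_norm_sum _ _ _) _.
apply: (@le_trans _ _ (\sum_k (L / 4 * psi k ^+ 2 + L / 4 * psi (s i k) ^+ 2))).
  apply: ler_sum => k _; rewrite -!mulrA normrM distrC.
  apply: le_trans (ler_wpM2r (normr_ge0 _) (fL k)) _.
  rewrite !normrM [`|(_ * _)^-1|]gtr0_norm ?invr_gt0 ?mulr_gt0//.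
  have -> : L * h * (`|psi k| * (`|psi (s i k)| * (2 * h)^-1)) =
     L * (`|psi k| * `|psi (s i k)| / 2).
    by field; rewrite gt_eqF.
  rewrite -(real_normK (num_real (psi k))) -(real_normK (num_real (psi (s i k)))).
  set A := `|psi k|; set B := `|psi (s i k)|.
  have := mulr_ge0 L0 (sqr_ge0 (A - B)); lra.
rewrite big_split /= -!mulr_sumr (sum_shift i (fun k => psi k ^+ 2)).
by lra.
Qed.

(** Summation by parts in direction [j] gives [ctr i (fwd j psi) * fwd j psi], to which [ctr_skew]
    applies, and a term in which the difference falls on [f]. No second difference of [psi]
    survives. *)
Lemma ctr_diff2_le (f : G -> R) L i j psi : 0 <= L ->
  (forall l k, `|f (s l k) - f k| <= L * h) ->
  `|\sum_k f k * ctr i psi k * diff2 j psi k| <=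
    L * \sum_k fwd j psi k ^+ 2 + L / 2 * \sum_k fwd i psi k ^+ 2.
Proof.
move=> L0 fL.
have -> : \sum_k f k * ctr i psi k * diff2 j psi k =
  - (\sum_k f k * ctr i (fwd j psi) k * fwd j psi k +
     \sum_k fwd j f k * ctr i psi (s j k) * fwd j psi k).
  rewrite -[LHS]opprK -sum_by_parts -big_split; congr (- _).
  apply: eq_bigr => k _ /=; rewrite -mulrDl; congr (_ * _).
  by rewrite -fwd_ctr /fwd; field; rewrite gt_eqF.
rewrite normrN; apply: le_trans (ler_normD _ _) _.
have h1 := @ctr_skew f L i (fwd j psi) L0 (fL i).
have h2 : `|\sum_k fwd j f k * ctr i psi (s j k) * fwd j psi k| <=
   L / 2 * \sum_k fwd i psi k ^+ 2 + L / 2 * \sum_k fwd j psi k ^+ 2.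
  apply: le_trans (ler_norm_sum _ _ _) _.
  apply: (@le_trans _ _ (\sum_k (L / 2 * ctr i psi (s j k) ^+ 2 + L / 2 * fwd j psi k ^+ 2))).
    apply: ler_sum => k _; rewrite 2!normrM.
    rewrite -(real_normK (num_real (ctr _ _ _))) -(real_normK (num_real (fwd j psi k))).
    set A := `|ctr _ _ _|; set B := `|fwd j psi k|.
    have fl : `|fwd j f k| <= L.
      by rewrite /fwd normrM normfV (gtr0_norm h_gt0) ler_pdivrMr.
    rewrite -mulrA; apply: le_trans (ler_wpM2r _ fl) _; first by rewrite mulr_ge0 ?normr_ge0.
    have := mulr_ge0 L0 (sqr_ge0 (A - B)); lra.
  rewrite big_split /= -!mulr_sumr (sum_shift j (fun k => ctr i psi k ^+ 2)).
  by rewrite lerD2r ler_wpM2l ?divr_ge0// ctr_le.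
by lra.
Qed.

(** The adjoint equation with time reversed and source [zeta]. The zeroth-order coefficient is left
    out; [source_est_s] treats it as a perturbation. *)
Definition gen (b : G -> R) (f : 'I_N -> G -> R) (zeta psi : G -> R) k :=
  b k * dlap psi k - \sum_i f i k * ctr i psi k + zeta k.

Lemma sqr_sum_le (I : finType) (x : I -> R) :
  (\sum_i x i) ^+ 2 <= #|I|%:R * \sum_i x i ^+ 2.
Proof.
have : 0 <= \sum_i \sum_j (x i - x j) ^+ 2.
  by do 2 (apply: sumr_ge0 => ? _); exact: sqr_ge0.
have E (i : I) : \sum_j (x i - x j) ^+ 2 =
   #|I|%:R * x i ^+ 2 - 2 * x i * (\sum_j x j) + \sum_j x j ^+ 2.
  rewrite mulr_sumr mulr_natl -sumr_const -sumrB -big_split; apply: eq_bigr => j _ /=.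
  by ring.
rewrite (eq_bigr _ (fun (i : I) _ => E i)) big_split sumrB /= -mulr_sumr -mulr_suml -mulr_sumr.
have -> : \sum_(i : I) \sum_(j : I) x j ^+ 2 = #|I|%:R * \sum_j x j ^+ 2.
  by rewrite mulr_natl -sumr_const.
by rewrite -mulrA -expr2; set a := #|I|%:R * _; lra.
Qed.

(** * One explicit step: energy estimate and maximum principle *)

Section step.
Variables (b : G -> R) (f : 'I_N -> G -> R) (zeta psi : G -> R) (M F L tau : R).
Hypothesis M_ge1 : 1 <= M.
Hypothesis F_ge0 : 0 <= F.
Hypothesis L_ge0 : 0 <= L.
Hypothesis tau_gt0 : 0 < tau.
Hypothesis bM : forall k, 0 <= b k <= M.
Hypothesis fF : forall i k, `|f i k| <= F.
Hypothesis fL : forall i l k, `|f i (s l k) - f i k| <= L * h.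
Hypothesis cfl : tau * (12 * N%:R * M) <= h ^+ 2.

Let B := \sum_k b k * dlap psi k ^+ 2.
Let Z := \sum_k zeta k ^+ 2.

(** Only one factor [b k] is estimated by [M], so that the other remains as the weight in the
    dissipation [B]. *)
Lemma gen_sqr_le :
  \sum_k gen b f zeta psi k ^+ 2 <= 3 * (M * B + N%:R * F ^+ 2 * dir psi + Z).
Proof.
have E k : gen b f zeta psi k ^+ 2 <= 3 * (M * (b k * dlap psi k ^+ 2)
    + N%:R * F ^+ 2 * (\sum_i ctr i psi k ^+ 2) + zeta k ^+ 2).
  rewrite /gen; set X := b k * _; set Y := \sum_i _; set z := zeta k.
  have hX : X ^+ 2 <= M * (b k * dlap psi k ^+ 2).
    rewrite /X exprMn expr2 -mulrA; case/andP: (bM k) => b0 b1.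
    by rewrite ler_wpM2r// mulr_ge0// sqr_ge0.
  have hY : Y ^+ 2 <= N%:R * F ^+ 2 * (\sum_i ctr i psi k ^+ 2).
    apply: le_trans (sqr_sum_le _) _; rewrite card_ord -mulrA ler_wpM2l// mulr_sumr.
    apply: ler_sum => i _; rewrite exprMn ler_wpM2r ?sqr_ge0//.
    by rewrite -(real_normK (num_real (f i k))) lerXn2r// nnegrE.
  have := sqr_ge0 (X + Y); have := sqr_ge0 (X - z); have := sqr_ge0 (Y + z); nra.
apply: le_trans (ler_sum _ (fun k _ => E k)) _.
rewrite -mulr_sumr ler_wpM2l// !big_split /= -!mulr_sumr.
rewrite lerD2r lerD2l ler_wpM2l ?mulr_ge0 ?sqr_ge0// exchange_big /=.
by apply: ler_sum => i _; exact: ctr_le.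
Qed.

(** The diffusion tested with [dlap psi] is exactly [B], and no difference of [b] appears. The
    source is summed by parts, so that it enters through first differences of [zeta]. *)
Lemma gen_dlap_ge : B - 2 * N%:R * L * dir psi - (dir zeta + dir psi) / 2 <=
  \sum_k gen b f zeta psi k * dlap psi k.
Proof.
have -> : \sum_k gen b f zeta psi k * dlap psi k =
   B - \sum_i \sum_j \sum_k f i k * ctr i psi k * diff2 j psi k
   - \sum_j \sum_k fwd j zeta k * fwd j psi k.
  have -> : \sum_i \sum_j \sum_k f i k * ctr i psi k * diff2 j psi k =
     \sum_k (\sum_i f i k * ctr i psi k) * dlap psi k.
    under [RHS]eq_bigr do rewrite mulr_suml.
    rewrite [RHS]exchange_big /=; apply: eq_bigr => i _.
    by rewrite exchange_big; apply: eq_bigr => k _; rewrite -mulr_sumr.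
  have -> : \sum_j \sum_k fwd j zeta k * fwd j psi k = - \sum_k zeta k * dlap psi k.
    under [LHS]eq_bigr do rewrite sum_by_parts.
    by rewrite sumrN exchange_big; congr (- _); apply: eq_bigr => k _; rewrite -mulr_sumr.
  rewrite opprK -sumrB -big_split; apply: eq_bigr => k _ /=.
  by rewrite /gen; ring.
have h1 : \sum_i \sum_j \sum_k f i k * ctr i psi k * diff2 j psi k <= 2 * N%:R * L * dir psi.
  apply: (@le_trans _ _ (\sum_(i < N) \sum_(j < N)
     (L * \sum_k fwd j psi k ^+ 2 + L / 2 * \sum_k fwd i psi k ^+ 2))).
    apply: ler_sum => i _; apply: ler_sum => j _.
    by apply: le_trans (ler_norm _) _; apply: ctr_diff2_le.
  rewrite (eq_bigr (fun i => L * dir psi + N%:R * (L / 2 * \sum_k fwd i psi k ^+ 2))); last first.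
    by move=> i _; rewrite big_split /= -mulr_sumr sumr_const card_ord -[_ *+ N]mulr_natl.
  rewrite big_split /= sumr_const card_ord -!mulr_sumr -[_ *+ N]mulr_natl -/(dir psi).
  have : 0 <= N%:R * (L * dir psi).
    by rewrite !mulr_ge0//; do 2 (apply: sumr_ge0 => ? _); exact: sqr_ge0.
  lra.
have h2 : \sum_j \sum_k fwd j zeta k * fwd j psi k <= (dir zeta + dir psi) / 2.
  rewrite -big_split mulr_suml; apply: ler_sum => j _.
  rewrite -big_split mulr_suml; apply: ler_sum => k _ /=.
  by have := sqr_ge0 (fwd j zeta k - fwd j psi k); lra.
by lra.
Qed.

(** Of the gain [2 * tau * B] in the linear term, the quadratic term of the explicit step consumes
    at most [tau * B]; the other half is kept as dissipation. *)
Lemma energy_step : dir (fun k => psi k + tau * gen b f zeta psi k) + tau * B <=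
  (1 + tau * (4 * N%:R * L + 1 + N%:R * F ^+ 2)) * dir psi + tau * (dir zeta + Z).
Proof.
rewrite dirD.
have h1 := ler_wpM2l (ltW tau_gt0) gen_dlap_ge.
have h2 : tau ^+ 2 * dir (gen b f zeta psi) <=
    tau * (B + N%:R * F ^+ 2 * dir psi + Z).
  (* The 12 in [cfl] is 4 from the inverse inequality [dir_le] times 3 from the square of a
     three-term sum in [gen_sqr_le]. *)
  apply: (@le_trans _ _ (tau ^+ 2 * (4 * N%:R / h ^+ 2 *
     (3 * (M * B + N%:R * F ^+ 2 * dir psi + Z))))).
    rewrite ler_wpM2l ?sqr_ge0//; apply: le_trans (dir_le _) _.
    by rewrite ler_wpM2l// ?gen_sqr_le// divr_ge0 ?sqr_ge0// mulr_ge0 ?ler0n.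
  have B0 : 0 <= B.
    by apply: sumr_ge0 => k _; rewrite mulr_ge0 ?sqr_ge0//; case/andP: (bM k).
  have D0 : 0 <= N%:R * F ^+ 2 * dir psi.
    rewrite !mulr_ge0 ?sqr_ge0//.
    by do 2 (apply: sumr_ge0 => ? _); exact: sqr_ge0.
  have Z0 : 0 <= Z by apply: sumr_ge0 => k _; exact: sqr_ge0.
  set D := _ * dir psi in D0 *.
  have hX : M * B + D + Z <= M * (B + D + Z).
    by have := mulr_ge0 (_ : 0 <= M - 1) D0; have := mulr_ge0 (_ : 0 <= M - 1) Z0; rewrite subr_ge0 => /(_ M_ge1) ? /(_ M_ge1) ?; lra.
  have -> : tau ^+ 2 * (4 * N%:R / h ^+ 2 * (3 * (M * B + D + Z))) =
     tau * (tau * (12 * N%:R) / h ^+ 2 * (M * B + D + Z)).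
    by field; rewrite gt_eqF.
  rewrite ler_pM2l//; apply: le_trans (ler_wpM2l _ hX) _.
    by rewrite !mulr_ge0 ?invr_ge0 ?sqr_ge0// ltW.
  rewrite [leLHS]mulrA -[leRHS]mul1r ler_wpM2r ?addr_ge0//.
  by rewrite mulrAC ler_pdivrMr ?exprn_gt0// mul1r -mulrA.
lra.
Qed.

(** The new value, apart from the source, is a combination of the old values at [k] and its
    neighbours. The first two conditions make all the coefficients nonnegative, and they add up to
    1. *)
Lemma max_step p z : (forall k, 2 * N%:R * tau * b k <= h ^+ 2) ->
  (forall i k, `|f i k| * h <= 2 * b k) ->
  (forall k, `|psi k| <= p) -> (forall k, `|zeta k| <= z) ->
  forall k, `|psi k + tau * gen b f zeta psi k| <= p + tau * z.
Proof.
move=> cfl2 mono psip zetaz k.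
have -> : psi k + tau * gen b f zeta psi k =
   (1 - 2 * N%:R * tau * b k / h ^+ 2) * psi k +
   \sum_i (tau * (b k / h ^+ 2 - f i k / (2 * h)) * psi (s i k) +
           tau * (b k / h ^+ 2 + f i k / (2 * h)) * psi (s' i k)) + tau * zeta k.
  rewrite /gen /dlap mulr_sumr -sumrB mulrDr addrA; congr (_ + _).
  apply/eqP; rewrite -subr_eq0; apply/eqP.
  have -> (A B' C D' : R) : A + B' - (C * A + D') = A * (1 - C) + (B' - D') by ring.
  rewrite mulr_sumr -sumrB.
  under eq_bigr do rewrite /diff2 /ctr.
  rewrite (eq_bigr (fun _ => - (2 * tau * b k / h ^+ 2 * psi k))).
    rewrite sumr_const card_ord -mulr_natl; field; by rewrite gt_eqF.
  by move=> i _; field; rewrite gt_eqF.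
apply: le_trans (ler_normD _ _) _; apply: lerD; last first.
  by rewrite normrM gtr0_norm// ler_pM2l.
have pos1 : 0 <= 1 - 2 * N%:R * tau * b k / h ^+ 2.
  by rewrite subr_ge0 ler_pdivrMr ?exprn_gt0// mul1r.
have hb i : `|f i k| / (2 * h) <= b k / h ^+ 2.
  rewrite ler_pdivrMr ?mulr_gt0// mulrAC ler_pdivlMr ?exprn_gt0//.
  by rewrite expr2 mulrA [leRHS]mulrA [b k * 2]mulrC ler_pM2r.
have pos2 i : 0 <= tau * (b k / h ^+ 2 - f i k / (2 * h)).
  rewrite mulr_ge0 ?(ltW tau_gt0)// subr_ge0; apply: le_trans (hb i).
  by rewrite ler_pM2r ?invr_gt0 ?mulr_gt0// ler_norm.
have pos3 i : 0 <= tau * (b k / h ^+ 2 + f i k / (2 * h)).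
  rewrite mulr_ge0 ?(ltW tau_gt0)// -[f i k]opprK mulNr subr_ge0; apply: le_trans (hb i).
  by rewrite ler_pM2r ?invr_gt0 ?mulr_gt0// -normrN ler_norm.
apply: le_trans (ler_normD _ _) _.
rewrite normrM (ger0_norm pos1).
apply: (@le_trans _ _ ((1 - 2 * N%:R * tau * b k / h ^+ 2) * p +
   \sum_(i < N) (2 * tau * b k / h ^+ 2 * p))).
  apply: lerD; first by rewrite ler_wpM2l.
  apply: le_trans (ler_norm_sum _ _ _) _; apply: ler_sum => i _.
  apply: le_trans (ler_normD _ _) _.
  rewrite [`|_ * psi (s i k)|]normrM [`|_ * psi (s' i k)|]normrM (ger0_norm (pos2 i)) (ger0_norm (pos3 i)).
  have := ler_wpM2l (pos2 i) (psip (s i k)).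
  have := ler_wpM2l (pos3 i) (psip (s' i k)).
  lra.
rewrite sumr_const card_ord -[_ *+ N]mulr_natl.
by lra.
Qed.

End step.

Section iteration.
Variables (b : nat -> G -> R) (f : 'I_N -> G -> R) (zeta : nat -> G -> R).
Variables (M F L tau : R).

(** Explicit steps for the adjoint equation; time runs backward, and [scheme n] is
    later placed at time [T1 - n * tau]. *)
Fixpoint scheme n : G -> R :=
  if n is n'.+1 then
    fun k => scheme n' k + tau * gen (b n') f (zeta n') (scheme n') k
  else fun=> 0.

Lemma schemeS n k :
  scheme n.+1 k = scheme n k + tau * gen (b n) f (zeta n) (scheme n) k.
Proof. by []. Qed.

Hypothesis M_ge1 : 1 <= M.
Hypothesis F_ge0 : 0 <= F.
Hypothesis L_ge0 : 0 <= L.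
Hypothesis tau_gt0 : 0 < tau.
Hypothesis bM : forall n k, 0 <= b n k <= M.
Hypothesis fF : forall i k, `|f i k| <= F.
Hypothesis fL : forall i l k, `|f i (s l k) - f i k| <= L * h.
Hypothesis cfl : tau * (12 * N%:R * M) <= h ^+ 2.

Let C := 4 * N%:R * L + 1 + N%:R * F ^+ 2.

(** The discrete Gronwall inequality for [energy_step]. The scheme starts from 0, so only the
    sources contribute. *)
Lemma scheme_energy n :
  dir (scheme n) + tau * \sum_(j < n) \sum_k b j k * dlap (scheme j) k ^+ 2 <=
  (1 + tau * C) ^+ n * (tau * \sum_(j < n) (dir (zeta j) + \sum_k zeta j k ^+ 2)).
Proof.
have C0 : 0 <= C by rewrite !addr_ge0 ?mulr_ge0 ?sqr_ge0.
have c1 : 1 <= 1 + tau * C by rewrite lerDl mulr_ge0// ltW.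
have S0 (j : nat) : 0 <= dir (zeta j) + \sum_k zeta j k ^+ 2.
  rewrite addr_ge0//; last by apply: sumr_ge0 => *; exact: sqr_ge0.
  by do 2 (apply: sumr_ge0 => ? _); exact: sqr_ge0.
elim: n => [|n IH].
  rewrite !big_ord0 !mulr0 addr0 /dir /= big1// => i _.
  by rewrite big1// => k _; rewrite /fwd subrr mul0r expr0n.
have := @energy_step (b n) f (zeta n) (scheme n) M F L tau
  M_ge1 F_ge0 L_ge0 tau_gt0 (bM n) fF fL cfl.
rewrite -/C -[dir (fun k => _)]/(dir (scheme n.+1)).
set D' := dir (scheme n.+1) => st.
rewrite !big_ord_recr exprS; move: (scheme n) D' st IH => sn D' /= st IH.
set Sg := \sum_(j < n) (dir _ + _) in IH *.
set Bg := \sum_(j < n) \sum_k b j k * _ in IH *.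
set Dn := dir sn in IH st.
have Bg0 : 0 <= Bg.
  apply: sumr_ge0 => j _; apply: sumr_ge0 => k _.
  by rewrite mulr_ge0 ?sqr_ge0//; case/andP: (bM j k).
set c := 1 + tau * C in c1 IH st *.
have h1 : c * Dn + tau * Bg <= c * (c ^+ n * (tau * Sg)).
  apply: le_trans (ler_wpM2l (le_trans ler01 c1) IH).
  rewrite mulrDr lerD2l -[leLHS]mul1r ler_wpM2r//.
  by rewrite mulr_ge0// ltW.
have h2 : tau * (dir (zeta n) + \sum_k zeta n k ^+ 2) <= c * c ^+ n *
   (tau * (dir (zeta n) + \sum_k zeta n k ^+ 2)).
  apply: ler_peMl; last by rewrite -exprS exprn_ege1.
  by apply: mulr_ge0; [exact: ltW|exact: S0].
by move: st h1 h2; rewrite ![_ * (_ + _)]mulrDr !mulrA; lra.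
Qed.

(** Letting the bound [z] vary with the step matters: with the indicator of a time interval it
    yields the length of that interval in place of the elapsed time. *)
Lemma scheme_max (z : nat -> R) n :
  (forall n k, 2 * N%:R * tau * b n k <= h ^+ 2) ->
  (forall n i k, `|f i k| * h <= 2 * b n k) ->
  (forall n k, `|zeta n k| <= z n) ->
  forall k, `|scheme n k| <= tau * \sum_(j < n) z j.
Proof.
move=> c1 c2 zz; elim: n => [|n IH] k; first by rewrite big_ord0 mulr0 normr0.
rewrite big_ord_recr mulrDr schemeS.
exact: (max_step tau_gt0 (c1 n) (c2 n) IH (zz n)).
Qed.

End iteration.
End finite_differences.

(** * Cubic B-splines *)

Section spline.
Context {R : realType}.
Implicit Types (x y r : R).

Definition ppow (n : nat) y : R := Num.max 0 y ^+ n.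

Lemma ppow_pos n y : 0 <= y -> ppow n y = y ^+ n.
Proof. by move=> y0; rewrite /ppow max_r. Qed.

Lemma ppow_neg n y : y <= 0 -> ppow n.+1 y = 0.
Proof. by move=> y0; rewrite /ppow max_l// expr0n. Qed.

Lemma is_derive_ppow n x :
  is_derive x 1 (ppow n.+2) (n.+2%:R * ppow n.+1 x).
Proof.
have [x0|x0|->] := ltgtP x 0.
- rewrite ppow_neg ?ltW// mulr0.
  apply: (@near_eq_is_derive _ _ _ (cst 0)).
  near=> y; rewrite /= ppow_neg// ltW//.
  by near: y; exact: lt_nbhsl.
- rewrite ppow_pos ?ltW//.
  apply: (@near_eq_is_derive _ _ _ (fun y => y ^+ n.+2)).
    near=> y; rewrite /= ppow_pos// ltW//.
    by near: y; exact: lt_nbhsr.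
  split; first exact: exprn_derivable.
  by rewrite exp_derive /GRing.scale/= mulr1.
- rewrite ppow_neg ?ltxx// mulr0.
  have H : h^-1 *: ((ppow n.+2 \o shift 0) (h *: (1 : R)) - ppow n.+2 0) @[h --> 0^'] --> (0 : R).
    apply/cvgrPdist_le => e e0; near=> h.
    rewrite /shift/= addr0 [ppow _ 0]ppow_neg// subr0 sub0r normrN /GRing.scale/= mulr1.
    have [h0|h0] := leP h 0; first by rewrite ppow_neg// mulr0 normr0 ltW.
    rewrite ppow_pos ?ltW// exprS mulKf ?gt_eqF// exprS normrM.
    apply: (@le_lt_trans _ _ `|h|); last by near: h; apply: dnbhs0_lt.
    rewrite ger_pMr ?normr_gt0 ?gt_eqF// normrX exprn_ile1//.
    by near: h; exact: dnbhs0_le.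
  by split; [apply/cvg_ex; exists 0|exact: cvg_lim H].
Unshelve. all: by end_near. Qed.

Lemma continuous_ppow n : continuous (ppow n).
Proof.
move=> x; apply: (@continuous_comp _ _ _ (fun y : R => Num.max 0 y) (fun y => y ^+ n)).
  have -> : (fun y : R => Num.max 0 y) = (fun y : R => (y + `|y|) / 2).
    by apply/funext => y; case: (leP 0 y) => y0; [rewrite ger0_norm//|rewrite ltr0_norm//]; lra.
  by apply: cvgMl; apply: cvgD; [exact: cvg_id|apply: cvg_norm; exact: cvg_id].
exact: exprn_continuous.
Qed.

(** Fourth differences of truncated powers: [kap] is the cubic B-spline on [[0, 4]],
    [kap1] and [kap2] are its derivatives. *)
Definition spl (n : nat) y : R := ppow n y - 4 * ppow n (y - 1) +
  6 * ppow n (y - 2) - 4 * ppow n (y - 3) + ppow n (y - 4).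

Definition kap y : R := spl 3 y / 6.
Definition kap1 y : R := spl 2 y / 2.
Definition kap2 y : R := spl 1 y.

Lemma is_derive_spl n x : is_derive x 1 (spl n.+2) (n.+2%:R * spl n.+1 x).
Proof.
have sh c : is_derive x 1 (fun y => ppow n.+2 (y - c)) (n.+2%:R * ppow n.+1 (x - c)).
  apply: is_derive_eq.
    apply: (@is_derive1_comp _ (ppow n.+2) (fun y => y - c)); exact: is_derive_ppow.
  by rewrite subr0 mulr1.
have := is_derive_ppow n x => ?.
rewrite /spl.
apply: is_derive_eq.
by rewrite /GRing.scale /=; ring.
Qed.

Lemma is_derive_kap x : is_derive x 1 kap (kap1 x).
Proof.
have -> : kap = (6^-1 : R) \*o spl 3 by apply/funext => y; rewrite /kap mulrC.
have := is_derive_spl 1 x => ?.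
by apply: is_derive_eq; rewrite /GRing.scale /kap1 /=; field.
Qed.

Lemma is_derive_kap1 x : is_derive x 1 kap1 (kap2 x).
Proof.
have -> : kap1 = (2^-1 : R) \*o spl 2 by apply/funext => y; rewrite /kap1 mulrC.
have := is_derive_spl 0 x => ?.
by apply: is_derive_eq; rewrite /GRing.scale /kap2 /=; field.
Qed.

Lemma continuous_spl n : continuous (spl n).
Proof.
have sh c : continuous (fun y => ppow n (y - c)).
  move=> x; apply: (@cvg_comp _ _ _ (fun y => y - c) (ppow n)); last exact: continuous_ppow.
  by apply: cvgB; [exact: cvg_id|exact: cvg_cst].
move=> x; rewrite /spl.
have M c d : c * ppow n (y - d) @[y --> x] --> c * ppow n (x - d).
  by apply: (cvgM (cvg_cst c)); exact: sh.
exact: (cvgD (cvgB (cvgD (cvgB (@continuous_ppow n x) (M 4 1)) (M 6 2)) (M 4 3)) (sh 4 x)).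
Qed.

Lemma continuous_kap2 : continuous kap2.
Proof. exact: continuous_spl. Qed.

(** The sum of [kap (y - l)] over [l >= 0], which turns sums of translates of [kap]
    into telescoping sums. *)
Definition kapF y : R := (ppow 3 y - 3 * ppow 3 (y - 1) + 3 * ppow 3 (y - 2) - ppow 3 (y - 3)) / 6.

Lemma kapFE y : kap y = kapF y - kapF (y - 1).
Proof.
rewrite /kap /kapF /spl.
have -> : y - 1 - 1 = y - 2 by lra.
have -> : y - 1 - 2 = y - 3 by lra.
have -> : y - 1 - 3 = y - 4 by lra.
lra.
Qed.

Lemma kapF0 y : y <= 0 -> kapF y = 0.
Proof. by move=> y0; rewrite /kapF !ppow_neg; try lra. Qed.

Lemma kapF1 y : 3 <= y -> kapF y = 1.
Proof. by move=> y0; rewrite /kapF !ppow_pos; try lra. Qed.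

Lemma spl_out n y : (y <= 0) || (4 <= y) -> (0 < n <= 3)%N -> spl n y = 0.
Proof.
case: n => [//|n]; case/orP => y0 n3; rewrite /spl.
  by rewrite !ppow_neg; lra.
rewrite !ppow_pos; try lra.
by move: n n3 => [|[|[|]]]// _; ring.
Qed.

Lemma kap_out y : (y <= 0) || (4 <= y) -> kap y = 0.
Proof. by move=> yo; rewrite /kap spl_out// mul0r. Qed.

Lemma kap1_out y : (y <= 0) || (4 <= y) -> kap1 y = 0.
Proof. by move=> yo; rewrite /kap1 spl_out// mul0r. Qed.

Lemma kap2_out y : (y <= 0) || (4 <= y) -> kap2 y = 0.
Proof. by move=> yo; rewrite /kap2 spl_out. Qed.

Lemma kap_ge0 y : 0 <= kap y.
Proof.
have [y0|y0] := leP y 0; first by rewrite kap_out// y0.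
have [y4|y4] := leP 4 y; first by rewrite kap_out// y4 orbT.
rewrite /kap /spl divr_ge0//.
have [y1|y1] := leP y 1.
  rewrite ppow_pos ?(ltW y0)// !ppow_neg; [|lra..].
  by have := exprn_ge0 3 (ltW y0); lra.
have [y2|y2] := leP y 2.
  rewrite !(@ppow_neg _ (y - 2)) ?(@ppow_neg _ (y - 3)) ?(@ppow_neg _ (y - 4)); [|lra..].
  rewrite !ppow_pos; [|lra..].
  have : 0 <= (y - 1) ^+ 2 * (2 - y) by rewrite mulr_ge0 ?sqr_ge0//; lra.
  by lra.
have [y3|y3] := leP y 3.
  rewrite !(@ppow_neg _ (y - 3)) ?(@ppow_neg _ (y - 4)); [|lra..].
  rewrite !ppow_pos; [|lra..].
  have : 0 <= (3 - y) ^+ 2 * (y - 2) by rewrite mulr_ge0 ?sqr_ge0//; lra.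
  by lra.
rewrite !(@ppow_neg _ (y - 4)); [|lra..].
rewrite !ppow_pos; [|lra..].
have : 0 <= (4 - y) ^+ 3 by rewrite exprn_ge0//; lra.
by lra.
Qed.

(** Three shifts to the left reach the value 0 and three to the right the value 1; the increments
    are values of [kap], hence nonnegative. *)
Lemma kapF_bound y : 0 <= kapF y <= 1.
Proof.
have [y0|y0] := leP y 0; first by rewrite kapF0// lexx ler01.
have [y3|y3] := leP 3 y; first by rewrite kapF1// lexx ler01.
have e1 := kapFE y; have e2 := kapFE (y - 1); have e3 := kapFE (y - 1 - 1).
have e4 := kapFE (y + 1); have e5 := kapFE (y + 1 + 1); have e6 := kapFE (y + 1 + 1 + 1).
have z : kapF (y - 1 - 1 - 1) = 0 by apply: kapF0; lra.
have u : kapF (y + 1 + 1 + 1) = 1 by apply: kapF1; lra.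
have := kap_ge0 y; have := kap_ge0 (y - 1); have := kap_ge0 (y - 1 - 1).
have := kap_ge0 (y + 1); have := kap_ge0 (y + 1 + 1); have := kap_ge0 (y + 1 + 1 + 1).
have z1 : y + 1 - 1 = y by lra.
have z2 : y + 1 + 1 - 1 = y + 1 by lra.
have z3 : y + 1 + 1 + 1 - 1 = y + 1 + 1 by lra.
rewrite z1 in e4; rewrite z2 in e5; rewrite z3 in e6.
by lra.
Qed.

Lemma kap_le1 y : kap y <= 1.
Proof. by rewrite kapFE; have := kapF_bound y; have := kapF_bound (y - 1); lra. Qed.

(** The unit step in [kapFE] is [q] grid indices, so the sum telescopes exactly and leaves [q] terms
    at either end. *)
Lemma sum_kap (X : R) (q m : nat) : (0 < q)%N ->
  \sum_(l < m) kap ((X - l%:R) / q%:R) / q%:R =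
  (\sum_(l < q) kapF ((X - l%:R) / q%:R) -
   \sum_(l < q) kapF ((X - (m + l)%:R) / q%:R)) / q%:R.
Proof.
move=> q0; rewrite -mulr_suml; congr (_ / _).
pose G l := kapF ((X - l%:R) / q%:R).
transitivity (\sum_(l < m) (G l - G (q + l)%N)).
  apply: eq_bigr => l _; rewrite kapFE; congr (_ - kapF _).
  by rewrite natrD; field; rewrite pnatr_eq0 -lt0n.
rewrite sumrB; apply/eqP; rewrite subr_eq addrAC -subr_eq opprK.
rewrite -(big_mkord xpredT G) -(big_mkord xpredT (fun l => G (q + l)%N)).
rewrite -(big_mkord xpredT (fun l => G l)) -(big_mkord xpredT (fun l => G (m + l)%N)).
have sh a b : \sum_(0 <= l < b) G (a + l)%N = \sum_(a <= l < a + b) G l.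
  have := big_addn 0 (a + b) a xpredT G; rewrite add0n addKn => ->.
  by apply: eq_bigr => l _; rewrite addnC.
rewrite (sh q m) (sh m q).
have cat a b : \sum_(0 <= l < a) G l + \sum_(a <= l < a + b) G l = \sum_(0 <= l < a + b) G l.
  by rewrite [RHS](@big_cat_nat _ _ _ a 0 (a + b) xpredT G)// leq_addr.
by rewrite !cat addnC.
Qed.

Lemma sum_kap_le1 (X : R) (q m : nat) : (0 < q)%N ->
  \sum_(l < m) kap ((X - l%:R) / q%:R) / q%:R <= 1.
Proof.
move=> q0; rewrite sum_kap// ler_pdivrMr ?ltr0n// mul1r.
apply: (@le_trans _ _ (\sum_(l < q) 1)); last by rewrite sumr_const card_ord.
rewrite -sumrB; apply: ler_sum => l _.
have := kapF_bound ((X - l%:R) / q%:R).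
have := kapF_bound ((X - (m + l)%:R) / q%:R).
lra.
Qed.

Lemma sum_kap_eq1 (X : R) (q m : nat) : (0 < q)%N ->
  4 * q%:R <= X -> X <= m%:R ->
  \sum_(l < m) kap ((X - l%:R) / q%:R) / q%:R = 1.
Proof.
move=> q0 X4 Xm; rewrite sum_kap//.
have q0' : 0 < q%:R :> R by rewrite ltr0n.
rewrite [X in _ - X]big1 => [|l _].
  rewrite (eq_bigr (fun _ => 1)) => [|l _].
    by rewrite sumr_const card_ord subr0 divff// gt_eqF.
  (* The factor 4 in the hypothesis is 3, where [kapF] becomes 1, plus 1 for [l < q]. *)
  apply: kapF1; rewrite ler_pdivlMr//.
  have : l%:R <= q%:R :> R by rewrite ler_nat ltnW.
  lra.
apply: kapF0; rewrite pmulr_lle0 ?invr_gt0// natrD.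
have : 0 <= l%:R :> R by [].
lra.
Qed.

(** Counts the integers in an interval of length [A]. The second bound, carried along in the
    induction, controls the count when the new index [m] is itself counted. *)
Lemma sum_count (X A : R) (m : nat) : 0 <= A ->
  \sum_(l < m) (if (0 <= X - l%:R <= A) then 1 else 0) <= A + 1 :> R.
Proof.
move=> A0.
suff : \sum_(l < m) (if (0 <= X - l%:R <= A) then 1 else 0) <= A + 1 :> R /\
       (\sum_(l < m) (if (0 <= X - l%:R <= A) then 1 else 0) <= Num.max 0 (m%:R - (X - A)) :> R).
  by case.
elim: m => [|m [IH1 IH2]]; first by rewrite big_ord0 le_max lexx; split => //; lra.
rewrite big_ord_recr /=; set S := \sum_(l < m) _ in IH1 IH2 *.
have hm : m.+1%:R = m%:R + 1 :> R by rewrite -natr1.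
case: ifPn => hX; last first.
  rewrite addr0; split=> //; apply: le_trans IH2 _; rewrite ge_max le_max lexx /=.
  by rewrite le_max; apply/orP; right; rewrite hm; lra.
have e : Num.max 0 (m%:R - (X - A)) = m%:R - (X - A) by rewrite max_r//; lra.
rewrite e in IH2; split; first by lra.
by rewrite le_max; apply/orP; right; rewrite hm; lra.
Qed.

Lemma sum_count_scaled (X A : R) (q m : nat) : (0 < q)%N -> 0 <= A ->
  \sum_(l < m) (if (0 <= (X - l%:R) / q%:R <= A) then 1 else 0) <= A * q%:R + 1 :> R.
Proof.
move=> q0 A0; have q0' : 0 < q%:R :> R by rewrite ltr0n.
apply: le_trans (sum_count X m (mulr_ge0 A0 (ltW q0'))).
apply: ler_sum => l _.
by rewrite ler_pdivrMr// ler_pdivlMr// mul0r.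
Qed.

Lemma normr_le2 (a b : R) : - b <= a -> a <= b -> `|a| <= b.
Proof. by rewrite ler_norml => -> ->. Qed.

(** For [r <= y] the second difference of the cube is exact and for [y <= - r] everything vanishes;
    in between each term is of order [r ^+ 3]. *)
Lemma cub_diff2 y r : 0 < r ->
  `|ppow 3 (y + r) - 2 * ppow 3 y + ppow 3 (y - r) - 6 * ppow 1 y * r ^+ 2| <= 16 * r ^+ 3.
Proof.
move=> r0; have r3 := exprn_gt0 3 r0.
have [h|h] := leP r y; first by rewrite !ppow_pos; [|lra..]; apply: normr_le2; lra.
have [h'|h'] := leP y (- r); first by rewrite !ppow_neg; [|lra..]; apply: normr_le2; lra.
rewrite (@ppow_neg _ (y - r)) ?(@ppow_pos _ (y + r)); [|lra..].
have h1 : (y + r) ^+ 3 <= (2 * r) ^+ 3 by rewrite lerXn2r// ?nnegrE; lra.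
have h2 : 0 <= (y + r) ^+ 3 by rewrite exprn_ge0//; lra.
have h3 : 0 <= ppow 3 y <= r ^+ 3.
  have [y0|y0] := leP y 0; first by rewrite ppow_neg//; lra.
  by rewrite ppow_pos ?(ltW y0)// exprn_ge0 ?(ltW y0)// lerXn2r// ?nnegrE; lra.
have h4 : 0 <= ppow 1 y * r ^+ 2 <= r ^+ 3.
  have [y0|y0] := leP y 0; first by rewrite ppow_neg//; lra.
  rewrite ppow_pos ?(ltW y0)// expr1 mulr_ge0 ?sqr_ge0 ?(ltW y0)//=.
  by rewrite [leRHS]exprS ler_wpM2r ?sqr_ge0//; lra.
by apply: normr_le2; lra.
Qed.

Lemma cub_diff1 y r : 0 < r ->
  `|ppow 3 (y + r) - ppow 3 (y - r) - 6 * ppow 2 y * r| <= 16 * r ^+ 3.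
Proof.
move=> r0; have r3 := exprn_gt0 3 r0.
have [h|h] := leP r y; first by rewrite !ppow_pos; [|lra..]; apply: normr_le2; lra.
have [h'|h'] := leP y (- r); first by rewrite !ppow_neg; [|lra..]; apply: normr_le2; lra.
rewrite (@ppow_neg _ (y - r)) ?(@ppow_pos _ (y + r)); [|lra..].
have h1 : (y + r) ^+ 3 <= (2 * r) ^+ 3 by rewrite lerXn2r// ?nnegrE; lra.
have h2 : 0 <= (y + r) ^+ 3 by rewrite exprn_ge0//; lra.
have h4 : 0 <= ppow 2 y * r <= r ^+ 3.
  have [y0|y0] := leP y 0; first by rewrite ppow_neg//; lra.
  rewrite ppow_pos ?(ltW y0)// mulr_ge0 ?sqr_ge0 ?(ltW r0)//=.
  by rewrite [leRHS]exprSr ler_wpM2r ?(ltW r0)// lerXn2r// ?nnegrE; lra.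
by apply: normr_le2; lra.
Qed.

Lemma cub_diff0 y r : 0 < r -> r <= 1 -> y <= 5 ->
  `|ppow 3 (y + r) - ppow 3 y - 3 * ppow 2 y * r| <= 16 * r ^+ 2.
Proof.
move=> r0 r1 y5; have r3 := exprn_gt0 2 r0.
have rr : r ^+ 3 <= r ^+ 2 by rewrite exprS ler_piMl// ltW.
have rr0 : 0 < r ^+ 3 by rewrite exprn_gt0.
have [h|h] := leP 0 y.
  rewrite !ppow_pos; [|lra..].
  have : 0 <= (5 - y) * r ^+ 2 by rewrite mulr_ge0 ?sqr_ge0//; lra.
  have : 0 <= y * r ^+ 2 by rewrite mulr_ge0 ?sqr_ge0//; lra.
  by move=> ? ?; apply: normr_le2; lra.
rewrite !(@ppow_neg _ y) ?(ltW h)//.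
have [y0|y0] := leP (y + r) 0; first by rewrite !ppow_neg; [|lra..]; apply: normr_le2; lra.
rewrite ppow_pos ?(ltW y0)//.
have h1 : (y + r) ^+ 3 <= r ^+ 3 by rewrite lerXn2r// ?nnegrE; lra.
have h2 : 0 <= (y + r) ^+ 3 by rewrite exprn_ge0//; lra.
by apply: normr_le2; lra.
Qed.

(** The coefficients of [spl] have absolute sum 16; with an error of [16 * r ^+ 3] for each
    truncated cube and the division by 6 the constant is [256 / 6 < 50]. *)
Lemma kap_diff2 y r : 0 < r ->
  `|kap2 y - (kap (y + r) - 2 * kap y + kap (y - r)) / r ^+ 2| <= 50 * r.
Proof.
move=> r0.
have E : kap2 y - (kap (y + r) - 2 * kap y + kap (y - r)) / r ^+ 2 =
  (kap2 y * r ^+ 2 - (kap (y + r) - 2 * kap y + kap (y - r))) / r ^+ 2.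
  by field; rewrite gt_eqF.
rewrite E normrM normfV (gtr0_norm (exprn_gt0 2 r0)) ler_pdivrMr ?exprn_gt0//.
rewrite -mulrA -exprS /kap2 /kap /spl.
have e c : (y + r - c = y - c + r) * (y - r - c = y - c - r) by split; ring.
rewrite !e.
have := cub_diff2 y r0; have := cub_diff2 (y - 1) r0; have := cub_diff2 (y - 2) r0.
have := cub_diff2 (y - 3) r0; have := cub_diff2 (y - 4) r0.
rewrite !ler_norml => /andP[a1 a2] /andP[b1 b2] /andP[c1 c2] /andP[d1 d2] /andP[e1 e2].
have r3 := exprn_gt0 3 r0.
by apply/andP; split; lra.
Qed.

Lemma kap_diff1 y r : 0 < r -> r <= 1 ->
  `|kap1 y - (kap (y + r) - kap (y - r)) / (2 * r)| <= 50 * r.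
Proof.
move=> r0 r1.
have E : kap1 y - (kap (y + r) - kap (y - r)) / (2 * r) =
  (kap1 y * (2 * r) - (kap (y + r) - kap (y - r))) / (2 * r).
  by field; rewrite gt_eqF.
rewrite E normrM normfV (@gtr0_norm _ (2 * r)) ?mulr_gt0// ler_pdivrMr ?mulr_gt0//.
rewrite /kap1 /kap /spl.
have e c : (y + r - c = y - c + r) * (y - r - c = y - c - r) by split; ring.
rewrite !e.
have := cub_diff1 y r0; have := cub_diff1 (y - 1) r0; have := cub_diff1 (y - 2) r0.
have := cub_diff1 (y - 3) r0; have := cub_diff1 (y - 4) r0.
rewrite !ler_norml => /andP[a1 a2] /andP[b1 b2] /andP[c1 c2] /andP[d1 d2] /andP[e1 e2].
have rr : r ^+ 3 <= r ^+ 2 by rewrite exprS ler_piMl ?sqr_ge0.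
by apply/andP; split; lra.
Qed.

(** A one-sided difference, since the scheme is explicit in time. Its error for a truncated cube
    grows like [y * r ^+ 2], so the range [5 < y], where every term vanishes, is treated apart. *)
Lemma kap_diff0 y r : 0 < r -> r <= 1 ->
  `|kap1 y - (kap (y + r) - kap y) / r| <= 50 * r.
Proof.
move=> r0 r1.
have [y5|y5] := leP y 5; last first.
  by rewrite kap1_out ?kap_out ?kap_out ?subrr ?mul0r ?subrr ?normr0 ?mulr_ge0 ?(ltW r0)//; apply/orP; right; lra.
have E : kap1 y - (kap (y + r) - kap y) / r =
  (kap1 y * r - (kap (y + r) - kap y)) / r.
  by field; rewrite gt_eqF.
rewrite E normrM normfV (gtr0_norm r0) ler_pdivrMr//.
rewrite /kap1 /kap /spl.
have e c : (y + r - c = y - c + r) by ring.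
rewrite !e.
have h c : 0 <= c -> `|ppow 3 (y - c + r) - ppow 3 (y - c) - 3 * ppow 2 (y - c) * r| <= 16 * r ^+ 2.
  by move=> c0; apply: cub_diff0 => //; lra.
have := cub_diff0 r0 r1 y5; have := h 1 ler01; have := h 2 (ler0n _ _).
have := h 3 (ler0n _ _); have := h 4 (ler0n _ _).
rewrite !ler_norml => /andP[a1 a2] /andP[b1 b2] /andP[c1 c2] /andP[d1 d2] /andP[e1 e2].
have r3 := exprn_gt0 2 r0.
by apply/andP; split; lra.
Qed.

Lemma ppow_bound n c y : 0 <= c -> y <= 4 -> (n <= 2)%N -> 0 <= ppow n (y - c) <= 16.
Proof.
move=> c0 y4 n2; rewrite /ppow exprn_ge0 ?le_max ?lexx//=.
have h : 0 <= Num.max 0 (y - c) <= 4.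
  by rewrite le_max lexx ge_max /=; lra.
case: n n2 => [|[|[|]]]// _; rewrite ?expr0 ?expr1; [lra|lra|].
by case/andP: h => ? h; rewrite (_ : 16 = 4 ^+ 2); [rewrite lerXn2r// nnegrE|ring].
Qed.

Lemma spl_bound n y : (0 < n <= 2)%N -> `|spl n y| <= 200.
Proof.
move=> /andP[n0 n2].
have [yo|] := boolP ((y <= 0) || (4 <= y)).
  by rewrite spl_out ?n0 ?(leq_trans n2) ?normr0 //; exact: ler0n.
rewrite negb_or -!ltNge => /andP[y0 y4]; rewrite /spl.
have := ppow_bound (lexx 0) (ltW y4) n2; rewrite subr0.
have := ppow_bound ler01 (ltW y4) n2; have := ppow_bound (ler0n R 2) (ltW y4) n2.
have := ppow_bound (ler0n R 3) (ltW y4) n2; have := ppow_bound (ler0n R 4) (ltW y4) n2.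
by rewrite ler_norml; lra.
Qed.

Lemma kap1_bound y : `|kap1 y| <= 200.
Proof.
rewrite /kap1 normrM normfV (@gtr0_norm _ 2)//.
by have := @spl_bound 2 y isT; have := normr_ge0 (spl 2 y); lra.
Qed.

Lemma kap2_bound y : `|kap2 y| <= 200.
Proof. exact: spl_bound. Qed.

End spline.

(** * Functions of class C^k *)

Section line.
Context {R : realType} {V : normedModType R}.
Implicit Types (f g : V -> R) (z v : V).

Lemma is_derive_line f z v d :
  is_derive (0 : R) (1 : R) (fun s : R => f (s *: v + z)) d <-> is_derive z v f d.
Proof.
have E : (fun s : R => s^-1 *: (((fun s : R => f (s *: v + z)) \o shift 0) (s *: (1 : R)) -
     f ((0 : R) *: v + z))) = (fun s => s^-1 *: ((f \o shift z) (s *: v) - f z)).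
  apply/funext => s; rewrite /shift /= addr0 scale0r add0r.
  by rewrite /(s *: 1)/= /GRing.scale/= mulr1.
by split => -[d1 d2]; split; move: d1 d2; rewrite /derivable /derive E.
Qed.

Lemma is_derive_comp_line (g : R -> R) (l : V -> R) z v (c d : R) :
  (forall s : R, l (s *: v + z) = l z + s * c) ->
  is_derive (l z) (1 : R) g d -> is_derive z v (g \o l) (c * d).
Proof.
move=> lE dg; apply/is_derive_line.
have -> : (fun s : R => (g \o l) (s *: v + z)) = g \o (fun s => l z + s * c).
  by apply/funext => s /=; rewrite lE.
have dl : is_derive (0 : R) 1 (fun s : R => l z + s * c) c.
  have -> : (fun s : R => l z + s * c) = cst (l z) \+ c \*: id.
    by apply/funext => s; rewrite /= /GRing.scale /= mulrC.
  by apply: is_derive_eq; rewrite /GRing.scale /= add0r mulr1.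
rewrite mulrC; apply: is_derive1_comp; by rewrite mul0r addr0.
Qed.

Lemma is_derive_bigsum (I : Type) (r : seq I) (F : I -> V -> R) (dF : I -> R) z v :
  (forall i, is_derive z v (F i) (dF i)) ->
  is_derive z v (fun y => \sum_(i <- r) F i y) (\sum_(i <- r) dF i).
Proof.
move=> FdF; elim: r => [|i r IH].
  rewrite big_nil; have -> : (fun y => \sum_(i <- [::]) F i y) = cst 0.
    by apply/funext => y; rewrite big_nil.
  exact: is_derive_cst.
rewrite big_cons; have -> : (fun y => \sum_(j <- i :: r) F j y) =
    F i \+ (fun y => \sum_(j <- r) F j y).
  by apply/funext => y; rewrite big_cons.
exact: is_deriveD.
Qed.

Lemma is_deriveMl (c : R) f z v d : is_derive z v f d ->
  is_derive z v (fun y => c * f y) (c * d).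
Proof.
move=> fd; have -> : (fun y => c * f y) = c \*: f by [].
exact: is_deriveZ.
Qed.

Lemma CkW k f : Ck k.+1 setT f -> Ck k setT f.
Proof.
elim: k f => [|k IH] f [cf df]; first by split.
by split => // v; have [d1 d2] := df v; split => //; apply: IH.
Qed.

Lemma Ck_cts k f : Ck k setT f -> continuous f.
Proof. by case: k => [|k] [cf _] x; exact: cf. Qed.

Lemma Ck_cst k (c : R) : Ck k setT (cst c : V -> R).
Proof.
elim: k c => [|k IH] c; first by split => // x _; exact: cst_continuous.
split=> [x _|v]; first exact: cst_continuous.
split=> [x _|]; first exact: derivable_cst.
have -> : 'D_v (cst c : V -> R) = cst 0 by apply/funext => x; rewrite derive_cst.
exact: IH.
Qed.

Lemma CkD k f g : Ck k setT f -> Ck k setT g -> Ck k setT (fun z => f z + g z).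
Proof.
elim: k f g => [|k IH] f g [cf df] [cg dg].
  by split => // x _; apply: cvgD; [exact: cf|exact: cg].
split=> [x _|v]; first by apply: cvgD; [exact: cf|exact: cg].
have [d1 d2] := df v; have [d3 d4] := dg v.
split=> [x _|]; first by apply: derivableD; [exact: d1|exact: d3].
have -> : 'D_v (fun z => f z + g z) = (fun z => 'D_v f z + 'D_v g z).
  by apply/funext => x; rewrite deriveD//; [exact: d1|exact: d3].
exact: IH.
Qed.

Lemma CkM k f g : Ck k setT f -> Ck k setT g -> Ck k setT (fun z => f z * g z).
Proof.
elim: k f g => [|k IH] f g Cf Cg.
  by split => // x _; apply: cvgM; [exact: Cf.1|exact: Cg.1].
split=> [x _|v]; first by apply: cvgM; [exact: Cf.1|exact: Cg.1].
have [d1 d2] := Cf.2 v; have [d3 d4] := Cg.2 v.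
split=> [x _|]; first by apply: derivableM; [exact: d1|exact: d3].
have -> : 'D_v (fun z => f z * g z) = (fun z => f z * 'D_v g z + g z * 'D_v f z).
  by apply/funext => x; rewrite deriveM//; [exact: d1|exact: d3].
by apply: CkD; apply: IH => //; exact: CkW.
Qed.

Lemma Ck_sum k (I : Type) (r : seq I) (F : I -> V -> R) :
  (forall i, Ck k setT (F i)) -> Ck k setT (fun z => \sum_(i <- r) F i z).
Proof.
move=> CF; elim: r => [|i r IH].
  have -> : (fun z => \sum_(i <- [::]) F i z) = cst 0.
    by apply/funext => z; rewrite big_nil.
  exact: Ck_cst.
have -> : (fun z => \sum_(j <- i :: r) F j z) = (fun z => F i z + \sum_(j <- r) F j z).
  by apply/funext => z; rewrite big_cons.
exact: CkD.
Qed.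

Lemma Ck_prod k (I : Type) (r : seq I) (F : I -> V -> R) :
  (forall i, Ck k setT (F i)) -> Ck k setT (fun z => \prod_(i <- r) F i z).
Proof.
move=> CF; elim: r => [|i r IH].
  have -> : (fun z => \prod_(i <- [::]) F i z) = cst 1.
    by apply/funext => z; rewrite big_nil.
  exact: Ck_cst.
have -> : (fun z => \prod_(j <- i :: r) F j z) = (fun z => F i z * \prod_(j <- r) F j z).
  by apply/funext => z; rewrite big_cons.
exact: CkM.
Qed.

Definition C2_slot (g g1 g2 : R -> R) :=
  [/\ forall y : R, is_derive y (1 : R) g (g1 y),
    forall y : R, is_derive y (1 : R) g1 (g2 y) & continuous g2].

Lemma C2_slot_cts (g g1 g2 : R -> R) : C2_slot g g1 g2 -> continuous g /\ continuous g1.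
Proof.
move=> [h1 h2 _]; split => y; apply: differentiable_continuous;
  apply/derivable1_diffP; [by have [] := h1 y|by have [] := h2 y].
Qed.

(** Along [v] the composite has as derivative the constant [l0 v] times the composite of [g1] with
    [l], so the iterated directional derivatives required by [Ck] keep the same form. *)
Lemma Ck_slot (g g1 g2 : R -> R) (l l0 : V -> R) : C2_slot g g1 g2 ->
  continuous l -> (forall s v z, l (s *: v + z) = l z + s * l0 v) ->
  Ck 2 setT (g \o l).
Proof.
move=> Cg cl lE; have [cg cg1] := C2_slot_cts Cg; have [dg dg1 cg2] := Cg.
have cc (k : R -> R) : continuous k -> continuous (k \o l).
  by move=> ck x; apply: continuous_comp; [exact: cl|exact: ck].
have dd (k k1 : R -> R) : (forall y : R, is_derive y (1 : R) k (k1 y)) ->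
    forall v z, is_derive z v (k \o l) (l0 v * k1 (l z)).
  by move=> dk v z; apply: is_derive_comp_line => // s; exact: lE.
have DE (k k1 : R -> R) v : (forall y : R, is_derive y (1 : R) k (k1 y)) ->
    'D_v (k \o l) = (fun z => cst (l0 v) z * (k1 \o l) z).
  by move=> dk; apply/funext => z; have [_ ->] := dd _ _ dk v z.
split=> [x _|v]; first exact: cc.
split=> [x _|]; first by have [] := dd _ _ dg v x.
rewrite (DE _ _ v dg); apply: CkM; first exact: Ck_cst.
split=> [x _|v']; first exact: cc.
split=> [x _|]; first by have [] := dd _ _ dg1 v' x.
rewrite (DE _ _ v' dg1); split => // x _.
by apply: cvgM; [exact: cvg_cst|exact: cc].
Qed.

End line.

(** * Tensor products of functions of one variable *)

Section tensor.
Context {R : realType} {N : nat}.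
Local Notation X := ('rV[R]_N * R)%type.
Implicit Types (z : X) (a : 'I_N -> R -> R) (b : R -> R).

Definition tens a b z : R := (\prod_j a j (z.1 0 j)) * b z.2.
(** Differentiating a tensor product along [ei i] replaces its factor number [i]. *)
Definition upd a i (g : R -> R) j := if j == i then g else a j.

Lemma tensE a b i z : tens a b z =
  a i (z.1 0 i) * ((\prod_(j | j != i) a j (z.1 0 j)) * b z.2).
Proof. by rewrite /tens (bigD1 i)//= mulrA. Qed.

Lemma tens_upd a b i g z : tens (upd a i g) b z =
  g (z.1 0 i) * ((\prod_(j | j != i) a j (z.1 0 j)) * b z.2).
Proof.
rewrite (tensE _ _ i) /upd eqxx; congr (_ * (_ * _)).
by apply: eq_bigr => j /negPf ->.
Qed.

Lemma is_derive_tens_x a b i g z : is_derive (z.1 0 i) 1 (a i) (g (z.1 0 i)) ->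
  is_derive z ((ei i, 0) : X) (tens a b) (tens (upd a i g) b z).
Proof.
move=> dg; apply/is_derive_line; rewrite tens_upd.
have -> : (fun s : R => tens a b (s *: ((ei i, 0) : X) + z)) = (fun s =>
   ((\prod_(j | j != i) a j (z.1 0 j)) * b z.2) * (a i \o (fun s => z.1 0 i + s * 1)) s).
  apply/funext => s; rewrite (tensE _ _ i) mulrC /=; congr (_ * _ * _).
  - apply: eq_bigr => j ji; rewrite !mxE eqxx /= (negPf ji) mulr0 add0r//.
  - by rewrite scaler0 add0r.
  - by rewrite !mxE !eqxx addrC.
rewrite [g _ * _]mulrC; apply: is_deriveMl.
rewrite -[g _]mul1r; apply: is_derive_comp_line.
  by move=> s; rewrite /GRing.scale /=; ring.
by rewrite mul0r addr0.
Qed.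

Lemma is_derive_tens_t a b (b' : R) z : is_derive z.2 1 b b' ->
  is_derive z ((0, 1) : X) (tens a b) ((\prod_j a j (z.1 0 j)) * b').
Proof.
move=> dg; apply/is_derive_line.
have -> : (fun s : R => tens a b (s *: ((0, 1) : X) + z)) = (fun s =>
   (\prod_j a j (z.1 0 j)) * (b \o (fun s => z.2 + s * 1)) s).
  apply/funext => s; rewrite /tens /=; congr (_ * _).
  - by apply: eq_bigr => j _; rewrite !mxE mulr0 add0r.
  - by rewrite addrC.
apply: is_deriveMl.
rewrite -[b']mul1r; apply: is_derive_comp_line.
  by move=> s; rewrite /GRing.scale /=; ring.
by rewrite mul0r addr0.
Qed.

Lemma coord_cts (i : 'I_N) : continuous (fun z : X => z.1 0 i).
Proof.
move=> z; apply: (@continuous_comp _ _ _ fst (fun x : 'rV[R]_N => x 0 i)).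
  exact: cvg_fst.
exact: coord_continuous.
Qed.

Lemma Ck_coord (g g1 g2 : R -> R) i : C2_slot g g1 g2 ->
  Ck 2 setT (fun z : X => g (z.1 0 i)).
Proof.
move=> Cg; apply: (Ck_slot (l := fun z : X => z.1 0 i) (l0 := fun z => z.1 0 i) Cg).
  exact: coord_cts.
by move=> s v z; rewrite !mxE addrC.
Qed.

Lemma Ck_time (g g1 g2 : R -> R) : C2_slot g g1 g2 ->
  Ck 2 setT (fun z : X => g z.2).
Proof.
move=> Cg; apply: (Ck_slot (l := fun z : X => z.2) (l0 := fun z => z.2) Cg).
  by move=> z; exact: cvg_snd.
by move=> s v z; rewrite /= addrC.
Qed.

Lemma Ck_tens a a1 a2 b b1 b2 : (forall j, C2_slot (a j) (a1 j) (a2 j)) ->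
  C2_slot b b1 b2 -> Ck 2 setT (tens a b).
Proof.
move=> Ca Cb; apply: CkM; last exact: Ck_time Cb.
by apply: Ck_prod => j; exact: Ck_coord (Ca j).
Qed.

Lemma C2_slot_kap (p r c : R) : C2_slot (fun y => kap ((y - p) / r) * c)
  (fun y => kap1 ((y - p) / r) / r * c) (fun y => kap2 ((y - p) / r) / r ^+ 2 * c).
Proof.
have key (g g1 : R -> R) (y : R) : (forall y : R, is_derive y (1 : R) g (g1 y)) ->
    is_derive y (1 : R) (fun y : R => g ((y - p) / r)) (g1 ((y - p) / r) / r).
  move=> dg; rewrite mulrC.
  apply: (@is_derive_comp_line _ _ g (fun y => (y - p) / r)) => //.
  by move=> s; rewrite /GRing.scale /=; ring.
have key2 (g : R -> R) (d d' y : R) : is_derive y (1 : R) g d -> d' = c * d ->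
    is_derive y (1 : R) (fun y : R => g y * c) d'.
  move=> dg ->; have -> : (fun y => g y * c) = (fun y => c * g y).
    by apply/funext => x; rewrite mulrC.
  exact: is_deriveMl.
split=> [y|y|].
- exact: (key2 (fun y => kap ((y - p) / r)) _ _ y (key _ _ y (@is_derive_kap R)) (mulrC _ _)).
- apply: (key2 (fun y => kap1 ((y - p) / r) / r) (r^-1 * (kap2 ((y - p) / r) / r))).
    have -> : (fun y => kap1 ((y - p) / r) / r) = (fun y => r^-1 * kap1 ((y - p) / r)).
      by apply/funext => x; rewrite mulrC.
    by apply: is_deriveMl; apply: key => x; exact: is_derive_kap1.
  by rewrite expr2 invfM; ring.
- move=> y; do 2 apply: cvgMl.
  apply: (@continuous_comp _ _ _ (fun y => (y - p) / r) kap2); last exact: continuous_kap2.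
  by apply: cvgMl; apply: cvgB; [exact: cvg_id|exact: cvg_cst].
Qed.

End tensor.

(** Lipschitz for the maximum norm, with [r] standing for any bound on the coordinate
    differences. *)
Definition xlip {R : realType} {N : nat} (L : R) (g : 'rV[R]_N -> R) :=
  forall (x x' : 'rV[R]_N) (r : R), (forall i, `|x 0 i - x' 0 i| <= r) -> `|g x - g x'| <= L * r.

Definition xtlip {R : realType} {N : nat} (L : R) (g : 'rV[R]_N * R -> R) :=
  forall (z z' : 'rV[R]_N * R) (r : R), (forall i, `|z.1 0 i - z'.1 0 i| <= r) -> `|z.2 - z'.2| <= r ->
  `|g z - g z'| <= L * r.

Lemma ler_norm_sumM {R : realType} (I : finType) (a b : I -> R) (P : R) :
  (forall i, `|a i| <= P) -> `|\sum_i a i * b i| <= P * \sum_i `|b i|.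
Proof.
move=> aP; apply: le_trans (ler_norm_sum _ _ _) _; rewrite mulr_sumr.
by apply: ler_sum => i _; rewrite normrM ler_wpM2r.
Qed.

(** * Interpolated solutions of the scheme *)

Section grid.
Context {R : realType} {N : nat}.
Local Notation X := ('rV[R]_N * R)%type.
Variables (delta : R) (q p c n1 : nat) (T1 : R).
Hypothesis delta_gt0 : 0 < delta.
Hypothesis delta_le1 : delta <= 1.
Hypothesis q_gt0 : (0 < q)%N.
Hypothesis p_gt0 : (0 < p)%N.
Implicit Types (z : X) (y t : R) (n : nat).

Definition gh : R := delta / q%:R.
Definition gtau : R := delta / p%:R.
Notation h := gh.
Notation tau := gtau.
Notation m := (c.*2).+1.
Local Notation G := {ffun 'I_N -> 'I_m}.

Let q_gt0' : 0 < q%:R :> R. Proof. by rewrite ltr0n. Qed.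
Let p_gt0' : 0 < p%:R :> R. Proof. by rewrite ltr0n. Qed.

Lemma gh_gt0 : 0 < h. Proof. exact: divr_gt0. Qed.
Lemma gtau_gt0 : 0 < tau. Proof. exact: divr_gt0. Qed.
Let h_gt0 := gh_gt0.
Let tau_gt0 := gtau_gt0.

Lemma gh_le : h <= delta.
Proof. by rewrite ler_pdivrMr// ler_peMr ?(ltW delta_gt0)// ler1n. Qed.

(** The grid is a torus, so that summation by parts has no boundary terms. *)
Definition gs (i : 'I_N) (k : G) : G := [ffun j => if j == i then ordS (k j) else k j].
Definition gs' (i : 'I_N) (k : G) : G := [ffun j => if j == i then ord_pred (k j) else k j].

Lemma gsK i : cancel (gs i) (gs' i).
Proof. by move=> k; apply/ffunP => j; rewrite !ffunE; case: eqP => // _; rewrite ordSK. Qed.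

Lemma gs'K i : cancel (gs' i) (gs i).
Proof. by move=> k; apply/ffunP => j; rewrite !ffunE; case: eqP => // _; rewrite ord_predK. Qed.

Lemma gsC i j k : gs i (gs j k) = gs j (gs i k).
Proof.
by apply/ffunP => l; rewrite !ffunE; case: eqP => //; case: eqP.
Qed.

Definition gpos (l : 'I_m) : R := h * (l%:R - c%:R).
Definition gt n : R := T1 - n%:R * tau.
Definition gpt n (k : G) : X := (\row_i gpos (k i), gt n).

(** Kernels of width [4 * delta] on a mesh of size [delta / q]: for large [q] the
    derivatives of the kernels are close to the difference quotients. *)
Definition xs (l : 'I_m) y := kap ((y - gpos l) / delta) * q%:R^-1.
Definition xs1 (l : 'I_m) y := kap1 ((y - gpos l) / delta) / delta * q%:R^-1.
Definition xs2 (l : 'I_m) y := kap2 ((y - gpos l) / delta) / delta ^+ 2 * q%:R^-1.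
(** The division by [- delta] puts the support of [ts n] before the time [gt n], so that [Phi]
    vanishes after the source has ended, and [ts_arg] takes the same form as [xs_arg]. *)
Definition ts n t := kap ((t - gt n) / (- delta)) * p%:R^-1.
Definition ts1 n t := kap1 ((t - gt n) / (- delta)) / (- delta) * p%:R^-1.
Definition om n (k : G) : X -> R := tens (fun j => xs (k j)) (ts n).

Lemma xs_ge0 l y : 0 <= xs l y.
Proof. by rewrite mulr_ge0 ?kap_ge0. Qed.

Lemma ts_ge0 n t : 0 <= ts n t.
Proof. by rewrite mulr_ge0 ?kap_ge0. Qed.

Lemma om_ge0 n k z : 0 <= om n k z.
Proof.
rewrite /om /tens mulr_ge0 ?ts_ge0//; apply: prodr_ge0 => j _; exact: xs_ge0.
Qed.

Lemma xs_arg l y : (y - gpos l) / delta = ((y / h + c%:R) - l%:R) / q%:R.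
Proof. by rewrite /gpos /gh; field; rewrite !gt_eqF. Qed.

Lemma ts_arg n t : (t - gt n) / (- delta) = ((T1 - t) / tau - n%:R) / p%:R.
Proof. by rewrite /gt /gtau; field; rewrite !gt_eqF. Qed.

Lemma sum_xs_le1 y : \sum_l xs l y <= 1.
Proof.
under eq_bigr do rewrite /xs xs_arg.
exact: (sum_kap_le1 (y / h + c%:R) m q_gt0).
Qed.

Lemma sum_ts_le1 t M : \sum_(n < M) ts n t <= 1.
Proof.
under eq_bigr do rewrite /ts ts_arg.
exact: sum_kap_le1.
Qed.

Lemma sum_xs_eq1 L0 y : L0 + 4 * delta <= h * c%:R -> `|y| <= L0 -> \sum_l xs l y = 1.
Proof.
move=> L0c; rewrite ler_norml => /andP[y1 y2].
have mulrDl' : y + h * c%:R = (y / h + c%:R) * h by field; rewrite gt_eqF// gh_gt0.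
under eq_bigr do rewrite /xs xs_arg.
apply: (@sum_kap_eq1 _ (y / h + c%:R) q m q_gt0).
  rewrite -(ler_pM2r h_gt0) -mulrDl'.
  have -> : 4 * q%:R * h = 4 * delta by rewrite /gh; field; rewrite gt_eqF.
  lra.
rewrite -(ler_pM2r h_gt0) -mulrDl' -addnn -natr1 natrD.
have -> : (c%:R + c%:R + 1) * h = h * c%:R + h * c%:R + h by ring.
by have := delta_gt0; have := h_gt0; lra.
Qed.

Lemma sum_ts_eq1 t M : t <= T1 - 4 * delta -> T1 - t <= M%:R * tau ->
  \sum_(n < M) ts n t = 1.
Proof.
move=> t1 t2; under eq_bigr do rewrite /ts ts_arg.
apply: sum_kap_eq1 => //; last by rewrite ler_pdivrMr.
rewrite ler_pdivlMr//.
have -> : 4 * p%:R * tau = 4 * delta by rewrite /gtau; field; rewrite gt_eqF.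
lra.
Qed.

Lemma sum_tens (a : 'I_N -> 'I_m -> R) :
  \sum_(k : G) \prod_j a j (k j) = \prod_j \sum_l a j l.
Proof. by rewrite bigA_distr_bigA. Qed.

Lemma sum_om_le1 z : \sum_(n < n1.+1) \sum_k om n k z <= 1.
Proof.
have E n : \sum_k om n k z <= ts n z.2.
  rewrite /om /tens -mulr_suml (sum_tens (fun j l => xs l (z.1 0 j))).
  rewrite ler_piMl ?ts_ge0//.
  apply: prodr_ile1 => j _; rewrite sum_xs_le1 andbT.
  by apply: sumr_ge0 => l _; exact: xs_ge0.
by apply: le_trans (sum_ts_le1 z.2 n1.+1); apply: ler_sum => n _.
Qed.

(** Away from the ends of the grid the kernels form a partition of unity; this is how a value at [z]
    is compared with values at the nodes. *)
Lemma sum_om_eq1 L0 z : L0 + 4 * delta <= h * c%:R ->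
  (forall i, `|z.1 0 i| <= L0) -> z.2 <= T1 - 4 * delta -> T1 - z.2 <= n1.+1%:R * tau ->
  \sum_(n < n1.+1) \sum_k om n k z = 1.
Proof.
move=> L0c zL z1 z2.
rewrite -(sum_ts_eq1 z1 z2); apply: eq_bigr => n _.
rewrite /om /tens -mulr_suml (sum_tens (fun j l => xs l (z.1 0 j))).
rewrite big1 ?mul1r// => j _; exact: (sum_xs_eq1 L0c).
Qed.

Lemma om_near n k z : om n k z != 0 ->
  (forall i, `|z.1 0 i - (gpt n k).1 0 i| <= 4 * delta) /\
  `|z.2 - (gpt n k).2| <= 4 * delta /\ z.2 <= gt n.
Proof.
have key d y : 0 < d -> kap (y / d) != 0 -> 0 <= y <= 4 * d.
  move=> d0; apply: contraNT; rewrite negb_and -!ltNge => h; apply/eqP/kap_out.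
  case/orP: h => h; apply/orP; [left|right].
    by rewrite pmulr_lle0 ?invr_gt0// ltW.
  by rewrite ler_pdivlMr// ltW.
rewrite /om /tens mulf_eq0 negb_or => /andP[h1 h2]; split.
  move=> i; rewrite /gpt /= mxE.
  move: h1; rewrite (bigD1 i)//= mulf_eq0 negb_or => /andP[h1 _].
  move: h1; rewrite /xs mulf_eq0 negb_or => /andP[/(key _ _ delta_gt0) h1 _].
  by rewrite ger0_norm; lra.
move: h2; rewrite /ts mulf_eq0 negb_or => /andP[h2 _].
have : kap ((gt n - z.2) / delta) != 0.
  suff -> : (gt n - z.2) / delta = (z.2 - gt n) / - delta by [].
  by field; rewrite gt_eqF.
move=> /(key _ _ delta_gt0) h3; rewrite /gpt /=; split; last by lra.
by rewrite distrC ger0_norm; lra.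
Qed.

(** Away from the seam of the torus a shift of the point is a shift of the node. At the seam both
    sides vanish, because the room 6 in the hypothesis keeps [y] out of the supports concerned. *)
Lemma xs_shift (L0 : R) l (y : R) : L0 + 6 <= h * c%:R -> `|y| <= L0 ->
  xs l (y + h) = xs (ord_pred l) y /\ xs l (y - h) = xs (ordS l) y.
Proof.
move=> L0c; rewrite ler_norml => /andP[y1 y2].
have hd := gh_le; have h0 := h_gt0; have d1 := delta_le1.
have out (l' : 'I_m) y' : (y' <= gpos l') || (4 * delta <= y' - gpos l') -> xs l' y' = 0.
  move=> H; rewrite /xs kap_out ?mul0r//.
  case/orP: H => H; apply/orP; [left|right].
    by rewrite pmulr_lle0 ?invr_gt0// subr_le0.
  by rewrite ler_pdivlMr.
have pE (l' : 'I_m) : gpos l' = h * l'%:R - h * c%:R by rewrite /gpos mulrBr.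
split.
  have [l0|l0] := posnP l.
    rewrite !out//.
      apply/orP; left; rewrite pE /= l0 /= modn_small//.
      by rewrite -addnn natrD; lra.
    by apply/orP; right; rewrite pE l0 mulr0; lra.
  suff e : y + h - gpos l = y - gpos (ord_pred l) by rewrite /xs e.
  have el : nat_of_ord (ord_pred l) = l.-1.
    by rewrite /= -(prednK l0) addSn /= modnDr modn_small// prednK// ltnW.
  by rewrite (pE l) (pE (ord_pred l)) el -{1}(prednK l0) -natr1; lra.
have [lm|lm] := eqVneq (l : nat) c.*2.
  rewrite !out//.
    by apply/orP; right; rewrite pE /= lm modnn; lra.
  by apply/orP; left; rewrite pE lm -addnn natrD; lra.
suff e : y - h - gpos l = y - gpos (ordS l) by rewrite /xs e.
have el : nat_of_ord (ordS l) = l.+1.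
  by rewrite /= modn_small// ltn_neqAle eqSS lm /= ltn_ord.
by rewrite (pE l) (pE (ordS l)) el -natr1; lra.
Qed.

Section field.
Variable psi : nat -> G -> R.

(** A quasi-interpolant: the kernels span many mesh cells, so [Phi] averages the values [psi] near a
    node and need not reproduce them. The weights are nonnegative with sum at most 1, hence bounds
    on [psi] carry over. *)
Definition Phi z : R := \sum_(n < n1.+1) \sum_k psi n k * om n k z.

Lemma Phi_Ck : Ck 2 setT Phi.
Proof.
apply: Ck_sum => n; apply: Ck_sum => k; apply: CkM; first exact: Ck_cst.
by apply: Ck_tens => [j|]; exact: C2_slot_kap.
Qed.

Lemma Phi_bound P z : (forall n k, (n <= n1)%N -> `|psi n k| <= P) -> `|Phi z| <= P.
Proof.
move=> psiP; have P0 : 0 <= P.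
  by apply: le_trans (normr_ge0 _) (psiP 0%N [ffun=> ord0] (leq0n _)).
rewrite -[leRHS]mulr1; apply: le_trans (ler_wpM2l P0 (sum_om_le1 z)).
apply: le_trans (ler_norm_sum _ _ _) _; rewrite mulr_sumr; apply: ler_sum => n _.
apply: le_trans (ler_norm_sum _ _ _) _; rewrite mulr_sumr; apply: ler_sum => k _.
by rewrite normrM (ger0_norm (om_ge0 _ _ _)) ler_wpM2r ?om_ge0// psiP// -ltnS.
Qed.

Lemma is_derive_Phi (d : nat -> G -> R) z v :
  (forall n k, is_derive z v (om n k) (d n k)) ->
  is_derive z v Phi (\sum_(n < n1.+1) \sum_k psi n k * d n k).
Proof.
move=> dom; apply: is_derive_bigsum => n; apply: is_derive_bigsum => k.
Qed.

Definition omx i (g : 'I_m -> R -> R) n (k : G) : X -> R :=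
  tens (upd (fun j => xs (k j)) i (g (k i))) (ts n).

Lemma dx_Phi i : dx i Phi = fun z => \sum_(n < n1.+1) \sum_k psi n k * omx i xs1 n k z.
Proof.
apply/funext => z; rewrite /dx.
suff : is_derive z ((ei i, 0) : X) Phi
    (\sum_(n < n1.+1) \sum_k psi n k * omx i xs1 n k z) by case.
apply: (is_derive_Phi (d := fun n k => omx i xs1 n k z)) => n k.
have [h1 _ _] := C2_slot_kap (gpos (k i)) delta q%:R^-1.
exact: (@is_derive_tens_x _ _ (fun j => xs (k j)) _ i (xs1 (k i)) z (h1 _)).
Qed.

Lemma dxx_Phi i : dx i (dx i Phi) =
  fun z => \sum_(n < n1.+1) \sum_k psi n k * omx i xs2 n k z.
Proof.
rewrite dx_Phi; apply/funext => z; rewrite /dx.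
suff : is_derive z ((ei i, 0) : X)
    (fun z => \sum_(n < n1.+1) \sum_k psi n k * omx i xs1 n k z)
    (\sum_(n < n1.+1) \sum_k psi n k * omx i xs2 n k z) by case.
apply: is_derive_bigsum => n; apply: is_derive_bigsum => k; apply: is_deriveMl.
have -> : omx i xs2 n k z = tens (upd (upd (fun j => xs (k j)) i (xs1 (k i))) i (xs2 (k i))) (ts n) z.
  rewrite /omx !tens_upd; congr (_ * (_ * _)); apply: eq_bigr => j /negPf ji.
  by rewrite /upd ji.
have [_ h1 _] := C2_slot_kap (gpos (k i)) delta q%:R^-1.
by apply: is_derive_tens_x; rewrite /upd eqxx; exact: h1.
Qed.

Definition omt (g : nat -> R -> R) n (k : G) : X -> R := tens (fun j => xs (k j)) (g n).

Lemma dt_Phi : dt Phi = fun z => \sum_(n < n1.+1) \sum_k psi n k * omt ts1 n k z.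
Proof.
apply/funext => z; rewrite /dt.
suff : is_derive z ((0, 1) : X) Phi
    (\sum_(n < n1.+1) \sum_k psi n k * omt ts1 n k z) by case.
apply: (is_derive_Phi (d := fun n k => omt ts1 n k z)) => n k.
have [h1 _ _] := C2_slot_kap (gt n) (- delta) p%:R^-1.
exact: (@is_derive_tens_t _ _ (fun j => xs (k j)) _ _ z (h1 _)).
Qed.

Variable P : R.
Hypothesis psiP : forall n k, (n <= n1)%N -> `|psi n k| <= P.
Let P_ge0 : 0 <= P.
Proof. by apply: le_trans (normr_ge0 _) (psiP [ffun=> ord0] (leq0n _)). Qed.

(** Only the factor in direction [i] is altered; the sums over the other directions and over time
    are at most 1. *)
Lemma sum_omx_le i g z :
  `|\sum_(n < n1.+1) \sum_k psi n k * omx i g n k z| <= P * \sum_l `|g l (z.1 0 i)|.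
Proof.
have E n : \sum_k `|omx i g n k z| <= (\sum_l `|g l (z.1 0 i)|) * ts n z.2.
  rewrite /omx /tens.
  under eq_bigr do rewrite normrM (ger0_norm (ts_ge0 _ _)) normr_prod.
  rewrite -mulr_suml ler_wpM2r ?ts_ge0//.
  pose A j (l : 'I_m) := if j == i then `|g l (z.1 0 i)| else xs l (z.1 0 j).
  under eq_bigr => k _.
    rewrite (eq_bigr (fun j => A j (k j))); last first.
      move=> j _; rewrite /upd /A; case: eqP => [->//|_].
      by rewrite ger0_norm ?xs_ge0.
    over.
  rewrite (sum_tens A) (bigD1 i)//= {1}/A eqxx ler_piMr ?sumr_ge0//.
  apply: prodr_ile1 => j /negPf ji; rewrite /A ji sum_xs_le1 andbT.
  by apply: sumr_ge0 => l _; exact: xs_ge0.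
apply: le_trans (ler_norm_sum _ _ _) _.
apply: (@le_trans _ _ (\sum_(n < n1.+1) P * ((\sum_l `|g l (z.1 0 i)|) * ts n z.2))).
  apply: ler_sum => n _; apply: (le_trans (y := P * \sum_k `|omx i g n k z|)).
    by apply: ler_norm_sumM => k; apply: psiP; rewrite -ltnS.
  by rewrite ler_wpM2l.
rewrite -mulr_sumr ler_wpM2l// -mulr_sumr ler_piMr ?sum_ts_le1//.
by apply: sumr_ge0.
Qed.

Lemma sum_omt_le (g : nat -> R -> R) z :
  `|\sum_(n < n1.+1) \sum_k psi n k * omt g n k z| <= P * \sum_(n < n1.+1) `|g n z.2|.
Proof.
have E (n : nat) : \sum_k `|omt g n k z| <= `|g n z.2|.
  rewrite /omt /tens.
  under eq_bigr do rewrite normrM normr_prod.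
  rewrite -mulr_suml ler_piMl//.
  under eq_bigr => k _ do under eq_bigr do rewrite (ger0_norm (xs_ge0 _ _)).
  rewrite (sum_tens (fun j l => xs l (z.1 0 j))).
  apply: prodr_ile1 => j _; rewrite sum_xs_le1 andbT.
  by apply: sumr_ge0 => l _; exact: xs_ge0.
apply: le_trans (ler_norm_sum _ _ _) _; rewrite mulr_sumr.
apply: ler_sum => n _; apply: (le_trans (y := P * \sum_k `|omt g n k z|)).
  by apply: ler_norm_sumM => k; apply: psiP; rewrite -ltnS.
by rewrite ler_wpM2l.
Qed.

(** A window of length 6 contains at most [6 * r + 1 <= 7 * r] indices. The range from -1 to 5 is
    the support [[0, 4]] of [kap] widened by 1 for the shifted arguments. *)
Lemma sum_window (M r : nat) (Y B : R) (a : nat -> R) : (0 < r)%N -> 0 <= B ->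
  (forall l, `|a l| <= B) ->
  (forall l, ~~ (-1 <= (Y - l%:R) / r%:R <= 5) -> a l = 0) ->
  \sum_(l < M) `|a l| <= B * (7 * r%:R).
Proof.
move=> r0 B0 aB a0; have r0' : 0 < r%:R :> R by rewrite ltr0n.
apply: (@le_trans _ _ (B * \sum_(l < M) (if 0 <= (Y + r%:R - l%:R) / r%:R <= 6 then 1 else 0))).
  rewrite mulr_sumr; apply: ler_sum => l _.
  have -> : (Y + r%:R - l%:R) / r%:R = (Y - l%:R) / r%:R + 1 by field; rewrite gt_eqF.
  case: ifPn => H; first by rewrite mulr1.
  rewrite a0 ?normr0 ?mulr0//; apply: contra H => /andP[H1 H2]; apply/andP; split; lra.
rewrite ler_wpM2l//.
apply: le_trans (@sum_count_scaled _ (Y + r%:R) 6 r M r0 _) _ => //.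
have : 1 <= r%:R :> R by rewrite ler1n.
lra.
Qed.

Let qinv1 : q%:R^-1 <= 1 :> R. Proof. by rewrite invf_le1// ler1n. Qed.
Let pinv1 : p%:R^-1 <= 1 :> R. Proof. by rewrite invf_le1// ler1n. Qed.

Lemma kap_diff_out (y r : R) : 0 <= r -> r <= 1 -> ~~ (-1 <= y <= 5) ->
  [/\ kap y = 0, kap1 y = 0, kap2 y = 0, kap (y + r) = 0 & kap (y - r) = 0].
Proof.
move=> r0 r1; rewrite negb_and -!ltNge => yo.
have [h1 h2 h3] : [/\ (y <= 0) || (4 <= y), (y + r <= 0) || (4 <= y + r) & (y - r <= 0) || (4 <= y - r)].
  by case/orP: yo => yo; split; apply/orP; ((left; lra) || (right; lra)).
by rewrite !kap_out// kap1_out// kap2_out.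
Qed.

(** The errors [ex2], [ex1] and [et1] compare the derivative of a kernel with the difference
    quotient that the scheme uses in its place. *)
Definition ex2 l y := xs2 l y - (xs l (y + h) - 2 * xs l y + xs l (y - h)) / h ^+ 2.
Definition ex1 l y := xs1 l y - (xs l (y + h) - xs l (y - h)) / (2 * h).
Definition et1 n t := ts1 n t - (ts n t - kap ((t - gt n) / (- delta) + p%:R^-1) / p%:R) / tau.

Lemma h_shift l y : ((y + h - gpos l) / delta = (y - gpos l) / delta + q%:R^-1) *
  ((y - h - gpos l) / delta = (y - gpos l) / delta - q%:R^-1).
Proof. by rewrite /gh; split; field; rewrite !gt_eqF. Qed.

(** At most [7 * q] kernels are active, each with error [50 / q] by [kap_diff2], whence 350. The
    remaining factor [1 / q] is what a fine mesh exploits. *)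
Lemma sum_ex2 y : \sum_l `|ex2 l y| <= 350 / (delta ^+ 2 * q%:R).
Proof.
pose W := y / h + c%:R.
pose e Y := (kap2 Y - (kap (Y + q%:R^-1) - 2 * kap Y + kap (Y - q%:R^-1)) / q%:R^-1 ^+ 2) / (delta ^+ 2 * q%:R).
have E l : ex2 l y = e ((W - l%:R) / q%:R).
  rewrite /ex2 /xs2 /xs !h_shift xs_arg -/W /e /gh; set Y := (W - _) / _.
  by field; rewrite !gt_eqF.
under eq_bigr do rewrite E.
apply: le_trans (@sum_window m q W (50 / q%:R / (delta ^+ 2 * q%:R)) (fun l => e ((W - l%:R) / q%:R)) q_gt0 _ _ _) _.
- by rewrite !divr_ge0// ?mulr_ge0 ?sqr_ge0// ltW.
- move=> l; rewrite /e normrM normfV (@gtr0_norm _ (_ * _)) ?mulr_gt0 ?exprn_gt0//.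
  by rewrite ler_pM2r ?invr_gt0 ?mulr_gt0 ?exprn_gt0// kap_diff2// invr_gt0.
- move=> l /(@kap_diff_out _ q%:R^-1 (ltW _) qinv1).
  rewrite invr_gt0 => /(_ q_gt0')[e1 _ e2 e3 e4].
  by rewrite /e e1 e2 e3 e4; ring.
by rewrite le_eqVlt; apply/orP; left; apply/eqP; field; rewrite !gt_eqF.
Qed.

Lemma sum_ex1 y : \sum_l `|ex1 l y| <= 350 / (delta * q%:R).
Proof.
pose W := y / h + c%:R.
pose e Y := (kap1 Y - (kap (Y + q%:R^-1) - kap (Y - q%:R^-1)) / (2 * q%:R^-1)) / (delta * q%:R).
have E l : ex1 l y = e ((W - l%:R) / q%:R).
  rewrite /ex1 /xs1 /xs !h_shift xs_arg -/W /e /gh; set Y := (W - _) / _.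
  by field; rewrite !gt_eqF.
under eq_bigr do rewrite E.
apply: le_trans (@sum_window m q W (50 / q%:R / (delta * q%:R)) (fun l => e ((W - l%:R) / q%:R)) q_gt0 _ _ _) _.
- by rewrite !divr_ge0// ?mulr_ge0 ?sqr_ge0// ltW.
- move=> l; rewrite /e normrM normfV (@gtr0_norm _ (_ * _)) ?mulr_gt0//.
  by rewrite ler_pM2r ?invr_gt0 ?mulr_gt0// kap_diff1// invr_gt0.
- move=> l /(@kap_diff_out _ q%:R^-1 (ltW _) qinv1).
  rewrite invr_gt0 => /(_ q_gt0')[e1 e2 _ e3 e4].
  by rewrite /e e2 e3 e4; ring.
by rewrite le_eqVlt; apply/orP; left; apply/eqP; field; rewrite !gt_eqF.
Qed.

Lemma sum_et1 t M : \sum_(n < M) `|et1 n t| <= 350 / (delta * p%:R).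
Proof.
pose W := (T1 - t) / tau.
pose e Y := (kap1 Y - (kap (Y + p%:R^-1) - kap Y) / p%:R^-1) / (delta * p%:R).
have E n : et1 n t = - e ((W - n%:R) / p%:R).
  rewrite /et1 /ts1 /ts ts_arg -/W /e /gtau; set Y := (W - _) / _.
  by field; rewrite !gt_eqF.
under eq_bigr do rewrite E normrN.
apply: le_trans (@sum_window M p W (50 / p%:R / (delta * p%:R)) (fun l => e ((W - l%:R) / p%:R)) p_gt0 _ _ _) _.
- by rewrite !divr_ge0// ?mulr_ge0 ?sqr_ge0// ltW.
- move=> l; rewrite /e normrM normfV (@gtr0_norm _ (_ * _)) ?mulr_gt0//.
  by rewrite ler_pM2r ?invr_gt0 ?mulr_gt0// kap_diff0// invr_gt0.
- move=> l /(@kap_diff_out _ p%:R^-1 (ltW _) pinv1).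
  rewrite invr_gt0 => /(_ p_gt0')[e1 e2 _ e3 e4].
  by rewrite /e e1 e2 e3; ring.
by rewrite le_eqVlt; apply/orP; left; apply/eqP; field; rewrite !gt_eqF.
Qed.

Lemma sum_crude (k : R -> R) (r : nat) W M B : (0 < r)%N -> 0 <= B ->
  (forall y, `|k y| <= 200) -> (forall y, (y <= 0) || (4 <= y) -> k y = 0) ->
  \sum_(l < M) `|k ((W - l%:R) / r%:R) * B / r%:R| <= 1400 * B.
Proof.
move=> r0 B0 kb ko; have r0' : 0 < r%:R :> R by rewrite ltr0n.
apply: le_trans (@sum_window M r W (200 * B / r%:R) (fun l => k ((W - l%:R) / r%:R) * B / r%:R) r0 _ _ _) _.
- apply: divr_ge0; last exact: ltW.
  by apply: mulr_ge0; [exact: (ler0n R 200)|exact: B0].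
- move=> l; rewrite !normrM (ger0_norm B0) normfV (gtr0_norm r0').
  by rewrite ler_pM2r ?invr_gt0// ler_wpM2r.
- move=> l H; rewrite ko ?mul0r//; move: H; rewrite negb_and -!ltNge => /orP[H|H].
    by apply/orP; left; lra.
  by apply/orP; right; lra.
by rewrite le_eqVlt; apply/orP; left; apply/eqP; field; rewrite gt_eqF.
Qed.

(** 1400 is 7 from [sum_window] times 200 from [kap2_bound]. The bound does not involve the mesh, so
    it is available when the box is chosen, before the grid. *)
Lemma dxx_Phi_crude i z : `|dx i (dx i Phi) z| <= P * (1400 / delta ^+ 2).
Proof.
rewrite dxx_Phi; apply: le_trans (sum_omx_le _ _ _) _; rewrite ler_wpM2l//.
under eq_bigr do rewrite /xs2 xs_arg.
apply: (@sum_crude kap2 q _ m (delta ^+ 2)^-1 q_gt0).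
- by rewrite invr_ge0 sqr_ge0.
- exact: kap2_bound.
- exact: kap2_out.
Qed.

Lemma dx_Phi_crude i z : `|dx i Phi z| <= P * (1400 / delta).
Proof.
rewrite dx_Phi; apply: le_trans (sum_omx_le _ _ _) _; rewrite ler_wpM2l//.
under eq_bigr do rewrite /xs1 xs_arg.
apply: (@sum_crude kap1 q _ m (delta)^-1 q_gt0).
- by rewrite invr_ge0 ltW.
- exact: kap1_bound.
- exact: kap1_out.
Qed.

Lemma dt_Phi_crude z : `|dt Phi z| <= P * (1400 / delta).
Proof.
rewrite dt_Phi; apply: le_trans (sum_omt_le _ _) _; rewrite ler_wpM2l//.
under eq_bigr do rewrite /ts1 ts_arg invrN mulrN mulNr normrN.
apply: (@sum_crude kap1 p _ n1.+1 (delta)^-1 p_gt0).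
- by rewrite invr_ge0 ltW.
- exact: kap1_bound.
- exact: kap1_out.
Qed.

Section consistency.
Variables (L0 : R) (z : X).
Hypothesis L0c : L0 + 6 <= h * c%:R.
Hypothesis zL0 : forall i, `|z.1 0 i| <= L0.

Lemma omx_shift i n k : (omx i (fun l y => xs l (y + h)) n k z = om n (gs' i k) z) *
  (omx i (fun l y => xs l (y - h)) n k z = om n (gs i k) z).
Proof.
have [e1 e2] := xs_shift (k i) L0c (zL0 i).
rewrite /omx !tens_upd /om !(tensE _ _ i) !ffunE eqxx e1 e2.
by split; congr (_ * (_ * _)); apply: eq_bigr => j /negPf ji; rewrite ffunE ji.
Qed.

Lemma omx_id i n k : omx i xs n k z = om n k z.
Proof.
rewrite /omx !tens_upd /om (tensE _ _ i).
by congr (_ * (_ * _)); apply: eq_bigr => j /negPf ji; rewrite ?ji.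
Qed.

(** Summation by parts on the torus moves the differences from [psi] to the kernels, and [omx_shift]
    turns shifts of the index into shifts of [z]; what remains is [ex2]. *)
Lemma dxx_Phi_cons i : `|dx i (dx i Phi) z -
  \sum_(n < n1.+1) \sum_k diff2 gs gs' h i (psi n) k * om n k z| <=
  P * (350 / (delta ^+ 2 * q%:R)).
Proof.
have -> : dx i (dx i Phi) z - \sum_(n < n1.+1) \sum_k diff2 gs gs' h i (psi n) k * om n k z =
    \sum_(n < n1.+1) \sum_k psi n k * omx i ex2 n k z.
  rewrite dxx_Phi -sumrB; apply: eq_bigr => n _.
  have -> : \sum_k diff2 gs gs' h i (psi n) k * om n k z =
     \sum_k psi n k * ((om n (gs' i k) z - 2 * om n k z + om n (gs i k) z) / h ^+ 2).
    have e1 : \sum_k psi n (gs i k) * om n k z = \sum_k psi n k * om n (gs' i k) z.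
      rewrite -(sum_shift (@gsK) (@gs'K) i (fun k => psi n k * om n (gs' i k) z)).
      by apply: eq_bigr => k _; rewrite gsK.
    have e2 : \sum_k psi n (gs' i k) * om n k z = \sum_k psi n k * om n (gs i k) z.
      rewrite -(sum_shift' (@gsK) (@gs'K) i (fun k => psi n k * om n (gs i k) z)).
      by apply: eq_bigr => k _; rewrite gs'K.
    transitivity ((\sum_k psi n (gs i k) * om n k z - 2 * \sum_k psi n k * om n k z +
      \sum_k psi n (gs' i k) * om n k z) / h ^+ 2).
      rewrite mulr_sumr -sumrB -big_split mulr_suml; apply: eq_bigr => k _ /=.
      by rewrite /diff2; ring.
    rewrite e1 e2 mulr_sumr -sumrB -big_split mulr_suml; apply: eq_bigr => k _ /=.
    by ring.
  rewrite -sumrB; apply: eq_bigr => k _; rewrite -mulrBr; congr (_ * _).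
  have [e1 e2] := omx_shift i n k.
  rewrite -e1 -e2 -(omx_id i n k) /omx !tens_upd /ex2; ring.
apply: le_trans (sum_omx_le _ _ _) _; rewrite ler_wpM2l//; exact: sum_ex2.
Qed.

Lemma dx_Phi_cons i : `|dx i Phi z -
  \sum_(n < n1.+1) \sum_k ctr gs gs' h i (psi n) k * om n k z| <=
  P * (350 / (delta * q%:R)).
Proof.
have -> : dx i Phi z - \sum_(n < n1.+1) \sum_k ctr gs gs' h i (psi n) k * om n k z =
    \sum_(n < n1.+1) \sum_k psi n k * omx i ex1 n k z.
  rewrite dx_Phi -sumrB; apply: eq_bigr => n _.
  have -> : \sum_k ctr gs gs' h i (psi n) k * om n k z =
     \sum_k psi n k * ((om n (gs' i k) z - om n (gs i k) z) / (2 * h)).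
    have e1 : \sum_k psi n (gs i k) * om n k z = \sum_k psi n k * om n (gs' i k) z.
      rewrite -(sum_shift (@gsK) (@gs'K) i (fun k => psi n k * om n (gs' i k) z)).
      by apply: eq_bigr => k _; rewrite gsK.
    have e2 : \sum_k psi n (gs' i k) * om n k z = \sum_k psi n k * om n (gs i k) z.
      rewrite -(sum_shift' (@gsK) (@gs'K) i (fun k => psi n k * om n (gs i k) z)).
      by apply: eq_bigr => k _; rewrite gs'K.
    transitivity ((\sum_k psi n (gs i k) * om n k z -
      \sum_k psi n (gs' i k) * om n k z) / (2 * h)).
      rewrite -sumrB mulr_suml; apply: eq_bigr => k _ /=.
      by rewrite /ctr; ring.
    rewrite e1 e2 -sumrB mulr_suml; apply: eq_bigr => k _ /=.
    by ring.
  rewrite -sumrB; apply: eq_bigr => k _; rewrite -mulrBr; congr (_ * _).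
  have [e1 e2] := omx_shift i n k.
  rewrite -e1 -e2 /omx !tens_upd /ex1; ring.
apply: le_trans (sum_omx_le _ _ _) _; rewrite ler_wpM2l//; exact: sum_ex1.
Qed.

Hypothesis psi0 : forall k, psi 0%N k = 0.
Hypothesis z0 : 0 <= z.2.
Hypothesis T1n : T1 <= n1%:R * tau.

Lemma sum_abel (a b b' : nat -> R) M : a 0%N = 0 -> (forall n, b' n.+1 = b n) ->
  \sum_(n < M.+1) a n * (b n - b' n) =
  \sum_(n < M) (a n - a n.+1) * b n + a M * b M.
Proof.
move=> a0 bb; elim: M => [|M IH].
  by rewrite big_ord_recl !big_ord0 a0 !mul0r !addr0.
by rewrite big_ord_recr IH [in RHS]big_ord_recr /= bb; ring.
Qed.

(** Abel summation in time. The boundary term at 0 vanishes because the scheme starts from 0, the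
    one at [n1] because the support of [ts n1] lies in times at most 0. *)
Lemma dt_Phi_cons : `|dt Phi z -
  \sum_(n < n1) \sum_k (psi n k - psi n.+1 k) / tau * om n k z| <=
  P * (350 / (delta * p%:R)).
Proof.
have -> : dt Phi z - \sum_(n < n1) \sum_k (psi n k - psi n.+1 k) / tau * om n k z =
    \sum_(n < n1.+1) \sum_k psi n k * omt et1 n k z.
  rewrite dt_Phi.
  pose b' n t := kap ((t - gt n) / (- delta) + p%:R^-1) / p%:R.
  have -> : \sum_(n < n1) \sum_k (psi n k - psi n.+1 k) / tau * om n k z =
      \sum_(n < n1.+1) \sum_k psi n k * omt (fun n t => (ts n t - b' n t) / tau) n k z.
    rewrite exchange_big [RHS]exchange_big; apply: eq_bigr => k _ /=.
    set Q := \prod_j xs (k j) (z.1 0 j).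
    transitivity ((\sum_(n < n1.+1) psi n k * (ts n z.2 - b' n z.2)) * (Q / tau)).
      rewrite (@sum_abel (fun n => psi n k) (fun n => ts n z.2) (fun n => b' n z.2)) ?psi0//.
        have -> : ts n1 z.2 = 0.
          rewrite /ts kap_out ?mul0r//; apply/orP; left.
          rewrite invrN mulrN oppr_le0 divr_ge0 ?(ltW delta_gt0)// subr_ge0 /gt.
          by apply: le_trans z0; rewrite subr_le0.
        rewrite mulr0 addr0 mulr_suml; apply: eq_bigr => n _.
        by rewrite /om /tens -/Q; ring.
      move=> n; rewrite /b' /ts /gt; congr (kap _ / _).
      by rewrite -natr1 /gtau; field; rewrite !gt_eqF.
    rewrite mulr_suml; apply: eq_bigr => n _.
    by rewrite /omt /tens -/Q; ring.
  rewrite -sumrB; apply: eq_bigr => n _; rewrite -sumrB; apply: eq_bigr => k _.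
  by rewrite -mulrBr -mulrBr.
apply: le_trans (sum_omt_le _ _) _; rewrite ler_wpM2l//; exact: sum_et1.
Qed.

End consistency.
End field.
End grid.

(** Jensen's inequality for weights of total mass at most 1. *)
Lemma wsum_sqr {R : realType} (I : finType) (a w : I -> R) :
  (forall i, 0 <= w i) -> \sum_i w i <= 1 ->
  (\sum_i a i * w i) ^+ 2 <= \sum_i a i ^+ 2 * w i.
Proof.
move=> w0 w1; set s := \sum_i a i * w i.
have es : \sum_i a i * w i = s by [].
clearbody s.
have : 0 <= \sum_i (a i - s) ^+ 2 * w i.
  by apply: sumr_ge0 => i _; rewrite mulr_ge0 ?sqr_ge0.
have -> : \sum_i (a i - s) ^+ 2 * w i =
    \sum_i a i ^+ 2 * w i - 2 * s * s + s ^+ 2 * \sum_i w i.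
  have -> : 2 * s * s = \sum_i 2 * s * (a i * w i) by rewrite -mulr_sumr es.
  rewrite mulr_sumr -sumrB -big_split /=; apply: eq_bigr => i _; ring.
have : s ^+ 2 * \sum_i w i <= s ^+ 2 by rewrite ler_piMr ?sqr_ge0.
by rewrite expr2; lra.
Qed.

Lemma wsum2_sqr {R : realType} (I J : finType) (a w : I -> J -> R) :
  (forall i j, 0 <= w i j) -> \sum_i \sum_j w i j <= 1 ->
  (\sum_i \sum_j a i j * w i j) ^+ 2 <= \sum_i \sum_j a i j ^+ 2 * w i j.
Proof.
rewrite !pair_bigA /= => w0 w1.
exact: (@wsum_sqr _ (I * J)%type (fun u => a u.1 u.2) (fun u => w u.1 u.2)).
Qed.

Lemma sumr_ord {R : realType} N (x : R) : \sum_(i < N) x = N%:R * x.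
Proof. by rewrite sumr_const card_ord [RHS]mulr_natl. Qed.

(** * The scheme with the coefficients of the adjoint problem *)

Section adjoint.
Context {R : realType} {N : nat}.
Local Notation X := ('rV[R]_N * R)%type.
Variables (delta : R) (q p c n1 : nat) (T1 : R).
Hypothesis delta_gt0 : 0 < delta.
Hypothesis delta_le1 : delta <= 1.
Hypothesis q_gt0 : (0 < q)%N.
Hypothesis p_gt0 : (0 < p)%N.
Notation h := (gh delta q).
Notation tau := (gtau delta p).
Notation m := (c.*2).+1.
Local Notation G := {ffun 'I_N -> 'I_m}.
Local Notation sf := (@gs N c).
Local Notation sb := (@gs' N c).
Variables (be : X -> R) (f : 'I_N -> 'rV[R]_N -> R) (ze : X -> R).
Variables (Lb eps M F Lf Lz A alpha beta L0 Tm : R).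
Hypothesis be_lip : xtlip Lb be.
Hypothesis be_bd : forall z, eps <= be z <= M.
Hypothesis eps_gt0 : 0 < eps.
Hypothesis M_ge1 : 1 <= M.
Hypothesis f_bd : forall i x, `|f i x| <= F.
Hypothesis f_lip : forall i, xlip Lf (f i).
Hypothesis Lf_ge0 : 0 <= Lf.
Hypothesis F_ge0 : 0 <= F.
Hypothesis ze_lip : xtlip Lz ze.
Hypothesis ze_bd : forall z, `|ze z| <= 1.
Hypothesis ze_out : forall z, ze z != 0 ->
  alpha <= z.2 <= beta /\ forall i, `|z.1 0 i| <= A.
Hypothesis alpha_beta : alpha <= beta.
Hypothesis A_ge0 : 0 <= A.
Hypothesis L0_ge0 : 0 <= L0.
Hypothesis L0c : L0 + 6 <= h * c%:R.
Hypothesis Ac : A + 1 <= h * c%:R.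
Hypothesis cfl : tau * (12 * N%:R * M) <= h ^+ 2.
Hypothesis mono : F * h <= 2 * eps.
Hypothesis T1n : T1 <= n1%:R * tau.
Hypothesis nT : n1.+1%:R * tau <= Tm.

Let h_gt0 : 0 < h. Proof. exact: gh_gt0. Qed.
Let tau_gt0 : 0 < tau. Proof. exact: gtau_gt0. Qed.
Let h_le1 : h <= 1. Proof. exact: le_trans (gh_le delta_gt0 q_gt0) delta_le1. Qed.
Let M_ge0 : 0 <= M. Proof. exact: le_trans ler01 M_ge1. Qed.

(** [f] is cut off before the grid wraps around. *)
Definition cut (x : 'rV[R]_N) : R :=
  Num.max 0 (1 - \sum_i Num.max 0 (`|x 0 i| - (L0 + 4))).

Lemma cut_bd x : 0 <= cut x <= 1.
Proof.
rewrite /cut le_max lexx ge_max ler01 /= gerBl.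
by apply: sumr_ge0 => i _; rewrite le_max lexx.
Qed.

Lemma cut_in (x : 'rV[R]_N) : (forall i, `|x 0 i| <= L0 + 4) -> cut x = 1.
Proof.
move=> xL; rewrite /cut big1 ?subr0 ?max_r// => i _.
by rewrite max_l// subr_le0.
Qed.

Lemma cut_out (x : 'rV[R]_N) i : L0 + 5 <= `|x 0 i| -> cut x = 0.
Proof.
move=> xL; rewrite /cut max_l// subr_le0 (bigD1 i)//=.
apply: (@le_trans _ _ (Num.max 0 (`|x 0 i| - (L0 + 4)))).
  by rewrite le_max; apply/orP; right; lra.
by rewrite lerDl; apply: sumr_ge0 => j _; rewrite le_max lexx.
Qed.

Lemma max0_lip (u v : R) : `|Num.max 0 u - Num.max 0 v| <= `|u - v|.
Proof.
case: (leP 0 u) => u0; case: (leP 0 v) => v0; rewrite ?subrr ?normr0//.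
- by rewrite subr0 ger0_norm// ler_normr; apply/orP; left; lra.
- by rewrite sub0r normrN ger0_norm// ler_normr; apply/orP; right; lra.
Qed.

Lemma cut_lip : xlip N%:R cut.
Proof.
move=> x x' r xx'; apply: le_trans (max0_lip _ _) _.
have -> (u v : R) : 1 - u - (1 - v) = v - u by ring.
rewrite -sumrB.
apply: le_trans (ler_norm_sum _ _ _) _.
have -> : N%:R * r = \sum_(i < N) r by rewrite sumr_ord.
apply: ler_sum => i _; apply: le_trans (max0_lip _ _) _.
have -> (u v w : R) : u - w - (v - w) = u - v by ring.
by apply: le_trans (ler_dist_dist _ _) _; rewrite distrC.
Qed.

Definition px (k : G) : 'rV[R]_N := \row_i gpos delta q (k i).
Definition nb n (k : G) := be (gpt delta q p T1 n k).
Definition nf i (k : G) := f i (px k) * cut (px k).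
Definition nz n (k : G) := ze (gpt delta q p T1 n k).

(** The second case is the seam of the torus, where [cut] and the source vanish at both nodes. *)
Lemma px_shift i (k : G) :
  (forall j, `|px (sf i k) 0 j - px k 0 j| <= h) \/
  (`|px (sf i k) 0 i| = h * c%:R /\ `|px k 0 i| = h * c%:R).
Proof.
have [lm|lm] := eqVneq (k i : nat) c.*2.
  right; rewrite !mxE ffunE eqxx /gpos /= lm modnn -addnn natrD sub0r mulrN normrN addrK.
  by rewrite ger0_norm// mulr_ge0// ltW.
left=> j; rewrite !mxE ffunE; case: eqP => [->|_]; last by rewrite subrr normr0 ltW.
have el : nat_of_ord (ordS (k i)) = (k i).+1.
  by rewrite /= modn_small// ltn_neqAle eqSS lm /= ltn_ord.
rewrite /gpos el -natr1.
have -> (u v : R) : h * (u + 1 - v) - h * (u - v) = h by ring.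
by rewrite gtr0_norm.
Qed.

Lemma nf_bd i k : `|nf i k| <= F.
Proof.
rewrite /nf normrM -[leRHS]mulr1; apply: ler_pM => //.
by have := cut_bd (px k) => /andP[? ?]; rewrite ger0_norm.
Qed.

Lemma nf_lip i l k : `|nf i (sf l k) - nf i k| <= (Lf + N%:R * F) * h.
Proof.
have F0 := F_ge0.
have [H|[H1 H2]] := px_shift l k; last first.
  rewrite /nf !(@cut_out _ l) ?H1 ?H2 ?mulr0 ?subrr ?normr0; [|by have := L0c; lra..].
  by rewrite mulr_ge0 ?addr_ge0 ?mulr_ge0// ltW.
rewrite /nf; set x := px _ in H *; set x' := px _ in H *.
have -> : f i x * cut x - f i x' * cut x' =
  (f i x - f i x') * cut x + f i x' * (cut x - cut x') by ring.
apply: le_trans (ler_normD _ _) _; rewrite [leRHS]mulrDl; apply: lerD.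
  rewrite normrM -[leRHS]mulr1; apply: ler_pM => //; first exact: f_lip.
  by have := cut_bd x => /andP[? ?]; rewrite ger0_norm.
rewrite normrM mulrAC mulrC; apply: ler_pM => //; exact: cut_lip.
Qed.

Lemma nz_bd n k : `|nz n k| <= 1. Proof. exact: ze_bd. Qed.

(** One mesh width more than the support of the source, so that the forward differences of [nz]
    vanish off this set too. *)
Definition near0 (k : G) := [forall i, `|px k 0 i| <= A + h].

Lemma nz_near n k : ~~ near0 k -> nz n k = 0.
Proof.
apply: contraNeq => /ze_out[_ H]; apply/forallP => i.
by apply: le_trans (H i) _; rewrite lerDl ltW.
Qed.

Lemma nz_fwd n i k : `|fwd sf h i (nz n) k| <= Lz * (near0 k)%:R.
Proof.
have Lz0 : 0 <= Lz.
  have := @ze_lip 0 0 1; rewrite !subrr normr0 mulr1; apply => // j.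
  by rewrite subrr normr0.
rewrite /fwd normrM normfV (gtr0_norm h_gt0) ler_pdivrMr//.
have [H|[H1 H2]] := px_shift i k; last first.
  have o (k' : G) : `|px k' 0 i| = h * c%:R -> nz n k' = 0.
    move=> E; apply/eqP; apply: contraT => /ze_out[_ /(_ i)].
    by rewrite [X in `|X|](_ : _ = px k' 0 i)// E; have := Ac; lra.
  by rewrite !o// subrr normr0 !mulr_ge0// ltW.
have [kn|kn] := boolP (near0 k).
  rewrite mulr1; apply: ze_lip; first exact: H.
  by rewrite /= subrr normr0 ltW.
rewrite (nz_near n kn) subr0 mulr0 mul0r.
suff -> : nz n (sf i k) = 0 by rewrite normr0.
apply/eqP; apply: contraNT kn => /ze_out[_ zA]; apply/forallP => j.
have := H j; have := zA j; rewrite [X in `|X|](_ : _ = px (sf i k) 0 j)//.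
set u := px _ 0 j; set v := px _ 0 j => a1 a2.
have -> : v = u - (u - v) by lra.
by apply: le_trans (ler_normB _ _) _; apply: lerD.
Qed.

(** Each direction contributes at most [2 * (A + h) + h] once the mesh width is multiplied in, and
    [h <= 1]. *)
Lemma card_near0 : h ^+ N * \sum_(k : G) (near0 k)%:R <= (2 * A + 3) ^+ N.
Proof.
have -> : \sum_(k : G) (near0 k)%:R = \sum_(k : G) \prod_i (`|gpos delta q (k i)| <= A + h)%R%:R :> R.
  apply: eq_bigr => k _; rewrite /near0; case: forallP => [H|H].
    by rewrite big1// => i _; move: (H i); rewrite mxE => ->.
  have [i Hi] : exists i, ~~ (`|px k 0 i| <= A + h).
    by move/existsNP: H => [i /negP]; exists i.
  rewrite (bigD1 i)//=; move: Hi; rewrite mxE => /negPf ->.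
  by rewrite mul0r.
rewrite (sum_tens (fun _ l => (`|gpos delta q l| <= A + h)%R%:R)) prodr_const card_ord -exprMn.
have hh := h_gt0; have h1 := h_le1; have A0 := A_ge0.
apply: lerXn2r; rewrite ?nnegrE; [by rewrite mulr_ge0 ?(ltW hh)// sumr_ge0|lra|].
apply: (@le_trans _ _ (h * (2 * (A + h) / h + 1))).
  rewrite ler_wpM2l ?(ltW hh)//.
  apply: le_trans (@sum_count _ (c%:R + (A + h) / h) (2 * (A + h) / h) m _); last first.
    by rewrite divr_ge0 ?(ltW hh)//; lra.
  apply: ler_sum => l _; case: ifPn => // H; last first.
    case: (boolP (`|gpos delta q l| <= A + h)) => //= H'; case/negP: H.
    rewrite -(ler_pM2l hh) mulr0 -[X in _ && (X)](ler_pM2l hh).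
    move: H'; rewrite /gpos ler_norml => /andP[u1 u2].
    have e1 : h * (c%:R + (A + h) / h - l%:R) = (A + h) - h * (l%:R - c%:R).
      by field; rewrite gt_eqF.
    have e2 : h * (2 * (A + h) / h) = 2 * (A + h) by field; rewrite gt_eqF.
    by rewrite e1 e2; apply/andP; split; lra.
  by case: (`|gpos delta q l| <= A + h).
have -> : h * (2 * (A + h) / h + 1) = 2 * (A + h) + h by field; rewrite gt_eqF.
lra.
Qed.

Definition psi := scheme sf sb h nb nf nz tau.

Definition Kz : R := (2 * A + 3) ^+ N * (N%:R * Lz ^+ 2 + 1).
(** Neither [eps] nor [Lb] nor the grid enters: this is the uniformity on which the duality argument
    rests. [Lf + N%:R * F] is a Lipschitz constant of [f] times the cutoff [cut]. *)
Definition Ke : R := expR ((4 * N%:R * (Lf + N%:R * F) + 1 + N%:R * F ^+ 2) * Tm) * (Tm * Kz).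

Lemma nz_energy n : h ^+ N * (dir sf h (nz n) + \sum_k nz n k ^+ 2) <= Kz.
Proof.
have hN : 0 <= h ^+ N by rewrite exprn_ge0// ltW.
rewrite /Kz; apply: le_trans (ler_wpM2r _ card_near0); last first.
  by apply: addr_ge0 => //; apply: mulr_ge0 => //; exact: sqr_ge0.
rewrite -mulrA ler_wpM2l// mulrDr mulr1; apply: lerD.
  have -> : (\sum_k (near0 k)%:R) * (N%:R * Lz ^+ 2) =
      \sum_(i < N) (\sum_k (near0 k)%:R) * Lz ^+ 2.
    by rewrite sumr_ord mulrCA.
  apply: ler_sum => i _; rewrite mulr_suml; apply: ler_sum => k _.
  have := nz_fwd n i k; case: near0; rewrite ?mulr1 ?mulr0 ?mul1r ?mul0r => H.
    rewrite -(real_normK (num_real (fwd _ _ _ _ _))) lerXn2r// nnegrE//.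
    exact: le_trans (normr_ge0 _) H.
  by move: H; rewrite normr_le0 => /eqP ->; rewrite expr0n.
apply: ler_sum => k _; have [kn|kn] := boolP (near0 k).
  by rewrite -(real_normK (num_real (nz n k))) exprn_ile1// nz_bd.
by rewrite nz_near// expr0n.
Qed.

Let Cc : R := 4 * N%:R * (Lf + N%:R * F) + 1 + N%:R * F ^+ 2.

Lemma Cc_ge0 : 0 <= Cc.
Proof.
rewrite /Cc; apply: addr_ge0; last by apply: mulr_ge0 => //; exact: sqr_ge0.
by rewrite addr_ge0 ?mulr_ge0 ?addr_ge0 ?mulr_ge0.
Qed.

Let b0M n (k : G) : 0 <= nb n k <= M.
Proof.
by have /andP[u1 u2] := be_bd (gpt delta q p T1 n k); rewrite /nb u2 (le_trans (ltW eps_gt0)).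
Qed.

Lemma psi_energy n : (n <= n1.+1)%N ->
  h ^+ N * (dir sf h (psi n) + tau * \sum_(j < n) \sum_k nb j k * dlap sf sb h (psi j) k ^+ 2) <= Ke.
Proof.
have Tm0 : 0 <= Tm by apply: le_trans nT; rewrite mulr_ge0// ltW.
have Kz0 : 0 <= Kz.
  apply: mulr_ge0; first by rewrite exprn_ge0//; have := A_ge0; lra.
  by apply: addr_ge0 => //; apply: mulr_ge0 => //; exact: sqr_ge0.
have hN : 0 <= h ^+ N by rewrite exprn_ge0// ltW.
move=> nn1.
have NF : 0 <= Lf + N%:R * F by rewrite addr_ge0 ?mulr_ge0.
have := @scheme_energy _ _ _ sf sb h (@gsK N c) (@gs'K N c) (@gsC N c) h_gt0 nb nf nz M F
  (Lf + N%:R * F) tau M_ge1 F_ge0 NF tau_gt0 b0M nf_bd nf_lip cfl n.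
rewrite -/psi -/Cc => H.
apply: le_trans (ler_wpM2l hN H) _.
rewrite mulrCA; apply: ler_pM.
- by rewrite exprn_ge0// addr_ge0// mulr_ge0 ?Cc_ge0// ltW.
- rewrite mulr_ge0//mulr_ge0 ?(ltW tau_gt0)//; apply: sumr_ge0 => j _.
  rewrite addr_ge0//; last by apply: sumr_ge0 => k _; exact: sqr_ge0.
  by apply: sumr_ge0 => i _; apply: sumr_ge0 => k _; exact: sqr_ge0.
- apply: (@le_trans _ _ (expR (tau * Cc) ^+ n)).
    by rewrite lerXn2r// ?nnegrE ?expR_ge0// ?expR_ge1Dx// addr_ge0// mulr_ge0 ?Cc_ge0// ltW.
  rewrite -expRM_natl ler_expR mulrA mulrC ler_wpM2l ?Cc_ge0//.
  by apply: le_trans nT; rewrite ler_wpM2r ?(ltW tau_gt0)// ler_nat.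
- rewrite mulrCA mulr_sumr mulrC.
  apply: (@le_trans _ _ ((\sum_(j < n) Kz) * tau)).
    by rewrite ler_wpM2r ?(ltW tau_gt0)//; apply: ler_sum => j _; exact: nz_energy.
  rewrite sumr_const card_ord -mulr_natl mulrAC ler_wpM2r//.
  by apply: le_trans nT; rewrite ler_wpM2r ?(ltW tau_gt0)// ler_nat.
Qed.

Lemma psi_dir n : (n <= n1.+1)%N -> h ^+ N * dir sf h (psi n) <= Ke.
Proof.
move=> /psi_energy; apply: le_trans; rewrite ler_wpM2l ?exprn_ge0 ?(ltW h_gt0)//.
rewrite lerDl mulr_ge0 ?(ltW tau_gt0)//; apply: sumr_ge0 => j _; apply: sumr_ge0 => k _.
by rewrite mulr_ge0 ?sqr_ge0//; case/andP: (b0M j k).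
Qed.

(** The dissipation is at least [eps] times the squared Laplacian. The resulting factor [1 / eps] is
    compensated by the weight in Young's inequality in [source_est_s]. *)
Lemma psi_lap2 : h ^+ N * tau *
  (\sum_(n < n1.+1) \sum_k dlap sf sb h (psi n) k ^+ 2) <= Ke / eps.
Proof.
rewrite ler_pdivlMr// -mulrA; apply: le_trans (psi_energy (leqnn _)).
rewrite -mulrA ler_wpM2l ?exprn_ge0 ?(ltW h_gt0)//.
apply: (@le_trans _ _ (tau * \sum_(j < n1.+1) \sum_k nb j k * dlap sf sb h (psi j) k ^+ 2)).
  rewrite -[leLHS]mulrA ler_wpM2l ?(ltW tau_gt0)// mulr_suml; apply: ler_sum => j _.
  rewrite mulr_suml; apply: ler_sum => k _; rewrite mulrC ler_wpM2r ?sqr_ge0//.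
  by have /andP[] := be_bd (gpt delta q p T1 j k).
by rewrite lerDr; apply: sumr_ge0 => i _; apply: sumr_ge0 => k _; exact: sqr_ge0.
Qed.

Lemma psi_ctr2 : h ^+ N * tau *
  (\sum_(n < n1.+1) \sum_k \sum_i ctr sf sb h i (psi n) k ^+ 2) <= Tm * Ke.
Proof.
have hN : 0 <= h ^+ N by rewrite exprn_ge0// ltW.
have Ke0 : 0 <= Ke.
  apply: le_trans (psi_dir (leq0n _)); rewrite mulr_ge0//.
  by apply: sumr_ge0 => i _; apply: sumr_ge0 => k _; exact: sqr_ge0.
apply: le_trans (ler_wpM2r Ke0 nT); rewrite [h ^+ N * _]mulrC -mulrA.
rewrite [_ * tau]mulrC -[leRHS]mulrA ler_wpM2l ?(ltW tau_gt0)// mulr_sumr.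
rewrite mulr_natl -[n1.+1 in leRHS]card_ord -sumr_const; apply: ler_sum => n _.
apply: le_trans (psi_dir (ltnW (ltn_ord n))); rewrite ler_wpM2l//.
rewrite exchange_big /dir; apply: ler_sum => i _.
exact: (ctr_le (@gsK N c) (@gs'K N c) h_gt0).
Qed.

Lemma sum_ind (a b : R) n : a <= b ->
  tau * \sum_(j < n) (if a <= gt delta p T1 j <= b then 1 else 0) <= b - a + tau.
Proof.
move=> ab.
have -> : \sum_(j < n) (if a <= gt delta p T1 j <= b then 1 else 0 : R) =
   \sum_(j < n) (if 0 <= (T1 - a) / tau - j%:R <= (b - a) / tau then 1 else 0 : R).
  apply: eq_bigr => j _; congr (if _ then _ else _); rewrite /gt.
  rewrite -(ler_pM2l tau_gt0 0) -(ler_pM2l tau_gt0 _ ((b - a) / tau)) mulr0.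
  have -> : tau * ((T1 - a) / tau - j%:R) = T1 - a - j%:R * tau by field; rewrite gt_eqF.
  have -> : tau * ((b - a) / tau) = b - a by field; rewrite gt_eqF.
  by apply/idP/idP => /andP[? ?]; apply/andP; split; lra.
have h0 : 0 <= (b - a) / tau by rewrite divr_ge0 ?(ltW tau_gt0)// subr_ge0.
apply: le_trans (ler_wpM2l (ltW tau_gt0) (sum_count _ _ h0)) _.
by rewrite mulrDr mulr1 lerD2r mulrCA divff ?gt_eqF// mulr1.
Qed.

(** The source is at most 1 and acts only at times in [[alpha, beta]], so the maximum principle
    accumulates the length of that interval, up to one time step. *)
Lemma psi_max n k : `|psi n k| <= beta - alpha + tau.
Proof.
apply: le_trans (sum_ind n alpha_beta).
apply: (@scheme_max _ _ _ sf sb h h_gt0 nb nf nz tau tau_gt0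
  (fun j => if alpha <= gt delta p T1 j <= beta then 1 else 0)).
- move=> j k'; apply: le_trans cfl; have /andP[b0 bM] := b0M j k'.
  have : 0 <= tau * (N%:R * (M - nb j k')).
    by rewrite mulr_ge0 ?(ltW tau_gt0)// mulr_ge0// subr_ge0.
  have : 0 <= tau * (N%:R * nb j k') by rewrite mulr_ge0 ?(ltW tau_gt0)// mulr_ge0.
  by lra.
- move=> j i k'; apply: (@le_trans _ _ (F * h)).
    by rewrite ler_wpM2r ?(ltW h_gt0)// nf_bd.
  apply: le_trans mono _; rewrite ler_wpM2l//.
  by have /andP[] := be_bd (gpt delta q p T1 j k').
- move=> j k'; case: ifPn => H; first exact: nz_bd.
  suff -> : nz j k' = 0 by rewrite normr0.
  by apply/eqP; apply: contraNT H => /ze_out[].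
Qed.

Lemma psi_late n k : beta <= gt delta p T1 n -> psi n k = 0.
Proof.
suff H : forall n, (forall j k, (j < n)%N -> nz j k = 0) -> psi n = fun=> 0.
  move=> bn; rewrite H// => j k' jn; apply/eqP; apply: contraT => /ze_out[].
  rewrite /gpt /= => /andP[_ +] _; rewrite leNgt => /negP[].
  apply: le_lt_trans bn _; rewrite /gt ltrD2l ltrN2 ltr_pM2r// ltr_nat//.
elim=> [//|n' IH] H; apply/funext => k'; rewrite /psi schemeS -/psi IH; last first.
  by move=> j k'' jn; apply: H; rewrite ltnW.
rewrite /gen H// addr0 [X in _ - X]big1 => [|i _].
  rewrite /dlap big1 ?mulr0 ?subr0 ?mulr0 ?addr0// => i _.
  by rewrite /diff2 mulr0 subrr addr0 mul0r.
by rewrite /ctr subrr mul0r mulr0.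
Qed.

Lemma psi_init k : psi 0%N k = 0. Proof. by []. Qed.

Local Notation PHI := (Phi delta q p n1 T1 psi).
Local Notation OM := (om delta q p T1).
Let Pb := beta - alpha + tau.

(** [lapS] and [errS] are averages of grid quantities with the weights [OM], so that [wsum2_sqr]
    applies to them. [errS] is the cost of freezing [be] and [f] at the nodes within the reach
    [4 * delta] of the kernels. *)
Definition lapS (z : X) : R :=
  \sum_(n < n1.+1) \sum_k `|dlap sf sb h (psi n) k| * OM n k z.
Definition errS (z : X) : R := \sum_(n < n1.+1) \sum_k
  (4 * delta * (Lb * `|dlap sf sb h (psi n) k| + \sum_i Lf * `|ctr sf sb h i (psi n) k|)) * OM n k z.

Definition consE : R := Lz * (4 * delta) + Pb * (350 / (delta * p%:R))
  + M * (N%:R * (Pb * (350 / (delta ^+ 2 * q%:R)))) + N%:R * (F * (Pb * (350 / (delta * q%:R)))).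

Lemma laplacian_Phi (z : X) : (forall i, `|z.1 0 i| <= L0) ->
  `|laplacian PHI z - \sum_(n < n1.+1) \sum_k dlap sf sb h (psi n) k * OM n k z|
   <= N%:R * (Pb * (350 / (delta ^+ 2 * q%:R))).
Proof.
move=> zL; have -> : \sum_(n < n1.+1) \sum_k dlap sf sb h (psi n) k * OM n k z =
   \sum_i \sum_(n < n1.+1) \sum_k diff2 sf sb h i (psi n) k * OM n k z.
  rewrite [RHS]exchange_big; apply: eq_bigr => n _ /=; rewrite [RHS]exchange_big.
  by apply: eq_bigr => k _ /=; rewrite /dlap mulr_suml.
rewrite /laplacian -sumrB; apply: le_trans (ler_norm_sum _ _ _) _.
apply: (@le_trans _ _ (\sum_(i < N) (Pb * (350 / (delta ^+ 2 * q%:R))))); last first.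
  by rewrite sumr_ord.
apply: ler_sum => i _.
exact: (dxx_Phi_cons T1 delta_gt0 delta_le1 q_gt0 p_gt0 (fun n k _ => psi_max n k) L0c zL).
Qed.

Lemma lap_le (z : X) : (forall i, `|z.1 0 i| <= L0) ->
  `|laplacian PHI z| <= lapS z + N%:R * (Pb * (350 / (delta ^+ 2 * q%:R))).
Proof.
move=> zL; have H := laplacian_Phi zL.
rewrite -[laplacian _ _](subrK (\sum_(n < n1.+1) \sum_k dlap sf sb h (psi n) k * OM n k z)).
rewrite addrC; apply: le_trans (ler_normD _ _) _; apply: lerD => //.
apply: le_trans (ler_norm_sum _ _ _) _; apply: ler_sum => n _.
apply: le_trans (ler_norm_sum _ _ _) _; apply: ler_sum => k _.
by rewrite normrM (ger0_norm (om_ge0 _ _ _ _ _ _ _)).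
Qed.

(** The scheme holds exactly at the nodes. Averaging it with the partition of unity leaves the
    variation of the coefficients over the reach of the kernels, which is [errS] and the first term
    of [consE], and the consistency errors, which are the rest of [consE]. *)
Lemma residual_le (z : X) : (forall i, `|z.1 0 i| <= L0) -> 0 <= z.2 -> z.2 <= T1 - 4 * delta ->
  `|ze z + dt PHI z + be z * laplacian PHI z - \sum_i f i z.1 * dx i PHI z|
  <= errS z + consE.
Proof.
move=> zL z0 z1.
have n2 : T1 - z.2 <= n1.+1%:R * tau.
  have : n1%:R * tau <= n1.+1%:R * tau by rewrite ler_wpM2r ?(ltW tau_gt0)// ler_nat.
  by have := T1n; lra.
have L04 : L0 + 4 * delta <= h * c%:R by have := L0c; have := delta_le1; lra.
have om1 := sum_om_eq1 delta_gt0 q_gt0 p_gt0 L04 zL z1 n2.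
have pm := (fun n k (_ : (n <= n1)%N) => psi_max n k).
have Ht := dt_Phi_cons delta_gt0 q_gt0 p_gt0 pm psi_init z0 T1n.
have Hl := laplacian_Phi zL.
have Hx i := dx_Phi_cons T1 delta_gt0 delta_le1 q_gt0 p_gt0 pm L0c zL i.
set Dt := \sum_(n < n1) _ in Ht; set Dl := \sum_(n < n1.+1) _ in Hl.
pose Dx i := \sum_(n < n1.+1) \sum_k ctr sf sb h i (psi n) k * OM n k z.
have DtE : Dt = - \sum_(n < n1.+1) \sum_k gen sf sb h (nb n) nf (nz n) (psi n) k * OM n k z.
  rewrite /Dt [X in - X]big_ord_recr /= [X in - (_ + X)]big1 ?addr0; last first.
    move=> k _; suff tz : ts delta p T1 n1 z.2 = 0 by rewrite /om /tens tz !mulr0.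
    rewrite /ts kap_out ?mul0r//; apply/orP; left.
    rewrite invrN mulrN oppr_le0 divr_ge0 ?(ltW delta_gt0)// subr_ge0.
    by apply: le_trans z0; rewrite /gt subr_le0.
  rewrite -sumrN; apply: eq_bigr => n _; rewrite -sumrN; apply: eq_bigr => k _.
  rewrite -mulNr; congr (_ * _).
  by field; rewrite gt_eqF.
have key : ze z + Dt + be z * Dl - \sum_i f i z.1 * Dx i = \sum_(n < n1.+1) \sum_k
   ((ze z - nz n k) + (be z - nb n k) * dlap sf sb h (psi n) k
     - \sum_i (f i z.1 - nf i k) * ctr sf sb h i (psi n) k) * OM n k z.
  have eze : ze z = \sum_(n < n1.+1) \sum_(k : G) ze z * OM n k z.
    by rewrite -[LHS]mulr1 -om1 mulr_sumr; apply: eq_bigr => n _; rewrite mulr_sumr.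
  rewrite [X in X + Dt]eze.
  have -> : \sum_i f i z.1 * Dx i = \sum_(n < n1.+1) \sum_k
      (\sum_i f i z.1 * ctr sf sb h i (psi n) k) * OM n k z.
    under eq_bigr do rewrite mulr_sumr.
    rewrite exchange_big; apply: eq_bigr => n _ /=.
    under eq_bigr do rewrite mulr_sumr.
    rewrite exchange_big; apply: eq_bigr => k _ /=.
    by rewrite mulr_suml; apply: eq_bigr => i _; rewrite mulrA.
  rewrite DtE mulr_sumr -!sumrB -big_split -sumrB; apply: eq_bigr => n _ /=.
  rewrite mulr_sumr -!sumrB -big_split -sumrB; apply: eq_bigr => k _ /=.
  under [X in _ = (_ - X) * _]eq_bigr do rewrite mulrBl.
  by rewrite sumrB /gen; ring.
have hk : `|ze z + Dt + be z * Dl - \sum_i f i z.1 * Dx i| <= errS z + Lz * (4 * delta).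
  rewrite key; apply: le_trans (ler_norm_sum _ _ _) _.
  have -> : Lz * (4 * delta) = \sum_(n < n1.+1) \sum_(k : G) Lz * (4 * delta) * OM n k z.
    move: (Lz * (4 * delta)) => r; rewrite -[LHS]mulr1 -om1 mulr_sumr.
    by apply: eq_bigr => n _; rewrite mulr_sumr.
  rewrite /errS -big_split; apply: ler_sum => n _ /=.
  rewrite -big_split; apply: le_trans (ler_norm_sum _ _ _) _; apply: ler_sum => k _ /=.
  rewrite normrM (ger0_norm (om_ge0 _ _ _ _ _ _ _)).
  have [->|/(om_near delta_gt0)[near1 [near2 _]]] := eqVneq (OM n k z) 0.
    by rewrite !mulr0 addr0.
  rewrite -mulrDl ler_wpM2r ?om_ge0//.
  apply: le_trans (ler_normB _ _) _; apply: le_trans (lerD (ler_normD _ _) (lexx _)) _.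
  have e1 : `|ze z - nz n k| <= Lz * (4 * delta) by exact: ze_lip.
  have e2 : `|(be z - nb n k) * dlap sf sb h (psi n) k| <=
      4 * delta * (Lb * `|dlap sf sb h (psi n) k|).
    by rewrite normrM mulrA [4 * delta * Lb]mulrC ler_wpM2r//; exact: be_lip.
  have e3 : `|\sum_i (f i z.1 - nf i k) * ctr sf sb h i (psi n) k| <=
      4 * delta * \sum_i Lf * `|ctr sf sb h i (psi n) k|.
    apply: le_trans (ler_norm_sum _ _ _) _; rewrite mulr_sumr; apply: ler_sum => i _.
    rewrite normrM mulrA [4 * delta * Lf]mulrC ler_wpM2r// /nf cut_in ?mulr1; first exact: f_lip.
    move=> j; have := near1 j; rewrite /gpt/= -/(px k) => nj.
    rewrite -[px k 0 j](subrK (z.1 0 j)) [_ + z.1 0 j]addrC.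
    apply: le_trans (ler_normD _ _) _; apply: lerD; first exact: zL.
    by rewrite distrC; apply: le_trans nj _; have := delta_le1; lra.
  by rewrite mulrDr; lra.
have -> : ze z + dt PHI z + be z * laplacian PHI z - \sum_i f i z.1 * dx i PHI z =
  (ze z + Dt + be z * Dl - \sum_i f i z.1 * Dx i) + (dt PHI z - Dt) +
  be z * (laplacian PHI z - Dl) - \sum_i f i z.1 * (dx i PHI z - Dx i).
  under [X in _ = _ - X]eq_bigr do rewrite mulrBr.
  by rewrite sumrB; ring.
apply: le_trans (ler_normB _ _) _; apply: le_trans (lerD (ler_normD _ _) (lexx _)) _.
apply: le_trans (lerD (lerD (ler_normD _ _) (lexx _)) (lexx _)) _.
have h2 : `|be z * (laplacian PHI z - Dl)| <= M * (N%:R * (Pb * (350 / (delta ^+ 2 * q%:R)))).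
  rewrite normrM; apply: ler_pM => //.
  have /andP[b0 bM] := be_bd z; rewrite ger0_norm//.
  by apply: le_trans b0; exact: ltW.
have h3 : `|\sum_i f i z.1 * (dx i PHI z - Dx i)| <=
    N%:R * (F * (Pb * (350 / (delta * q%:R)))).
  apply: le_trans (ler_norm_sum _ _ _) _.
  apply: (@le_trans _ _ (\sum_(i < N) (F * (Pb * (350 / (delta * q%:R)))))); last first.
    by rewrite sumr_ord.
  by apply: ler_sum => i _; rewrite normrM; apply: ler_pM.
rewrite /consE !addrA; apply: lerD => //; apply: lerD => //; exact: lerD.
Qed.

End adjoint.

(** * Measure theory *)

Section L1.
Context d (T : measurableType d) {R : realType} (mu : {measure set T -> \bar R}).
Implicit Types (f g h w b : T -> R) (M c : R).
Notation L1 g := (mu.-integrable [set: T] (EFin \o g)).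
Notation Int g := (\int[mu]_x g x).

Lemma L1_meas g : L1 g -> measurable_fun setT g.
Proof. by move=> /measurable_int/measurable_EFinP. Qed.

Lemma L1_le g h : measurable_fun setT g -> (forall x, `|g x| <= h x) -> L1 h -> L1 g.
Proof.
move=> mg gh ih; apply: le_integrable ih => //; first exact/measurable_EFinP.
by move=> x _ /=; rewrite lee_fin; apply: le_trans (ler_norm _).
Qed.

Lemma eq_L1 g h : g =1 h -> L1 h -> L1 g.
Proof. by move=> /funext ->. Qed.

Lemma L1D f g : L1 f -> L1 g -> L1 (fun x => f x + g x).
Proof. by move=> hf hg; have := integrableD measurableT hf hg. Qed.

Lemma L1B f g : L1 f -> L1 g -> L1 (fun x => f x - g x).
Proof. by move=> hf hg; have := integrableB measurableT hf hg. Qed.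

Lemma L1Z c f : L1 f -> L1 (fun x => c * f x).
Proof. by move=> hf; have := integrableZl measurableT c hf. Qed.

Lemma L1_0 : L1 (fun _ : T => 0 : R).
Proof. exact: integrable0. Qed.

Lemma L1_sum (I : Type) (r : seq I) (F : I -> T -> R) :
  (forall i, L1 (F i)) -> L1 (fun x => \sum_(i <- r) F i x).
Proof.
move=> iF; elim: r => [|i r IH].
  by apply: eq_L1 L1_0 => x; rewrite big_nil.
by apply: eq_L1 (L1D (iF i) IH) => x; rewrite big_cons.
Qed.

Lemma L1_norm f : L1 f -> L1 (fun x => `|f x|).
Proof.
move=> hf; apply: (@le_integrable _ _ _ mu setT measurableT _ (EFin \o f)) => //.
  by apply/measurable_EFinP; apply: measurableT_comp => //; exact: L1_meas.
by move=> x _ /=; rewrite normr_id.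
Qed.

Lemma L1M w b M : L1 w -> measurable_fun setT b -> (forall x, `|b x| <= M) ->
  L1 (fun x => w x * b x).
Proof.
move=> iw mb bM; apply: (@L1_le _ (fun x => M * `|w x|)).
- by apply: measurable_funM => //; exact: L1_meas.
- by move=> x; rewrite normrM mulrC ler_wpM2r.
- exact/L1Z/L1_norm.
Qed.

Lemma Int_le f g : L1 f -> L1 g -> (forall x, f x <= g x) -> Int f <= Int g.
Proof. by move=> hf hg fg; apply: le_Rintegral. Qed.

Lemma Int_ge0 f : (forall x, 0 <= f x) -> 0 <= Int f.
Proof. by move=> f0; apply: Rintegral_ge0. Qed.

Lemma IntD f g : L1 f -> L1 g -> Int (fun x => f x + g x) = Int f + Int g.
Proof. by move=> hf hg; rewrite RintegralD. Qed.

Lemma IntB f g : L1 f -> L1 g -> Int (fun x => f x - g x) = Int f - Int g.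
Proof. by move=> hf hg; rewrite RintegralB. Qed.

Lemma IntZ c f : L1 f -> Int (fun x => c * f x) = c * Int f.
Proof. by move=> hf; rewrite RintegralZl. Qed.

Lemma Int_sum (I : Type) (r : seq I) (F : I -> T -> R) :
  (forall i, L1 (F i)) -> Int (fun x => \sum_(i <- r) F i x) = \sum_(i <- r) Int (F i).
Proof.
move=> iF; elim: r => [|i r IH].
  rewrite big_nil; under eq_Rintegral do rewrite big_nil.
  by rewrite Rintegral_cst// mul0r.
rewrite big_cons -IH -IntD//; last exact: L1_sum.
by apply: eq_Rintegral => x _; rewrite big_cons.
Qed.

Lemma Int_norm f : L1 f -> `|Int f| <= Int (fun x => `|f x|).
Proof. by move=> hf; apply: le_normr_Rintegral. Qed.

Lemma eq_Int f g : f =1 g -> Int f = Int g.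
Proof. by move=> /funext ->. Qed.

Lemma Int_cvg (f_ : nat -> T -> R) f g : (forall n, measurable_fun setT (f_ n)) ->
  (forall x, f_ n x @[n --> \oo] --> f x) -> L1 g -> (forall n x, `|f_ n x| <= g x) ->
  L1 f /\ Int (f_ n) @[n --> \oo] --> Int f.
Proof.
move=> mf cf ig fg.
have mF : measurable_fun setT f by apply: (measurable_fun_cvg mf) => x _; exact: cf.
have cF : {ae mu, forall x, setT x -> (EFin \o f_ n) x @[n --> \oo] --> (EFin \o f) x}.
  by apply: aeW => x _; apply: cvg_EFin; [exact: nearW|exact: cf].
have bF : {ae mu, forall x n, setT x -> (`|(EFin \o f_ n) x| <= (EFin \o g) x)%E}.
  by apply: aeW => x n _; rewrite /= lee_fin.
have [i1 _ i3] := dominated_convergence measurableT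
  (fun n => measurableT_comp (@EFin_measurable _ _) (mf n))
  (measurableT_comp (@EFin_measurable _ _) mF) cF ig bF.
split=> //; apply: fine_cvg; rewrite fineK//.
exact: integrable_fin_num.
Qed.

End L1.

(** * Density in a weighted L1 space *)

Section approx.
Context d (T : measurableType d) {R : realType} (mu : {measure set T -> \bar R}).
Notation L1 g := (mu.-integrable [set: T] (EFin \o g)).
Notation Int g := (\int[mu]_x g x).
Variables (W : T -> R) (Fam : set (T -> R)).
Hypothesis W_L1 : L1 W.
Hypothesis W_ge0 : forall x, 0 <= W x.
Hypothesis Fam_meas : forall g, Fam g -> measurable_fun setT g.
Hypothesis Fam_bd : forall g x, Fam g -> 0 <= g x <= 1.
Hypothesis Fam1 : Fam (cst 1).
Hypothesis FamC : forall g, Fam g -> Fam (fun x => 1 - g x).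
Hypothesis FamM : forall g h, Fam g -> Fam h -> Fam (fun x => g x * h x).

Definition approximable (A : set T) := measurable A /\ forall e, 0 < e ->
  exists2 g, Fam g & Int (fun x => W x * `|\1_A x - g x|) <= e.

Let L1_diff (A : set T) g : measurable A -> Fam g -> L1 (fun x => W x * `|\1_A x - g x|).
Proof.
move=> mA Fg; apply: (@L1M _ _ _ _ _ _ 1) => //.
  apply: measurableT_comp => //; apply: measurable_funB; last exact: Fam_meas.
  exact: measurable_indic.
move=> x; rewrite normr_id indicE; have := Fam_bd x Fg.
by rewrite ler_norml; case: (x \in A) => /=; lra.
Qed.

Lemma approximableC A : approximable A -> approximable (~` A).
Proof.
move=> [mA aA]; split; first exact: measurableC.
move=> e /aA[g Fg H]; exists (fun x => 1 - g x); first exact: FamC.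
apply: le_trans H; rewrite le_eqVlt; apply/orP; left; apply/eqP.
apply: eq_Int => x; congr (_ * _); rewrite !indicE in_setC.
by rewrite distrC; case: (x \in A) => /=; rewrite ?subr0 ?sub0r ?opprK; congr `|_|; lra.
Qed.

Lemma approximableI A B : approximable A -> approximable B -> approximable (A `&` B).
Proof.
move=> [mA aA] [mB aB]; split; first exact: measurableI.
move=> e e0; have e2 : 0 < e / 2 by lra.
have [g Fg Hg] := aA _ e2; have [h Fh Hh] := aB _ e2.
exists (fun x => g x * h x); first exact: FamM.
apply: (@le_trans _ _ (Int (fun x => W x * `|\1_A x - g x| + W x * `|\1_B x - h x|))); last first.
  by rewrite IntD; [lra|exact: L1_diff..].
apply: Int_le.
- by apply: L1_diff; [exact: measurableI|exact: FamM].
- by apply: L1D; exact: L1_diff.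
move=> x; rewrite -mulrDr ler_wpM2l// !indicE in_setI.
have := Fam_bd x Fg; have := Fam_bd x Fh.
set u : R := (x \in A)%:R; set v : R := (x \in B)%:R => hh hg.
have -> : ((x \in A) && (x \in B))%:R = u * v.
  by rewrite /u /v; case: (x \in A); case: (x \in B); rewrite /= ?mulr0 ?mulr1.
have -> : u * v - g x * h x = (u - g x) * v + g x * (v - h x) by ring.
apply: le_trans (ler_normD _ _) _; rewrite !normrM; apply: lerD.
  by rewrite ler_piMr// /v; case: (x \in B); rewrite ?normr1 ?normr0.
by rewrite ler_piMl// ger0_norm; lra.
Qed.

Lemma approximable_limit A (h : nat -> T -> R) : measurable A -> (forall n, Fam (h n)) ->
  (forall x, h n x @[n --> \oo] --> (\1_A x : R)) -> approximable A.
Proof.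
move=> mA Fh hA; split=> // e e0.
have [_ C] : L1 (fun x => 0 : R) /\
    Int (fun x => W x * `|\1_A x - h n x|) @[n --> \oo] --> Int (fun x => 0 : R).
  apply: (@Int_cvg _ _ _ mu (fun n x => W x * `|\1_A x - h n x|) _ W) => //.
  - by move=> n; have /L1_meas := L1_diff mA (Fh n).
  - move=> x; rewrite -(mulr0 (W x)); apply: cvgMr.
    rewrite -(normr0 R) -(subrr (\1_A x : R)); apply: cvg_norm.
    by apply: cvgB => //; exact: cvg_cst.
  - move=> n x; rewrite normrM normr_id (ger0_norm (W_ge0 x)) ler_piMr//.
    rewrite indicE; have := Fam_bd x (Fh n).
    by rewrite ler_norml; case: (x \in A) => /=; lra.
rewrite Rintegral_cst// mul0r in C.
have /cvgrPdist_le/(_ _ e0)[n _ /(_ n (leqnn n))] := C.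
rewrite /= sub0r normrN => H; exists (h n) => //.
by apply: le_trans H; exact: ler_norm.
Qed.

(** The good-sets argument: [FamC] and [FamM] give complements and intersections, and dominated
    convergence reduces a countable union to a finite one. *)
Lemma approximable_sigma : sigma_algebra setT approximable.
Proof.
split.
- rewrite -setCT; apply: approximableC; split => // e e0; exists (cst 1) => //.
  rewrite (_ : (fun x => _) = (fun x => 0 : R)) ?Rintegral_cst ?mul0r ?ltW//.
  by apply/funext => x; rewrite indicT subrr normr0 mulr0.
- by move=> A aA; rewrite setTD; exact: approximableC.
- move=> A aA.
  have mA n : measurable (A n) by have [] := aA n.
  have aB n : approximable (\bigcup_(k < n) A k).
    elim: n => [|n IH].
      rewrite bigcup_mkord big_ord0 -setCT; apply: approximableC; split => // e e0.
      exists (cst 1) => //.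
      rewrite (_ : (fun x => _) = (fun x => 0 : R)) ?Rintegral_cst ?mul0r ?ltW//.
      by apply/funext => x; rewrite indicT subrr normr0 mulr0.
    rewrite bigcup_mkord big_ord_recr /= -bigcup_mkord.
    rewrite -(setCK (_ `|` _)) setCU; apply: approximableC.
    by apply: approximableI; exact: approximableC.
  have mU : measurable (\bigcup_k A k) by exact: bigcupT_measurable.
  split => // e e0; have e2 : 0 < e / 2 by lra.
  have [_ C] : L1 (fun x => 0 : R) /\
      Int (fun x => W x * `|\1_(\bigcup_k A k) x - \1_(\bigcup_(k < n) A k) x|)
        @[n --> \oo] --> Int (fun x => 0 : R).
    apply: (@Int_cvg _ _ _ mu (fun n x => W x * `|\1_(\bigcup_k A k) x - \1_(\bigcup_(k < n) A k) x|) _ W) => //.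
    + move=> n; apply: measurable_funM; first exact: (L1_meas W_L1).
      apply: measurableT_comp => //; apply: measurable_funB; apply: measurable_indic => //.
      by have [] := aB n.
    + move=> x; have [Ux|Ux] := pselect ((\bigcup_k A k) x).
        have [k _ Akx] := Ux; apply: cvg_near_cst; near=> n.
        rewrite !indicE !mem_set ?subrr ?normr0 ?mulr0//.
        by exists k => //=; near: n; exact: nbhs_infty_gt.
      apply: cvg_near_cst; near=> n.
      rewrite !indicE !memNset ?subrr ?normr0 ?mulr0//.
      by move=> [k _ Akx]; apply: Ux; exists k.
    + move=> n x; rewrite normrM normr_id (ger0_norm (W_ge0 x)) ler_piMr//.
      rewrite !indicE; case: (x \in _); case: (x \in _);
      by rewrite /= ?subrr ?subr0 ?sub0r ?normrN ?normr0 ?normr1.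
  rewrite Rintegral_cst// mul0r in C.
  have /cvgrPdist_le/(_ _ e2)[n _ /(_ n (leqnn n))] := C.
  rewrite /= sub0r normrN => H.
  have [mB /(_ _ e2)[g Fg Hg]] := aB n; exists g => //.
  have L1U : L1 (fun x => W x * `|\1_(\bigcup_k A k) x - \1_(\bigcup_(k < n) A k) x|).
    apply: (@L1M _ _ _ _ _ _ 1) => //.
      apply: measurableT_comp => //; apply: measurable_funB; exact: measurable_indic.
    move=> x; rewrite normr_id !indicE; case: (x \in _); case: (x \in _);
    by rewrite /= ?subrr ?subr0 ?sub0r ?normrN ?normr0 ?normr1.
  apply: (@le_trans _ _ (Int (fun x => W x * `|\1_(\bigcup_k A k) x - \1_(\bigcup_(k < n) A k) x|
      + W x * `|\1_(\bigcup_(k < n) A k) x - g x|))); last first.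
    rewrite IntD//; last exact: L1_diff.
    by have := le_trans (ler_norm _) H; lra.
  apply: Int_le; [exact: L1_diff|by apply: L1D => //; exact: L1_diff|].
  by move=> x; rewrite -mulrDr ler_wpM2l//; exact: ler_distD.
Unshelve. all: by end_near. Qed.

Lemma layer_cake (c b : R) n : 0 < c -> 0 <= b <= n%:R * c ->
  b <= \sum_(j < n) c * (if j%:R * c < b then 1 else 0) <= b + c.
Proof.
move=> c0 /andP[b0 bn].
suff : (b <= n%:R * c -> b <= \sum_(j < n) c * (if j%:R * c < b then 1 else 0) <= b + c) /\
    (n%:R * c <= b -> \sum_(j < n) c * (if j%:R * c < b then 1 else 0) = n%:R * c).
  by case=> /(_ bn).
elim: n {bn} => [|n [IH1 IH2]].
  by rewrite !big_ord0 mul0r; split => //; lra.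
rewrite !big_ord_recr /= -!natr1 !mulrDl !mul1r.
have [nb|nb] := ltP (n%:R * c) b.
  by rewrite (IH2 (ltW nb)) mulr1; split => // *; lra.
rewrite mulr0 addr0; split => [_|H]; first exact: IH1.
lra.
Qed.

(** A staircase in [n] layers whose level sets are approximated one by one. Keeping [n%:R * c = M]
    makes the approximation stay between 0 and [M]. *)
Lemma approx_bounded (b : T -> R) (M e : R) : 0 < M -> 0 < e -> measurable_fun setT b ->
  (forall x, 0 <= b x <= M) -> (forall A, measurable A -> approximable A) ->
  exists n (g : 'I_n -> T -> R) c, [/\ 0 < c, n%:R * c = M, forall i, Fam (g i) &
    Int (fun x => W x * `|b x - \sum_i c * g i x|) <= e].
Proof.
move=> M0 e0 mb bM app.
set J := Int W; have J0 : 0 <= J by exact: Int_ge0.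
have [n n0 nM] : exists2 n, (0 < n)%N & M * J / n%:R <= e / 2.
  exists (Num.truncn (M * J / (e / 2))).+1 => //.
  rewrite ler_pdivrMr ?ltr0n// [leRHS]mulrC -ler_pdivrMr ?divr_gt0//.
  exact/ltW/truncnS_gt.
have n0' : 0 < n%:R :> R by rewrite ltr0n.
pose c := M / n%:R; have c0 : 0 < c by exact: divr_gt0.
pose A (j : 'I_n) := [set x | j%:R * c < b x].
have mA j : measurable (A j).
  rewrite (_ : A j = setT `&` b @^-1` `]j%:R * c, +oo[).
    by apply: mb => //; exact: measurable_itv.
  by apply/seteqP; split => x /=; rewrite in_itv/= andbT // => -[].
have /choice[g Hg] : forall j : 'I_n, exists g, Fam g /\
    Int (fun x => W x * `|\1_(A j) x - g x|) <= e / (2 * M).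
  move=> j; have [_ /(_ (e / (2 * M)))] := app _ (mA j).
  by case=> [|g Fg H]; [rewrite divr_gt0//; lra|exists g].
have nc : n%:R * c = M by rewrite /c mulrC divfK// gt_eqF.
exists n, g, c; split => //; first by move=> i; have [] := Hg i.
have L1A j : L1 (fun x => c * (W x * `|\1_(A j) x - g j x|)).
  by apply: L1Z; apply: L1_diff => //; have [] := Hg j.
apply: (@le_trans _ _ (Int (fun x => c * W x + \sum_j c * (W x * `|\1_(A j) x - g j x|)))).
  apply: Int_le.
  - apply: (@L1M _ _ _ _ _ _ (2 * M)) => //.
      apply: measurableT_comp => //; apply: measurable_funB => //.
      apply: measurable_sum => j; apply: measurable_funM => //.
      by apply: Fam_meas; have [] := Hg j.
    move=> x; rewrite normr_id; apply: le_trans (ler_normB _ _) _.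
    have h1 : `|b x| <= M by have := bM x; rewrite ler_norml; lra.
    have h2 : `|\sum_i c * g i x| <= M.
      rewrite ger0_norm; last first.
        by apply: sumr_ge0 => i _; have [/(Fam_bd x)/andP[g0 _] _] := Hg i; rewrite mulr_ge0// ltW.
      rewrite -nc -sumr_ord; apply: ler_sum => i _; rewrite ler_piMr ?(ltW c0)//.
      by have [/(Fam_bd x)/andP[]] := Hg i.
    lra.
  - by apply: L1D; [exact: L1Z|apply: L1_sum].
  - move=> x; have -> : c * W x + \sum_j c * (W x * `|\1_(A j) x - g j x|) =
       W x * (c + \sum_j c * `|\1_(A j) x - g j x|).
      rewrite mulrDr mulrC mulr_sumr; congr (_ + _); apply: eq_bigr => j _; ring.
    rewrite ler_wpM2l//.
    have -> : b x - \sum_i c * g i x = (b x - \sum_i c * \1_(A i) x) +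
      \sum_i c * (\1_(A i) x - g i x).
      under [X in _ = _ + X]eq_bigr do rewrite mulrBr.
      by rewrite sumrB; ring.
    apply: le_trans (ler_normD _ _) _; apply: lerD.
      have := @layer_cake c (b x) n c0; rewrite nc => /(_ (bM x)).
      have -> : \sum_(j < n) c * (if j%:R * c < b x then 1 else 0) = \sum_i c * \1_(A i) x.
        apply: eq_bigr => j _; rewrite indicE; congr (_ * _).
        case: ifPn => h; first by rewrite mem_set.
        by rewrite memNset// => /=; apply/negP.
      by rewrite ler_norml; lra.
    apply: le_trans (ler_norm_sum _ _ _) _; apply: ler_sum => i _.
    by rewrite normrM (gtr0_norm c0).
rewrite IntD; [|exact: L1Z|exact: L1_sum].
rewrite IntZ// Int_sum// -/J.
have -> : e = e / 2 + \sum_(j < n) c * (e / (2 * M)).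
  by rewrite sumr_ord mulrA nc; field; rewrite gt_eqF.
apply: lerD; first by rewrite /c mulrAC.
apply: ler_sum => j _; rewrite IntZ; last by apply: L1_diff => //; have [] := Hg j.
by rewrite ler_wpM2l ?(ltW c0)//; have [] := Hg j.
Qed.

End approx.

(** * Measurability on space-time and density of Lipschitz functions *)

Section spacetime_measurability.
Context {R : realType} {N : nat}.
Local Notation X := ('rV[R]_N * R)%type.
Implicit Types (z : X) (D : set X) (g : X -> R).

Lemma meas_coord i : measurable_fun setT (fun z : X => z.1 0 i).
Proof. exact: (measurableT_comp (measurable_coord i) measurable_fst). Qed.

Lemma meas_time : measurable_fun setT (fun z : X => z.2).
Proof. exact: measurable_snd. Qed.

Lemma nbhs_coord z (A : set X) : nbhs z A <->
  exists2 r : R, 0 < r & forall z', (forall i, `|z.1 0 i - z'.1 0 i| < r) ->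
    `|z.2 - z'.2| < r -> A z'.
Proof.
split=> [/nbhs_ballP[r /= r0 rA]|[r r0 rA]].
  exists r => // z' h1 h2; apply: rA; split => //=.
  by split=> // i j; rewrite (ord1 i); exact: h1.
apply/nbhs_ballP; exists r => //= z' [/= [_ h1] h2]; apply: rA => // i.
exact: h1.
Qed.

Definition cell : Type := ({ffun 'I_N -> int} * int)%type.
Definition cellof n z : cell :=
  ([ffun i => Num.floor (z.1 0 i * n.+1%:R)], Num.floor (z.2 * n.+1%:R)).
Definition cellpt n (k : cell) : X :=
  (\row_i ((k.1 i)%:~R / n.+1%:R), k.2%:~R / n.+1%:R).

Lemma cellptP n z : (forall i, `|z.1 0 i - (cellpt n (cellof n z)).1 0 i| <= n.+1%:R^-1) /\
  `|z.2 - (cellpt n (cellof n z)).2| <= n.+1%:R^-1.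
Proof.
have n0 : 0 < n.+1%:R :> R by [].
have key (y : R) : `|y - (Num.floor (y * n.+1%:R))%:~R / n.+1%:R| <= n.+1%:R^-1.
  have /andP[h1 h2] := floor_itv (y * n.+1%:R).
  rewrite intrD in h2.
  have -> : y - (Num.floor (y * n.+1%:R))%:~R / n.+1%:R =
     (y * n.+1%:R - (Num.floor (y * n.+1%:R))%:~R) / n.+1%:R by field; rewrite gt_eqF.
  rewrite normrM normfV (gtr0_norm n0) -[leRHS]mul1r ler_pM2r ?invr_gt0//.
  by rewrite ger0_norm; lra.
by split => [i|]; rewrite /cellpt /cellof /= ?mxE ?ffunE; exact: key.
Qed.

(** There are countably many cells, so whatever depends only on the cell is measurable for the
    sigma-algebra of the coordinates. *)
Lemma meas_cell n (P : set cell) : measurable [set z | P (cellof n z)].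
Proof.
have mfl (c : X -> R) (k : int) : measurable_fun setT c ->
    measurable [set z | Num.floor (c z * n.+1%:R) = k].
  move=> mc; rewrite (_ : mkset _ = setT `&`
      (fun z => c z * n.+1%:R) @^-1` `[k%:~R, (k + 1)%:~R[); last first.
    apply/seteqP; split => z /=; rewrite in_itv /=.
      by move=> <-; split => //; exact: floor_itv.
    move=> [_ h]; exact: floor_def.
  by apply: measurable_funM => //; exact: measurable_itv.
rewrite (_ : mkset _ = \bigcup_(k : cell) (if `[< P k >] then [set z | cellof n z = k] else set0)).
  apply: countable_bigcupT_measurable => [|k]; first exact: countableP.
  case: asboolP => _; last exact: measurable0.
  rewrite (_ : [set z | cellof n z = k] =
    (\bigcap_(i in [set: 'I_N]) [set z : X | Num.floor (z.1 0 i * n.+1%:R) = k.1 i]) `&`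
    [set z : X | Num.floor (z.2 * n.+1%:R) = k.2]).
    apply: measurableI; last exact: mfl meas_time.
    by apply: fin_bigcap_measurable => // i _; apply: mfl; exact: meas_coord.
  apply/seteqP; split => z /=.
    by move=> <-; split => //= i _; rewrite ffunE.
  move=> [h1 h2]; rewrite /cellof h2 [RHS]surjective_pairing; congr pair.
  by apply/ffunP => i; rewrite ffunE; exact: h1.
apply/seteqP; split => z /=.
  by move=> Pz; exists (cellof n z) => //=; rewrite asboolT.
by move=> [k _]; case: asboolP => // Pk /= ->.
Qed.

(** The sigma-algebra is generated by the coordinates; an open set is a countable
    union of grid cells. *)
Lemma open_meas D : open D -> measurable D.
Proof.
move=> oD.
pose P n (k : cell) := forall z', (forall i, `|z'.1 0 i - (cellpt n k).1 0 i| <= n.+1%:R^-1) ->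
  `|z'.2 - (cellpt n k).2| <= n.+1%:R^-1 -> D z'.
rewrite (_ : D = \bigcup_n [set z | P n (cellof n z)]).
  by apply: bigcupT_measurable => n; exact: meas_cell.
apply/seteqP; split => z /=.
  move=> Dz; have /nbhs_coord[r r0 rD] : nbhs z D by exact: open_nbhs_nbhs.
  have [n _ /(_ n (leqnn n)) nr] : \forall n \near \oo, (n.+1%:R^-1 : R) < r / 2.
    by apply: near_infty_natSinv_lt (PosNum (divr_gt0 r0 (ltr0n _ 2))).
  exists n => // z' h1 h2; have [h3 h4] := cellptP n z.
  have key (a b e : R) : `|a - e| <= n.+1%:R^-1 -> `|b - e| <= n.+1%:R^-1 -> `|a - b| < r.
    move=> ae be; rewrite (_ : a - b = (a - e) - (b - e)); last ring.
    move: nr ae be; set q := n.+1%:R^-1 => nr ae be.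
    by apply: le_lt_trans (ler_normB _ _) _; lra.
  by apply: rD => [i|]; [exact: key (h3 i) (h1 i)|exact: key h4 h2].
by move=> [n _ Pn]; have [h3 h4] := cellptP n z; exact: Pn.
Qed.

Lemma cellpt_cvg z : cellpt n (cellof n z) @[n --> \oo] --> z.
Proof.
move=> A /nbhs_coord[r r0 rA].
have [n0 _ nr] : \forall n \near \oo, (n.+1%:R^-1 : R) < r.
  exact: near_infty_natSinv_lt (PosNum r0).
exists n0 => // n /nr nr'; have [h3 h4] := cellptP n z.
by apply: rA => [i|]; apply: le_lt_trans nr'.
Qed.

(** The values of [g] at the cell corners are measurable functions of the point and converge to
    [g]. *)
Lemma cts_on_meas D g : open D -> (forall z, D z -> {for z, continuous g}) ->
  measurable_fun D g.
Proof.
move=> oD cg; have mD := open_meas oD.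
apply: (@measurable_fun_cvg _ _ _ D (fun n z => g (cellpt n (cellof n z)))).
  move=> n; apply: measurable_funTS => _ B mB.
  rewrite setTI; exact: (meas_cell n (fun k => B (g (cellpt n k)))).
move=> z Dz; apply: (@cvg_comp nat X R (fun n => cellpt n (cellof n z)) g \oo (nbhs z)); [exact: cellpt_cvg|exact: cg].
Qed.

Lemma cts_meas g : continuous g -> measurable_fun setT g.
Proof. by move=> cg; apply: cts_on_meas => [|z _]; [exact: (@openT X)|exact: cg]. Qed.

Lemma xtlip_cts L g : xtlip L g -> continuous g.
Proof.
move=> gL z; apply/cvgrPdist_lt => e e0.
have L0 : 0 <= L.
  have := @gL 0 0 1; rewrite !subrr normr0 mulr1; apply => // i.
  by rewrite subrr normr0.
apply/nbhs_coord; exists (e / (L + 1)); first by rewrite divr_gt0// ltr_wpDl.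
move=> z' h1 h2; apply: (@le_lt_trans _ _ (L * (e / (L + 1)))).
  by apply: gL => [i|]; apply: ltW; [exact: h1|exact: h2].
rewrite mulrA ltr_pdivrMr ?ltr_wpDl//; lra.
Qed.

Definition LipFam (g : X -> R) : Prop :=
  (forall z, 0 <= g z <= 1) /\ exists L, xtlip L g.

Lemma xtlip_ge0 L g : xtlip L g -> 0 <= L.
Proof.
move=> gL; have := @gL 0 0 1; rewrite !subrr normr0 mulr1; apply => // i.
by rewrite subrr normr0.
Qed.

Lemma xtlipM L L' (M M' : R) (g h : X -> R) : xtlip L g -> xtlip L' h ->
  (forall z, `|g z| <= M) -> (forall z, `|h z| <= M') ->
  xtlip (L * M' + M * L') (fun z => g z * h z).
Proof.
move=> gL hL gM hM z z' r h1 h2.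
have -> : g z * h z - g z' * h z' = (g z - g z') * h z + g z' * (h z - h z') by ring.
apply: le_trans (ler_normD _ _) _; rewrite !normrM.
have -> : (L * M' + M * L') * r = (L * r) * M' + M * (L' * r) by ring.
by apply: lerD; apply: ler_pM => //; [exact: gL|exact: hL].
Qed.

Lemma xtlipD L L' (g h : X -> R) : xtlip L g -> xtlip L' h ->
  xtlip (L + L') (fun z => g z + h z).
Proof.
move=> gL hL z z' r h1 h2; rewrite mulrDl opprD addrACA.
by apply: le_trans (ler_normD _ _) _; apply: lerD; [exact: gL|exact: hL].
Qed.

Lemma xtlipZ L c (g : X -> R) : xtlip L g -> xtlip (`|c| * L) (fun z => c * g z).
Proof.
move=> gL z z' r h1 h2; rewrite -mulrBr normrM -mulrA ler_wpM2l//; exact: gL.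
Qed.

Lemma xtlip_cst c : xtlip 0 (fun _ : X => c).
Proof. by move=> z z' r _ _; rewrite subrr normr0 mul0r. Qed.

Lemma xtlip_sum (I : Type) (r : seq I) (L : I -> R) (g : I -> X -> R) :
  (forall i, xtlip (L i) (g i)) -> xtlip (\sum_(i <- r) L i) (fun z => \sum_(i <- r) g i z).
Proof.
move=> gL; elim: r => [|i r IH].
  rewrite big_nil (_ : (fun z => _) = fun=> 0); first exact: xtlip_cst.
  by apply/funext => z; rewrite big_nil.
rewrite big_cons (_ : (fun z => _) = fun z => g i z + \sum_(j <- r) g j z).
  exact: xtlipD.
by apply/funext => z; rewrite big_cons.
Qed.

Definition clamp (y : R) : R := Num.min 1 (Num.max 0 y).

Lemma clamp_bd y : 0 <= clamp y <= 1.
Proof. by rewrite /clamp le_min ler01 le_max lexx ge_min lexx. Qed.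

Lemma clamp_lip u v : `|clamp u - clamp v| <= `|u - v|.
Proof.
have h a b : a <= b -> clamp a <= clamp b /\ clamp b - clamp a <= b - a.
  have E (y : R) : (y <= 0 /\ clamp y = 0) \/ (0 <= y <= 1 /\ clamp y = y) \/ (1 <= y /\ clamp y = 1).
    have [y0|y0] := leP y 0; first by left; rewrite /clamp max_l ?min_r.
    have [y1|y1] := leP y 1; right; [left|right]; rewrite /clamp max_r ?(ltW y0)//.
      by rewrite min_r// y1.
    by rewrite min_l ?(ltW y1).
  by case: (E a) => [[? ->]|[[? ->]|[? ->]]]; case: (E b) => [[? ->]|[[? ->]|[? ->]]] ab; split; lra.
have [uv|vu] := leP u v.
  have [h1 h2] := h _ _ uv; rewrite distrC [leRHS]distrC ger0_norm ?subr_ge0//.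
  by rewrite ger0_norm ?subr_ge0.
have [h1 h2] := h _ _ (ltW vu); rewrite ger0_norm ?subr_ge0//.
by rewrite ger0_norm ?subr_ge0// ltW.
Qed.

Lemma clamp1 y : 1 <= y -> clamp y = 1.
Proof. by move=> y1; rewrite /clamp max_r ?min_l//; lra. Qed.

Lemma clamp0 y : y <= 0 -> clamp y = 0.
Proof. by move=> y1; rewrite /clamp max_l ?min_r//; lra. Qed.

Lemma xtlip_clamp L g : xtlip L g -> xtlip L (fun z => clamp (g z)).
Proof. by move=> gL z z' r h1 h2; apply: le_trans (clamp_lip _ _) _; exact: gL. Qed.

Lemma xtlip_coord i : xtlip 1 (fun z => z.1 0 i).
Proof. by move=> z z' r h1 _; rewrite mul1r. Qed.

Lemma xtlip_time : xtlip 1 (fun z => z.2).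
Proof. by move=> z z' r _ h2; rewrite mul1r. Qed.

Variable (mu : {measure set X -> \bar R}) (W : X -> R).
Hypothesis W_L1 : mu.-integrable setT (EFin \o W).
Hypothesis W_ge0 : forall z, 0 <= W z.
Notation Int g := (\int[mu]_x g x).

Lemma LipFam_meas g : LipFam g -> measurable_fun setT g.
Proof. by move=> [_ [L /xtlip_cts]]; exact: cts_meas. Qed.

Let Fam_bd g z : LipFam g -> 0 <= g z <= 1. Proof. by move=> [+ _]. Qed.

Let Fam1 : LipFam (cst 1).
Proof. by split=> [z|]; [rewrite ler01 lexx|exists 0; exact: xtlip_cst]. Qed.

Let FamC g : LipFam g -> LipFam (fun x => 1 - g x).
Proof.
move=> [g01 [L gL]]; split=> [z|]; first by have := g01 z; lra.
exists L => z z' r h1 h2; rewrite (_ : _ - _ = - (g z - g z')) ?normrN; last by ring.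
exact: gL.
Qed.

Let FamM g h : LipFam g -> LipFam h -> LipFam (fun x => g x * h x).
Proof.
move=> [g01 [L gL]] [h01 [L' hL]]; split=> [z|].
  have /andP[? ?] := g01 z; have /andP[? ?] := h01 z.
  by rewrite mulr_ge0//= mulr_ile1.
exists (L * 1 + 1 * L'); apply: xtlipM => // z; rewrite ger0_norm;
  by have := g01 z; have := h01 z; lra.
Qed.

Let app := approximable mu W LipFam.
Let app_sigma : sigma_algebra setT app.
Proof. exact: (approximable_sigma W_L1 W_ge0 LipFam_meas Fam_bd Fam1 FamC FamM). Qed.

(** Clamped affine functions of growing slope converge to the indicator of the half-space. *)
Let app_ray (c : X -> R) (a : R) : measurable_fun setT c -> xtlip 1 c ->
  app (c @^-1` `]a, +oo[).
Proof.
move=> mc c1.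
apply: (@approximable_limit _ _ _ mu W LipFam W_L1 W_ge0 LipFam_meas Fam_bd _
  (fun n z => clamp (n%:R * (c z - a)))).
- by rewrite -[X in measurable X]setTI; apply: mc => //; exact: measurable_itv.
- move=> n; split=> [z|]; first exact: clamp_bd.
  exists (`|n%:R| * (1 + 0)); apply: xtlip_clamp; apply: xtlipZ; apply: xtlipD => //.
  exact: xtlip_cst.
move=> z; rewrite indicE; have [ca|ca] := ltP a (c z).
  rewrite mem_set/=; last by rewrite /= in_itv/= andbT.
  apply: cvg_near_cst; near=> n; apply: clamp1.
  have ca0 : 0 < c z - a by rewrite subr_gt0.
  rewrite -ler_pdivrMr//; near: n.
  exact: nbhs_infty_ger.
rewrite memNset/=; last by rewrite /= in_itv/= andbT; apply/negP; rewrite -leNgt.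
apply: cvg_near_cst; near=> n; apply: clamp0.
by rewrite mulr_ge0_le0// subr_le0.
Unshelve. all: by end_near. Qed.

Lemma sigma_algebra_image U (phi : X -> U) : sigma_algebra setT [set C | app (phi @^-1` C)].
Proof.
have [h0 hC hU] := app_sigma; split => /=.
- by rewrite preimage_set0.
- by move=> C aC; rewrite setTD preimage_setC -setTD; exact: hC.
- by move=> C aC; rewrite preimage_bigcup; exact: hU.
Qed.

Let app_coord (c : X -> R) : measurable_fun setT c -> xtlip 1 c ->
  forall C, measurable C -> app (c @^-1` C).
Proof.
move=> mc c1 C; rewrite [measurable]RGenOInfty.measurableE => mC.
suff : <<s @RGenOInfty.G R >> `<=` [set C | app (c @^-1` C)] by apply.
apply: smallest_sub; first exact: sigma_algebra_image.
by move=> _ [a ->]; exact: app_ray.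
Qed.

Lemma lip_dense_sets (A : set X) : measurable A -> approximable mu W LipFam A.
Proof.
move=> mA; suff : g_sigma_preimageU (@fst 'rV[R]_N R) (@snd 'rV[R]_N R) `<=` app by apply.
apply: smallest_sub; first exact: app_sigma.
move=> B [[C mC <-]|[C mC <-]]; rewrite setTI; last first.
  exact: (app_coord meas_time xtlip_time).
suff : g_sigma_preimage (fun (i : 'I_N) (x : 'rV[R]_N) => x 0 i) `<=` [set C | app (fst @^-1` C)].
  by apply.
apply: smallest_sub; first exact: sigma_algebra_image.
rewrite -bigcup_seq /=; apply: bigcup_sub => i _ _ [E mE <-] /=.
rewrite setTI -comp_preimage.
exact: (app_coord (meas_coord i) (xtlip_coord i)).
Qed.

(** The weight will be [|w|], since the error in the diffusion occurs only multiplied by it. That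
    [b'] keeps the range of [b] serves later to bound the square of the error by the error
    itself. *)
Lemma lip_dense (b : X -> R) (M e : R) : 0 < M -> 0 < e -> measurable_fun setT b ->
  (forall z, 0 <= b z <= M) ->
  exists b', [/\ exists L, xtlip L b', forall z, 0 <= b' z <= M &
    Int (fun z => W z * `|b z - b' z|) <= e].
Proof.
move=> M0 e0 mb bM.
have [n [g [c [c0 nc Fg Hg]]]] :=
  approx_bounded W_L1 W_ge0 LipFam_meas Fam_bd M0 e0 mb bM lip_dense_sets.
exists (fun z => \sum_i c * g i z); split => //.
- have /choice[L gL] : forall i, exists L, xtlip L (g i) by move=> i; have [] := Fg i.
  by exists (\sum_i `|c| * L i); apply: xtlip_sum => i; exact: xtlipZ.
- move=> z; apply/andP; split.
    apply: sumr_ge0 => i _; rewrite mulr_ge0 ?(ltW c0)//.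
    by have /andP[] := Fam_bd z (Fg i).
  rewrite -nc -sumr_ord; apply: ler_sum => i _; rewrite ler_piMr ?(ltW c0)//.
  by have /andP[] := Fam_bd z (Fg i).
Qed.

End spacetime_measurability.

(** * Measure-preserving maps *)

Section invariance.
Context d (T : measurableType d) {R : realType} (mu : {measure set T -> \bar R}).
Notation L1 g := (mu.-integrable [set: T] (EFin \o g)).
Notation Int g := (\int[mu]_x g x).

Definition preserves (phi : T -> T) := measurable_fun setT phi /\
  forall A, measurable A -> mu (phi @^-1` A) = mu A.

Variable phi : T -> T.
Hypothesis phi_inv : preserves phi.

Lemma integral_preserves (f : T -> \bar R) : measurable_fun setT f ->
  (forall x, 0 <= f x)%E -> (\int[mu]_x f (phi x) = \int[mu]_x f x)%E.
Proof.
have [mphi inv] := phi_inv => mf f0.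
transitivity (\int[pushforward mu phi]_(x in setT) f x)%E; last first.
  by apply: (@eq_measure_integral _ _ _ setT mu) => A mA _; exact: inv.
by rewrite ge0_integral_pushforward// preimage_setT.
Qed.

Lemma L1_preserves g : L1 g -> L1 (g \o phi).
Proof.
have [mphi inv] := phi_inv => ig; have mg := L1_meas ig.
apply/integrableP; split; first by apply/measurable_EFinP; exact: measurableT_comp.
have /integrableP[_] := ig.
rewrite -(integral_preserves (f := fun x => `|(g x)%:E|%E))//.
by apply/measurable_EFinP; exact: measurableT_comp.
Qed.

Lemma Int_preserves g : L1 g -> Int (g \o phi) = Int g.
Proof.
have [mphi inv] := phi_inv => ig; have mg := L1_meas ig; have igp := L1_preserves ig.
rewrite /Rintegral; congr fine.
transitivity (\int[pushforward mu phi]_(x in setT) (g x)%:E)%E; last first.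
  by apply: (@eq_measure_integral _ _ _ setT mu) => A mA _; exact: inv.
rewrite integral_pushforward ?preimage_setT//.
exact/measurable_EFinP.
Qed.

End invariance.

Section translation.
Context {R : realType}.

Lemma preserves_addR (a : R) : preserves (@lebesgue_R R) (fun y => y + a).
Proof.
have mphi : measurable_fun [set: measurableTypeR R] ((fun y => y + a) : measurableTypeR R -> measurableTypeR R).
  by apply: measurable_funD.
split; first exact: mphi.
move=> A mA; apply/esym.
have /= := @lebesgue_measure_unique R (pushforward (@lebesgue_measure R)
   ((fun y => y + a) : measurableTypeR R -> measurableTypeR R)).
apply => //= _ [[x y]] _ <-.
rewrite /pushforward (_ : _ @^-1` _ = [set` `]x - a, y - a]]); last first.
  by apply/seteqP; split => z /=; rewrite !in_itv /= ltrBlDr lerBrDr.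
by rewrite !lebesgue_measure_itv/= !lte_fin ltrD2r -!EFinB; congr (if _ then EFin _ else _); ring.
Qed.

Section product.
Context d1 d2 (T1 : measurableType d1) (T2 : measurableType d2).
Variables (m1 : {sigma_finite_measure set T1 -> \bar R}) (m2 : {sigma_finite_measure set T2 -> \bar R}).

Lemma preserves_prodl phi : preserves m1 phi ->
  preserves (m1 \x m2)%E (fun z : T1 * T2 => (phi z.1, z.2)).
Proof.
move=> pphi; have [mphi inv] := pphi.
have mP : measurable_fun setT (fun z : T1 * T2 => (phi z.1, z.2)).
  apply/measurable_fun_pairP; split; last exact: measurable_snd.
  exact: (measurableT_comp mphi measurable_fst).
split=> // A mA; rewrite /product_measure1 /=.
transitivity (\int[m1]_x (m2 \o xsection A) (phi x))%E; last first.
  by apply: integral_preserves => //; exact: measurable_fun_xsection.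
by apply: eq_integral => x _ /=; congr (m2 _).
Qed.

Lemma preserves_prodr phi : preserves m2 phi ->
  preserves (m1 \x m2)%E (fun z : T1 * T2 => (z.1, phi z.2)).
Proof.
move=> pphi; have [mphi inv] := pphi.
have mP : measurable_fun setT (fun z : T1 * T2 => (z.1, phi z.2)).
  apply/measurable_fun_pairP; split; first exact: measurable_fst.
  exact: (measurableT_comp mphi measurable_snd).
split=> // A mA; rewrite /product_measure1 /=.
apply: eq_integral => x _ /=; rewrite -[RHS]inv; last exact: measurable_xsection.
by congr (m2 _); apply/seteqP; split => y; rewrite /xsection /= !inE.
Qed.

End product.

Lemma preserves_addV n (i : 'I_n) (a : R) :
  preserves (lebesgue_rV n) (fun x : 'rV[R]_n => x + a *: ei i).
Proof.
elim: n i => [[] //|n IH] i.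
have mT : measurable_fun setT (fun x : 'rV[R]_n.+1 => x + a *: ei i).
  apply/measurable_fun_rVP => j; under eq_fun do rewrite !mxE.
  by apply: measurable_funD => //; exact: measurable_coord.
split=> // A mA; rewrite /= /lebesgue_step /pushforward.
have mcA : measurable (@rV_cons R n @^-1` A).
  by rewrite -[X in measurable X]setTI; apply: measurable_rV_cons.
have [j ->|->] := unliftP ord0 i.
  have [_ h] := preserves_prodr (@lebesgue_R R) (IH j); rewrite -[RHS]h//.
  congr ((_ \x _)%E _); apply/funext => z /=; rewrite /preimage /=; congr A.
  apply/rowP => l; rewrite !mxE; case: (unliftP ord0 l) => [l' ->|->] /=.
    by rewrite (inj_eq lift_inj) !mxE.
  by rewrite ?unlift_none /= mulr0 addr0.
have [_ h] := preserves_prodl (lebesgue_rV n) (preserves_addR a); rewrite -[RHS]h//.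
congr ((_ \x _)%E _); apply/funext => z /=; rewrite /preimage /=; congr A.
apply/rowP => l; rewrite !mxE; case: (unliftP ord0 l) => [l' ->|->] /=.
  by rewrite ?liftK /= mulr0 addr0.
by rewrite ?unlift_none /= mulr1.
Qed.

End translation.

(** * Translations and boxes in space-time *)

Section xt_translation.
Context {R : realType} {N : nat}.
Local Notation X := ('rV[R]_N * R)%type.
Notation mu := (@lebesgue_xt R N).
Notation L1 g := (mu.-integrable [set: X] (EFin \o g)).
Notation Int g := (\int[mu]_x g x).

Lemma preserves_x i (a : R) : preserves mu (fun z : X => z + a *: ((ei i, 0) : X)).
Proof.
have := preserves_prodl (@lebesgue_R R) (preserves_addV i a).
rewrite (_ : (fun z => (_, _)) = (fun z : X => z + a *: ((ei i, 0) : X))) //.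
by apply/funext => -[x t] /=; congr pair; rewrite /= scaler0 addr0.
Qed.

Lemma preserves_t (a : R) : preserves mu (fun z : X => z + a *: ((0, 1) : X)).
Proof.
have := preserves_prodr (lebesgue_rV N) (preserves_addR a).
rewrite (_ : (fun z => (_, _)) = (fun z : X => z + a *: ((0, 1) : X))) //.
by apply/funext => -[x t] /=; congr pair; rewrite /= ?scaler0 ?addr0//; congr (_ + _); rewrite /GRing.scale /= mulr1.
Qed.

(** Integrals of difference quotients vanish by translation invariance. *)
Lemma Int_derive0 (v : X) (g gd C : X -> R) :
  (forall a : R, preserves mu (fun z : X => z + a *: v)) -> L1 g -> L1 C ->
  (forall z, (g (z + n.+1%:R^-1 *: v) - g z) * n.+1%:R @[n --> \oo] --> gd z) ->
  (forall n z, `|(g (z + n.+1%:R^-1 *: v) - g z) * n.+1%:R| <= C z) ->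
  L1 gd /\ Int gd = 0.
Proof.
move=> pv ig iC gdE gC.
have ip n : L1 (fun z => g (z + n.+1%:R^-1 *: v)).
  exact: (L1_preserves (pv n.+1%:R^-1) ig).
have iq n : L1 (fun z => (g (z + n.+1%:R^-1 *: v) - g z) * n.+1%:R).
  by apply: eq_L1 (L1Z n.+1%:R (L1B (ip n) ig)) => z; rewrite mulrC.
have [? cv] := Int_cvg (fun n => L1_meas (iq n)) gdE iC gC.
split=> //; apply/esym; apply: cvg_unique cv => //.
rewrite (_ : (fun n => _) = fun=> 0); first exact: cvg_cst.
apply/funext => n; rewrite (@eq_Int _ _ _ mu _ (fun z => n.+1%:R * (g (z + n.+1%:R^-1 *: v) - g z))); last first.
  by move=> z; rewrite mulrC.
rewrite IntZ; last exact: L1B.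
by rewrite IntB// (Int_preserves (pv n.+1%:R^-1) ig) subrr mulr0.
Qed.

Lemma xt_box (lo hi : 'I_N -> R) (a b : R) : (forall i, lo i <= hi i) -> a <= b ->
  mu [set z : X | (forall i, lo i <= z.1 0 i <= hi i) /\ a <= z.2 <= b] =
  ((\prod_i (hi i - lo i)) * (b - a))%:E.
Proof.
move=> lohi ab.
have itvE (x y : R) : x <= y -> lebesgue_R [set` `[x, y]] = (y - x)%:E.
  move=> xy; rewrite /lebesgue_R lebesgue_measure_itv /= lte_fin.
  by case: ltP => // yx; rewrite (@le_anti _ _ x y) ?xy// subrr.
have mE : measurable [set x : 'rV[R]_N | forall i, [set` `[lo i, hi i]] (x 0 i)].
  rewrite (_ : mkset _ = \bigcap_(i in [set: 'I_N]) [set x : 'rV[R]_N | [set` `[lo i, hi i]] (x 0 i)]).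
    apply: fin_bigcap_measurable => // i _; rewrite -[X in measurable X]setTI.
    exact: (measurable_coord i).
  by apply/seteqP; split => x /= H i; [move=> _|]; exact: H.
rewrite (_ : mkset _ = [set x : 'rV[R]_N | forall i, [set` `[lo i, hi i]] (x 0 i)] `*` [set` `[a, b]]); last first.
  apply/seteqP; split => -[x t] /=.
    by move=> [h1 h2]; split; [move=> i; rewrite in_itv; exact: h1|rewrite in_itv].
  by move=> [h1 h2]; split; [move=> i; have := h1 i; rewrite in_itv|move: h2; rewrite in_itv].
have pE := product_measure1E (lebesgue_rV N) (@lebesgue_R R) mE (measurable_itv `[a, b]).
have bE := @lebesgue_rV_box R N (fun i => [set` `[lo i, hi i]]) (fun i => measurable_itv _).
apply: (eq_trans pE).
transitivity ((\prod_(i < N) lebesgue_R [set` `[lo i, hi i]]) * lebesgue_R [set` `[a, b]])%E.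
  by congr (_ * _)%E; exact: bE.
rewrite itvE// EFinM; congr (_ * _)%E.
rewrite -prodEFin; apply: eq_bigr => i _; exact: itvE.
Qed.

Lemma measurable_box (lo hi : 'I_N -> R) (a b : R) :
  measurable [set z : X | (forall i, lo i <= z.1 0 i <= hi i) /\ a <= z.2 <= b].
Proof.
rewrite (_ : mkset _ = (\bigcap_(i in [set: 'I_N]) [set z : X | [set` `[lo i, hi i]] (z.1 0 i)]) `&`
   [set z : X | [set` `[a, b]] z.2]); last first.
  apply/seteqP; split => -[x t] /=.
    by move=> [h1 h2]; split; [move=> i _ /=; rewrite in_itv; exact: h1|rewrite in_itv].
  by move=> [h1 h2]; split; [move=> i; have := h1 i I; rewrite /= in_itv|move: h2; rewrite in_itv].
apply: measurableI; last first.
  by rewrite -[X in measurable X]setTI; exact: meas_time.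
apply: fin_bigcap_measurable => // i _; rewrite -[X in measurable X]setTI.
exact: (meas_coord i).
Qed.

Lemma L1_indic (A : set X) : measurable A -> (mu A < +oo)%E ->
  L1 (\1_A : X -> R) /\ Int (\1_A : X -> R) = fine (mu A).
Proof.
move=> mA Aoo; split; last by rewrite /Rintegral integral_indic// setIT.
apply/integrableP; split; first exact/measurable_EFinP/measurable_indic.
rewrite (eq_integral (fun z => (\1_A z)%:E)) ?integral_indic ?setIT// => z _ /=.
by rewrite ger0_norm.
Qed.

Lemma L1_box (g : X -> R) (M L a b : R) : measurable_fun setT g -> (forall z, `|g z| <= M) ->
  (forall z, g z != 0 -> (forall i, `|z.1 0 i| <= L) /\ a <= z.2 <= b) -> L1 g.
Proof.
move=> mg gM g0; pose L' : R := Num.max 0 L; pose b' : R := Num.max a b.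
pose B := [set z : X | (forall i, (fun=> - L') i <= z.1 0 i <= (fun=> L') i) /\ a <= z.2 <= b'].
have L'0 : 0 <= L' by rewrite /L' le_max lexx.
have mB : measurable B := @measurable_box (fun=> - L') (fun=> L') a b'.
have [iB _] : L1 (\1_B : X -> R) /\ Int (\1_B : X -> R) = fine (mu B).
  apply: L1_indic => //; rewrite xt_box ?ltry// => [_|]; last by rewrite le_max lexx.
  by apply: (le_trans _ L'0); rewrite oppr_le0.
apply: (@L1_le _ _ _ _ _ (fun z => M * \1_B z)) => //; last exact: L1Z.
move=> z; rewrite indicE; have [->|/g0[h1 h2]] := eqVneq (g z) 0.
  by rewrite normr0 mulr_ge0// (le_trans (normr_ge0 (g z))).
rewrite mem_set ?mulr1//; split => [i|] /=.
  by rewrite -ler_norml; apply: le_trans (h1 i) _; rewrite le_max lexx orbT.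
by move: h2 => /andP[-> h2] /=; rewrite le_max h2 orbT.
Qed.

End xt_translation.

(** * Duality *)

Section adjoint_exists.
Context {R : realType} {N : nat}.
Local Notation X := ('rV[R]_N * R)%type.
Notation mu := (@lebesgue_xt R N).
Notation L1 g := (mu.-integrable [set: X] (EFin \o g)).
Notation Int g := (\int[mu]_x g x).

Section weights.
Variables (delta : R) (q p c n1 : nat) (T1 : R).
Hypothesis delta_gt0 : 0 < delta.
Hypothesis q_gt0 : (0 < q)%N.
Hypothesis p_gt0 : (0 < p)%N.
Notation h := (gh delta q).
Notation tau := (gtau delta p).
Local Notation G := {ffun 'I_N -> 'I_(c.*2).+1}.
Local Notation OM := (@om R N delta q p c T1).

Lemma om_meas n (k : G) : measurable_fun setT (OM n k).
Proof.
apply: cts_meas; apply: (@Ck_cts _ _ 2); apply: Ck_tens => [j|]; exact: C2_slot_kap.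
Qed.

Lemma om_le n (k : G) z : OM n k z <= q%:R^-1 ^+ N * p%:R^-1.
Proof.
rewrite /om /tens; have q0 : 0 <= q%:R^-1 :> R by rewrite invr_ge0.
have p0 : 0 <= p%:R^-1 :> R by rewrite invr_ge0.
apply: ler_pM.
- by apply: prodr_ge0 => j _; exact: xs_ge0.
- exact: ts_ge0.
- rewrite -[X in _ <= _ ^+ X](card_ord N) -prodr_const; apply: ler_prod => j _.
  by rewrite xs_ge0 /= /xs ler_piMl// kap_le1.
- by rewrite /ts ler_piMl// kap_le1.
Qed.

(** The support lies in a box of side [8 * delta], from the two-sided bounds of [om_near], and the
    height is at most [1 / (q ^ N * p)]; the powers of [delta] combine with it to [h ^+ N * tau]. *)
Lemma om_Int n (k : G) : L1 (OM n k) /\ Int (OM n k) <= 8 ^+ N.+1 * (h ^+ N * tau).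
Proof.
pose K : R := q%:R^-1 ^+ N * p%:R^-1.
have K0 : 0 <= K by rewrite mulr_ge0 ?exprn_ge0 ?invr_ge0.
pose c0 := gpt delta q p T1 n k.
pose lo i := c0.1 0 i - 4 * delta; pose hi i := c0.1 0 i + 4 * delta.
pose a := c0.2 - 4 * delta; pose b := c0.2 + 4 * delta.
have lohi i : lo i <= hi i by rewrite /lo /hi; have := delta_gt0; lra.
have ab : a <= b by rewrite /a /b; have := delta_gt0; lra.
pose B := [set z : X | (forall i, lo i <= z.1 0 i <= hi i) /\ a <= z.2 <= b].
have mB : measurable B := measurable_box lo hi a b.
have vB : mu B = ((\prod_i (hi i - lo i)) * (b - a))%:E := xt_box lohi ab.
have [iB IB] : L1 (\1_B : X -> R) /\ Int (\1_B : X -> R) = fine (mu B).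
  by apply: L1_indic => //; rewrite vB ltry.
have le z : OM n k z <= K * \1_B z.
  rewrite indicE; have [->|/(om_near delta_gt0)[h1 [h2 _]]] := eqVneq (OM n k z) 0.
    by rewrite mulr_ge0.
  rewrite mem_set ?mulr1; first exact: om_le.
  have key (x y : R) : `|x - y| <= 4 * delta -> y - 4 * delta <= x <= y + 4 * delta.
    by rewrite ler_norml => /andP[? ?]; apply/andP; split; lra.
  by split => [i|]; apply: key.
have iO : L1 (OM n k).
  apply: (@L1_le _ _ _ _ _ (fun z => K * \1_B z)); [exact: om_meas| |exact: L1Z].
  by move=> z; rewrite (ger0_norm (om_ge0 _ _ _ _ _ _ _)).
split=> //; apply: le_trans (Int_le iO (L1Z K iB) le) _.
rewrite (IntZ K iB) IB vB /= le_eqVlt; apply/orP; left; apply/eqP.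
have -> : b - a = 8 * delta by rewrite /a /b; lra.
rewrite (eq_bigr (fun=> 8 * delta)); last by move=> i _; rewrite /hi /lo; lra.
rewrite prodr_const card_ord /K /gh /gtau !exprMn !exprVn exprS.
by ring.
Qed.

Lemma wsum_Int (a : nat -> G -> R) : (forall n k, 0 <= a n k) ->
  L1 (fun z => \sum_(n < n1.+1) \sum_(k : G) a n k * OM n k z) /\
  Int (fun z => \sum_(n < n1.+1) \sum_(k : G) a n k * OM n k z) <=
    8 ^+ N.+1 * (h ^+ N * tau * \sum_(n < n1.+1) \sum_(k : G) a n k).
Proof.
move=> a0.
have i1 n k : L1 (fun z => a n k * OM n k z) by apply: L1Z; have [] := om_Int n k.
have i2 (n : 'I_n1.+1) : L1 (fun z => \sum_(k : G) a n k * OM n k z).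
  by apply: L1_sum => k.
split; first by apply: L1_sum => n.
rewrite Int_sum// !mulr_sumr; apply: ler_sum => n _.
rewrite Int_sum// !mulr_sumr; apply: ler_sum => k _.
have [iO leO] := om_Int n k; rewrite IntZ// mulrA [leRHS]mulrC ler_wpM2l//.
Qed.

End weights.

Lemma Phi_ge0 (delta : R) q p c n1 T1 psi (z : X) : (forall n k, 0 <= psi n k) ->
  0 <= @Phi R N delta q p c n1 T1 psi z.
Proof.
move=> p0; apply: sumr_ge0 => n _; apply: sumr_ge0 => k _.
by rewrite mulr_ge0// om_ge0.
Qed.

Lemma PhiB (delta : R) q p c n1 T1 psi psi' (z : X) :
  @Phi R N delta q p c n1 T1 (fun n k => psi n k - psi' n k) z =
  Phi delta q p n1 T1 psi z - Phi delta q p n1 T1 psi' z.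
Proof.
rewrite /Phi -sumrB; apply: eq_bigr => n _; rewrite -sumrB; apply: eq_bigr => k _.
by rewrite mulrBl.
Qed.

(** Only finitely many nodes occur, so a sum over all of them serves as radius. The bound that must
    be sharp is [beta]; it comes from the one-sided support of the time kernels. *)
Lemma Phi_support (delta : R) q p c n1 T1 psi (beta : R) : 0 < delta ->
  (forall n (k : {ffun 'I_N -> 'I_(c.*2).+1}), beta <= gt delta p T1 n -> psi n k = 0) ->
  exists r, forall z, Phi delta q p n1 T1 psi z != 0 ->
    (forall i, `|z.1 0 i| <= r) /\ - r <= z.2 <= beta.
Proof.
move=> d0 late.
exists (\sum_(n < n1.+1) \sum_(k : {ffun 'I_N -> 'I_(c.*2).+1})
  (\sum_i `|(gpt delta q p T1 n k).1 0 i| + `|(gpt delta q p T1 n k).2| + 4 * delta)) => z.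
set r := \sum_(n < _) _ => Pz.
have [n [k [om0 ps0]]] : exists (n : 'I_n1.+1) (k : {ffun 'I_N -> 'I_(c.*2).+1}),
    om delta q p T1 n k z != 0 /\ psi n k != 0.
  apply: contrapT => H; move/negP: Pz; apply; apply/eqP.
  apply: big1 => n _; apply: big1 => k _; apply/eqP; rewrite mulf_eq0 -[_ || _]negbK negb_or.
  by apply/negP => /andP[? ?]; apply: H; exists n, k.
have [h1 [h2 h3]] := om_near d0 om0.
have rle : \sum_i `|(gpt delta q p T1 n k).1 0 i| + `|(gpt delta q p T1 n k).2| + 4 * delta <= r.
  have nn n' (k' : {ffun 'I_N -> 'I_(c.*2).+1}) :
     0 <= \sum_i `|(gpt delta q p T1 n' k').1 0 i| + `|(gpt delta q p T1 n' k').2| + 4 * delta.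
    by rewrite !addr_ge0 ?sumr_ge0// mulr_ge0// ltW.
  rewrite /r (bigD1 n)//= (bigD1 k)//=; set S0 := \sum_i _ + _ + _; clearbody S0.
  rewrite -addrA lerDl addr_ge0//.
    by apply: sumr_ge0 => k' _; exact: (nn n k').
  by apply: sumr_ge0 => n' _; apply: sumr_ge0 => k' _; exact: (nn n' k').
have s0 : 0 <= \sum_i `|(gpt delta q p T1 n k).1 0 i| by apply: sumr_ge0.
split=> [i|].
  apply: le_trans rle; have := h1 i; rewrite (bigD1 i)//=.
  have : 0 <= \sum_(j | j != i) `|(gpt delta q p T1 n k).1 0 j| by apply: sumr_ge0.
  have := ler_normD (z.1 0 i - (gpt delta q p T1 n k).1 0 i) ((gpt delta q p T1 n k).1 0 i).
  rewrite subrK; have := normr_ge0 (gpt delta q p T1 n k).2; lra.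
apply/andP; split.
  rewrite lerNl; apply: le_trans rle.
  have := ler_normD (z.2 - (gpt delta q p T1 n k).2) (gpt delta q p T1 n k).2.
  rewrite subrK; have := ler_norm (- z.2); rewrite normrN; lra.
apply: le_trans h3 _; rewrite leNgt; apply/negP => lt; move/negP: ps0; apply; apply/eqP.
by apply: late; exact: ltW.
Qed.

Lemma sum2_le (x y p : R) : x + y <= p -> 0 <= x -> 0 <= y -> x <= p /\ y <= p.
Proof. by split; lra. Qed.

Lemma sum3_le (x y z p : R) : x + y + z <= p -> 0 <= x -> 0 <= y -> 0 <= z -> y <= p /\ z <= p.
Proof. by split; lra. Qed.

Lemma grid_end (n t d U : R) : n * t <= U + 4 * d -> t <= 1 -> d <= 1 -> n * t + 2 * t <= U + 7.
Proof. by lra. Qed.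

Lemma quarter_le (k : R) : 0 < k -> k / 4 <= k.
Proof. by lra. Qed.

Lemma quarters_le (x y k : R) : 0 < k -> x <= k / 4 -> y <= k / 4 -> x + (y + y) <= k.
Proof. by lra. Qed.

Lemma nat_above (x : R) : exists2 n : nat, (0 < n)%N & x <= n%:R.
Proof. by exists (Num.truncn x).+1 => //; apply: ltW; exact: truncnS_gt. Qed.

Variables (f : 'I_N -> 'rV[R]_N -> R) (F Lf : R).
Hypothesis f_bd : forall i x, `|f i x| <= F.
Hypothesis f_lip : forall i, xlip Lf (f i).
Hypothesis Lf_ge0 : 0 <= Lf.
Hypothesis F_ge0 : 0 <= F.
Variables (ze be : X -> R) (Lz A alpha beta Lb eps M delta L0 kappa T : R).
Hypothesis ze_lip : xtlip Lz ze.
Hypothesis ze_bd : forall z, `|ze z| <= 1.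
Hypothesis ze_out : forall z, ze z != 0 ->
  alpha <= z.2 <= beta /\ forall i, `|z.1 0 i| <= A.
Hypothesis be_lip : xtlip Lb be.
Hypothesis be_bd : forall z, eps <= be z <= M.
Hypothesis alpha_beta : alpha <= beta.
Hypothesis A_ge0 : 0 <= A.
Hypothesis eps_gt0 : 0 < eps.
Hypothesis M_ge1 : 1 <= M.
Hypothesis delta_gt0 : 0 < delta.
Hypothesis delta_le1 : delta <= 1.
Hypothesis L0_ge0 : 0 <= L0.
Hypothesis kappa_gt0 : 0 < kappa.
Hypothesis kappa_le1 : kappa <= 1.
Hypothesis T_gt0 : 0 < T.

(** The factor [8 ^+ N.+1] is that of [om_Int]; the horizon [T + 7] leaves room for the kernels and
    the last time steps beyond [T], see [grid_end]. *)
Definition energy_bd : R := 8 ^+ N.+1 * @Ke R N F Lf Lz A (T + 7).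

Definition residual (Phi : X -> R) (z : X) : R :=
  ze z + dt Phi z + be z * laplacian Phi z - \sum_i f i z.1 * dx i Phi z.

Definition crude_bd : R := (beta - alpha + 1) * (1400 / delta ^+ 2).

(** The order of choice is [q], [p], [c], [n1]: the stability condition limits the time step in
    terms of the mesh width, and the extent of the grid is counted in units of both. *)
Lemma grid_exists : exists q p c n1 : nat,
  [/\ (0 < q)%N, (0 < p)%N, L0 + 6 <= gh delta q * c%:R & A + 1 <= gh delta q * c%:R] /\
  [/\ gtau delta p * (12 * N%:R * M) <= gh delta q ^+ 2, F * gh delta q <= 2 * eps,
      T + 4 * delta <= n1%:R * gtau delta p & n1.+1%:R * gtau delta p <= T + 7] /\
  [/\ gtau delta p <= kappa, N%:R * ((beta - alpha + gtau delta p) * (350 / (delta ^+ 2 * q%:R))) <= kappa &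
      @consE R N delta q p M F Lz alpha beta <= Lz * (4 * delta) + kappa].
Proof.
have M0 : 0 < M := lt_le_trans ltr01 M_ge1.
pose D : R := (beta - alpha + 1) * 350 * (M * N%:R + N%:R * F + 1) / delta ^+ 2.
have d2 : 0 < delta ^+ 2 by rewrite exprn_gt0.
have E0 : 0 < M * N%:R + N%:R * F + 1.
  by rewrite ltr_wpDl// addr_ge0// mulr_ge0// ltW.
have ba : 0 <= beta - alpha by rewrite subr_ge0.
have ba1 : 0 < beta - alpha + 1 by rewrite ltr_wpDl.
have p350 : 0 < 350 :> R by rewrite ltr0n.
have l350 := ltW p350.
have D0 : 0 < D.
  by rewrite /D; apply: divr_gt0; [apply: mulr_gt0; [exact: mulr_gt0|exact: E0]|exact: d2].
have lD0 := ltW D0; have lk0 := ltW kappa_gt0; have ld0 := ltW delta_gt0.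
have DE : D = (M * N%:R + N%:R * F + 1) * ((beta - alpha + 1) * 350) / delta ^+ 2 by rewrite /D; ring.
clearbody D.
(* The first summand makes the consistency errors small, the second gives [F * h <= 2 * eps]. *)
have [q q0 qD] := nat_above (4 * D / kappa + F * delta / (2 * eps)).
have q0' : 0 < q%:R :> R by rewrite ltr0n.
have h0 : 0 < gh delta q by rewrite /gh divr_gt0.
(* The summands provide consistency in time, a time step at most [kappa], and the stability
   condition. *)
have [p p0 pD] := nat_above (4 * D / kappa + delta / kappa + delta * (12 * N%:R * M) / gh delta q ^+ 2).
have p0' : 0 < p%:R :> R by rewrite ltr0n.
have t0 : 0 < gtau delta p by rewrite /gtau divr_gt0.
have [c c0 cD] := nat_above ((L0 + 6 + (A + 1)) / gh delta q).
pose n1 := (Num.truncn ((T + 4 * delta) / gtau delta p)).+1.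
have pos1 : 0 <= 4 * D / kappa by apply: divr_ge0 => //; exact: mulr_ge0.
have le0 := ltW eps_gt0; have lM0 := ltW M0; have lh0 := ltW h0; have lt0 := ltW t0.
have pos2 : 0 <= F * delta / (2 * eps) by apply: divr_ge0; apply: mulr_ge0.
have pos3 : 0 <= delta / kappa by exact: divr_ge0.
have pos4 : 0 <= delta * (12 * N%:R * M) / gh delta q ^+ 2.
  apply: divr_ge0; last exact: sqr_ge0.
  by apply: mulr_ge0 => //; apply: mulr_ge0 => //; exact: mulr_ge0.
have Kd (r : R) : 0 < r -> 4 * D / kappa <= r -> D / r <= kappa / 4.
  move=> r0; rewrite ler_pdivrMr// => H; rewrite ler_pdivrMr//.
  by rewrite mulrAC ler_pdivlMr// [leLHS]mulrC [kappa * r]mulrC.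
have qK : D / q%:R <= kappa / 4 by apply: Kd => //; apply: le_trans qD; rewrite lerDl.
have pK : D / p%:R <= kappa / 4.
  by apply: Kd => //; apply: le_trans pD; rewrite -addrA lerDl addr_ge0.
have d1 : delta ^+ 2 <= delta by rewrite expr2 ler_piMr// ltW.
have N0 : 0 <= N%:R :> R by [].
have MN : 0 <= M * N%:R by rewrite mulr_ge0// ltW.
have NF : 0 <= N%:R * F by rewrite mulr_ge0.
have [pD1 pD2] := sum3_le pD pos1 pos3 pos4.
have [qD1 qD2] := sum2_le qD pos1 pos2.
have tk : gtau delta p <= kappa.
  by rewrite /gtau ler_pdivrMr// mulrC -ler_pdivrMr//; exact: pD1.
have t1 : gtau delta p <= 1 := le_trans tk kappa_le1.
have key (a d r : R) : 0 <= a -> a <= M * N%:R + N%:R * F + 1 -> delta ^+ 2 <= d -> 0 < r ->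
    a * ((beta - alpha + gtau delta p) * (350 / (d * r))) <= D / r.
  move=> a0 aS dd r0; have d0 : 0 < d := lt_le_trans d2 dd.
  have -> : a * ((beta - alpha + gtau delta p) * (350 / (d * r))) =
     (a * ((beta - alpha + gtau delta p) * 350)) / d / r.
    by field; rewrite !gt_eqF.
  rewrite DE.
  rewrite ler_pM2r ?invr_gt0//; apply: ler_pM.
  - apply: mulr_ge0; [exact: a0|apply: mulr_ge0; last exact: l350].
    by apply: addr_ge0; [exact: ba|exact: ltW].
  - by rewrite invr_ge0 ltW.
  - apply: ler_pM; [exact: a0| |exact: aS|].
      by apply: mulr_ge0; [apply: addr_ge0; [exact: ba|exact: ltW]|exact: l350].
    by apply: ler_wpM2r; [exact: l350|rewrite lerD2l].
  - by rewrite lef_pV2 ?posrE.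
have cc : L0 + 6 + (A + 1) <= gh delta q * c%:R by rewrite mulrC -ler_pdivrMr.
have [cc1 cc2] := sum2_le cc (addr_ge0 L0_ge0 (ler0n R 6)) (addr_ge0 A_ge0 ler01).
exists q, p, c, n1; split; [split=> //|split; [split|split]] => //.
- by rewrite /gtau mulrAC ler_pdivrMr// [leRHS]mulrC -ler_pdivrMr ?exprn_gt0//; exact: pD2.
- by rewrite /gh mulrA ler_pdivrMr// [leRHS]mulrC -ler_pdivrMr ?mulr_gt0//; exact: qD2.
- by rewrite -ler_pdivrMr// ltW// truncnS_gt.
- have : (Num.truncn ((T + 4 * delta) / gtau delta p))%:R * gtau delta p <= T + 4 * delta.
    rewrite -ler_pdivlMr// truncn_le//.
    by apply: divr_ge0 => //; apply: addr_ge0; [exact: ltW|exact: mulr_ge0].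
  rewrite /n1; set n0 := Num.truncn _; clearbody n0.
  have -> : n0.+2%:R * gtau delta p = n0%:R * gtau delta p + 2 * gtau delta p by rewrite -addn2 natrD mulrDl.
  by move=> nT; exact: grid_end nT t1 delta_le1.
- apply: le_trans (key N%:R (delta ^+ 2) q%:R N0 _ (lexx _) q0') _.
    by apply: (@le_trans _ _ (M * N%:R)); [rewrite ler_peMl|rewrite -addrA lerDl addr_ge0].
  by apply: le_trans qK _; exact: quarter_le.
- rewrite /consE -addrA -addrA lerD2l.
  have k1 := key 1 delta p%:R ler01 _ d1 p0'.
  have k2 := key (M * N%:R) (delta ^+ 2) q%:R MN _ (lexx _) q0'.
  have k3 := key (N%:R * F) delta q%:R NF _ d1 q0'.
  rewrite mul1r in k1; rewrite -[M * N%:R * _]mulrA in k2; rewrite -[N%:R * F * _]mulrA in k3.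
  apply: le_trans (lerD (k1 _) (lerD (k2 _) (k3 _))) _; [| | |].
  + by rewrite lerDr addr_ge0.
  + by rewrite -addrA lerDl addr_ge0.
  + by rewrite [M * _ + _]addrC -addrA lerDl addr_ge0.
  exact: quarters_le.
Qed.

(** [lap1] and [err1] are controlled by [E1] and [E2] through Jensen's inequality, and the integrals
    of the latter are bounded by grid sums that the energy estimate controls. The bound for [E2]
    carries [delta ^+ 2], so a large [Lb] is beaten by a small [delta]. *)
Lemma adjoint_exists : exists Phi Phi1 Phi2 lap1 err1 E1 E2 : X -> R,
  [/\ forall z : X, Phi z = Phi1 z - Phi2 z,
      (Ck 2 setT Phi1 /\ Ck 2 setT Phi2) /\ Ck 2 setT Phi,
      forall z : X, 0 <= Phi1 z /\ 0 <= Phi2 z &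
      exists r, forall z : X, (Phi1 z != 0) || (Phi2 z != 0) || (Phi z != 0) ->
        (forall i, `|z.1 0 i| <= r) /\ - r <= z.2 <= beta] /\
  [/\ forall z : X, `|Phi z| <= beta - alpha + kappa,
      forall z : X, `|dt Phi z| <= crude_bd,
      forall i (z : X), `|dx i Phi z| <= crude_bd &
      forall i (z : X), `|dx i (dx i Phi) z| <= crude_bd] /\
  [/\ forall z : X, lap1 z ^+ 2 <= E1 z, forall z : X, err1 z ^+ 2 <= E2 z,
      L1 E1 /\ Int E1 <= energy_bd / eps &
      L1 E2 /\ Int E2 <= 32 * delta ^+ 2 * (Lb ^+ 2 / eps + N%:R * Lf ^+ 2 * (T + 7)) * energy_bd] /\
  (forall z : X, (forall i, `|z.1 0 i| <= L0) -> 0 <= z.2 <= T ->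
     `|laplacian Phi z| <= lap1 z + kappa /\
     `|residual Phi z| <= err1 z + (Lz * (4 * delta) + kappa)).
Proof.
have [q [p [c [n1 [[q0 p0 L0c Ac] [[cfl mono T1n nT] [tk lk ck]]]]]]] := grid_exists.
(* The partition of unity holds at times up to [T1 - 4 * delta], which is [T]. *)
pose T1 := T + 4 * delta.
pose ps := psi delta q p (c := c) T1 be f ze L0.
(* The grid values are split into positive and negative parts, and not [Phi] itself, so that both
   interpolants are of class C^2. *)
pose pp n k : R := Num.max 0 (ps n k); pose pm n k : R := Num.max 0 (- ps n k).
have psE n k : ps n k = pp n k - pm n k.
  rewrite /pp /pm; have [p00|p00] := leP 0 (ps n k).
    by rewrite max_l ?oppr_le0// subr0.
  by rewrite max_r ?oppr_ge0 ?(ltW p00)// sub0r opprK.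
have psmax := psi_max T1 delta_gt0 q0 p0 L0 be_bd eps_gt0 f_bd ze_bd ze_out alpha_beta cfl mono.
have pslate := fun n => @psi_late R N delta q p c T1 delta_gt0 p0 be f ze A alpha beta L0 ze_out n.
have P1 n k : (n <= n1)%N -> `|ps n k| <= beta - alpha + 1.
  by move=> _; apply: le_trans (psmax c n k) _; rewrite lerD2l (le_trans tk).
have crude1 : (beta - alpha + 1) * (1400 / delta) <= crude_bd.
  apply: ler_wpM2l; first by have := alpha_beta; lra.
  apply: ler_wpM2l; first exact: ler0n.
  by rewrite lef_pV2 ?posrE ?exprn_gt0// expr2 ler_piMr// ltW.
exists (Phi delta q p n1 T1 ps), (Phi delta q p n1 T1 pp), (Phi delta q p n1 T1 pm).
exists (lapS delta q p c n1 T1 be f ze L0), (errS delta q p c n1 T1 be f ze Lb Lf L0).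
exists (fun z => \sum_(n < n1.+1) \sum_(k : {ffun 'I_N -> 'I_(c.*2).+1})
  `|dlap (@gs N c) (@gs' N c) (gh delta q) (ps n) k| ^+ 2 * om delta q p T1 n k z).
exists (fun z => \sum_(n < n1.+1) \sum_(k : {ffun 'I_N -> 'I_(c.*2).+1})
  (4 * delta * (Lb * `|dlap (@gs N c) (@gs' N c) (gh delta q) (ps n) k| +
   \sum_i Lf * `|ctr (@gs N c) (@gs' N c) (gh delta q) i (ps n) k|)) ^+ 2 * om delta q p T1 n k z).
split; [split|split; [split|split; [split|]]].
- move=> z; rewrite -PhiB; congr Phi; apply/funext => n; apply/funext => k; exact: psE.
- by split; [split|]; exact: Phi_Ck.
- by move=> z; split; apply: Phi_ge0 => n k; rewrite /pp /pm le_max lexx.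
- have [r1 H1] := @Phi_support delta q p c n1 T1 pp beta delta_gt0
    (fun n k H => ltac:(by rewrite /pp /ps pslate// max_l)).
  have [r2 H2] := @Phi_support delta q p c n1 T1 pm beta delta_gt0
    (fun n k H => ltac:(by rewrite /pm /ps pslate// oppr0 max_l)).
  have [r3 H3] := @Phi_support delta q p c n1 T1 ps beta delta_gt0 pslate.
  have key (a b : R) (z : X) : a <= b -> (forall i, `|z.1 0 i| <= a) /\ - a <= z.2 <= beta ->
      (forall i, `|z.1 0 i| <= b) /\ - b <= z.2 <= beta.
    move=> ab [h1 /andP[h2 h3]]; split=> [i|]; first exact: le_trans (h1 i) ab.
    by rewrite h3 andbT; apply: le_trans h2; rewrite lerN2.
  exists (`|r1| + `|r2| + `|r3|) => z /orP[/orP[/H1|/H2]|/H3]; apply: key.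
  + by have := ler_norm r1; have := normr_ge0 r2; have := normr_ge0 r3; lra.
  + by have := ler_norm r2; have := normr_ge0 r1; have := normr_ge0 r3; lra.
  + by have := ler_norm r3; have := normr_ge0 r2; have := normr_ge0 r1; lra.
- move=> z; apply: (@Phi_bound _ _ delta q p c n1 T1) => // n k _.
  by apply: le_trans (psmax c n k) _; rewrite lerD2l.
- by move=> z; apply: le_trans (dt_Phi_crude T1 delta_gt0 q0 p0 P1 z) _.
- by move=> i z; apply: le_trans (dx_Phi_crude T1 delta_gt0 q0 p0 P1 i z) _.
- move=> i z; rewrite /crude_bd; apply: le_trans (dxx_Phi_crude T1 delta_gt0 q0 p0 P1 i z) _.
  exact: lexx.
- move=> z; apply: wsum2_sqr => [n k|]; first exact: om_ge0.
  exact: sum_om_le1.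
- move=> z; apply: wsum2_sqr => [n k|]; first exact: om_ge0.
  exact: sum_om_le1.
- have [|i1 I1] := @wsum_Int delta q p c n1 T1 delta_gt0
    (fun n k => `|dlap (@gs N c) (@gs' N c) (gh delta q) (ps n) k| ^+ 2); first by move=> n k; exact: sqr_ge0.
  split=> //; apply: le_trans I1 _; rewrite /energy_bd -[leRHS]mulrA; apply: ler_wpM2l; first by rewrite exprn_ge0.
  have := psi_lap2 T1 delta_gt0 delta_le1 q0 p0 be_bd eps_gt0 M_ge1 f_bd f_lip Lf_ge0 F_ge0
    ze_lip ze_bd ze_out A_ge0 L0c Ac cfl nT.
  apply: le_trans; rewrite le_eqVlt; apply/orP; left; apply/eqP; congr (_ * _).
  by apply: eq_bigr => n _; apply: eq_bigr => k _; rewrite real_normK ?num_real.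
- pose co n k := (4 * delta * (Lb * `|dlap (@gs N c) (@gs' N c) (gh delta q) (ps n) k| +
    \sum_i Lf * `|ctr (@gs N c) (@gs' N c) (gh delta q) i (ps n) k|)) ^+ 2.
  have [|i1 I1] := @wsum_Int delta q p c n1 T1 delta_gt0 co; first by move=> n k; exact: sqr_ge0.
  split=> //; apply: le_trans I1 _.
  have E1 := psi_lap2 T1 delta_gt0 delta_le1 q0 p0 be_bd eps_gt0 M_ge1 f_bd f_lip Lf_ge0 F_ge0
    ze_lip ze_bd ze_out A_ge0 L0c Ac cfl nT.
  have E2 := psi_ctr2 T1 delta_gt0 delta_le1 q0 p0 be_bd eps_gt0 M_ge1 f_bd f_lip Lf_ge0 F_ge0
    ze_lip ze_bd ze_out A_ge0 L0c Ac cfl nT.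
  rewrite -/ps in E1 E2.
  have co_le n k : co n k <= 32 * delta ^+ 2 * (Lb ^+ 2 * dlap (@gs N c) (@gs' N c) (gh delta q) (ps n) k ^+ 2 +
      N%:R * Lf ^+ 2 * \sum_i ctr (@gs N c) (@gs' N c) (gh delta q) i (ps n) k ^+ 2).
    have := sqr_sum_le (fun i => `|ctr (@gs N c) (@gs' N c) (gh delta q) i (ps n) k|).
    rewrite card_ord; under [X in _ <= _ * X]eq_bigr do rewrite real_normK ?num_real//.
    rewrite /co -mulr_sumr -[dlap _ _ _ _ _ ^+ 2]real_normK ?num_real//.
    set s := \sum_i `|_|; set s2 := \sum_i _; set y := `|_|; clearbody s s2 y => H.
    have -> : (4 * delta * (Lb * y + Lf * s)) ^+ 2 =
      32 * delta ^+ 2 * (Lb ^+ 2 * y ^+ 2 + Lf ^+ 2 * s ^+ 2) - 16 * delta ^+ 2 * (Lb * y - Lf * s) ^+ 2 by ring.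
    apply: (@le_trans _ _ (32 * delta ^+ 2 * (Lb ^+ 2 * y ^+ 2 + Lf ^+ 2 * s ^+ 2))).
      by rewrite gerBl; apply: mulr_ge0; [apply: mulr_ge0; [exact: ler0n|]|]; exact: sqr_ge0.
    apply: ler_wpM2l; first by apply: mulr_ge0; [exact: ler0n|exact: sqr_ge0].
    rewrite lerD2l (_ : N%:R * _ * s2 = Lf ^+ 2 * (N%:R * s2)); last by ring.
    by apply: ler_wpM2l; first exact: sqr_ge0.
  rewrite /energy_bd [leRHS]mulrCA; apply: ler_wpM2l; first by rewrite exprn_ge0.
  apply: (@le_trans _ _ (gh delta q ^+ N * gtau delta p * \sum_(n < n1.+1) \sum_(k : {ffun 'I_N -> 'I_(c.*2).+1})
    32 * delta ^+ 2 * (Lb ^+ 2 * dlap (@gs N c) (@gs' N c) (gh delta q) (ps n) k ^+ 2 +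
      N%:R * Lf ^+ 2 * \sum_i ctr (@gs N c) (@gs' N c) (gh delta q) i (ps n) k ^+ 2))).
    apply: ler_wpM2l; first by rewrite mulr_ge0 ?exprn_ge0 ?divr_ge0// ltW.
    by apply: ler_sum => n _; apply: ler_sum => k _; exact: co_le.
  under eq_bigr do rewrite -mulr_sumr big_split /= -2!mulr_sumr.
  rewrite -mulr_sumr big_split /= -2!mulr_sumr.
  set S1 := \sum_(n < _) _ in E1 *; set S2 := \sum_(n < _) _ in E2 *; clearbody S1 S2.
  set K := Ke _ _ _ _ _ in E1 E2 *; clearbody K; set g := _ * gtau _ _ in E1 E2 *; clearbody g.
  have -> : g * (32 * delta ^+ 2 * (Lb ^+ 2 * S1 + N%:R * Lf ^+ 2 * S2)) =
     32 * delta ^+ 2 * (Lb ^+ 2 * (g * S1) + N%:R * Lf ^+ 2 * (g * S2)) by ring.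
  rewrite -[leRHS]mulrA; apply: ler_wpM2l; first by apply: mulr_ge0; [exact: ler0n|exact: sqr_ge0].
  rewrite mulrDl; apply: lerD.
    rewrite [leRHS]mulrAC -[leRHS]mulrA; apply: ler_wpM2l; [exact: sqr_ge0|exact: E1].
  by rewrite -[leRHS]mulrA; apply: ler_wpM2l => //; apply: mulr_ge0; [exact: ler0n|exact: sqr_ge0].
move=> z zL /andP[z0 zT]; split.
  apply: le_trans (lap_le n1 T1 delta_gt0 delta_le1 q0 p0 be_bd eps_gt0 f_bd ze_bd ze_out
    alpha_beta L0c cfl mono zL) _.
  by rewrite lerD2l.
have zT1 : z.2 <= T1 - 4 * delta by rewrite /T1 addrK.
apply: le_trans (residual_le delta_gt0 delta_le1 q0 p0 be_lip be_bd eps_gt0 f_bd f_lip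
    ze_lip ze_bd ze_out alpha_beta L0c cfl mono T1n zL z0 zT1) _.
by rewrite lerD2l.
Qed.

End adjoint_exists.

(** * The estimate of [w] by duality *)

Section duality.
Context {R : realType} {N : nat}.
Local Notation X := ('rV[R]_N * R)%type.
Notation mu := (@lebesgue_xt R N).
Notation L1 g := (mu.-integrable [set: X] (EFin \o g)).
Notation Int g := (\int[mu]_x g x).

Lemma amgm (x y r : R) : 0 < r -> x * y <= (x ^+ 2 / r + r * y ^+ 2) / 2.
Proof.
move=> r0; have : 0 <= (x - r * y) ^+ 2 / r / 2.
  by apply: divr_ge0 => //; apply: divr_ge0; [exact: sqr_ge0|exact: ltW].
have -> : (x - r * y) ^+ 2 / r / 2 = (x ^+ 2 / r + r * y ^+ 2) / 2 - x * y.
  by field; rewrite gt_eqF.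
by rewrite subr_ge0.
Qed.

Lemma itv_dist (x y M : R) : 0 <= x <= M -> 0 <= y <= M -> `|x - y| <= M.
Proof. by move=> xM yM; rewrite ler_norml; lra. Qed.

Lemma sqrD_le (x y M : R) : 0 <= x -> x <= M -> (x + y) ^+ 2 <= 2 * (M * x + y ^+ 2).
Proof.
move=> x0 xM; have h1 : x * x <= M * x by rewrite ler_wpM2r.
have h2 : 0 <= (x - y) ^+ 2 by exact: sqr_ge0.
by move: h1 h2; rewrite !expr2; lra.
Qed.

Lemma add_estimates1 (L r p1 p2 p3 p4 x3 x4 x5 x8 x9 x10 x11 x12 : R) :
  L <= p1 + p2 + x5 -> r <= p3 + p4 + x8 -> p1 <= x3 + x4 -> p3 <= x9 -> p2 <= x10 ->
  p4 <= x11 -> 0 <= x12 -> L + r <= x4 + x9 + (x5 + x8) + x3 + x10 + x11 + x12.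
Proof. by lra. Qed.

Lemma add_estimates2 (s y1 y2 y3 y4 y5 x6 x7 x8 x9 x10 x11 x12 x13 x14 x15 : R) :
  y1 <= x11 -> y2 <= x12 -> y3 <= x9 -> y4 <= x7 -> y5 <= s -> x6 + x7 <= s -> x8 <= x10 ->
  y1 + x13 + (x14 + x6 + (x15 + (x8 + x10))) + y2 + y3 + y4 + y5 <=
  x11 + x13 + x14 + x15 + x10 + x10 + x12 + x9 + s + s.
Proof. by lra. Qed.

Lemma add_estimates3 (d x1 x2 x3 : R) : 0 <= d -> 0 <= x1 -> 0 <= x2 -> 0 <= x3 ->
  x1 / 2 + 16 * x2 <= x1 + 32 * x2 + 4 * x3 + d.
Proof. by lra. Qed.

Lemma add_estimates4 (d x1 x2 x3 : R) : 0 <= d -> 0 <= x1 -> 0 <= x2 ->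
  x3 <= x1 + 32 * x2 + x3 + d.
Proof. by lra. Qed.

Lemma IntDZ (c : R) (g h : X -> R) : L1 g -> L1 h ->
  L1 (fun z => g z + c * h z) /\ Int (fun z => g z + c * h z) = Int g + c * Int h.
Proof.
move=> ig ih; have ich := L1Z c ih; split; first exact: L1D.
by rewrite (IntD ig ich) IntZ.
Qed.

Lemma Ck_meas k (g : X -> R) : Ck k setT g -> measurable_fun setT g.
Proof. by move=> /Ck_cts; exact: cts_meas. Qed.

Lemma Ck_derive k (g : X -> R) v : Ck k.+1 setT g -> Ck k setT ('D_v g).
Proof. by case=> _ /(_ v)[]. Qed.

Lemma laplacian_meas (g : X -> R) : Ck 2 setT g -> measurable_fun setT (laplacian g).
Proof.
move=> Cg; rewrite /laplacian; apply: measurable_sum => i.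
by apply: (@Ck_meas 0); do 2 apply: Ck_derive.
Qed.

Lemma xlip_meas L (g : 'rV[R]_N -> R) : xlip L g -> measurable_fun setT (fun z : X => g z.1).
Proof.
move=> gL; apply: cts_meas; apply: (@xtlip_cts _ _ L) => z z' r h1 _.
exact: gL.
Qed.

Variables (w b cc : X -> R) (f : 'I_N -> 'rV[R]_N -> R).
Variables (Bw Bb K y0 T F Lf : R).
Hypothesis w_L1 : L1 w.
Hypothesis w_bd : forall z, `|w z| <= Bw.
Hypothesis w_out : forall z, w z != 0 -> 0 < z.2 < T.
Hypothesis b_meas : measurable_fun setT b.
Hypothesis b_bd : forall z, 0 <= b z <= Bb.
Hypothesis Bb_ge0 : 0 < Bb.
Hypothesis cc_meas : measurable_fun setT cc.
Hypothesis cc_bd : forall z, `|cc z| <= K.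
Hypothesis f_bd : forall i x, `|f i x| <= F.
Hypothesis f_lip : forall i, xlip Lf (f i).
Hypothesis Lf_ge0 : 0 <= Lf.
Hypothesis F_ge0 : 0 <= F.
Hypothesis T_gt0 : 0 < T.
Hypothesis y0_ge0 : 0 <= y0.

Definition adj_op (Phi : X -> R) (z : X) : R :=
  dt Phi z - \sum_i f i z.1 * dx i Phi z - cc z * Phi z + b z * laplacian Phi z.

(** [Phi1] and [Phi2] are kept because the entropy inequality only admits
    nonnegative test functions. *)
Definition test_fun (beta : R) (Phi Phi1 Phi2 : X -> R) : Prop :=
  [/\ forall z : X, Phi z = Phi1 z - Phi2 z,
      (Ck 2 setT Phi1 /\ Ck 2 setT Phi2) /\ Ck 2 setT Phi,
      forall z : X, 0 <= Phi1 z /\ 0 <= Phi2 z &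
      exists r, forall z : X, (Phi1 z != 0) || (Phi2 z != 0) || (Phi z != 0) ->
        (forall i, `|z.1 0 i| <= r) /\ - r <= z.2 <= beta].

Hypothesis weak_form : forall beta Phi Phi1 Phi2 P, beta < T -> test_fun beta Phi Phi1 Phi2 ->
  (forall z, `|Phi z| <= P) -> `|Int (fun z => w z * adj_op Phi z)| <= y0 * P.

Let absw (z : X) : R := `|w z|.
Let iabs : L1 absw. Proof. exact: L1_norm. Qed.
Let absw0 z : 0 <= absw z. Proof. exact: normr_ge0. Qed.
Let J1 := Int absw.

Definition past (beta : R) : set X := [set z : X | z.2 <= beta].

Lemma past_meas beta : measurable (past beta).
Proof.
rewrite (_ : past beta = setT `&` (fun z : X => z.2) @^-1` [set` `]-oo, beta]]).
  by apply: meas_time => //; exact: measurable_itv.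
by rewrite setTI; apply/seteqP; split => z; rewrite /past /= in_itv.
Qed.

Definition outer (L0 : R) : set X := [set z : X | exists i, L0 < `|z.1 0 i|].

Lemma outer_meas L0 : measurable (outer L0).
Proof.
rewrite (_ : outer L0 = \bigcup_(i in [set: 'I_N]) (setT `&`
   (fun z : X => `|z.1 0 i|) @^-1` [set` `]L0, +oo[])).
  apply: fin_bigcup_measurable => // i _.
  have m1 : measurable_fun setT (fun z : X => `|z.1 0 i|).
    by apply: measurableT_comp => //; exact: meas_coord.
  by apply: m1 => //; exact: measurable_itv.
apply/seteqP; split => z /=.
  by move=> [i Hi]; exists i => //; split => //=; rewrite in_itv/= Hi.
by move=> [i _ [_]] /=; rewrite in_itv/= andbT => Hi; exists i.
Qed.

Lemma L1_ind (g : X -> R) (S : set X) : L1 g -> measurable S -> L1 (fun z => g z * \1_S z).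
Proof.
move=> ig mS; apply: (L1M (M := 1) ig); first exact: measurable_indic.
by move=> z; rewrite indicE; case: (_ \in _); rewrite ?normr1 ?normr0.
Qed.

(** Outside a large box [Phi] obeys only the crude bounds, so the smallness there has to come from
    [|w|]. *)
Lemma tail_small (e : R) : 0 < e -> exists2 L0 : R, 0 <= L0 &
  Int (fun z => absw z * \1_(outer L0) z) <= e.
Proof.
move=> e0.
have m n : measurable_fun setT (fun z => absw z * \1_(outer n%:R) z : R).
  by apply: L1_meas; apply: L1_ind => //; exact: outer_meas.
have c z : absw z * \1_(outer n%:R) z @[n --> \oo] --> (0 : R).
  apply: cvg_near_cst; near=> n; rewrite indicE memNset ?mulr0// => -[i].
  apply/negP; rewrite -leNgt.
  apply: (@le_trans _ _ (\sum_j `|z.1 0 j|)).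
    by rewrite (bigD1 i)//= lerDl sumr_ge0.
  by near: n; exact: nbhs_infty_ger.
have d n z : `|absw z * \1_(outer n%:R) z| <= absw z.
  rewrite indicE; case: (_ \in _); rewrite ?mulr1 ?mulr0 ?normr0 ?absw0//.
  by rewrite ger0_norm.
have [_ cv] := Int_cvg m c iabs d.
rewrite Rintegral_cst// mul0r in cv.
move/cvgrPdist_le : cv => /(_ _ e0)[n _ /(_ n (leqnn n))] /= H.
exists n%:R => //; apply: le_trans H; rewrite sub0r normrN; exact: ler_norm.
Unshelve. all: by end_near. Qed.

Section fixed_source.
Variables (ze : X -> R) (Lz A alpha beta : R).
Hypothesis ze_lip : xtlip Lz ze.
Hypothesis ze_bd : forall z, `|ze z| <= 1.
Hypothesis ze_out : forall z, ze z != 0 ->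
  alpha <= z.2 <= beta /\ forall i, `|z.1 0 i| <= A.
Hypothesis A_ge0 : 0 <= A.
Hypothesis alpha_beta : alpha <= beta.
Hypothesis beta_T : beta < T.

Let Jb := Int (fun z => absw z * \1_(past beta) z).
Let en : R := @energy_bd R N F Lf Lz A T.
Let Cst : R := y0 + K * Jb + Bw * (J1 + Bb) + en / 2 + 1 + J1 * (Bb + 3) + 1.

Lemma energy_bd_ge0 : 0 <= en.
Proof.
rewrite /en /energy_bd; apply: mulr_ge0; first by rewrite exprn_ge0.
rewrite /Ke; apply: mulr_ge0; first exact: expR_ge0.
apply: mulr_ge0; first by have := T_gt0; lra.
rewrite /Kz; apply: mulr_ge0; first by rewrite exprn_ge0//; have := A_ge0; lra.
by apply: addr_ge0 => //; apply: mulr_ge0 => //; exact: sqr_ge0.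
Qed.

(** [w * ze] is written as [w] times the residual, minus [w * adj_op Phi], plus the errors from
    [b - be] and from [cc]. The weak form controls the second term, and each of the others is
    estimated pointwise by an integrable function whose integral is known. *)
Lemma source_est_s (s : R) : 0 < s -> s <= 1 ->
  Int (fun z => w z * ze z) <= (beta - alpha) * (y0 + K * Jb) + Cst * s.
Proof.
move=> s0 s1.
have en0 := energy_bd_ge0.
have K0 : 0 <= K := le_trans (normr_ge0 _) (cc_bd 0).
have Bw0 : 0 <= Bw := le_trans (normr_ge0 _) (w_bd 0).
have Lz0 : 0 <= Lz := xtlip_ge0 ze_lip.
have J10 : 0 <= J1 by exact: Int_ge0.
have Jb0 : 0 <= Jb.
  by apply: Int_ge0 => z; rewrite mulr_ge0// indicE; case: (_ \in _).
have s4 : 0 < s ^+ 4 by rewrite exprn_gt0.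
have [b' [[Lb b'L] b'_bd bb']] := lip_dense iabs absw0 Bb_ge0 s4 b_meas b_bd.
pose be z := b' z + s ^+ 2; pose M := Bb + 1.
have s2 : 0 < s ^+ 2 by rewrite exprn_gt0.
have s21 : s ^+ 2 <= 1 by rewrite expr_le1// ltW.
have be_lip : xtlip Lb be.
  by rewrite -[Lb]addr0; apply: xtlipD => //; exact: xtlip_cst.
have be_bd z : s ^+ 2 <= be z <= M.
  by have := b'_bd z; rewrite /be /M; move: (s ^+ 2) s21 => u ?; lra.
have M1 : 1 <= M by rewrite /M; have := Bb_ge0; lra.
pose C2 := Lb ^+ 2 / s ^+ 2 + N%:R * Lf ^+ 2 * (T + 7).
have C20 : 0 <= C2.
  apply: addr_ge0; first by apply: divr_ge0; [exact: sqr_ge0|exact: ltW].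
  apply: mulr_ge0; last by have := T_gt0; lra.
  by apply: mulr_ge0 => //; exact: sqr_ge0.
(* [delta * Dn = s], so every error proportional to [delta] becomes of order [s]. [C2] contains
   [Lb], which is why [b'] is chosen before [delta]. *)
pose Dn := Bw * J1 + 32 * C2 * en + 4 * Lz + 1.
have Dn1 : 1 <= Dn.
  rewrite /Dn lerDr addr_ge0//; last by rewrite mulr_ge0.
  by rewrite addr_ge0// mulr_ge0// mulr_ge0.
have Dn0 : 0 < Dn := lt_le_trans ltr01 Dn1.
pose delta := s / Dn.
have d0 : 0 < delta by rewrite divr_gt0.
have d1 : delta <= 1 by rewrite ler_pdivrMr// mul1r (le_trans s1).
have dD : delta * Dn = s by rewrite /delta divfK// gt_eqF.
pose cr := crude_bd alpha beta delta.
have cr0 : 0 <= cr.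
  rewrite /cr /crude_bd; apply: mulr_ge0; first by have := alpha_beta; lra.
  by apply: divr_ge0; [exact: ler0n|exact: sqr_ge0].
pose Cr := M * (N%:R * cr) + (1 + cr + M * (N%:R * cr) + N%:R * (F * cr)).
have M0 : 0 <= M := le_trans ler01 M1.
have Cr0 : 0 <= Cr.
  by rewrite /Cr; do ?[apply: addr_ge0 => //|apply: mulr_ge0 => //].
have [L0 L00 tL] : exists2 L0 : R, 0 <= L0 &
    Int (fun z => absw z * \1_(outer L0) z) <= s / (Cr + 1).
  by apply: tail_small; rewrite divr_gt0// ltr_wpDl.
have [Phi [Phi1 [Phi2 [lap1 [err1 [E1 [E2 [H1 [[P1 P2 P3 P4] [[lapE errE [iE1 IE1] [iE2 IE2]] inner]]]]]]]]]] :=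
  adjoint_exists f_bd f_lip Lf_ge0 F_ge0 ze_lip ze_bd ze_out be_lip be_bd alpha_beta A_ge0
   s2 M1 d0 d1 L00 s0 s1 T_gt0.
have [PE [_ CP] PP [r0 supp]] := H1.
have wf := weak_form beta_T H1 P1.
have lapb z : `|laplacian Phi z| <= N%:R * cr.
  apply: le_trans (ler_norm_sum _ _ _) _; rewrite -sumr_ord; apply: ler_sum => i _; exact: P4.
have sdx z : `|\sum_i f i z.1 * dx i Phi z| <= N%:R * (F * cr).
  apply: le_trans (ler_norm_sum _ _ _) _; rewrite -sumr_ord; apply: ler_sum => i _.
  by rewrite normrM; apply: ler_pM => //; exact: P3.
have resb z : `|residual f ze be Phi z| <= 1 + cr + M * (N%:R * cr) + N%:R * (F * cr).
  rewrite /residual; apply: le_trans (ler_normB _ _) _; apply: lerD (sdx z).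
  apply: le_trans (ler_normD _ _) _; apply: lerD.
    by apply: le_trans (ler_normD _ _) _; apply: lerD; [exact: ze_bd|exact: P2].
  rewrite normrM; apply: ler_pM => //; have /andP[u1 u2] := be_bd z.
  by rewrite ger0_norm// (le_trans (ltW s2)).
pose P := beta - alpha + s.
have P0 : 0 <= P by apply: addr_ge0; [rewrite subr_ge0; exact: alpha_beta|exact: ltW].
have iadj : L1 (fun z => w z * adj_op Phi z).
  apply: (L1M (M := cr + N%:R * (F * cr) + K * P + Bb * (N%:R * cr)) w_L1).
    apply: measurable_funD; [apply: measurable_funB; [apply: measurable_funB|]|].
    - by apply: (@Ck_meas 1); exact: Ck_derive.
    - apply: measurable_sum => i; apply: measurable_funM; first exact: xlip_meas (f_lip i).
      by apply: (@Ck_meas 1); exact: Ck_derive.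
    - by apply: measurable_funM => //; exact: Ck_meas CP.
    - by apply: measurable_funM => //; exact: laplacian_meas.
  move=> z; rewrite /adj_op; apply: le_trans (ler_normD _ _) _; apply: lerD.
    apply: le_trans (ler_normB _ _) _; apply: lerD.
      by apply: le_trans (ler_normB _ _) _; apply: lerD; [exact: P2|exact: sdx].
    by rewrite normrM; apply: ler_pM => //; exact: P1.
  by rewrite normrM; apply: ler_pM => //; have /andP[u1 u2] := b_bd z; rewrite ger0_norm.
have iw1 : L1 (fun z => absw z * \1_(past beta) z).
  by apply: L1_ind => //; exact: past_meas.
have iw2 : L1 (fun z => absw z * \1_(outer L0) z).
  by apply: L1_ind => //; exact: outer_meas.
have mb' : measurable_fun setT b' by apply: cts_meas; exact: xtlip_cts b'L.
have iwb : L1 (fun z => absw z * `|b z - b' z|).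
  apply: (L1M (M := Bb) iabs).
    by apply: measurableT_comp => //; exact: measurable_funB.
  by move=> z; rewrite normr_id; exact: itv_dist.
have iwz : L1 (fun z => w z * ze z).
  apply: (L1M (M := 1) w_L1) => //; apply: cts_meas; exact: xtlip_cts ze_lip.
pose c3 := Bw * s + delta * Bw / 2 + (M * s + (Lz * (4 * delta) + s)).
pose c4 := Bw * Bb / s ^+ 3.
have [i1 I1] := IntDZ (K * P) (L1Z (-1) iadj) iw1.
have [i2 I2] := IntDZ c3 i1 iabs.
have [i3 I3] := IntDZ c4 i2 iwb.
have [i4 I4] := IntDZ (s ^+ 3 / 2) i3 iE1.
have [i5 I5] := IntDZ (2 * delta)^-1 i4 iE2.
have [i6 I6] := IntDZ Cr i5 iw2.
apply: (@le_trans _ _ (Int (fun z => -1 * (w z * adj_op Phi z) + K * P * (absw z * \1_(past beta) z)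
   + c3 * absw z + c4 * (absw z * `|b z - b' z|) + s ^+ 3 / 2 * E1 z + (2 * delta)^-1 * E2 z
   + Cr * (absw z * \1_(outer L0) z)))).
  apply: Int_le => // z; set RHS := (X in _ <= X).
  have E10 : 0 <= s ^+ 3 / 2 * E1 z.
    apply: mulr_ge0; first by apply: divr_ge0 => //; apply: exprn_ge0; exact: ltW.
    by apply: le_trans (lapE z); exact: sqr_ge0.
  have E20 : 0 <= (2 * delta)^-1 * E2 z.
    apply: mulr_ge0; first by rewrite invr_ge0; apply: mulr_ge0 => //; exact: ltW.
    by apply: le_trans (errE z); exact: sqr_ge0.
  (* [E1] and [E2] are not multiplied by [w]; where [w] vanishes only their signs matter. *)
  have [w0|wn0] := eqVneq (w z) 0.
    rewrite /RHS /absw w0 normr0 !mul0r !mulr0 !addr0 !add0r.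
    by apply: addr_ge0; [exact: E10|exact: E20].
  have /andP[t0 tT] := w_out wn0.
  have key : w z * ze z = -1 * (w z * adj_op Phi z) + - (w z * (cc z * Phi z)) +
     w z * (b z - be z) * laplacian Phi z + w z * residual f ze be Phi z.
    by rewrite /adj_op /residual; set S := \sum_i _; set l := laplacian _ _; ring.
  have t1 : - (w z * (cc z * Phi z)) <= K * P * (absw z * \1_(past beta) z).
    (* [Phi] vanishes after [beta], so the zeroth-order term sees only the past; this makes
       Gronwall's argument possible. *)
    have [->|Pn0] := eqVneq (Phi z) 0.
      rewrite !mulr0 oppr0; apply: mulr_ge0; first exact: mulr_ge0.
      by apply: mulr_ge0 => //; rewrite indicE; case: (_ \in _).
    have [_ /andP[_ zb]] : (forall i, `|z.1 0 i| <= r0) /\ - r0 <= z.2 <= beta.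
      by apply: supp; rewrite Pn0 orbT.
    rewrite indicE mem_set// mulr1; apply: le_trans (ler_norm _) _.
    rewrite normrN !normrM mulrC; apply: ler_wpM2r => //.
    by apply: ler_pM => //.
  pose a := absw z; pose Db := `|b z - b' z|; pose Dd := `|b z - be z|.
  have a0 : 0 <= a by exact: absw0.
  have Db0 : 0 <= Db by exact: normr_ge0.
  have Dd0 : 0 <= Dd by exact: normr_ge0.
  have DbB : Db <= Bb by exact: itv_dist.
  have DdD : Dd <= Db + s ^+ 2.
    rewrite /Dd /be opprD addrA; apply: le_trans (ler_normB _ _) _.
    by rewrite (gtr0_norm s2).
  have DdM : Dd <= M by apply: le_trans DdD _; exact: lerD.
  have aB : a <= Bw by exact: w_bd.
  pose l := `|laplacian Phi z|; pose rho := `|residual f ze be Phi z|.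
  have t2 : w z * (b z - be z) * laplacian Phi z <= a * Dd * l.
    by apply: le_trans (ler_norm _) _; rewrite !normrM.
  have t3 : w z * residual f ze be Phi z <= a * rho.
    by apply: le_trans (ler_norm _) _; rewrite normrM.
  suff main : a * Dd * l + a * rho <= c3 * a + c4 * (a * Db) + s ^+ 3 / 2 * E1 z +
      (2 * delta)^-1 * E2 z + Cr * (a * \1_(outer L0) z).
    rewrite key /RHS.
    apply: le_trans (lerD (lerD (lerD (lexx _) t1) t2) t3) _.
    by rewrite -[leLHS]addrA -!(addrA (-1 * _ + _)) lerD2l.
  have aDd0 : 0 <= a * Dd by exact: mulr_ge0.
  have c30 : 0 <= c3.
    have [ds ss] : 0 <= delta /\ 0 <= s by split; exact: ltW.
    rewrite /c3; apply: addr_ge0; last first.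
      by apply: addr_ge0; [exact: mulr_ge0|apply: addr_ge0 => //; apply: mulr_ge0 => //; exact: mulr_ge0].
    by apply: addr_ge0; [exact: mulr_ge0|apply: divr_ge0 => //; exact: mulr_ge0].
  have c40 : 0 <= c4.
    by rewrite /c4; apply: divr_ge0; [apply: mulr_ge0 => //; exact: ltW|apply: exprn_ge0; exact: ltW].
  (* Outside the box [Cr] collects the crude bounds; [L0] was chosen in terms of [Cr]. *)
  have [in0|/existsNP[i /negP iL]] := pselect (forall i, `|z.1 0 i| <= L0); last first.
    rewrite indicE mem_set ?mulr1; last by exists i; rewrite ltNge.
    apply: (@le_trans _ _ (Cr * a)); last first.
      by rewrite lerDr; do ?[apply: addr_ge0 => //|apply: mulr_ge0 => //].
    rewrite /Cr mulrDl; apply: lerD.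
      rewrite [leRHS]mulrC -[leLHS]mulrA; apply: ler_wpM2l => //.
      by apply: ler_pM => //; [exact: normr_ge0|exact: lapb].
    by rewrite [leRHS]mulrC; apply: ler_wpM2l => //; exact: resb.
  have [h1 h2] := inner z in0 ltac:(by rewrite !ltW).
  (* The weight [s ^+ 3] balances the two sides: [E1] has integral at most [en / s ^+ 2], and the
     integral of [(a * Dd) ^+ 2] is of order [s ^+ 4]. *)
  have m1 : a * Dd * l <= ((a * Dd) ^+ 2 / s ^+ 3 + s ^+ 3 * lap1 z ^+ 2) / 2 + a * M * s.
    apply: (@le_trans _ _ (a * Dd * (lap1 z + s))); first exact: ler_wpM2l.
    rewrite mulrDr; apply: lerD; first by apply: amgm; exact: exprn_gt0.
    by apply: ler_wpM2r; [exact: ltW|exact: ler_wpM2l].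
  (* Here the weight is [delta^-1], matched to the factor [delta ^+ 2] in the bound for [E2]. *)
  have m2 : a * rho <= (a ^+ 2 / delta^-1 + delta^-1 * err1 z ^+ 2) / 2 + a * (Lz * (4 * delta) + s).
    apply: (@le_trans _ _ (a * (err1 z + (Lz * (4 * delta) + s)))); first exact: ler_wpM2l.
    by rewrite mulrDr; apply: lerD => //; apply: amgm; rewrite invr_gt0.
  (* One factor [|w|] and one factor [|b - b'|] are replaced by their bounds, so that closeness in
     weighted L1 suffices. *)
  have m3 : (a * Dd) ^+ 2 <= 2 * Bw * a * (Bb * Db + s ^+ 4).
    rewrite exprMn; have aa : a ^+ 2 <= Bw * a by rewrite expr2 ler_wpM2r.
    have dd : Dd ^+ 2 <= 2 * (Bb * Db + s ^+ 4).
      apply: (@le_trans _ _ ((Db + s ^+ 2) ^+ 2)); first by rewrite lerXn2r ?nnegrE// addr_ge0// ltW.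
      have -> : s ^+ 4 = (s ^+ 2) ^+ 2 by rewrite -exprM.
      exact: sqrD_le.
    apply: le_trans (ler_pM (sqr_ge0 _) (sqr_ge0 _) aa dd) _.
    by rewrite le_eqVlt; apply/orP; left; apply/eqP; ring.
  have m4 : (a * Dd) ^+ 2 / s ^+ 3 / 2 <= c4 * (a * Db) + Bw * s * a.
    have -> : c4 * (a * Db) + Bw * s * a = 2 * Bw * a * (Bb * Db + s ^+ 4) / s ^+ 3 / 2.
      by rewrite /c4; field; rewrite gt_eqF.
    by rewrite ler_pM2r// ler_pM2r// invr_gt0 exprn_gt0.
  have m5 : a ^+ 2 / delta^-1 / 2 <= delta * Bw / 2 * a.
    have -> : a ^+ 2 / delta^-1 / 2 = delta / 2 * (a * a) by rewrite invrK; ring.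
    have -> : delta * Bw / 2 * a = delta / 2 * (Bw * a) by ring.
    by apply: ler_wpM2l; [apply: divr_ge0 => //; exact: ltW|exact: ler_wpM2r].
  have m6 : s ^+ 3 * lap1 z ^+ 2 / 2 <= s ^+ 3 / 2 * E1 z.
    rewrite mulrAC; apply: ler_wpM2l; last exact: lapE.
    by apply: divr_ge0 => //; apply: exprn_ge0; exact: ltW.
  have m7 : delta^-1 * err1 z ^+ 2 / 2 <= (2 * delta)^-1 * E2 z.
    have -> : (2 * delta)^-1 = delta^-1 / 2 by field; rewrite gt_eqF.
    rewrite mulrAC; apply: ler_wpM2l; last exact: errE.
    by apply: divr_ge0 => //; rewrite invr_ge0 ltW.
  have m8 : 0 <= Cr * (a * \1_(outer L0) z).
    by apply: mulr_ge0 => //; apply: mulr_ge0 => //; rewrite indicE; case: (_ \in _).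
  rewrite mulrDl in m1; rewrite mulrDl in m2.
  have c3a : c3 * a = Bw * s * a + delta * Bw / 2 * a + (a * M * s + a * (Lz * (4 * delta) + s)).
    by rewrite /c3; ring.
  rewrite c3a; exact: add_estimates1 m1 m2 m4 m5 m6 m7 m8.
rewrite I6 I5 I4 I3 I2 I1 IntZ//.
have q1 : -1 * Int (fun z => w z * adj_op Phi z) <= y0 * P.
  by rewrite mulN1r; apply: le_trans wf; rewrite -normrN; exact: ler_norm.
have q2 : c4 * Int (fun z => absw z * `|b z - b' z|) <= Bw * Bb * s.
  apply: le_trans (ler_wpM2l _ bb') _.
    by rewrite /c4; apply: divr_ge0; [apply: mulr_ge0 => //; exact: ltW|apply: exprn_ge0; exact: ltW].
  by rewrite /c4 le_eqVlt; apply/orP; left; apply/eqP; field; rewrite gt_eqF.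
have q3 : s ^+ 3 / 2 * Int E1 <= s * en / 2.
  apply: le_trans (ler_wpM2l _ IE1) _.
    by apply: divr_ge0 => //; apply: exprn_ge0; exact: ltW.
  by rewrite -/en le_eqVlt; apply/orP; left; apply/eqP; field; rewrite gt_eqF.
have q4 : (2 * delta)^-1 * Int E2 <= 16 * (delta * (C2 * en)).
  apply: le_trans (ler_wpM2l _ IE2) _.
    by rewrite invr_ge0; apply: mulr_ge0 => //; exact: ltW.
  by rewrite -/en -/C2 le_eqVlt; apply/orP; left; apply/eqP; field; rewrite gt_eqF.
have q5 : Cr * Int (fun z => absw z * \1_(outer L0) z) <= s.
  apply: le_trans (ler_wpM2l Cr0 tL) _; rewrite mulrCA -[leRHS]mulr1.
  apply: ler_wpM2l; first exact: ltW.
  by rewrite ler_pdivrMr ?ltr_wpDl// mul1r lerDl.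
have ld0 := ltW d0.
have g1 : 0 <= delta * (Bw * J1) by apply: mulr_ge0 => //; exact: mulr_ge0.
have g2 : 0 <= delta * (C2 * en) by apply: mulr_ge0 => //; exact: mulr_ge0.
have g3 : 0 <= delta * Lz by exact: mulr_ge0.
have q6 : delta * (Bw * J1) / 2 + 16 * (delta * (C2 * en)) <= s.
  rewrite -dD /Dn.
  have -> : delta * (Bw * J1 + 32 * C2 * en + 4 * Lz + 1) =
     delta * (Bw * J1) + 32 * (delta * (C2 * en)) + 4 * (delta * Lz) + delta by ring.
  exact: add_estimates3.
have q7 : Lz * (4 * delta) * J1 <= s * J1.
  apply: ler_wpM2r => //; rewrite -dD /Dn.
  have -> : delta * (Bw * J1 + 32 * C2 * en + 4 * Lz + 1) =
     delta * (Bw * J1) + 32 * (delta * (C2 * en)) + Lz * (4 * delta) + delta by ring.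
  exact: add_estimates4.
rewrite -/J1 -/Jb.
have -> : c3 * J1 = Bw * s * J1 + delta * (Bw * J1) / 2 + (M * s * J1 + (Lz * (4 * delta) * J1 + s * J1)).
  by rewrite /c3; ring.
have -> : (beta - alpha) * (y0 + K * Jb) + Cst * s = y0 * P + K * P * Jb + Bw * s * J1 + M * s * J1 +
    s * J1 + s * J1 + Bw * Bb * s + s * en / 2 + s + s.
  by rewrite /Cst /P /M; field.
exact: add_estimates2 q1 q2 q3 q4 q5 q6 q7.
Qed.

Lemma source_est : Int (fun z => w z * ze z) <= (beta - alpha) * (y0 + K * Jb).
Proof.
apply/ler_addgt0Pr => e e0.
pose s := Num.min 1 (e / (`|Cst| + 1)).
have C0 : 0 < `|Cst| + 1 by rewrite ltr_wpDl.
have s0 : 0 < s by rewrite lt_min ltr01 divr_gt0.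
apply: le_trans (source_est_s s0 _) _; first by rewrite ge_min lexx.
rewrite lerD2l; apply: (@le_trans _ _ ((`|Cst| + 1) * (e / (`|Cst| + 1)))).
  apply: (@le_trans _ _ ((`|Cst| + 1) * s)).
    by apply: ler_wpM2r; [exact: ltW|apply: le_trans (ler_norm _) _; rewrite lerDl].
  by apply: ler_wpM2l; [exact: ltW|rewrite ge_min lexx orbT].
by rewrite mulrC divfK// gt_eqF.
Qed.

End fixed_source.

Lemma sg_le1 (y : R) : `|Num.sg y| <= 1.
Proof. by rewrite normr_sg; case: (_ == _). Qed.

(** The ideal source is the sign of [w] on the slab. A Lipschitz approximation in the weighted L1
    norm replaces it, and the cutoffs [chi] bring the support back into the slab and into a box, as
    [source_est] asks. *)
Theorem duality_estimate alpha beta : alpha < beta -> beta < T ->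
  Int (fun z => absw z * \1_[set z : X | alpha < z.2 < beta] z) <=
    (beta - alpha) * (y0 + K * Int (fun z => absw z * \1_(past beta) z)).
Proof.
move=> ab bT; pose S := [set z : X | alpha < z.2 < beta].
have mS : measurable S.
  rewrite (_ : S = setT `&` (fun z : X => z.2) @^-1` [set` `]alpha, beta[]).
    by apply: meas_time => //; exact: measurable_itv.
  by rewrite setTI; apply/seteqP; split => z; rewrite /S /= in_itv.
pose sg z : R := Num.sg (w z) * \1_S z.
have mw := L1_meas w_L1.
have msgn : measurable_fun setT (fun z => Num.sg (w z)).
  rewrite (_ : (fun z => _) = fun z => \1_(setT `&` w @^-1` [set` `]0, +oo[]) z -
      \1_(setT `&` w @^-1` [set` `]-oo, 0[]) z).
    by apply: measurable_funB; apply: measurable_indic; apply: mw => //; exact: measurable_itv.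
  apply/funext => z; rewrite !indicE.
  have -> : (z \in setT `&` w @^-1` [set` `]0, +oo[]) = (0 < w z).
    apply/idP/idP => [|h]; first by rewrite inE => -[_] /=; rewrite in_itv/= andbT.
    by rewrite inE; split => //=; rewrite in_itv/= h.
  have -> : (z \in setT `&` w @^-1` [set` `]-oo, 0[]) = (w z < 0).
    apply/idP/idP => [|h]; first by rewrite inE => -[_] /=; rewrite in_itv.
    by rewrite inE; split => //=; rewrite in_itv/= h.
  by case: sgrP => wz; rewrite ?wz ?ltxx ?subrr ?subr0 ?sub0r// ltNge (ltW wz) ?subr0 ?sub0r.
have msg : measurable_fun setT sg by apply: measurable_funM => //; exact: measurable_indic.
have sg1 z : -1 <= sg z <= 1.
  rewrite -ler_norml /sg normrM -[leRHS]mulr1; apply: ler_pM => //; first exact: sg_le1.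
  by rewrite indicE; case: (_ \in _); rewrite ?normr1 ?normr0.
have wsg z : w z * sg z = absw z * \1_S z.
  by rewrite /sg mulrA /absw normrEsg [w z * _]mulrC.
apply/ler_addgt0Pr => e e0.
have e2 : 0 < e / 2 by rewrite divr_gt0.
(* [lip_dense] concerns nonnegative functions, hence the shift of the sign by 1. *)
have m1s : measurable_fun setT (fun z => 1 + sg z) by apply: measurable_funD.
have s2 z : 0 <= 1 + sg z <= 2 by have := sg1 z; lra.
have [b' [[L b'L] b'_bd bb']] := lip_dense iabs absw0 (ltr0Sn _ 1) e2 m1s s2.
pose z0 z := b' z - 1.
have z0L : xtlip (L + 0) z0 by apply: xtlipD => //; exact: xtlip_cst.
have z0b z : `|z0 z| <= 1 by rewrite /z0 ler_norml; have := b'_bd z; lra.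
pose k1 n (z : X) : R := clamp (n%:R * (z.2 - alpha)).
pose k2 n (z : X) : R := clamp (n%:R * (beta - z.2)).
pose k3 n (z : X) : R := clamp (n.+1%:R - \sum_i `|z.1 0 i|).
pose chi n z := k1 n z * k2 n z * k3 n z.
have cl01 (y : R) : `|clamp y| <= 1.
  by have /andP[h1 h2] := clamp_bd y; rewrite ger0_norm.
have chib n z : 0 <= chi n z <= 1.
  have /andP[p1 p2] := clamp_bd (n%:R * (z.2 - alpha)).
  have /andP[p3 p4] := clamp_bd (n%:R * (beta - z.2)).
  have /andP[p5 p6] := clamp_bd (n.+1%:R - \sum_i `|z.1 0 i|).
  by rewrite /chi !mulr_ge0//= mulr_ile1// ?mulr_ge0// mulr_ile1.
have chiL n : exists L', xtlip L' (chi n).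
  have x1 : xtlip (`|n%:R| * (1 + 0)) (k1 n).
    by apply: xtlip_clamp; apply: xtlipZ; apply: xtlipD; [exact: xtlip_time|exact: xtlip_cst].
  have x2 : xtlip (`|n%:R| * (0 + `|-1| * 1)) (k2 n).
    apply: xtlip_clamp; apply: xtlipZ; apply: xtlipD; first exact: xtlip_cst.
    rewrite (_ : (fun z : X => - z.2) = fun z => -1 * z.2); last by apply/funext => z; rewrite mulN1r.
    by apply: xtlipZ; exact: xtlip_time.
  have x3 : xtlip (0 + `|-1| * \sum_(i < N) 1) (k3 n).
    apply: xtlip_clamp; apply: xtlipD; first exact: xtlip_cst.
    rewrite (_ : (fun z : X => - _) = fun z => -1 * \sum_i `|z.1 0 i|); last by apply/funext => z; rewrite mulN1r.
    apply: xtlipZ; apply: xtlip_sum => i z z' r h1 _; rewrite mul1r.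
    by apply: le_trans (h1 i); exact: ler_dist_dist.
  have x12 := xtlipM x1 x2 (fun z => cl01 _) (fun z => cl01 _).
  have b12 z : `|k1 n z * k2 n z| <= 1.
    by rewrite normrM -[leRHS]mulr1; apply: ler_pM => //; exact: cl01.
  have x := xtlipM x12 x3 b12 (fun z => cl01 _).
  by eexists; exact: x.
have chi1 z : S z -> chi n z @[n --> \oo] --> (1 : R).
  move=> /andP[Sz1 Sz2]; apply: cvg_near_cst; near=> n.
  have pa : 0 < z.2 - alpha by rewrite subr_gt0.
  have pb : 0 < beta - z.2 by rewrite subr_gt0.
  rewrite /chi /k1 /k2 /k3 !clamp1 ?mulr1//.
  - rewrite -addn1 natrD addrAC lerDr subr_ge0; near: n; exact: nbhs_infty_ger.
  - by rewrite -ler_pdivrMr//; near: n; exact: nbhs_infty_ger.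
  - by rewrite -ler_pdivrMr//; near: n; exact: nbhs_infty_ger.
have mchi n : measurable_fun setT (chi n).
  by apply: cts_meas; have [L' /xtlip_cts] := chiL n.
have iS : L1 (fun z => absw z * \1_S z) by exact: L1_ind.
have [_ cv] : L1 (fun z : X => 0 : R) /\
    Int (fun z => absw z * \1_S z * (1 - chi n z)) @[n --> \oo] --> Int (fun z : X => 0 : R).
  apply: (Int_cvg (g := fun z => absw z * \1_S z)) => //.
  - move=> n; apply: measurable_funM; first exact: L1_meas iS.
    by apply: measurable_funB.
  - move=> z; have [Sz|nSz] := pselect (S z).
      have -> : (0 : R) = absw z * \1_S z * (1 - 1) by rewrite subrr mulr0.
      by apply: cvgMr; apply: cvgB; [exact: cvg_cst|exact: chi1].
    rewrite indicE memNset// mulr0; under eq_fun do rewrite mul0r; exact: cvg_cst.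
  - move=> n z; have aS : 0 <= absw z * \1_S z.
      by apply: mulr_ge0 => //; rewrite indicE; case: (_ \in _).
    rewrite normrM (ger0_norm aS) ler_piMr// ger0_norm; have := chib n z; lra.
rewrite Rintegral_cst// mul0r in cv.
move/cvgrPdist_le : cv => /(_ _ e2)[n _ /(_ n (leqnn n))] /=.
rewrite sub0r normrN => /(le_trans (ler_norm _)) Hn.
pose ze z := z0 z * chi n z.
have [L' chL] := chiL n.
have zeL : xtlip ((L + 0) * 1 + 1 * L') ze.
  by apply: xtlipM => // z; have /andP[p1 p2] := chib n z; rewrite ger0_norm.
have zeb z : `|ze z| <= 1.
  have /andP[p1 p2] := chib n z.
  by rewrite normrM -[leRHS]mulr1; apply: ler_pM => //; rewrite ger0_norm.
have zeo z : ze z != 0 -> alpha <= z.2 <= beta /\ forall i, `|z.1 0 i| <= n.+1%:R.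
  rewrite /ze /chi !mulf_eq0 !negb_or => /andP[_ /andP[/andP[c1 c2] c3]].
  have pos (y : R) : clamp y != 0 -> 0 < y.
    by apply: contraR; rewrite -leNgt => /clamp0 ->.
  have n0 : 0 <= n%:R :> R by [].
  split=> [|i].
    apply/andP; split; rewrite leNgt; apply/negP => lt.
      by have := pos _ c1; rewrite ltNge mulr_ge0_le0// subr_le0 ltW.
    by have := pos _ c2; rewrite ltNge mulr_ge0_le0// subr_le0 ltW.
  have := pos _ c3; rewrite subr_gt0 => /ltW; apply: le_trans.
  by rewrite (bigD1 i)//= lerDl sumr_ge0.
have mze : measurable_fun setT ze by apply: cts_meas; exact: xtlip_cts zeL.
have iwze : L1 (fun z => w z * ze z) by exact: (L1M (M := 1) w_L1).
have iwb : L1 (fun z => absw z * `|1 + sg z - b' z|).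
  apply: (L1M (M := 2) iabs).
    apply: measurableT_comp => //; apply: measurable_funB => //.
    by apply: cts_meas; exact: xtlip_cts b'L.
  by move=> z; rewrite normr_id ler_norml; have := s2 z; have := b'_bd z; lra.
have iwS : L1 (fun z => absw z * \1_S z * (1 - chi n z)).
  apply: (L1M (M := 1) iS); first exact: measurable_funB.
  by move=> z; rewrite ler_norml; have := chib n z; lra.
have est := source_est zeL zeb zeo (ler0n _ _) (ltW ab) bT.
apply: (@le_trans _ _ (Int (fun z => w z * ze z + (absw z * `|1 + sg z - b' z| +
   absw z * \1_S z * (1 - chi n z))))).
  apply: Int_le => //; first by apply: L1D => //; exact: L1D.
  move=> z; have /andP[p1 p2] := chib n z; rewrite -wsg.
  have : w z * (sg z - z0 z) * chi n z <= absw z * `|1 + sg z - b' z|.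
    apply: le_trans (ler_norm _) _; rewrite normrM (ger0_norm p1) normrM.
    rewrite (_ : sg z - z0 z = 1 + sg z - b' z); last by rewrite /z0; ring.
    by rewrite ler_piMr// mulr_ge0.
  have -> : w z * (sg z - z0 z) * chi n z = w z * sg z * chi n z - w z * ze z.
    by rewrite /ze; ring.
  by move: (w z * ze z) (w z * sg z) (absw z * _) => x1 x2 x3; lra.
rewrite IntD//; last exact: L1D.
rewrite (IntD iwb iwS).
by move: est bb' Hn; lra.
Unshelve. all: by end_near. Qed.

End duality.

(** * Geometry of the domain *)

Section geometry.
Context {R : realType} {N : nat}.
Local Notation V := 'rV[R]_N.
Local Notation X := ('rV[R]_N * R)%type.
Implicit Types (x y v : V).

Lemma nbhs_rV x (A : set V) : nbhs x A <->
  exists2 r : R, 0 < r & forall y, (forall i, `|x 0 i - y 0 i| < r) -> A y.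
Proof.
split=> [/nbhs_ballP[r /= r0 rA]|[r r0 rA]].
  exists r => // y h1; apply: rA.
  by split=> // i j; rewrite (ord1 i); exact: h1.
apply/nbhs_ballP; exists r => //= y [_ h1]; apply: rA => i.
exact: h1.
Qed.

Lemma enormZ (c : R) v : enorm (c *: v) = `|c| * enorm v.
Proof.
rewrite /enorm -sqrtr_sqr -sqrtrM ?sqr_ge0// mulr_sumr; congr Num.sqrt.
by apply: eq_bigr => i _; rewrite mxE exprMn.
Qed.

(** Subdividing into [n] pieces gives [n] increments of order [n ^ -2], so their sum tends to 0. On
    short pieces the exponent [2 + p] may be lowered to 2. *)
Lemma segment_const (D : set V) (g : V -> R) (C p : R) x v : 0 < p ->
  (forall y z, D y -> D z -> `|g y - g z| <= C * enorm (y - z) `^ (2 + p)) ->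
  (forall s : R, 0 <= s <= 1 -> D (x + s *: v)) -> g (x + v) = g x.
Proof.
move=> p0 gC seg; pose E := enorm v.
have E0 : 0 <= E by exact: sqrtr_ge0.
have step n : E <= n.+1%:R -> `|g (x + v) - g x| <= `|C| * E ^+ 2 / n.+1%:R.
  move=> En; have n0 : 0 < n.+1%:R :> R by [].
  pose pt j := x + (j%:R / n.+1%:R) *: v.
  have -> : g (x + v) - g x = \sum_(0 <= j < n.+1) (g (pt j.+1) - g (pt j)).
    by rewrite telescope_sumr// /pt divff ?gt_eqF// scale1r mul0r scale0r addr0.
  apply: le_trans (ler_norm_sum _ _ _) _.
  rewrite big_mkord; apply: (@le_trans _ _ (\sum_(j < n.+1) `|C| * (E / n.+1%:R) ^+ 2)); last first.
    rewrite sumr_ord le_eqVlt; apply/orP; left; apply/eqP.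
    by field; rewrite gt_eqF.
  apply: ler_sum => j _.
  have inD k : (k <= n.+1)%N -> D (pt k).
    move=> kn; apply: seg; rewrite divr_ge0//= ler_pdivrMr// mul1r ler_nat//.
  apply: le_trans (gC _ _ (inD _ (ltn_ord j)) (inD _ (ltnW (ltn_ord j)))) _.
  have -> : pt j.+1 - pt j = n.+1%:R^-1 *: v.
    rewrite /pt opprD addrACA subrr add0r -scalerBl -mulrBl -natr1 addrAC subrr add0r.
    by rewrite mul1r.
  rewrite enormZ ger0_norm ?invr_ge0// -/E [_^-1 * E]mulrC.
  have q0 : 0 <= E / n.+1%:R by rewrite divr_ge0.
  have q1 : E / n.+1%:R <= 1 by rewrite ler_pdivrMr// mul1r.
  have pw : (E / n.+1%:R) `^ (2 + p) <= (E / n.+1%:R) ^+ 2.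
    have [->|q0'] := eqVneq (E / n.+1%:R) 0.
      by rewrite powR0 ?expr0n// gt_eqF// addr_gt0.
    have q2 : 0 < E / n.+1%:R <= 1 by rewrite lt_neqAle eq_sym q0' q0.
    by rewrite -(powR_mulrn 2 q0); apply: (ger_powR q2); rewrite lerDl ltW.
  apply: (@le_trans _ _ (`|C| * (E / n.+1%:R) `^ (2 + p))).
    by apply: ler_wpM2r; [exact: powR_ge0|exact: ler_norm].
  exact: ler_wpM2l.
apply/eqP; rewrite -subr_eq0 -normr_le0; apply/ler_addgt0Pr => e e0; rewrite add0r.
have [n _ nE] := nat_above (E + `|C| * E ^+ 2 / e).
have K0 : 0 <= `|C| * E ^+ 2 by rewrite mulr_ge0// sqr_ge0.
have Ke0 : 0 <= `|C| * E ^+ 2 / e by rewrite divr_ge0// ltW.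
have n1 : n%:R <= n.+1%:R :> R by rewrite ler_nat.
apply: le_trans (step n _) _; first by apply: le_trans n1; apply: le_trans nE; rewrite lerDl.
rewrite ler_pdivrMr// [leRHS]mulrC -ler_pdivrMr//; apply: le_trans n1; apply: le_trans nE.
by rewrite lerDr.
Qed.

Variable Omega : set V.
Hypothesis Omega_open : open Omega.

Lemma open_box x : Omega x -> exists2 r : R, 0 < r &
  forall y, (forall i, `|x 0 i - y 0 i| < r) -> Omega y.
Proof. by move=> Ox; apply/nbhs_rV; exact: open_nbhs_nbhs. Qed.

(** The level set of [g] through [x] and its complement in [Omega] are both open. *)
Lemma locally_const (T : Type) (g : V -> T) : connected Omega ->
  (forall x, Omega x -> \forall y \near x, g y = g x) ->
  forall x y, Omega x -> Omega y -> g x = g y.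
Proof.
move=> cO lc x y Ox Oy.
have oS (P : set T) : open [set z | Omega z /\ P (g z)].
  rewrite openE => z [Oz Pz]; have := lc _ Oz; have : nbhs z Omega by exact: open_nbhs_nbhs.
  move=> n1 n2; near=> t; split; first by near: t.
  by have -> : g t = g z by near: t.
suff : [set z | Omega z /\ g z = g x] = Omega by move=> /seteqP[_ /(_ _ Oy)[_ ->]].
apply: cO; first by exists x.
  exists [set z | Omega z /\ g z = g x]; first exact: (oS [set c | c = g x]).
  by apply/seteqP; split => [z [? ?]|z [? []]].
exists (~` [set z | Omega z /\ g z <> g x]).
  by apply: open_closedC; exact: (oS [set c | c <> g x]).
apply/seteqP; split => [z [? ?]|z [? h]]; split => //=; first by move=> [].
by apply: contrapT => gz; apply: h.
Unshelve. all: by end_near. Qed.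

Lemma holder_const (g : V -> R) (C p : R) : connected Omega -> 0 < p ->
  (forall y z, Omega y -> Omega z -> `|g y - g z| <= C * enorm (y - z) `^ (2 + p)) ->
  forall x y, Omega x -> Omega y -> g x = g y.
Proof.
move=> cO p0 gC; apply: locally_const => // x Ox.
have [r r0 rO] := open_box Ox; apply/nbhs_rV; exists r => // y xy.
rewrite -(subrK x y) addrC; apply: (segment_const p0 gC) => s /andP[s0 s1].
apply: rO => i; rewrite !mxE opprD addrA subrr add0r normrN normrM (ger0_norm s0).
by rewrite distrC; apply: le_lt_trans (xy i); rewrite ler_piMl.
Qed.

Lemma line_near x v (s e : R) : 0 < e -> exists2 d : R, 0 < d &
  forall s', `|s' - s| < d -> forall i, `|(x + s *: v) 0 i - (x + s' *: v) 0 i| < e.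
Proof.
move=> e0; have V0 : 0 < 1 + \sum_i `|v 0 i| by rewrite ltr_pwDl// sumr_ge0.
exists (e / (1 + \sum_i `|v 0 i|)); first by rewrite divr_gt0.
move=> s' ss i; rewrite !mxE opprD addrACA subrr add0r -mulrBl normrM distrC.
move: ss; rewrite ltr_pdivlMr//; apply: le_lt_trans; rewrite ler_wpM2l//.
by rewrite (bigD1 i)//= addrCA lerDl addr_ge0// sumr_ge0.
Qed.

(** The supremum of the parameters up to which the segment stays in [Omega]; as [Omega] is open, it
    is positive and its point lies outside [Omega]. *)
Lemma exit_point x v : Omega x -> ~ Omega (x + v) -> exists s : R,
  [/\ 0 < s, s <= 1, boundary Omega (x + s *: v) & forall s', 0 <= s' < s -> Omega (x + s' *: v)].
Proof.
move=> Ox Ov.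
pose S := [set s : R | 0 <= s /\ forall s', 0 <= s' <= s -> Omega (x + s' *: v)].
have S0 : S 0.
  by split=> // s' s0; rewrite (@le_anti _ _ s' 0) ?scale0r ?addr0// andbC.
have S1 s : S s -> s < 1.
  move=> [s0 Ss]; rewrite ltNge; apply/negP => s1; apply: Ov.
  by rewrite -[v]scale1r; apply: Ss; rewrite ler01.
have hS : has_sup S by split; [exists 0|exists 1 => s /S1/ltW].
have Sle s : S s -> s <= sup S := fun h => sup_upper_bound hS h.
have below s' : 0 <= s' < sup S -> Omega (x + s' *: v).
  move=> /andP[s0 sS]; have e0 : 0 < sup S - s' by rewrite subr_gt0.
  have [s [_ Ss]] := sup_adherent e0 hS.
  rewrite opprB addrC subrK => /ltW s's; apply: Ss; rewrite s0 //.
have ext s : 0 <= s -> Omega (x + s *: v) -> (forall s', 0 <= s' < s -> Omega (x + s' *: v)) ->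
    exists2 e, 0 < e & S (s + e).
  move=> s0 Os bel; have [r r0 rO] := open_box Os; have [d d0 dx] := line_near x v s r0.
  exists (d / 2); first by rewrite divr_gt0.
  split; first by rewrite addr_ge0// divr_ge0// ltW.
  move=> s' /andP[s'0 s'e]; have [lt|ge] := ltP s' s; first by apply: bel; rewrite s'0.
  apply: rO => i; apply: dx; rewrite ger0_norm ?subr_ge0// ltrBlDl.
  by apply: le_lt_trans s'e _; rewrite ltrD2l; lra.
have s0 : 0 < sup S.
  have [||| e e0 Se] := ext 0; rewrite ?scale0r ?addr0//.
    by move=> s' /andP[h1 h2]; have := le_lt_trans h1 h2; rewrite ltxx.
  by apply: lt_le_trans e0 _; rewrite add0r in Se; exact: Sle.
have nO : ~ Omega (x + sup S *: v).
  move=> Os; have [|e e0 Se] := ext _ (ltW s0) Os; first by [].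
  by have := Sle _ Se; rewrite gerDl leNgt e0.
exists (sup S); split=> //.
  by rewrite leNgt; apply/negP => s1; apply: Ov; rewrite -[v]scale1r; apply: below; rewrite ler01.
split; last by move/interior_subset.
move=> B /nbhs_rV[r r0 rB]; have [d d0 dx] := line_near x v (sup S) r0.
pose s' := Num.max 0 (sup S - d / 2).
have s'0 : 0 <= s' by rewrite le_max lexx.
have s'S : s' < sup S by rewrite gt_max s0 /= gtrBl divr_gt0.
exists (x + s' *: v); split; first by apply: below; rewrite s'0.
apply: rB => i; apply: dx; rewrite distrC ger0_norm ?subr_ge0 ?(ltW s'S)//.
have : sup S - d / 2 <= s' by rewrite le_max lexx orbT.
by move: d0 => ? ?; lra.
Qed.

Lemma no_boundary : Omega !=set0 -> ~ (boundary Omega !=set0) -> Omega = setT.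
Proof.
move=> [x Ox] nb; apply/seteqP; split => // y _; apply: contrapT => nOy.
have [|s [_ _ bs _]] := @exit_point x (y - x) Ox; first by rewrite addrC subrK.
by apply: nb; exists (x + s *: (y - x)).
Qed.

Lemma is_derive_seg (f : V -> R) x v (s d : R) :
  is_derive (x + s *: v) v f d <-> is_derive s (1 : R) (fun t : R => f (x + t *: v)) d.
Proof.
rewrite -is_derive_line -(is_derive_line (fun t : R => f (x + t *: v)) s (1 : R)).
rewrite (_ : (fun t => f (t *: v + (x + s *: v))) = (fun t => f (x + (t *: (1 : R) + s) *: v))) //.
apply/funext => t; congr f.
by rewrite (_ : t *: (1 : R) = t) ?scalerDl 1?addrCA// [LHS]mulr1.
Qed.

Section zero_extension.
Variables (f : V -> R) (M : R) (v : V).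
Hypothesis f_C1 : Ck 1 Omega f.
Hypothesis f_cts : {within closure Omega, continuous f}.
Hypothesis f_bdry : forall x, boundary Omega x -> f x = 0.
Hypothesis f_M : forall x, Omega x -> `|'D_v f x| <= M.
Hypothesis f_MN : forall x, Omega x -> `|'D_(- v) f x| <= M.

Lemma seg_in (w : V) x (s : R) : (forall y, Omega y -> `|'D_w f y| <= M) -> 0 <= s ->
  (forall s', 0 <= s' <= s -> Omega (x + s' *: w)) -> `|f (x + s *: w) - f x| <= M * s.
Proof.
move=> fM s0 seg; pose F (t : R) := f (x + t *: w).
have dF t : 0 <= t <= s -> is_derive t (1 : R) F ('D_w f (x + t *: w)).
  move=> ts; apply/is_derive_seg; have [_ /(_ w)[h _]] := f_C1.
  by apply: DeriveDef => //; apply: h; exact: seg.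
have [||c cs E] := @MVT_segment _ F (fun t => 'D_w f (x + t *: w)) 0 s s0.
- move=> t; rewrite in_itv/= => /andP[t0 ts]; apply: dF; rewrite !ltW//.
- apply: derivable_within_continuous => t; rewrite in_itv/= => ts.
  by have [] := dF t ts.
move: E; rewrite /F scale0r addr0 subr0 => ->.
rewrite normrM (ger0_norm s0) ler_wpM2r//; apply: fM; apply: seg.
by move: cs; rewrite in_itv.
Qed.

(** The segment first meets the boundary at a point where [f] vanishes. Since [f] is differentiable
    only inside, the mean value theorem is used up to a point shortly before, and continuity on the
    closure does the rest. *)
Lemma seg_out (w : V) x (s : R) : (forall y, Omega y -> `|'D_w f y| <= M) -> 0 <= s ->
  Omega x -> ~ (forall s', 0 <= s' <= s -> Omega (x + s' *: w)) -> `|f x| <= M * s.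
Proof.
move=> fM s0 Ox /existsNP[s1 /not_implyP[/andP[s10 s1s] nO]].
have M0 : 0 <= M := le_trans (normr_ge0 _) (fM x Ox).
have [t [t0 t1 bt bel]] := exit_point Ox nO.
have ps : t * s1 <= s by apply: le_trans s1s; rewrite ler_piMl.
have ct := bt.1; move/f_bdry : bt => ft.
have /subspace_continuousP/(_ _ ct) := f_cts.
move=> /cvgrPdist_lt cf; apply/ler_addgt0Pr => e e0.
have /nbhs_rV[r r0 rO] := cf e e0.
have [d d0 dx] := line_near x (s1 *: w) t r0.
pose t' := Num.max 0 (t - d / 2).
have t'0 : 0 <= t' by rewrite le_max lexx.
have t't : t' < t by rewrite gt_max t0 /= gtrBl divr_gt0.
have Ot' : Omega (x + t' *: (s1 *: w)) by apply: bel; rewrite t'0.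
have h1 : `|f (x + t' *: (s1 *: w))| < e.
  have H y : (forall i, `|(x + t *: (s1 *: w)) 0 i - y 0 i| < r) -> closure Omega y ->
     `|f (x + t *: (s1 *: w)) - f y| < e by exact: rO.
  have := H (x + t' *: (s1 *: w)); rewrite ft sub0r normrN; apply; last exact: subset_closure.
  apply: dx; rewrite distrC ger0_norm ?subr_ge0 ?(ltW t't)//.
  have : t - d / 2 <= t' by rewrite le_max lexx orbT.
  by move: d0 => ? ?; lra.
have h2 : `|f (x + (t' * s1) *: w) - f x| <= M * (t' * s1).
  apply: seg_in => //; first exact: mulr_ge0.
  move=> s' /andP[s'0 s't]; have [s10'|s1n0] := eqVneq s1 0.
    by move: s't; rewrite s10' mulr0 => h; rewrite (@le_anti _ _ s' 0) ?scale0r ?addr0// h.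
  have s1p : 0 < s1 by rewrite lt_neqAle eq_sym s1n0.
  have := bel (s' / s1); rewrite scalerA divfK//; apply; rewrite divr_ge0//=.
  by rewrite ltr_pdivrMr//; apply: le_lt_trans s't _; rewrite ltr_pM2r.
rewrite scalerA in h1; have := ler_normB (f (x + (t' * s1) *: w)) (f (x + (t' * s1) *: w) - f x).
rewrite opprB addrC subrK => h3; apply: le_trans h3 _; rewrite addrC; apply: lerD; last exact: ltW.
apply: le_trans h2 _; rewrite ler_wpM2l//; apply: le_trans ps.
by rewrite ler_wpM2r// ltW.
Qed.

Definition zero_ext x : R := f x * \1_Omega x.

Lemma zero_ext_in x : Omega x -> zero_ext x = f x.
Proof. by move=> Ox; rewrite /zero_ext indicE mem_set// mulr1. Qed.

Lemma zero_ext_out x : ~ Omega x -> zero_ext x = 0.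
Proof. by move=> Ox; rewrite /zero_ext indicE memNset// mulr0. Qed.

Lemma zero_ext_line x (s : R) : 0 <= s -> 0 <= M -> `|zero_ext (x + s *: v) - zero_ext x| <= 2 * M * s.
Proof.
move=> s0 M0; have Ms : 0 <= M * s by exact: mulr_ge0.
have rev : x = (x + s *: v) + s *: (- v) by rewrite scalerN addrK.
have revs s' : x + s' *: v = (x + s *: v) + (s - s') *: (- v).
  by rewrite scalerN scalerBl opprB addrC -addrA [s *: v + _]addrC subrK addrC.
have [seg|nseg] := pselect (forall s', 0 <= s' <= s -> Omega (x + s' *: v)).
  have Ox : Omega x by rewrite -[x]addr0 -(scale0r v); apply: seg; rewrite lexx.
  have Oy : Omega (x + s *: v) by apply: seg; rewrite s0 lexx.
  by rewrite !zero_ext_in//; apply: le_trans (seg_in f_M s0 seg) _; lra.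
have hx : `|zero_ext x| <= M * s.
  have [Ox|nOx] := pselect (Omega x); last by rewrite zero_ext_out// normr0.
  by rewrite zero_ext_in//; exact: seg_out f_M s0 Ox nseg.
have hy : `|zero_ext (x + s *: v)| <= M * s.
  have [Ox|nOx] := pselect (Omega (x + s *: v)); last by rewrite zero_ext_out// normr0.
  rewrite zero_ext_in//; apply: (seg_out f_MN s0 Ox) => H; apply: nseg => s' /andP[h1 h2].
  by rewrite revs; apply: H; rewrite subr_ge0 h2 /= gerBl.
by apply: le_trans (ler_normB _ _) _; lra.
Qed.

End zero_extension.

(** The coordinates are changed one at a time; a decrease is read as an increase from the other end,
    so increments with [0 <= s] are enough. *)
Lemma coord_lip (g : V -> R) (C : R) : 0 <= C ->
  (forall x i (s : R), 0 <= s -> `|g (x + s *: ei i) - g x| <= C * s) -> xlip (N%:R * C) g.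
Proof.
move=> C0 gC x y r xy.
pose pt k : V := \row_i (if (i < k)%N then y 0 i else x 0 i).
have p0 : pt 0%N = x by apply/rowP => i; rewrite mxE.
have pN : pt N = y by apply/rowP => i; rewrite mxE ltn_ord.
have r0 k : (k < N)%N -> 0 <= r by move=> kN; exact: le_trans (normr_ge0 _) (xy (Ordinal kN)).
have step k : (k < N)%N -> `|g (pt k) - g (pt k.+1)| <= C * r.
  move=> kN; pose i := Ordinal kN.
  have E : pt k.+1 = pt k + (y 0 i - x 0 i) *: ei i.
    apply/rowP => j; rewrite !mxE /= ltnS leq_eqVlt.
    have [->|ji] := eqVneq j i; first by rewrite eqxx /= ltnn mulr1 addrC subrK.
    have -> : (nat_of_ord j == k) = false by apply: contra_neqF ji => /eqP jk; exact: val_inj.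
    by rewrite /= mulr0 addr0.
  have := xy i; rewrite distrC => xyi.
  have [h|h] := leP 0 (y 0 i - x 0 i).
    rewrite E distrC; apply: le_trans (gC _ _ _ h) _; rewrite ler_wpM2l//.
    by apply: le_trans xyi; exact: ler_norm.
  have E' : pt k = pt k.+1 + (- (y 0 i - x 0 i)) *: ei i by rewrite E scaleNr addrK.
  rewrite E'; have h' : 0 <= - (y 0 i - x 0 i) by rewrite oppr_ge0 ltW.
  apply: le_trans (gC _ _ _ h') _; rewrite ler_wpM2l//.
  by apply: le_trans xyi; rewrite -normrN; exact: ler_norm.
have -> : g x - g y = \sum_(0 <= k < N) (g (pt k) - g (pt k.+1)).
  rewrite -(opprB (g y)) -{1}pN -{1}p0 -(telescope_sumr (fun k => g (pt k)))// -sumrN.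
  by apply: eq_bigr => k _; rewrite opprB.
apply: le_trans (ler_norm_sum _ _ _) _; rewrite big_mkord.
apply: (@le_trans _ _ (\sum_(k < N) C * r)); last by rewrite sumr_ord mulrA.
by apply: ler_sum => k _; exact: step.
Qed.

Definition near_dom (d : R) (x : V) : Prop := forall y, (forall i, `|y 0 i - x 0 i| <= d) -> Omega y.

Lemma box_compact (a b : 'I_N -> R) : compact [set x : V | forall i, a i <= x 0 i <= b i].
Proof.
have := @rV_compact R N (fun i => [set` `[a i, b i]]) (fun i => @segment_compact _ _ _).
by rewrite (_ : mkset _ = [set x : V | forall i, a i <= x 0 i <= b i]).
Qed.

(** The interpolant with mesh [q = p = 1] whose grid values indicate the nodes with a box of
    half-width [4 * delta] inside [Omega]. The 9 is 4 for this box, 4 for the reach of a kernel and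
    1 for the neighbourhood of [z]. For times in []0, T[] the time kernels sum to 1, so [chi] is
    stationary there. *)
Lemma cutoff_exists (r delta T : R) : 0 <= r -> 0 < delta -> delta <= 1 -> 0 < T ->
  exists chi : X -> R,
  [/\ Ck 2 setT chi, forall z : X, 0 <= chi z <= 1,
      forall z : X, 0 < z.2 < T -> dt chi z = 0 &
      forall i (z : X), `|dx i chi z| <= 1400 / delta] /\
  (exists K : set V, [/\ compact K, K `<=` Omega & forall z : X, chi z != 0 -> K z.1]) /\
  (forall z : X, 0 < z.2 < T -> (forall i, `|z.1 0 i| <= r) -> near_dom (9 * delta) z.1 ->
     \forall z' \near z, chi z' = 1).
Proof.
move=> r0 d0 d1 T0.
have [c _ cD] := nat_above ((r + 1 + 6) / delta).
have [n1 _ nD] := nat_above ((T + 4 * delta + 1 + 1) / delta).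
(* The extra 1 keeps a whole neighbourhood of [z] within the times covered by the partition of
   unity. *)
pose T1 := T + 4 * delta + 1.
have hE : gh delta 1 = delta by rewrite /gh divr1.
have tE : gtau delta 1 = delta by rewrite /gtau divr1.
have L0c : r + 1 + 4 * delta <= gh delta 1 * c%:R.
  by rewrite hE mulrC; move: cD; rewrite ler_pdivrMr//; lra.
have T1n : T1 + 1 <= n1.+1%:R * gtau delta 1.
  rewrite tE; apply: (@le_trans _ _ (n1%:R * delta)).
    by rewrite -ler_pdivrMr.
  by rewrite ler_pM2r// ler_nat.
pose G := {ffun 'I_N -> 'I_(c.*2).+1}.
pose cen (k : G) : V := (gpt delta 1 1 T1 0 k).1.
pose ok (k : G) := near_dom (4 * delta) (cen k).
pose ps (n : nat) (k : G) : R := if `[< ok k >] then 1 else 0.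
have ps01 n k : 0 <= ps n k <= 1 by rewrite /ps; case: ifP => _; rewrite ?lexx ?ler01.
have psn n k : (n <= n1)%N -> `|ps n k| <= 1 by move=> _; have := ps01 n k => /andP[? ?]; rewrite ger0_norm.
exists (Phi delta 1 1 n1 T1 ps); split; [split|split].
- exact: Phi_Ck.
- move=> z; rewrite Phi_ge0/=; last by move=> n k; have /andP[] := ps01 n k.
  by apply: le_trans (ler_norm _) _; exact: (Phi_bound T1 d0).
- move=> z /andP[z0 zT].
  pose b (x : V) : R := \sum_(k : G) ps 0%N k * \prod_j xs delta 1 (k j) (x 0 j).
  have E (t : R) : 0 < t < T -> Phi delta 1 1 n1 T1 ps (z.1, t) = b z.1.
    move=> /andP[t0 tT].
    have st : \sum_(n < n1.+1) ts delta 1 T1 n t = 1.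
      by apply: sum_ts_eq1 => //; rewrite /T1 in T1n *; lra.
    rewrite /Phi -[b _]mulr1 -st mulr_sumr; apply: eq_bigr => n _.
    by rewrite /b mulr_suml; apply: eq_bigr => k _; rewrite mulrA.
  have : is_derive z ((0, 1) : X) (Phi delta 1 1 n1 T1 ps) 0; last by case.
  apply/is_derive_line; apply: (@near_eq_is_derive _ R R (cst (b z.1))).
  have e0 : 0 < Num.min z.2 (T - z.2) by rewrite lt_min z0 subr_gt0.
  apply/nbhs_ballP; exists (Num.min z.2 (T - z.2)) => // s.
  rewrite /ball /= sub0r normrN => sm; move: sm; rewrite lt_min !ltr_norml => /andP[/andP[s1 s2] /andP[s3 s4]].
  rewrite (_ : s *: ((0, 1) : X) + z = (z.1, s + z.2)); last first.
    by case: z {z0 zT E e0 s1 s2 s3 s4} => z1 z2; congr pair; rewrite /= ?scaler0 ?add0r// /GRing.scale/= mulr1.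
  by rewrite E//; apply/andP; split; lra.
- move=> i z; apply: le_trans (dx_Phi_crude T1 d0 (ltn0Sn 0) (ltn0Sn 0) psn i z) _.
  by rewrite mul1r.
- exists (\big[setU/set0]_(k : G | `[< ok k >]) [set x : V | forall i, cen k 0 i - 4 * delta <= x 0 i <= cen k 0 i + 4 * delta]).
  have bE (k : G) (x : V) : (forall i, cen k 0 i - 4 * delta <= x 0 i <= cen k 0 i + 4 * delta) <->
      (forall i, `|x 0 i - cen k 0 i| <= 4 * delta).
    by split=> H i; have := H i; rewrite ler_norml => /andP[? ?]; apply/andP; split; lra.
  split.
  + by apply: bigsetU_compact => k _; exact: box_compact.
  + move=> x; rewrite -bigcup_seq_cond => -[k /= /andP[_ /asboolP okk] /bE H].
    exact: okk.
  + move=> z Pz.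
    have [n [k [om0 ps0]]] : exists (n : 'I_n1.+1) (k : G), om delta 1 1 T1 n k z != 0 /\ ps n k != 0.
      apply: contrapT => H; move/negP: Pz; apply; apply/eqP.
      apply: big1 => n _; apply: big1 => k _; apply/eqP; rewrite mulf_eq0 -[_ || _]negbK negb_or.
      by apply/negP => /andP[? ?]; apply: H; exists n, k.
    have okk : ok k by move: ps0; rewrite /ps; case: asboolP => //; rewrite eqxx.
    rewrite -bigcup_seq_cond; exists k => /=; first by rewrite mem_index_enum asboolT.
    by apply/bE => i; have [/(_ i)] := om_near d0 om0.
move=> z /andP[z0 zT] zr nd.
apply/nbhs_coord; exists delta => // z' h1 h2.
have t1 := h2; rewrite ltr_norml in t1; move/andP: t1 => [t1 t2].
have zL i : `|z'.1 0 i| <= r + 1.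
  have := ler_normB (z.1 0 i) (z.1 0 i - z'.1 0 i); rewrite opprB addrC subrK.
  by have := h1 i; have := zr i; lra.
have t3 : z'.2 <= T1 - 4 * delta by rewrite /T1; lra.
have t4 : T1 - z'.2 <= n1.+1%:R * gtau delta 1 by lra.
rewrite -(sum_om_eq1 d0 (ltn0Sn 0) (ltn0Sn 0) L0c zL t3 t4).
apply: eq_bigr => n _; apply: eq_bigr => k _.
have [->|omn] := eqVneq (om delta 1 1 T1 n k z') 0; first by rewrite mulr0.
rewrite /ps asboolT ?mul1r// => y hy; apply: nd => i.
have [/(_ i) o1 _] := om_near d0 omn.
have -> : y 0 i - z.1 0 i = (y 0 i - cen k 0 i) - (z'.1 0 i - cen k 0 i) - (z.1 0 i - z'.1 0 i) by ring.
apply: le_trans (ler_normB _ _) _; have -> : 9 * delta = 4 * delta + 4 * delta + delta by ring.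
apply: lerD; last exact: ltW.
by apply: le_trans (ler_normB _ _) _; apply: lerD.
Qed.

End geometry.

(** * Entropy solutions *)

Section oriented.
Context {R : realType}.
Implicit Types (F G : R -> R) (p q r s : R).
Notation leb := (@lebesgue_measure R).
Notation O := (@oriented_int R).

Definition between p q s := p <= s <= q \/ q <= s <= p.

Lemma between_sym p q s : between p q s -> between q p s.
Proof. by case; [right|left]. Qed.

Lemma cts_integrable F p q : continuous F -> leb.-integrable [set` `[p, q]] (EFin \o F).
Proof.
move=> cF; apply: continuous_compact_integrable; first exact: segment_compact.
by apply: continuous_subspaceT => x; exact: cF.
Qed.

Lemma O_ge F p q : p <= q -> O p q F = \int[leb]_(s in [set` `[p, q]]) F s.
Proof. by rewrite /oriented_int => ->. Qed.

Lemma O_chasles_le F p q r : continuous F -> p <= q -> q <= r -> O p q F + O q r F = O p r F.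
Proof.
move=> cF pq qr; rewrite !O_ge//; last exact: le_trans qr.
rewrite -(Rintegral_itv_obnd_cbnd (r := q) (b := BRight r)).
  rewrite -(@Rintegral_itvB R F (BLeft p) (BRight r) q) ?bnd_simp//.
    by rewrite addrC subrK.
  exact: cts_integrable.
apply: integrableS (cts_integrable q r cF) => //.
by apply: subset_itvr; rewrite bnd_simp.
Qed.

Lemma O_same F p : continuous F -> O p p F = 0.
Proof. by move=> cF; have := O_chasles_le cF (lexx p) (lexx p); lra. Qed.

Lemma O_anti F p q : continuous F -> O q p F = - O p q F.
Proof.
move=> cF; rewrite /oriented_int; have [pq|qp] := leP p q; have [qp'|pq'] := leP q p.
- have -> : p = q by apply/le_anti; rewrite pq qp'.
  by have := O_same q cF; rewrite O_ge// => ->; rewrite oppr0.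
- by [].
- by rewrite opprK.
- by have := lt_trans qp pq'; rewrite ltxx.
Qed.

Lemma chasles_signs (x y z : R) :
  z - y = x \/ - z + x = - y \/ - x + z = y \/ y - z = - x \/ - y - x = - z -> x + y = z.
Proof. by case=> [|[|[|[|]]]]; lra. Qed.

Lemma O_chasles F p q r : continuous F -> O p q F + O q r F = O p r F.
Proof.
move=> cF; have key := O_chasles_le cF.
have a1 := O_anti p q cF; have a2 := O_anti q r cF; have a3 := O_anti p r cF.
have [pq|qp] := leP p q; have [qr|rq] := leP q r; have [pr|rp] := leP p r.
- exact: key.
- by have := le_lt_trans (le_trans pq qr) rp; rewrite ltxx.
- by apply: chasles_signs; left; have := key p r q pr (ltW rq); rewrite ?a1 ?a2 ?a3.
- by apply: chasles_signs; right; left; have := key r p q (ltW rp) pq; rewrite ?a1 ?a2 ?a3.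
- by apply: chasles_signs; do 2 right; left; have := key q p r (ltW qp) pr; rewrite ?a1 ?a2 ?a3.
- by apply: chasles_signs; do 3 right; left; have := key q r p qr (ltW rp); rewrite ?a1 ?a2 ?a3.
- by have := lt_le_trans (lt_trans rq qp) pr; rewrite ltxx.
- by apply: chasles_signs; do 4 right; have := key r q p (ltW rq) (ltW qp); rewrite ?a1 ?a2 ?a3.
Qed.

Lemma Rint_cst p q (B : R) : p <= q -> \int[leb]_(s in [set` `[p, q]]) B = B * (q - p).
Proof.
move=> pq; have mE : lebesgue_measure [set` `[p, q]] = (q - p)%:E.
  rewrite lebesgue_measure_itv /= lte_fin.
  by case: ltP => //= qp; rewrite (@le_anti _ _ p q) ?pq// subrr.
by rewrite Rintegral_cst//; congr (B * _); exact: (congr1 fine mE).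
Qed.

Lemma O_bound F p q (B : R) : continuous F -> (forall s, between p q s -> `|F s| <= B) ->
  `|O p q F| <= B * `|q - p|.
Proof.
move=> cF.
have key p' q' : p' <= q' -> (forall s, between p' q' s -> `|F s| <= B) -> `|O p' q' F| <= B * `|q' - p'|.
  move=> pq FB; rewrite O_ge// (ger0_norm (x := q' - p')) ?subr_ge0// -Rint_cst//.
  have iF := cts_integrable p' q' cF.
  apply: le_trans (le_normr_Rintegral _ iF) _ => //.
  apply: le_Rintegral => //.
  - exact: (integrable_norm iF).
  - apply: (cts_integrable p' q' (F := fun=> B)); exact: cst_continuous.
  - by move=> s; rewrite /= in_itv => sp; apply: FB; left.
move=> FB; have [pq|qp] := leP p q; first exact: key.
by rewrite O_anti// normrN distrC; apply: key => [|s /between_sym]; [exact: ltW|exact: FB].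
Qed.

Lemma O_eq0 F p q : continuous F -> (forall s, between p q s -> F s = 0) -> O p q F = 0.
Proof.
move=> cF F0; apply/eqP; rewrite -normr_le0 -(mul0r `|q - p|).
by apply: O_bound => // s /F0 ->; rewrite normr0.
Qed.

Lemma O_ext F G p q : (forall s, between p q s -> F s = G s) -> O p q F = O p q G.
Proof.
move=> FG; rewrite /oriented_int; case: ifP => pq; [|congr (- _)];
  apply: eq_Rintegral => s; rewrite inE /= in_itv => h; apply: FG; [by left|by right].
Qed.

Lemma O_cst p q (B : R) : O p q (fun=> B) = B * (q - p).
Proof.
rewrite /oriented_int; have [pq|qp] := leP p q; first exact: Rint_cst.
by rewrite Rint_cst ?ltW//; ring.
Qed.

Lemma O_le F G p q : continuous F -> continuous G -> p <= q ->
  (forall s, p <= s <= q -> F s <= G s) -> O p q F <= O p q G.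
Proof.
move=> cF cG pq FG; rewrite !O_ge//; apply: le_Rintegral => //; exact: cts_integrable.
Qed.

Lemma O_Z F p q (B : R) : continuous F -> O p q (fun s => B * F s) = B * O p q F.
Proof.
move=> cF; rewrite /oriented_int; case: ifP => _; rewrite RintegralZl ?mulrN//;
  exact: cts_integrable.
Qed.

Lemma O_lip F (B p : R) : continuous F -> (forall s, `|F s| <= B) ->
  forall x y, `|O p x F - O p y F| <= B * `|x - y|.
Proof.
move=> cF FB x y; rewrite -(O_chasles p y x cF) addrC addKr.
by apply: O_bound => // s _.
Qed.

Lemma lip_cts F (B : R) : (forall x y, `|F x - F y| <= B * `|x - y|) -> continuous F.
Proof.
move=> FL x; apply/cvgrPdist_lt => e e0.
have B0 : 0 < `|B| + 1 by rewrite ltr_wpDl.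
apply/nbhs_ballP; exists (e / (`|B| + 1)); first by rewrite /= divr_gt0.
move=> y; rewrite /ball /= ltr_pdivlMr// => xy; apply: le_lt_trans (FL x y) _.
apply: le_lt_trans xy; rewrite mulrC ler_wpM2l//.
by apply: le_trans (ler_norm B) _; rewrite lerDl.
Qed.

Section kernel.
Variable eta : R.
Hypothesis eta_gt0 : 0 < eta.
Notation h := (h_eta eta).
Notation S := (S_eta eta).
Notation I := (I_eta eta).

Lemma h_cts : continuous h.
Proof.
apply: (@lip_cts _ (2 / eta / eta)) => x y.
have h2 : 0 < 2 / eta by rewrite divr_gt0.
rewrite /h_eta -mulrBr normrM gtr0_norm// -!mulrA ler_pM2l// ler_pM2l ?invr_gt0//.
apply: le_trans (max0_lip _ _) _.
have -> : 1 - `|x| / eta - (1 - `|y| / eta) = (`|y| - `|x|) / eta by ring.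
rewrite normrM normfV (gtr0_norm eta_gt0) mulrC ler_pM2l ?invr_gt0// distrC.
exact: ler_dist_dist.
Qed.

Lemma h_bd s : 0 <= h s <= 2 / eta.
Proof.
have h2 : 0 < 2 / eta by rewrite divr_gt0.
rewrite /h_eta mulr_ge0 ?le_max ?lexx ?(ltW h2)//= -[leRHS]mulr1 ler_pM2l//.
by rewrite ge_max ler01 gerBl divr_ge0// ltW.
Qed.

Lemma h_out s : eta <= `|s| -> h s = 0.
Proof. by move=> es; rewrite /h_eta max_l ?mulr0// subr_le0 ler_pdivlMr// mul1r. Qed.

Lemma h_in s : `|s| <= eta / 2 -> eta^-1 <= h s.
Proof.
move=> es; have H : 2^-1 <= 1 - `|s| / eta.
  have : `|s| / eta <= 2^-1 by rewrite ler_pdivrMr// mulrC.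
  by lra.
have -> : eta^-1 = 2 / eta * 2^-1 by field; rewrite gt_eqF.
rewrite /h_eta ler_pM2l ?divr_gt0//; apply: le_trans H _.
by rewrite le_max lexx orbT.
Qed.

Lemma S_cts : continuous S.
Proof.
apply: (@lip_cts _ (2 / eta)) => x y; apply: O_lip; first exact: h_cts.
by move=> s; have /andP[? ?] := h_bd s; rewrite ger0_norm.
Qed.

Section side.
Variable sg : R.
Hypothesis sgP : sg = 1 \/ sg = -1.
(** Calculus gives the value [sg]; the argument works with the bounds of [side_mass_bd], which come
    from comparing [h_eta] with constants. *)
Definition side_mass : R := S (sg * eta).
Notation m := side_mass.

Lemma side_out s s' : eta <= sg * s -> between (sg * eta) s s' -> eta <= `|s'|.
Proof.
case: sgP => ->; rewrite ?mul1r ?mulN1r => h1 [/andP[h2 h3]|/andP[h2 h3]]; rewrite ler_normr; apply/orP;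
  by [left; lra|right; lra].
Qed.

Lemma side_mass_bd : 2^-1 <= sg * m <= 2.
Proof.
have c := h_cts; have e0 := eta_gt0.
have z p q : p <= q -> 0 <= O p q h.
  move=> pq; rewrite -(mul0r (q - p)) -O_cst; apply: O_le => //; first exact: cst_continuous.
  by move=> s _; have /andP[] := h_bd s.
have half p q : p <= q -> q - p = eta / 2 -> (forall s, p <= s <= q -> `|s| <= eta / 2) -> 2^-1 <= O p q h.
  move=> pq E H; have -> : 2^-1 = O p q (fun=> eta^-1).
    by rewrite O_cst E; field; rewrite gt_eqF.
  by apply: O_le => //; [exact: cst_continuous|move=> s /H; exact: h_in].
have ub p q : `|q - p| = eta -> `|O p q h| <= 2.
  move=> E; have -> : 2 = 2 / eta * `|q - p| by rewrite E divfK// gt_eqF.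
  by apply: O_bound => // s _; have /andP[? ?] := h_bd s; rewrite ger0_norm.
have pos : 2^-1 <= sg * m.
  rewrite /m /S_eta; case: sgP => ->.
    rewrite !mul1r -(O_chasles 0 (eta / 2) eta c).
    have : 2^-1 <= O 0 (eta / 2) h.
      by apply: half; [lra|lra|move=> s /andP[s0 s1]; rewrite ger0_norm].
    by have := z (eta / 2) eta ltac:(lra); lra.
  rewrite mulN1r mulN1r -(O_anti 0 _ c) -(O_chasles (- eta) (- (eta / 2)) 0 c).
  have : 2^-1 <= O (- (eta / 2)) 0 h.
    apply: half; [lra|lra|move=> s /andP[s0 s1]; rewrite ler_norml]; lra.
  by have := z (- eta) (- (eta / 2)) ltac:(lra); lra.
rewrite pos /=; apply: le_trans (ler_norm _) _; rewrite normrM.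
have -> : `|sg| = 1 by case: sgP => ->; rewrite ?normrN normr1.
rewrite mul1r; apply: ub; rewrite subr0 normrM (gtr0_norm eta_gt0).
by case: sgP => ->; rewrite ?normrN normr1 mul1r.
Qed.

Lemma S_side s : eta <= sg * s -> S s = m.
Proof.
move=> es; rewrite /S_eta -(O_chasles 0 (sg * eta) s h_cts).
by rewrite [X in _ + X](O_eq0 h_cts) ?addr0// => s' /(side_out es); exact: h_out.
Qed.

Lemma S_bd s : `|S s| <= 2 / eta * `|s|.
Proof.
rewrite /S_eta -{2}[s]subr0; apply: O_bound; first exact: h_cts.
by move=> s' _; have /andP[? ?] := h_bd s'; rewrite ger0_norm.
Qed.

Lemma I_side s : eta <= sg * s -> I s = I (sg * eta) + m * (s - sg * eta).
Proof.
move=> es; rewrite /I_eta -(O_chasles 0 (sg * eta) s S_cts); congr (_ + _).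
rewrite -O_cst; apply: O_ext => s' h; apply: S_side.
by move: es h; case: sgP => ->; rewrite ?mul1r ?mulN1r => es [/andP[h2 h3]|/andP[h2 h3]]; lra.
Qed.

Lemma I_edge : `|I (sg * eta)| <= 2 * eta.
Proof.
have nE : `|sg * eta| = eta.
  by rewrite normrM (gtr0_norm eta_gt0); case: sgP => ->; rewrite ?normrN normr1 mul1r.
have -> : 2 * eta = 2 * `|sg * eta - 0| by rewrite subr0 nE.
rewrite /I_eta; apply: O_bound; first exact: S_cts.
move=> s h; apply: le_trans (S_bd s) _; rewrite mulrAC ler_pdivrMr// ler_pM2l//.
move: h; case: sgP => ->; rewrite ?mul1r ?mulN1r => -[/andP[h2 h3]|/andP[h2 h3]];
  rewrite ler_norml; have := eta_gt0; lra.
Qed.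

(** Beyond distance [eta] from [k] the integrand vanishes, so the integral stops depending on [u];
    [d k] is its final value. *)
Lemma D_side : exists2 d : R -> R, (forall k, `|d k| <= 2 * eta) &
  forall k u, eta <= sg * (u - k) -> O k u (fun s => (s - k) * h (s - k)) = d k.
Proof.
have cF k : continuous (fun s => (s - k) * h (s - k)).
  move=> s; apply: cvgM; first by apply: cvgB; [exact: cvg_id|exact: cvg_cst].
  apply: (@cvg_comp _ _ _ (fun s => s - k) h); last exact: h_cts.
  by apply: cvgB; [exact: cvg_id|exact: cvg_cst].
exists (fun k => O k (k + sg * eta) (fun s => (s - k) * h (s - k))) => [k|k u es].
  have nE : `|sg * eta| = eta.
    by rewrite normrM (gtr0_norm eta_gt0); case: sgP => ->; rewrite ?normrN normr1 mul1r.
  have -> : 2 * eta = 2 * `|k + sg * eta - k| by rewrite addrAC subrr add0r nE.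
  apply: O_bound => // s _.
  have [lt|ge] := ltP `|s - k| eta; last by rewrite h_out// mulr0 normr0.
  have /andP[h0 h1] := h_bd (s - k); rewrite normrM (ger0_norm h0).
  apply: (@le_trans _ _ (eta * (2 / eta))); last by rewrite mulrC divfK// gt_eqF.
  by apply: ler_pM => //; exact: ltW.
rewrite -(O_chasles k (k + sg * eta) u (cF k)) [X in _ + X](O_eq0 (cF k)) ?addr0// => s h.
rewrite h_out ?mulr0//; apply: (side_out es).
by case: h => /andP[h1 h2]; [left|right]; apply/andP; split; lra.
Qed.

(** [S_eta eta] is locally constant there. This removes the term with [|G i x| ^+ 2] from the
    entropy inequality. *)
Lemma dS_side s : eta < sg * s -> derive1 S s = 0.
Proof.
move=> es; rewrite derive1E.
have : is_derive s (1 : R) S 0; last by case.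
apply: (@near_eq_is_derive _ R R (cst m)).
apply/nbhs_ballP; exists (sg * s - eta); first by rewrite /= subr_gt0.
move=> s'; rewrite /ball /= => h; apply/esym/S_side.
by move: es h; case: sgP => ->; rewrite ?mul1r ?mulN1r ltr_norml => es /andP[? ?]; lra.
Qed.

End side.
End kernel.
End oriented.

(** * Changing integrands on null sets *)

Section null_sets.
Import HBNNSimple.
Context d (T : measurableType d) {R : realType} (mu : {measure set T -> \bar R}).
Implicit Types (f g : T -> \bar R) (Nl : set T).

(** The integral is a supremum over simple functions below [f], and multiplying such a function by
    the indicator of the complement of [Nl] makes it lie below [g]. The measurability of the
    integrands in the entropy inequality is thus not at stake. *)
Lemma ge0_integral_null_le f g Nl : measurable Nl -> mu Nl = 0%E -> (forall x, (0 <= f x)%E) ->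
  (forall x, (0 <= g x)%E) -> (forall x, ~ Nl x -> f x = g x) ->
  (\int[mu]_x f x <= \int[mu]_x g x)%E.
Proof.
move=> mN N0 f0 g0 fg; rewrite !ge0_integralTE//; apply: ge_ereal_sup => _ [h hf <-].
have mC : measurable (~` Nl) by exact: measurableC.
pose h' := mul_nnsfun h (indic_nnsfun R mC).
have -> : sintegral mu h = sintegral mu h'.
  rewrite -!integralT_nnsfun; apply: ae_eq_integral => //.
  - by apply/measurable_EFinP; exact: measurable_funP.
  - by apply/measurable_EFinP; exact: measurable_funP.
  exists Nl; split=> // x /= /not_implyP[_] H; apply: contrapT => nNx; apply: H.
  by rewrite /= /mindic indicE mem_set// mulr1.
apply: ereal_sup_ubound; exists h' => //.
move=> x /=; rewrite /mindic indicE; have [Nx|nNx] := pselect (Nl x).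
  by rewrite memNset ?mulr0//; exact.
by rewrite mem_set// mulr1 -fg.
Qed.

Lemma integral_null f g Nl : measurable Nl -> mu Nl = 0%E ->
  (forall x, ~ Nl x -> f x = g x) -> (\int[mu]_x f x = \int[mu]_x g x)%E.
Proof.
move=> mN N0 fg.
have key f' g' : (forall x, (0 <= f' x)%E) -> (forall x, (0 <= g' x)%E) ->
    (forall x, ~ Nl x -> f' x = g' x) -> (\int[mu]_x f' x = \int[mu]_x g' x)%E.
  move=> f0 g0 E; apply/eqP; rewrite eq_le.
  by rewrite !(ge0_integral_null_le mN N0)// => x /E.
rewrite integralE [RHS]integralE; congr (_ - _)%E; apply: key => // x nNx.
  by rewrite !funeposE fg.
by rewrite !funenegE fg.
Qed.

Lemma Rintegral_null (F G : T -> R) (D Nl : set T) : measurable Nl -> mu Nl = 0%E ->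
  (forall x, D x -> ~ Nl x -> F x = G x) -> (forall x, ~ D x -> G x = 0) ->
  \int[mu]_(x in D) F x = \int[mu]_x G x.
Proof.
move=> mN N0 FG G0; rewrite Rintegral_mkcond /Rintegral; congr fine.
apply: (integral_null mN N0) => x nNx; congr EFin; rewrite /patch.
by have [Dx|nDx] := pselect (D x); [rewrite mem_set// FG|rewrite memNset// G0].
Qed.

End null_sets.

(** * Bounded representatives *)

Section truncation.
Context {R : realType} {N : nat}.
Local Notation X := ('rV[R]_N * R)%type.
Notation mu := (@lebesgue_xt R N).
Notation L1 g := (mu.-integrable [set: X] (EFin \o g)).
Notation Int g := (\int[mu]_x g x).

Lemma essentially_bounded (Q : set X) (u : X -> R) : Lp_on mu +oo%E Q u ->
  exists2 M : R, 0 <= M & mu [set z | M < `|(u \_ Q) z|] = 0%E.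
Proof.
rewrite /Lp_on inE /= => /andP[]; rewrite inE /= => mu_ fu.
have mabs : measurable_fun setT (fun z => `|(u \_ Q) z|) by exact: measurableT_comp.
have mS (M : R) : measurable [set z | M < `|(u \_ Q) z|].
  rewrite (_ : mkset _ = setT `&` (fun z => `|(u \_ Q) z|) @^-1` [set` `]M, +oo[]).
    by apply: mabs => //; exact: measurable_itv.
  by rewrite setTI; apply/seteqP; split => z /=; rewrite in_itv/= andbT.
move: fu; rewrite inE /= /finite_norm unlock.
(* The infinity norm has a default value when the whole space has measure 0; that case is settled
   directly. *)
case: ifPn => [_ H|]; last first.
  rewrite lt0e measure_ge0 andbT negbK => /eqP mT0 _; exists 0 => //.
  apply/eqP; rewrite eq_le measure_ge0 andbT -mT0.
  by apply: le_measure; rewrite ?inE.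
have [M HM] : exists M, \forall x \ae mu, (`|(u \_ Q) x| <= M)%R.
  by apply: ess_sup_inf.ess_supr_bounded; exact: H.
exists (Num.max 0 M); first by rewrite le_max lexx.
have [A [mA A0 sA]] := HM; apply/eqP; rewrite eq_le measure_ge0 andbT -A0.
apply: le_measure; rewrite ?inE// => z /= Mz; apply: sA => /=; apply/negP.
by rewrite -ltNge; apply: le_lt_trans Mz; rewrite le_max lexx orbT.
Qed.

Lemma bounded_version (Q : set X) (u : X -> R) : measurable Q ->
  Lp_on mu +oo%E Q u -> Lp_on mu 1%E Q u ->
  exists (u' : X -> R) (M : R) (Nl : set X),
    [/\ 0 <= M, L1 u', forall z, `|u' z| <= M & forall z, ~ Q z -> u' z = 0] /\
    [/\ measurable Nl, mu Nl = 0%E & forall z, Q z -> ~ Nl z -> u' z = u z].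
Proof.
move=> mQ uoo u1; have [M M0 HM] := essentially_bounded uoo.
move: u1; rewrite /Lp_on inE /= => /andP[]; rewrite inE /= => mu_.
rewrite inE /= /finite_norm Lnorm1 => fu.
have mabs : measurable_fun setT (fun z => `|(u \_ Q) z|) by exact: measurableT_comp.
pose Nl := [set z | M < `|(u \_ Q) z|].
have mS : measurable Nl.
  rewrite (_ : Nl = setT `&` (fun z => `|(u \_ Q) z|) @^-1` [set` `]M, +oo[]).
    by apply: mabs => //; exact: measurable_itv.
  by rewrite setTI; apply/seteqP; split => z /=; rewrite in_itv/= andbT.
have iu : L1 (u \_ Q).
  apply/integrableP; split; [exact/measurable_EFinP|exact: fu].
pose u' z := (u \_ Q) z * \1_(~` Nl) z.
have bd z : `|u' z| <= M.
  rewrite /u' indicE; have [Nz|nNz] := pselect (Nl z).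
    by rewrite memNset ?mulr0 ?normr0//; exact.
  by rewrite mem_set// mulr1 leNgt; apply/negP.
exists u', M, Nl; split; split=> //.
- apply: (L1M (M := 1) iu); first exact/measurable_indic/measurableC.
  by move=> z; rewrite indicE; case: (_ \in _); rewrite ?normr1 ?normr0.
- by move=> z nQ; rewrite /u' /patch memNset// mul0r.
- by move=> z Qz nNz; rewrite /u' /patch mem_set// indicE mem_set ?mulr1.
Qed.

End truncation.

Section parametric_oriented.
Context {R : realType} d (T : measurableType d).

(** The integral over a moving interval is written as one over the whole line of a jointly
    measurable function; Tonelli's theorem then explains the sign condition on [rho]. *)
Lemma oriented_meas (rho : R -> R -> R) (p : R) (U V : T -> R) :
  measurable_fun [set: R * R] (fun z : R * R => rho z.1 z.2) -> (forall s t, 0 <= rho s t) ->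
  measurable_fun setT U -> measurable_fun setT V ->
  measurable_fun setT (fun z => oriented_int p (U z) (fun s => rho s (V z))).
Proof.
move=> mr r0 mU mV.
have key (P Q : T -> R) : measurable_fun setT P -> measurable_fun setT Q ->
    measurable_fun setT (fun z => \int[lebesgue_measure]_(s in [set` `[P z, Q z]]) rho s (V z)).
  move=> mP mQ.
  pose H (w : T * measurableTypeR R) : \bar R :=
    (if (P w.1 <= w.2)%R && (w.2 <= Q w.1)%R then rho w.2 (V w.1) else 0)%:E.
  have mH : measurable_fun setT H.
    apply/measurable_EFinP; apply: measurable_fun_ifT.
    - apply: measurable_and; apply: measurable_fun_ler.
      + exact: (measurableT_comp mP measurable_fst).
      + exact: measurable_snd.
      + exact: measurable_snd.
      + exact: (measurableT_comp mQ measurable_fst).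
    - have mp : measurable_fun setT (fun w : T * measurableTypeR R => ((w.2 : R), V w.1)).
        apply/measurable_fun_pairP; split.
          exact: (measurable_snd : measurable_fun setT (fun w : T * measurableTypeR R => w.2)).
        exact: (measurableT_comp mV measurable_fst).
      exact: (measurableT_comp mr mp).
    - exact: measurable_cst.
  have H0 w : (0 <= H w)%E by rewrite /H lee_fin; case: ifP.
  have mF := @measurable_fun_fubini_tonelli_F _ _ T (measurableTypeR R) R (@lebesgue_measure R) H mH H0.
  have mf : measurable_fun setT (fine \o fubini_F (@lebesgue_measure R) H).
    by apply: measurableT_comp => //; exact: fine_measurable.
  apply: eq_measurable_fun mf => z _; rewrite /= Rintegral_mkcond /Rintegral /fubini_F.
  congr fine; apply: eq_integral => s _; rewrite /H /patch /=; congr EFin.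
  have -> : (s \in [set` `[P z, Q z]]) = (P z <= s <= Q z) by rewrite mem_setE in_itv.
  by [].
rewrite /oriented_int; apply: measurable_fun_ifT.
- by apply: measurable_fun_ler => //; exact: measurable_cst.
- exact: (key (fun=> p) U (measurable_cst _) mU).
- apply: measurableT_comp => //.
  exact: (key U (fun=> p) mU (measurable_cst _)).
Qed.

End parametric_oriented.

(** * Integration by parts with a Lipschitz factor *)

Section parts.
Context {R : realType} {N : nat}.
Local Notation X := ('rV[R]_N * R)%type.
Notation mu := (@lebesgue_xt R N).
Notation L1 g := (mu.-integrable [set: X] (EFin \o g)).
Notation Int g := (\int[mu]_x g x).

Lemma cts_compact_bound (g : X -> R) (K : set X) : continuous g -> compact K ->
  exists2 B : R, 0 <= B & forall z, K z -> `|g z| <= B.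
Proof.
move=> cg cK; have := compact_bounded (continuous_compact (continuous_subspaceT cg) cK).
move=> [B [_ HB]]; exists (`|B| + 1); first by rewrite addr_ge0.
by move=> z Kz; apply: HB; [apply: le_lt_trans (ler_norm B) _; rewrite ltrDl|exists z].
Qed.

Lemma compact_box (K : set X) : compact K -> exists2 r : R, 0 <= r &
  forall z, K z -> (forall i, `|z.1 0 i| <= r) /\ `|z.2| <= r.
Proof.
move=> cK.
have cc i : continuous (fun z : X => z.1 0 i) := xtlip_cts (xtlip_coord i).
have ct : continuous (fun z : X => z.2) := xtlip_cts xtlip_time.
have /choice[B HB] : forall i, exists B : R, 0 <= B /\ forall z, K z -> `|z.1 0 i| <= B.
  by move=> i; have [B B0 HB] := cts_compact_bound (cc i) cK; exists B.
have [Bt Bt0 HBt] := cts_compact_bound ct cK.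
have s0 : 0 <= \sum_i B i by apply: sumr_ge0 => i _; have [] := HB i.
exists (\sum_i B i + Bt); first exact: addr_ge0.
move=> z Kz; split=> [i|]; last by apply: le_trans (HBt _ Kz) _; rewrite lerDr.
apply: le_trans ((HB i).2 z Kz) _; apply: (@le_trans _ _ (\sum_j B j)); last by rewrite lerDl.
by rewrite (bigD1 i)//= lerDl; apply: sumr_ge0 => j _; have [] := HB j.
Qed.

Lemma line_mvt (psi : X -> R) (v z : X) (B s : R) : Ck 1 setT psi ->
  (forall y, `|'D_v psi y| <= B) -> `|psi (z + s *: v) - psi z| <= B * `|s|.
Proof.
move=> [_ /(_ v)[dpsi _]] bd; pose F (t : R) := psi (z + t *: v).
have dF t : is_derive t (1 : R) F ('D_v psi (z + t *: v)).
  have : is_derive (z + t *: v) v psi ('D_v psi (z + t *: v)) by apply: DeriveDef => //; exact: dpsi.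
  rewrite -is_derive_line -(is_derive_line F t (1 : R)).
  rewrite (_ : (fun s => psi (s *: v + (z + t *: v))) = (fun s => F (s *: (1 : R) + t))) //.
  apply/funext => r; rewrite /F; congr psi.
  by rewrite (_ : r *: (1 : R) = r) ?scalerDl 1?addrCA// [LHS]mulr1.
have key a b : a <= b -> `|F b - F a| <= B * (b - a).
  move=> ab; have [|c cs ->] := @MVT_segment _ F (fun t => 'D_v psi (z + t *: v)) a b ab.
    by apply: derivable_within_continuous => t _; have [] := dF t.
  by rewrite normrM (ger0_norm (x := b - a)) ?subr_ge0// ler_wpM2r ?subr_ge0.
have F0 : psi z = F 0 by rewrite /F scale0r addr0.
rewrite F0 -/(F s); have [s0|s0] := leP 0 s.
  by have := key _ _ s0; rewrite subr0 (ger0_norm s0).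
by have := key _ _ (ltW s0); rewrite distrC sub0r (ltr0_norm s0).
Qed.

(** [rho] is Lipschitz along [v] everywhere but differentiable only on [K]. The product [rho * psi]
    is nevertheless differentiable everywhere, since it vanishes near each point off [K], and its
    difference quotients are dominated by a constant on a box. *)
Lemma parts_zero (v : X) (rho drho psi : X -> R) (K : set X) (Br Lr : R) :
  (forall a : R, preserves mu (fun z : X => z + a *: v)) ->
  measurable_fun setT rho -> (forall z, `|rho z| <= Br) ->
  (forall z (s : R), 0 <= s -> `|rho (z + s *: v) - rho z| <= Lr * s) ->
  Ck 1 setT psi -> compact K -> (forall z, ~ K z -> psi z = 0) ->
  (forall z, K z -> is_derive z v rho (drho z)) ->
  L1 (fun z => drho z * psi z + rho z * 'D_v psi z) /\
  Int (fun z => drho z * psi z + rho z * 'D_v psi z) = 0.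
Proof.
move=> pv mrho rhoB rhoL Cpsi cK psi0 drhoE.
have Kcl : closed K by apply: compact_closed => //; exact: norm_hausdorff.
have near0 z : ~ K z -> \forall y \near z, psi y = 0.
  move=> nK; have : open (~` K) by exact: closed_openC.
  rewrite openE => /(_ z nK); apply: filterS => y; exact: psi0.
have D0 z : ~ K z -> is_derive z v psi 0.
  move=> nK; apply: (@near_eq_is_derive _ X R (cst 0)).
  by move: (near0 z nK); apply: filterS => y ->.
have cpsi := Ck_cts Cpsi.
have cD : continuous ('D_v psi) by apply: (@Ck_cts _ _ 0); have [_ /(_ v)[_]] := Cpsi.
have [Bp Bp0 HBp] := cts_compact_bound cpsi cK.
have [Bd Bd0 HBd] := cts_compact_bound cD cK.
have psiB z : `|psi z| <= Bp.
  by have [/HBp//|/psi0 ->] := pselect (K z); rewrite normr0.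
have DB z : `|'D_v psi z| <= Bd.
  have [/HBd//|nK] := pselect (K z).
  by have [_ ->] := D0 z nK; rewrite normr0.
have [r r0 Kr] := compact_box cK.
have Br0 : 0 <= Br := le_trans (normr_ge0 _) (rhoB 0).
have Lr0 : 0 <= Lr by have := rhoL 0 1 ler01; rewrite mulr1; exact: le_trans.
have mpsi : measurable_fun setT psi by exact: cts_meas.
pose g z := rho z * psi z.
have ig : L1 g.
  apply: (L1_box (M := Br * Bp) (L := r) (a := - r) (b := r)).
  - exact: measurable_funM.
  - by move=> z; rewrite normrM; apply: ler_pM.
  move=> z gn0; have Kz : K z.
    by apply: contrapT => /psi0 p0; move: gn0; rewrite /g p0 mulr0 eqxx.
  by have [h1 h2] := Kr z Kz; split=> //; rewrite -ler_norml.
(* The box is enlarged by the size of [v], because the difference quotients shift the point by up to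
   [v]. *)
pose vb : R := \sum_i `|v.1 0 i| + `|v.2|.
have vb0 : 0 <= \sum_i `|v.1 0 i| by exact: sumr_ge0.
pose Bx := [set z : X | (forall i, - (r + vb) <= z.1 0 i <= r + vb) /\ - (r + vb) <= z.2 <= r + vb].
have rv0 : 0 <= r + vb by rewrite addr_ge0// addr_ge0.
pose C0 := Lr * Bp + Br * Bd.
have C00 : 0 <= C0 by rewrite addr_ge0// mulr_ge0.
pose C z : R := C0 * \1_Bx z.
have iC : L1 C.
  have mB : measurable Bx := measurable_box (fun=> - (r + vb)) (fun=> r + vb) _ _.
  have [iB _] : L1 (\1_Bx : X -> R) /\ Int (\1_Bx : X -> R) = fine (mu Bx).
    apply: L1_indic => //; rewrite /Bx (@xt_box _ _ (fun=> - (r + vb)) (fun=> r + vb)) ?ltry// => [i|]; lra.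
  exact: L1Z.
have Kbox z : K z -> Bx z.
  move=> /Kr[h1 h2]; split=> [i|]; rewrite -ler_norml; first by apply: le_trans (h1 i) _; rewrite lerDl addr_ge0.
  by apply: le_trans h2 _; rewrite lerDl addr_ge0.
have Kbox' z (s : R) : 0 <= s <= 1 -> K (z + s *: v) -> Bx z.
  move=> /andP[s0 s1] /Kr[h1 h2]; split=> [i|]; rewrite -ler_norml.
    have := ler_normB ((z + s *: v).1 0 i) (s * v.1 0 i); rewrite !mxE addrK normrM (ger0_norm s0).
    have := h1 i; rewrite !mxE => h3 h4.
    have h5 : s * `|v.1 0 i| <= vb.
      apply: (@le_trans _ _ `|v.1 0 i|); first by rewrite ler_piMl.
      by rewrite /vb (bigD1 i)//= -addrA lerDl addr_ge0// sumr_ge0.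
    by apply: le_trans h4 _; apply: lerD.
  have := ler_normB ((z + s *: v).2) (s * v.2); rewrite /= addrK normrM (ger0_norm s0) => h4.
  apply: le_trans h4 _; apply: lerD => //.
  by apply: (@le_trans _ _ `|v.2|); [rewrite ler_piMl|rewrite /vb lerDr].
have [||iD ID] := @Int_derive0 R N v g (fun z => drho z * psi z + rho z * 'D_v psi z) C pv ig iC.
- move=> z.
  have dg : is_derive z v g (drho z * psi z + rho z * 'D_v psi z).
    have [Kz|nKz] := pselect (K z).
      have d1 := drhoE z Kz.
      have d2 : is_derive z v psi ('D_v psi z).
        by apply: DeriveDef => //; have [_ /(_ v)[h _]] := Cpsi; exact: h.
      have := is_deriveM d1 d2; rewrite /g /GRing.scale /= addrC [psi z * _]mulrC.
      by [].
    have [_ Dz] := D0 z nKz; rewrite Dz psi0// !mulr0 addr0.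
    apply: (@near_eq_is_derive _ X R (cst 0)).
    by move: (near0 z nKz); apply: filterS => y py; rewrite /g py mulr0.
  have /is_derive_line dl := dg.
  have [dv dE] := dl.
  have cq : h^-1 *: (g ((h *: (1 : R) + 0) *: v + z) - g (0 *: v + z)) @[h --> 0^'] --> drho z * psi z + rho z * 'D_v psi z.
    have := dv; rewrite /derivable => cv; rewrite -dE; exact: cv.
  have /cvgr_dnbhsP := cq => /(_ (fun n => n.+1%:R^-1)).
  have cond : (forall n, (n.+1%:R^-1 : R) != 0) /\ (n.+1%:R^-1 : R) @[n --> \oo] --> (0 : R).
    by split=> [n|]; [rewrite invr_neq0|exact: cvg_harmonic].
  move=> /(_ cond); apply: cvg_trans; apply: near_eq_cvg; near=> n.
  have e1 : ((n.+1%:R^-1 : R) *: (1 : R) + 0) *: v + z = z + n.+1%:R^-1 *: v.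
    by rewrite addr0 [_ *: (1 : R)]mulr1 addrC.
  by rewrite e1 scale0r add0r invrK; exact: mulrC.
- move=> n z.
  have h0 : 0 <= (n.+1%:R^-1 : R) by rewrite invr_ge0.
  have h1 : (n.+1%:R^-1 : R) <= 1 by rewrite invf_le1// ler1n.
  have [nz|/not_orP[nK nK']] := pselect (K z \/ K (z + n.+1%:R^-1 *: v)); last first.
    by rewrite /g !psi0// !mulr0 subrr mul0r normr0 /C mulr_ge0// indicE; case: (_ \in _).
  have Bz : Bx z by case: nz => [/Kbox//|]; apply: Kbox'; rewrite h0.
  rewrite /C indicE mem_set// mulr1 normrM (ger0_norm (x := n.+1%:R))// -ler_pdivlMr//.
  have -> : g (z + n.+1%:R^-1 *: v) - g z = (rho (z + n.+1%:R^-1 *: v) - rho z) * psi z +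
      rho (z + n.+1%:R^-1 *: v) * (psi (z + n.+1%:R^-1 *: v) - psi z) by rewrite /g; ring.
  apply: le_trans (ler_normD _ _) _; rewrite !normrM /C0 mulrDl; apply: lerD.
    by rewrite mulrAC; apply: ler_pM => //; exact: rhoL.
  rewrite -mulrA; apply: ler_pM => //; have := @line_mvt psi v z Bd n.+1%:R^-1 Cpsi DB.
  by rewrite (ger0_norm h0).
by split.
Unshelve. all: by end_near. Qed.

End parts.

(** * From the entropy inequality to a weak identity *)

Section weak_solution.
Context {R : realType} {N : nat}.
Local Notation V := 'rV[R]_N.
Local Notation X := ('rV[R]_N * R)%type.
Notation mu := (@lebesgue_xt R N).
Notation L1 g := (mu.-integrable [set: X] (EFin \o g)).
Notation Int g := (\int[mu]_x g x).

Lemma derive_off_compact (psi : X -> R) (K : set X) v z : compact K ->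
  (forall y, ~ K y -> psi y = 0) -> ~ K z -> is_derive z v psi 0.
Proof.
move=> cK psi0 nK; have Kcl : closed K by apply: compact_closed => //; exact: norm_hausdorff.
apply: (@near_eq_is_derive _ X R (cst 0)).
have : open (~` K) by exact: closed_openC.
by rewrite openE => /(_ z nK); apply: filterS => y /psi0 ->.
Qed.

Lemma L1_compact (rho psi : X -> R) (K : set X) (B : R) : measurable_fun setT rho ->
  (forall z, K z -> `|rho z| <= B) -> continuous psi -> compact K -> (forall z, ~ K z -> psi z = 0) ->
  L1 (fun z => rho z * psi z).
Proof.
move=> mrho rhoB cpsi cK psi0.
have [Bp Bp0 HBp] := cts_compact_bound cpsi cK.
have [r r0 Kr] := compact_box cK.
have K0 z : rho z * psi z != 0 -> K z.
  by move=> nz; apply: contrapT => /psi0 p0; move: nz; rewrite p0 mulr0 eqxx.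
apply: (L1_box (M := `|B| * Bp) (L := r) (a := - r) (b := r)).
- by apply: measurable_funM => //; exact: cts_meas.
- move=> z; have [->|/K0 Kz] := eqVneq (rho z * psi z) 0; first by rewrite normr0 mulr_ge0.
  rewrite normrM; apply: ler_pM => //; last exact: HBp.
  by apply: le_trans (rhoB z Kz) _; exact: ler_norm.
- by move=> z /K0 /Kr[h1 h2]; split=> //; rewrite -ler_norml.
Qed.

Variables (Omega : set V) (T : R).
Notation Q := (cylinder Omega T).
Variables (a : R -> X -> R) (f fx : 'I_N -> V -> R) (c g cq gq dv : X -> R) (al : R -> R -> R).
Variables (F Lf Kc Kg Kd : R).
Hypothesis fx_in : forall i x, Omega x -> fx i x = f i x.
Hypothesis fx_bd : forall i x, `|fx i x| <= F.
Hypothesis fx_lip : forall i, xlip Lf (fx i).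
Hypothesis Omega_open : open Omega.
Hypothesis f_der : forall i x, Omega x -> derivable (f i) x (ei i).
Hypothesis dv_in : forall z, Q z -> dv z = divf f z.1.
Hypothesis dv_meas : measurable_fun setT dv.
Hypothesis dv_bd : forall z, `|dv z| <= Kd.
Hypothesis cq_in : forall z, Q z -> cq z = c z.
Hypothesis cq_meas : measurable_fun setT cq.
Hypothesis cq_bd : forall z, `|cq z| <= Kc.
Hypothesis gq_in : forall z, Q z -> gq z = g z.
Hypothesis gq_meas : measurable_fun setT gq.
Hypothesis gq_bd : forall z, `|gq z| <= Kg.
Hypothesis al_meas : measurable_fun [set: R * R] (fun z : R * R => al z.1 z.2).
Hypothesis al_ge0 : forall s t, 0 <= al s t.
Hypothesis al_cts : forall t, continuous (al ^~ t).
Hypothesis al_bd : forall M, exists B, forall s t, `|s| <= M -> al s t <= B.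
Hypothesis al_a : forall s z, Q z -> a s z = al s z.2.
Hypothesis dxa0 : forall s z i, Q z -> dx i (a s) z = 0.

(** The Kirchhoff transform: as the diffusion does not depend on [x], formally [al u t] times the
    gradient of [u] is the gradient of [primitive u t]. *)
Definition primitive (U t : R) : R := oriented_int 0 U (al ^~ t).

Lemma primitive_meas (U : X -> R) : measurable_fun setT U ->
  measurable_fun setT (fun z => primitive (U z) z.2).
Proof. by move=> mU; exact: oriented_meas al_meas al_ge0 mU meas_time. Qed.

Lemma primitive_bd (M : R) : exists B, forall U t, `|U| <= M -> `|primitive U t| <= B.
Proof.
have [B HB] := al_bd M; exists (`|B| * M) => U t UM.
have M0 : 0 <= M := le_trans (normr_ge0 _) UM.
apply: (@le_trans _ _ (`|B| * `|U - 0|)); last by rewrite subr0 ler_wpM2l.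
apply: O_bound => // s h; rewrite ger0_norm//; apply: le_trans (ler_norm B); apply: HB.
apply: le_trans UM; rewrite ler_norml.
case: h => /andP[h1 h2]; first by rewrite (ger0_norm (x := U)) ?(le_trans h1)//; apply/andP; split; lra.
by rewrite (ler0_norm (x := U)) ?(le_trans h1)//; apply/andP; split; lra.
Qed.

Variables (u u' : X -> R) (M eta0 : R) (Nl : set X) (Gr : 'I_N -> X -> R).
Hypothesis u'_meas : measurable_fun setT u'.
Hypothesis u'_bd : forall z, `|u' z| <= M.
Hypothesis u'_in : forall z, Q z -> ~ Nl z -> u' z = u z.
Hypothesis Nl_meas : measurable Nl.
Hypothesis Nl_null : mu Nl = 0%E.
Hypothesis eta0_gt0 : 0 < eta0.

(** The equation tested with [phi] and integrated by parts, twice in the diffusion; the terms with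
    [fx] and [dv] together are [u'] times minus the divergence of [f * phi]. *)
Definition weak_integrand (phi : X -> R) (z : X) : R :=
  u' z * (dt phi z - \sum_i fx i z.1 * dx i phi z - dv z * phi z - cq z * phi z)
  + primitive (u' z) z.2 * laplacian phi z + gq z * phi z.

Section test.
Variables (phi : X -> R) (K : set X).
Hypothesis phi_C2 : Ck 2 setT phi.
Hypothesis K_compact : compact K.
Hypothesis K_Q : K `<=` Q.
Hypothesis phi_out : forall z, ~ K z -> phi z = 0.

Let D1 v : Ck 1 setT ('D_v phi).
Proof. exact: Ck_derive. Qed.
Let D1_out v z : ~ K z -> 'D_v phi z = 0.
Proof. by move=> nK; have [_ ->] := derive_off_compact v K_compact phi_out nK. Qed.
Let D2_out v w z : ~ K z -> 'D_w ('D_v phi) z = 0.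
Proof. by move=> nK; have [_ ->] := derive_off_compact w K_compact (@D1_out v) nK. Qed.
Let lap_out z : ~ K z -> laplacian phi z = 0.
Proof. by move=> nK; apply: big1 => i _; exact: D2_out. Qed.
Let phi_cts : continuous phi. Proof. exact: Ck_cts phi_C2. Qed.
Let D1_cts v : continuous ('D_v phi). Proof. exact: Ck_cts (D1 v). Qed.
Let D2_cts v w : continuous ('D_w ('D_v phi)).
Proof. by apply: (@Ck_cts _ _ 0); exact: Ck_derive (D1 v). Qed.

Let L1phi (rho : X -> R) (B : R) : measurable_fun setT rho -> (forall z, `|rho z| <= B) -> L1 (fun z => rho z * phi z).
Proof. by move=> m bd; apply: (L1_compact m (B := B)) phi_cts K_compact phi_out => z _. Qed.
Let L1dt (rho : X -> R) (B : R) : measurable_fun setT rho -> (forall z, `|rho z| <= B) -> L1 (fun z => rho z * dt phi z).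
Proof. by move=> m bd; apply: (L1_compact m (B := B)) (@D1_cts _) K_compact (@D1_out _) => z _. Qed.
Let L1dx i (rho : X -> R) (B : R) : measurable_fun setT rho -> (forall z, `|rho z| <= B) -> L1 (fun z => rho z * dx i phi z).
Proof. by move=> m bd; apply: (L1_compact m (B := B)) (@D1_cts _) K_compact (@D1_out _) => z _. Qed.
Let L1lap (rho : X -> R) (B : R) : measurable_fun setT rho -> (forall z, `|rho z| <= B) -> L1 (fun z => rho z * laplacian phi z).
Proof.
move=> m bd; apply: (eq_L1 (h := fun z => \sum_i rho z * dx i (dx i phi) z)).
  by move=> z; rewrite mulr_sumr.
by apply: L1_sum => i; apply: (L1_compact m (B := B)) (@D2_cts _ _) K_compact (@D2_out _ _) => z _.
Qed.

Let fx_meas i : measurable_fun setT (fun z : X => fx i z.1).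
Proof. exact: xlip_meas (fx_lip i). Qed.

Let m1 : measurable_fun setT (fun _ : X => 1 : R). Proof. exact: measurable_cst. Qed.
Let b1 : forall z : X, `|1 : R| <= 1. Proof. by move=> z; rewrite normr1. Qed.

Lemma parts_dt : Int (fun z => 1 * dt phi z) = 0.
Proof.
have [||_] := @parts_zero R N (0, 1) (cst 1) (cst 0) phi K 1 0 (@preserves_t R N) m1 b1 _ _ K_compact phi_out _.
- by move=> z s s0; rewrite subrr normr0 mul0r.
- exact: CkW.
by move=> <-; apply: eq_Int => z; rewrite /= mul0r add0r.
Qed.

Lemma line_const (h : R -> R) (v z : X) : v.2 = 0 -> is_derive z v (fun y : X => h y.2) 0.
Proof.
move=> v0; apply/is_derive_line.
have -> : (fun s : R => h (s *: v + z).2) = cst (h z.2).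
  by apply/funext => s /=; rewrite v0 scaler0 add0r.
exact: is_derive_cst.
Qed.

Lemma parts_dx : Int (fun z => \sum_i fx i z.1 * dx i phi z) = - Int (fun z => dv z * phi z).
Proof.
pose df i (z : X) := 'D_(ei i) (f i) z.1.
have key i : L1 (fun z => df i z * phi z + fx i z.1 * dx i phi z) /\
    Int (fun z => df i z * phi z + fx i z.1 * dx i phi z) = 0.
  have Lf0 : 0 <= Lf.
    have := @fx_lip i 0 0 1; rewrite !subrr normr0 mulr1; apply => j.
    by rewrite subrr normr0.
  apply: (parts_zero (Br := F) (Lr := Lf) (@preserves_x R N i) (fx_meas i) _ _ _ K_compact phi_out) => //.
  - move=> z s s0; apply: fx_lip => j; rewrite /= !mxE addrAC subrr add0r.
    by rewrite normrM (ger0_norm s0) ler_piMr//; case: (_ && _); rewrite ?normr1 ?normr0.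
  - exact: CkW.
  - move=> z /K_Q[Oz _].
    have d0 : is_derive z.1 (ei i) (fx i) (df i z).
      apply: (@near_eq_is_derive _ V R (f i)); last by apply: DeriveDef => //; exact: f_der.
      have : nbhs z.1 Omega by exact: open_nbhs_nbhs.
      by apply: filterS => y Oy; rewrite fx_in.
    apply/is_derive_line; move/is_derive_line : d0.
    by rewrite (_ : (fun s : R => fx i (s *: ei i + z.1)) = (fun s : R => fx i (s *: ((ei i, 0) : X) + z).1)).
have ifx : L1 (fun z => \sum_i fx i z.1 * dx i phi z).
  by apply: L1_sum => i; apply: (@L1dx i _ F).
have idv : L1 (fun z => dv z * phi z) by exact: L1phi dv_meas dv_bd.
apply/eqP; rewrite -addr_eq0 -(IntD ifx idv); apply/eqP.
have S0 : \sum_i Int (fun z => df i z * phi z + fx i z.1 * dx i phi z) = 0.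
  by apply: big1 => i _; have [] := key i.
rewrite -[RHS]S0 -Int_sum => [|i]; last by have [] := key i.
apply: eq_Int => z; rewrite big_split /= addrC; congr (_ + _).
have [Kz|nK] := pselect (K z); last by rewrite phi_out// !mulr0 big1// => i _; rewrite mulr0.
by rewrite dv_in; [rewrite /divf mulr_suml|exact: K_Q].
Qed.

(** Disposes of the part of [A_eta] that depends on time alone, see [A_split]. *)
Lemma parts_lap (r : R -> R) (B : R) : measurable_fun setT (fun z : X => r z.2) ->
  (forall t, `|r t| <= B) -> Int (fun z => r z.2 * laplacian phi z) = 0.
Proof.
move=> mr rB.
have key i : L1 (fun z => 0 * dx i phi z + r z.2 * dx i (dx i phi) z) /\
    Int (fun z => 0 * dx i phi z + r z.2 * dx i (dx i phi) z) = 0.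
  apply: (parts_zero (rho := fun z : X => r z.2) (drho := fun=> 0) (psi := dx i phi)
    (Br := B) (Lr := 0) (@preserves_x R N i) mr _ _ _ K_compact (@D1_out _)) => //.
  - by move=> z s s0; have -> : (z + s *: ((ei i, 0) : X)).2 = z.2 by [rewrite /= scaler0 addr0]; rewrite subrr normr0 mul0r.
  - exact: D1.
  - by move=> z _; exact: line_const.
have S0 : \sum_i Int (fun z => 0 * dx i phi z + r z.2 * dx i (dx i phi) z) = 0.
  by apply: big1 => i _; have [] := key i.
rewrite -[RHS]S0 -Int_sum => [|i]; last by have [] := key i.
apply: eq_Int => z; rewrite mulr_sumr; apply: eq_bigr => i _.
by rewrite mul0r add0r.
Qed.

Lemma weak_L1 : L1 (weak_integrand phi).
Proof.
have M0 : 0 <= M := le_trans (normr_ge0 _) (u'_bd 0).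
have [B HB] := primitive_bd M.
have mp := primitive_meas u'_meas.
apply: (L1D (f := fun z => u' z * (dt phi z - \sum_i fx i z.1 * dx i phi z - dv z * phi z - cq z * phi z)
  + primitive (u' z) z.2 * laplacian phi z)); last exact: L1phi gq_meas gq_bd.
apply: L1D; last by apply: (L1lap (B := B)) => // z; exact: HB.
apply: (eq_L1 (h := fun z => u' z * dt phi z - \sum_i (u' z * fx i z.1) * dx i phi z - (u' z * dv z) * phi z
   - (u' z * cq z) * phi z)).
  move=> z; rewrite !mulrBr !mulrA mulr_sumr; congr (_ - _ - _ - _).
  by apply: eq_bigr => i _; rewrite mulrA.
apply: L1B; last first.
  apply: (L1phi (B := M * Kc)); first exact: measurable_funM.
  by move=> z; rewrite normrM; apply: ler_pM.
apply: L1B; last first.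
  apply: (L1phi (B := M * Kd)); first exact: measurable_funM.
  by move=> z; rewrite normrM; apply: ler_pM.
apply: L1B; first exact: L1dt u'_meas u'_bd.
apply: L1_sum => i; apply: (@L1dx i _ (M * F)); first exact: measurable_funM.
by move=> z; rewrite normrM; apply: ler_pM.
Qed.

Section side.
Variables (sg eta : R).
Hypothesis sgP : sg = 1 \/ sg = -1.
Hypothesis eta_gt0 : 0 < eta.
Hypothesis eta_lt1 : eta < 1.
(** This [k] lies at distance at least 1 beyond the range of [u'], on the side given
    by [sg], so that [S_eta eta (u' - k)] is the constant [side_mass eta sg]. *)
Let k : R := - (sg * (M + 1)).
Hypothesis entropy : entropy_ineq Q a f c g u Gr phi k eta.

Let sg2 : sg * sg = 1.
Proof. by case: sgP => ->; rewrite ?mulr1// mulrNN mulr1. Qed.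

Let far U : `|U| <= M -> 1 <= sg * (U - k).
Proof.
rewrite /k opprK mulrDr mulrA sg2 mul1r ler_norml => /andP[? ?].
by case: sgP => ->; lra.
Qed.

Lemma S_sign y : 0 <= sg * y -> S_eta eta y = sg * `|S_eta eta y|.
Proof.
have hc := h_cts eta_gt0.
have z p q : p <= q -> 0 <= oriented_int p q (h_eta eta).
  move=> pq; rewrite -(mul0r (q - p)) -O_cst; apply: O_le => //; first exact: cst_continuous.
  by move=> s _; have /andP[] := h_bd eta_gt0 s.
case: sgP => ->; rewrite ?mul1r ?mulN1r => y0.
  by rewrite ger0_norm//; exact: z.
have S0 : S_eta eta y <= 0.
  by rewrite /S_eta O_anti// oppr_le0; apply: z; rewrite -oppr_ge0.
by rewrite ler0_norm// opprK.
Qed.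

(** The absolute value makes the integrand nonnegative, as [oriented_meas] asks; by [S_sign] the
    sign reappears as the factor [sg] in [r]. *)
Let rho s t : R := al s t * `|S_eta eta (s - k)|.
Let r t : R := sg * oriented_int k 0 (fun s => rho s t).
Let m := side_mass eta sg.
(** On that side [I_eta eta (U - k) = e + m * U]. *)
Let e := I_eta eta (sg * eta) - m * (k + sg * eta).

Let S_shift_cts : continuous (fun s => S_eta eta (s - k)).
Proof.
move=> s; apply: (@cvg_comp _ _ _ (fun s => s - k) (S_eta eta)); last exact: S_cts.
by apply: cvgB; [exact: cvg_id|exact: cvg_cst].
Qed.

Let al_S_cts t : continuous (fun s => al s t * S_eta eta (s - k)).
Proof. by move=> s; apply: cvgM; [exact: al_cts|exact: S_shift_cts]. Qed.

Let rho_cts t : continuous (fun s => rho s t).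
Proof.
move=> s; apply: cvgM; first exact: al_cts.
by apply: cvg_norm; exact: S_shift_cts.
Qed.

Let r_meas : measurable_fun setT (fun z : X => r z.2).
Proof.
apply: measurable_funM => //; apply: oriented_meas; [|by move=> s t; rewrite mulr_ge0| |exact: meas_time].
  apply: measurable_funM => //.
  have mS : measurable_fun [set: R] (fun s : R => `|S_eta eta (s - k)|).
    apply: measurableT_comp => //; exact: continuous_measurable_fun.
  exact: (measurableT_comp mS measurable_fst).
exact: measurable_cst.
Qed.

Let r_bd : exists B, forall t, `|r t| <= B.
Proof.
have [B HB] := al_bd `|k|.
exists (`|B| * (2 / eta * `|k|) * `|0 - k|) => t; rewrite /r normrM.
have -> : `|sg| = 1 by case: sgP => ->; rewrite ?normrN normr1.
rewrite mul1r; apply: O_bound => // s h.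
have hs : `|s| <= `|k| /\ `|s - k| <= `|k|.
  case: h => /andP[h1 h2].
    by rewrite (ler0_norm (x := s))// (ler0_norm (x := k)) ?(le_trans h1)// ger0_norm ?subr_ge0//; split; lra.
  by rewrite (ger0_norm (x := s))// (ger0_norm (x := k)) ?(le_trans h1)// ler0_norm ?subr_le0//; split; lra.
rewrite /rho normrM normr_id; apply: ler_pM => //.
  by rewrite ger0_norm//; apply: le_trans (ler_norm B); apply: HB; have [] := hs.
apply: le_trans (S_bd eta_gt0 _) _; rewrite ler_wpM2l ?divr_ge0// ?(ltW eta_gt0)//.
by have [] := hs.
Qed.

(** The integral is cut at 0: the part from [k] to 0 contains the variation of [S_eta] but not [U],
    while from 0 to [U] the function [S_eta] is the constant [m]. *)
Let A_split U t : `|U| <= M -> oriented_int k U (fun s => al s t * S_eta eta (s - k)) =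
  r t + m * primitive U t.
Proof.
move=> UM; rewrite -(O_chasles k 0 U (@al_S_cts t)); congr (_ + _).
  rewrite /r -(O_Z _ _ _ (@rho_cts t)); apply: O_ext => s h.
  rewrite /rho mulrCA; congr (_ * _); apply: S_sign.
  have M0 : 0 <= M := le_trans (normr_ge0 _) UM.
  by case: h; rewrite /k; case: sgP => -> /andP[h1 h2]; rewrite ?mul1r ?mulN1r in h1 h2 *; lra.
rewrite /primitive -(O_Z _ _ _ (@al_cts t)); apply: O_ext => s h.
rewrite mulrC; congr (_ * _); apply: S_side => //; apply: le_trans (ltW eta_lt1) _; apply: far.
apply: le_trans UM; rewrite ler_norml.
case: h => /andP[h1 h2]; first by rewrite (ger0_norm (x := U)) ?(le_trans h1)//; apply/andP; split; lra.
by rewrite (ler0_norm (x := U)) ?(le_trans h1)//; apply/andP; split; lra.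
Qed.

(** Every term of the entropy inequality is affine in the terms of the weak identity. The integrals
    paired with the additive constants vanish, except those that reduce to the divergence of [f],
    and these carry a factor of order [eta]. *)
Lemma side_ineq : 0 <= m * Int (weak_integrand phi) + 6 * eta * `|Int (fun z => dv z * phi z)|.
Proof.
have M0 : 0 <= M := le_trans (normr_ge0 _) (u'_bd 0).
have [d d_bd dE] := D_side eta_gt0 sgP.
have farz z : eta < sg * (u' z - k) by apply: lt_le_trans eta_lt1 _; apply: far.
pose h1 z := u' z * dt phi z.
pose h2 z := \sum_i (u' z * fx i z.1) * dx i phi z.
pose h3 z := primitive (u' z) z.2 * laplacian phi z.
pose h4 z := (u' z * dv z) * phi z.
pose h5 z := (u' z * cq z) * phi z.
pose h6 z := gq z * phi z.
pose k1 z := 1 * dt phi z.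
pose k2 z := \sum_i fx i z.1 * dx i phi z.
pose k3 z := r z.2 * laplacian phi z.
pose k4 z := dv z * phi z.
have [B HB] := primitive_bd M.
have [Br HBr] := r_bd.
have i1 : L1 h1 by exact: L1dt u'_meas u'_bd.
have i2 : L1 h2.
  apply: L1_sum => i; apply: (@L1dx i _ (M * F)); first exact: measurable_funM.
  by move=> z; rewrite normrM; apply: ler_pM.
have i3 : L1 h3.
  by apply: (L1lap (B := B)) => [|z]; [exact: primitive_meas|exact: HB].
have i4 : L1 h4.
  apply: (L1phi (B := M * Kd)); first exact: measurable_funM.
  by move=> z; rewrite normrM; apply: ler_pM.
have i5 : L1 h5.
  apply: (L1phi (B := M * Kc)); first exact: measurable_funM.
  by move=> z; rewrite normrM; apply: ler_pM.
have i6 : L1 h6 by exact: L1phi gq_meas gq_bd.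
have j1 : L1 k1 by exact: L1dt m1 b1.
have j2 : L1 k2 by apply: L1_sum => i; apply: (@L1dx i _ F).
have j3 : L1 k3 by exact: L1lap r_meas (fun z => HBr z.2).
have j4 : L1 k4 by exact: L1phi dv_meas dv_bd.
have z1 : Int k1 = 0 by exact: parts_dt.
have z2 : Int k2 = - Int k4 by exact: parts_dx.
have z3 : Int k3 = 0 by exact: parts_lap r_meas HBr.
have wE : Int (weak_integrand phi) = Int h1 - Int h2 - Int h4 - Int h5 + Int h3 + Int h6.
  have [a1 e1] := IntDZ (-1) i1 i2; have [a2 e2] := IntDZ (-1) a1 i4.
  have [a3 e3] := IntDZ (-1) a2 i5; have [a4 e4] := IntDZ 1 a3 i3; have [a5 e5] := IntDZ 1 a4 i6.
  have -> : Int (weak_integrand phi) = Int (fun z => h1 z + -1 * h2 z + -1 * h4 z + -1 * h5 z + 1 * h3 z + 1 * h6 z).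
    apply: eq_Int => z; rewrite /weak_integrand /h1 /h2 /h3 /h4 /h5 /h6.
    have -> : \sum_i u' z * fx i z.1 * dx i phi z = u' z * \sum_i fx i z.1 * dx i phi z.
      by rewrite mulr_sumr; apply: eq_bigr => i _; rewrite mulrA.
    by ring.
  by rewrite e5 e4 e3 e2 e1; ring.
have Kout z : ~ Q z -> ~ K z by move=> nQ /K_Q.
have := entropy; rewrite /entropy_ineq.
rewrite (@Rintegral_null _ _ _ mu _ (fun z => m * h1 z + e * k1 z + (- m) * h2 z + (- e) * k2 z + 1 * k3 z + m * h3 z) Q Nl)//; last 2 first.
- move=> z Qz nNz; have uz := u'_in Qz nNz; rewrite -uz.
  have IE : I_eta eta (u' z - k) = e + m * u' z.
    by rewrite (I_side eta_gt0 sgP (ltW (farz z))) /e -/m; ring.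
  have AE : A_eta eta a (u' z) z k = r z.2 + m * primitive (u' z) z.2.
    rewrite -(A_split _ (u'_bd z)) /A_eta; apply: O_ext => s _.
    by rewrite al_a.
  have SE : \sum_i derive1 (S_eta eta) (u' z - k) * `|Gr i z| ^+ 2 * phi z = 0.
    by apply: big1 => i _; rewrite (dS_side eta_gt0 sgP (farz z)) !mul0r.
  rewrite IE AE SE subr0.
  have -> : \sum_i f i z.1 * (e + m * u' z) * dx i phi z = e * k2 z + m * h2 z.
    rewrite /k2 /h2 !mulr_sumr -big_split /=; apply: eq_bigr => i _.
    by rewrite fx_in; [ring|case: Qz].
  by rewrite /h1 /k1 /k3 /h3; ring.
- move=> z /Kout nK; rewrite /h1 /k1 /h2 /k2 /k3 /h3 lap_out// /dt D1_out// !big1.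
  + by rewrite !mulr0 !addr0.
  + by move=> i _; rewrite /dx D1_out// mulr0.
  + by move=> i _; rewrite /dx D1_out// mulr0.
rewrite (@Rintegral_null _ _ _ mu _ (fun=> 0) Q Nl)//; last first.
  move=> z Qz nNz; apply: big1 => i _; rewrite (_ : (fun s => _) = fun=> 0).
    by rewrite O_cst mul0r mul0r.
  by apply/funext => s; rewrite dxa0// mul0r.
rewrite (@Rintegral_null _ _ _ mu _ (fun z => m * h4 z + (- (m * k)) * k4 z) Q Nl)//; last 2 first.
- move=> z Qz nNz; rewrite -(u'_in Qz nNz) (S_side eta_gt0 sgP (ltW (farz z))) -dv_in// /h4 /k4 -/m.
  by ring.
- by move=> z /Kout nK; rewrite /h4 /k4 phi_out// !mulr0 addr0.
rewrite (@Rintegral_null _ _ _ mu _ (fun z => d k * k4 z) Q Nl)//; last 2 first.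
- move=> z Qz nNz; rewrite -(u'_in Qz nNz) (dE _ _ (ltW (farz z))) -dv_in// /k4.
  by ring.
- by move=> z /Kout nK; rewrite /k4 phi_out// !mulr0.
rewrite (@Rintegral_null _ _ _ mu _ (fun z => m * h5 z + (- m) * h6 z) Q Nl)//; last 2 first.
- move=> z Qz nNz; rewrite -(u'_in Qz nNz) (S_side eta_gt0 sgP (ltW (farz z))) -cq_in// -gq_in// /h5 /h6 -/m.
  by ring.
- by move=> z /Kout nK; rewrite /h5 /h6 phi_out// !mulr0 addr0.
have [a1 e1] := IntDZ e (L1Z m i1) j1; have [a2 e2] := IntDZ (- m) a1 i2.
have [a3 e3] := IntDZ (- e) a2 j2; have [a4 e4] := IntDZ 1 a3 j3; have [a5 e5] := IntDZ m a4 i3.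
have [_ e6] := IntDZ (- (m * k)) (L1Z m i4) j4.
have [_ e7] := IntDZ (- m) (L1Z m i5) i6.
rewrite e5 e4 e3 e2 e1 e6 e7 Rintegral_cst// mul0r (IntZ m i1) (IntZ m i4) (IntZ m i5) (IntZ (d k) j4).
rewrite z1 z2 z3 wE => H; apply: le_trans H _.
(* The large terms in [k] cancel in [e + m * k]; each of the three terms left is at most
   [2 * eta]. *)
have E : `|e + m * k + d k| <= 6 * eta.
  have -> : e + m * k + d k = I_eta eta (sg * eta) - m * sg * eta + d k by rewrite /e; ring.
  apply: le_trans (ler_normD _ _) _; have -> : 6 * eta = 2 * eta + 2 * eta + 2 * eta by ring.
  apply: lerD (d_bd k); apply: le_trans (ler_normB _ _) _; apply: lerD; first exact: I_edge.
  rewrite normrM (gtr0_norm eta_gt0) ler_pM2r//.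
  have /andP[q1 q2] := side_mass_bd eta_gt0 sgP.
  by rewrite mulrC -/m ger0_norm// (le_trans _ q1).
apply: (@le_trans _ _ (m * (Int h1 - Int h2 - Int h4 - Int h5 + Int h3 + Int h6) + (e + m * k + d k) * Int k4)).
  by rewrite le_eqVlt; apply/orP; left; apply/eqP; ring.
rewrite lerD2l; apply: le_trans (ler_norm _) _; rewrite normrM.
exact: ler_wpM2r.
Qed.

End side.

(** The two choices of [sg] give the two opposite inequalities as [eta] tends to 0. *)
Lemma weak_solution_test :
  (forall kk eta : R, 0 < eta < eta0 -> entropy_ineq Q a f c g u Gr phi kk eta) ->
  Int (weak_integrand phi) = 0.
Proof.
move=> ent; set I := Int (weak_integrand phi); set D := `|Int (fun z => dv z * phi z)|.
have D0 : 0 <= D by exact: normr_ge0.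
have key sg : sg = 1 \/ sg = -1 -> 0 <= sg * I.
  move=> sgP; apply/ler_addgt0Pr => ep ep0.
  (* 12 is the 6 of [side_ineq] divided by the lower bound [2^-1] of [side_mass_bd]. *)
  pose eta := Num.min (eta0 / 2) (Num.min 2^-1 (ep / (12 * (D + 1)))).
  have D1' : 0 < 12 * (D + 1) by rewrite mulr_gt0// ltr_wpDl.
  have et0 : 0 < eta by rewrite !lt_min divr_gt0//= invr_gt0 ltr0n /= divr_gt0.
  have et1 : eta < 1.
    apply: (@le_lt_trans _ _ 2^-1); last by rewrite invf_lt1 ?ltr1n.
    by rewrite ge_min; apply/orP; right; rewrite ge_min lexx.
  have et2 : eta < eta0.
    apply: (@le_lt_trans _ _ (eta0 / 2)); first by rewrite ge_min lexx.
    by rewrite ltr_pdivrMr// ltr_pMr// ltr1n.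
  have et3 : eta <= ep / (12 * (D + 1)).
    by rewrite ge_min; apply/orP; right; rewrite ge_min lexx orbT.
  have := side_ineq sgP et0 et1 (ent _ eta ltac:(by rewrite et0)).
  have /andP[q1 q2] := side_mass_bd et0 sgP; rewrite -/I -/D.
  move: (side_mass eta sg) q1 q2 => m q1 q2 H.
  have e12 : 12 * eta * D <= ep.
    move: et3; rewrite ler_pdivlMr// => H3; apply: le_trans H3.
    have : 0 <= eta by exact: ltW.
    by move=> ?; lra.
  have sg2 : sg * sg = 1 by case: sgP => ->; rewrite ?mulr1// mulrNN mulr1.
  have mE : m = sg * (sg * m) by rewrite mulrA sg2 mul1r.
  rewrite leNgt; apply/negP => neg.
  have neg' : sg * I < - ep by lra.
  have : m * I = (sg * m) * (sg * I).
    by rewrite [sg * m]mulrC -mulrA [sg * (sg * I)]mulrA sg2 mul1r.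
  move: (m * I) (sg * m) (sg * I) H q1 q2 neg' e12 => x y w H q1 q2 neg' e12 xE.
  have : y * w <= 2^-1 * w.
    by apply: ler_wnM2r => //; have := ep0; lra.
  by rewrite -xE; lra.
have := key 1 (or_introl erefl); have := key (-1) (or_intror erefl).
by rewrite mulN1r mul1r => h1 h2; apply/eqP; rewrite eq_le h2 andbT -oppr_ge0.
Qed.

End test.
End weak_solution.

(** * Test functions that do not vanish on the boundary *)

Section ramp.
Context {R : realType}.

(** Third differences of truncated powers: [kapF] is [spl3 3 / 6], a step from 0 to 1 on
    [[0, 3]]. *)
Definition spl3 (n : nat) (y : R) : R :=
  ppow n y - 3 * ppow n (y - 1) + 3 * ppow n (y - 2) - ppow n (y - 3).

Lemma is_derive_spl3 n x : is_derive x (1 : R) (spl3 n.+2) (n.+2%:R * spl3 n.+1 x).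
Proof.
have sh c : is_derive x (1 : R) (fun y : R => ppow n.+2 (y - c)) (n.+2%:R * ppow n.+1 (x - c)).
  apply: is_derive_eq.
    apply: (@is_derive1_comp _ (ppow n.+2) (fun y => y - c)); exact: is_derive_ppow.
  by rewrite subr0 mulr1.
have := is_derive_ppow n x => ?.
rewrite /spl3.
apply: is_derive_eq.
by rewrite /GRing.scale /=; ring.
Qed.

Lemma spl3_cts n : continuous (spl3 n).
Proof.
have sh c : continuous (fun y : R => ppow n (y - c)).
  move=> x; apply: (@cvg_comp _ _ _ (fun y => y - c) (ppow n)); last exact: continuous_ppow.
  by apply: cvgB; [exact: cvg_id|exact: cvg_cst].
move=> x; rewrite /spl3.
have M c d : c * ppow n (y - d) @[y --> x] --> c * ppow n (x - d).
  by apply: (cvgM (cvg_cst c)); exact: sh.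
exact: (cvgB (cvgD (cvgB (@continuous_ppow R n x) (M 3 1)) (M 3 2)) (sh 3 x)).
Qed.

Lemma spl3_out y : (y <= 0) || (3 <= y) -> spl3 2 y = 0.
Proof.
by case/orP => y0; rewrite /spl3; [rewrite !ppow_neg; lra|rewrite !ppow_pos; try lra; ring].
Qed.

Lemma spl3_bd y : `|spl3 2 y| <= 24.
Proof.
have [y0|y0] := leP y 0; first by rewrite spl3_out ?y0// normr0 ler0n.
have [y3|y3] := leP 3 y; first by rewrite spl3_out ?y3 ?orbT// normr0 ler0n.
have B c k : (0 <= c) -> (y - c <= k) -> 0 <= k -> 0 <= ppow 2 (y - c) <= k ^+ 2.
  move=> c0 yk k0; have [h|h] := leP 0 (y - c).
    by rewrite ppow_pos// exprn_ge0//= lerXn2r// nnegrE.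
  by rewrite ppow_neg ?(ltW h)// lexx exprn_ge0.
have := B 0 3; rewrite subr0 => B0.
have /andP[p1 p2] : 0 <= ppow 2 y <= 3 ^+ 2 by apply: B0; lra.
have /andP[q1 q2] : 0 <= ppow 2 (y - 1) <= 2 ^+ 2 by apply: B; lra.
have /andP[r1 r2] : 0 <= ppow 2 (y - 2) <= 1 ^+ 2 by apply: B; lra.
have /andP[s1 s2] : 0 <= ppow 2 (y - 3) <= 0 ^+ 2 by apply: B; lra.
by rewrite /spl3 ler_norml; apply/andP; split; lra.
Qed.

(** A step in time of class C^2 that rises on [[s, 4 * s]]. *)
Definition ramp (s t : R) : R := kapF (t / s - 1).
Definition ramp1 (s t : R) : R := spl3 2 (t / s - 1) / (2 * s).
Definition ramp2 (s t : R) : R := spl3 1 (t / s - 1) / s ^+ 2.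

Lemma ramp_slot (s : R) : s != 0 -> C2_slot (ramp s) (ramp1 s) (ramp2 s).
Proof.
move=> s0.
have key (g g1 : R -> R) (y c : R) : (forall y : R, is_derive y (1 : R) g (g1 y)) ->
    is_derive y (1 : R) (fun y : R => c * g (y / s - 1)) (c * (s^-1 * g1 (y / s - 1))).
  move=> dg; apply: is_deriveMl.
  have lE (r : R) : (r *: (1 : R) + y) / s - 1 = (y / s - 1) + r * s^-1.
    by rewrite /GRing.scale /=; ring.
  exact: (@is_derive_comp_line R R g (fun y => y / s - 1) y 1 s^-1 _ lE (dg _)).
split=> [y|y|].
- have -> : ramp s = (fun y => 6^-1 * spl3 3 (y / s - 1)).
    by apply/funext => t; rewrite /ramp /kapF mulrC.
  have -> : ramp1 s y = 6^-1 * (s^-1 * (3 * spl3 2 (y / s - 1))) by rewrite /ramp1; field.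
  by apply: (key (spl3 3) (fun y => 3 * spl3 2 y)) => t; exact: is_derive_spl3.
- have -> : ramp1 s = (fun y => (2 * s)^-1 * spl3 2 (y / s - 1)).
    by apply/funext => t; rewrite /ramp1 mulrC.
  have -> : ramp2 s y = (2 * s)^-1 * (s^-1 * (2 * spl3 1 (y / s - 1))) by rewrite /ramp2; field.
  by apply: (key (spl3 2) (fun y => 2 * spl3 1 y)) => t; exact: is_derive_spl3.
- move=> y; apply: cvgMl.
  apply: (@cvg_comp _ _ _ (fun y : R => y / s - 1) (spl3 1)); last exact: spl3_cts.
  by apply: cvgB; [apply: cvgMl; exact: cvg_id|exact: cvg_cst].
Qed.

Lemma ramp_bd (s t : R) : 0 <= ramp s t <= 1.
Proof. exact: kapF_bound. Qed.

Lemma ramp0 (s t : R) : 0 < s -> t <= s -> ramp s t = 0.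
Proof. by move=> s0 ts; apply: kapF0; rewrite subr_le0 ler_pdivrMr// mul1r. Qed.

Lemma ramp_1 (s t : R) : 0 < s -> 4 * s <= t -> ramp s t = 1.
Proof. by move=> s0 ts; apply: kapF1; rewrite lerBrDr ler_pdivlMr//; lra. Qed.

Lemma ramp1_bd (s t : R) : 0 < s -> `|ramp1 s t| <= 12 / s.
Proof.
move=> s0; rewrite /ramp1 normrM normfV (gtr0_norm (x := 2 * s)); last by rewrite mulr_gt0.
rewrite ler_pdivrMr ?mulr_gt0//; apply: le_trans (spl3_bd _) _.
by rewrite le_eqVlt; apply/orP; left; apply/eqP; field; rewrite gt_eqF.
Qed.

Lemma ramp1_out (s t : R) : 0 < s -> (4 * s <= t) -> ramp1 s t = 0.
Proof.
move=> s0 ts; rewrite /ramp1 spl3_out ?mul0r//; apply/orP; right.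
by rewrite lerBrDr ler_pdivlMr//; lra.
Qed.

End ramp.

(** * The adjoint operator on products with cutoffs *)

Section adjoint_operator.
Context {R : realType} {N : nat}.
Local Notation V := 'rV[R]_N.
Local Notation X := ('rV[R]_N * R)%type.
Notation mu := (@lebesgue_xt R N).
Notation L1 g := (mu.-integrable [set: X] (EFin \o g)).
Notation Int g := (\int[mu]_x g x).

Lemma Ck_is_derive k (g : X -> R) (v z : X) : Ck k.+1 setT g -> is_derive z v g ('D_v g z).
Proof. by move=> [_ /(_ v)[d _]]; apply: DeriveDef => //; exact: d. Qed.

Lemma is_derive_prod (g h : X -> R) (z v : X) (a b : R) : is_derive z v g a -> is_derive z v h b ->
  is_derive z v (fun y => g y * h y) (a * h z + g z * b).
Proof.
move=> dg dh; have := @is_deriveM _ _ g h z v a b dg dh.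
by move=> d; apply: is_derive_eq; rewrite /GRing.scale /=; ring.
Qed.

Lemma derive_time (h h1 : R -> R) (z : X) : is_derive z.2 (1 : R) h (h1 z.2) ->
  is_derive z ((0, 1) : X) (fun y : X => h y.2) (h1 z.2).
Proof.
move=> dh; have lE (r : R) : (r *: ((0, 1) : X) + z).2 = z.2 + r * 1.
  by rewrite /= addrC.
have := @is_derive_comp_line R X h (fun y : X => y.2) z (0, 1) 1 _ lE dh.
by rewrite mul1r.
Qed.

Variables (b cc : X -> R) (f : 'I_N -> V -> R).
Variables (Bb K F : R).
Hypothesis b_meas : measurable_fun setT b.
Hypothesis b_bd : forall z, 0 <= b z <= Bb.
Hypothesis cc_meas : measurable_fun setT cc.
Hypothesis cc_bd : forall z, `|cc z| <= K.
Hypothesis f_bd : forall i x, `|f i x| <= F.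
Hypothesis f_meas : forall i, measurable_fun setT (fun z : X => f i z.1).

Lemma adj_opB (g h : X -> R) z : Ck 2 setT g -> Ck 2 setT h ->
  adj_op b cc f (fun z => g z - h z) z = adj_op b cc f g z - adj_op b cc f h z.
Proof.
have DB k (g' h' : X -> R) v y : Ck k.+1 setT g' -> Ck k.+1 setT h' ->
    'D_v (fun z => g' z - h' z) y = 'D_v g' y - 'D_v h' y.
  move=> [_ /(_ v)[dg _]] [_ /(_ v)[dh _]].
  by apply: deriveB; [exact: dg|exact: dh].
move=> Cg Ch; have E v y := DB 1%N g h v y Cg Ch.
have F1 : \sum_i f i z.1 * dx i (fun z => g z - h z) z =
    \sum_i f i z.1 * dx i g z - \sum_i f i z.1 * dx i h z.
  by rewrite -sumrB; apply: eq_bigr => i _; rewrite /dx E mulrBr.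
have Ft : dt (fun z => g z - h z) z = dt g z - dt h z by exact: E.
have Fl : laplacian (fun z => g z - h z) z = laplacian g z - laplacian h z.
  rewrite -sumrB; apply: eq_bigr => i _.
  have Ei : dx i (fun z => g z - h z) = (fun z => dx i g z - dx i h z).
    by apply/funext => y; exact: E.
  by rewrite Ei; exact: (DB 0%N _ _ _ _ (Ck_derive (ei i, 0) Cg) (Ck_derive (ei i, 0) Ch)).
rewrite /adj_op Ft F1 Fl.
move: (dt g z) (dt h z) (laplacian g z) (laplacian h z) => p q r s.
by move: (\sum_i _) (\sum_i _) => S1 S2; ring.
Qed.

Lemma compact_bd (psi : X -> R) (Ks : set X) : continuous psi -> compact Ks ->
  (forall z, ~ Ks z -> psi z = 0) -> exists2 B : R, 0 <= B & forall z, `|psi z| <= B.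
Proof.
move=> c cK psi0; have [B B0 HB] := cts_compact_bound c cK; exists B => // z.
by have [/HB//|/psi0->] := pselect (Ks z); rewrite normr0.
Qed.

Lemma adj_op_bd (phi : X -> R) (Ks : set X) : Ck 2 setT phi -> compact Ks ->
  (forall z, ~ Ks z -> phi z = 0) ->
  measurable_fun setT (adj_op b cc f phi) /\ exists2 B : R, 0 <= B & forall z, `|adj_op b cc f phi z| <= B.
Proof.
move=> Cp cK p0.
have D0 v z : ~ Ks z -> 'D_v phi z = 0.
  by move=> nK; have [_ ->] := derive_off_compact v cK p0 nK.
have D20 v z : ~ Ks z -> 'D_v ('D_v phi) z = 0.
  by move=> nK; have [_ ->] := derive_off_compact v cK (D0 v) nK.
have C1 v : Ck 1 setT ('D_v phi) by exact: Ck_derive.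
have C0 v : Ck 0 setT ('D_v ('D_v phi)) by exact: Ck_derive.
split.
  apply: measurable_funD; last by apply: measurable_funM => //; exact: laplacian_meas.
  apply: measurable_funB; last by apply: measurable_funM => //; exact: Ck_meas Cp.
  apply: measurable_funB; first exact: Ck_meas (C1 _).
  by apply: measurable_sum => i; apply: measurable_funM => //; exact: Ck_meas (C1 _).
have [B1 B10 H1] := compact_bd (Ck_cts Cp) cK p0.
have [B2 B20 H2] := compact_bd (Ck_cts (C1 (0, 1))) cK (D0 _).
have /choice[B3 H3] : forall i : 'I_N, exists B : R, 0 <= B /\ forall z, `|dx i phi z| <= B.
  by move=> i; have [B B0 H] := compact_bd (Ck_cts (C1 (ei i, 0))) cK (D0 _); exists B.
have /choice[B4 H4] : forall i : 'I_N, exists B : R, 0 <= B /\ forall z, `|dx i (dx i phi) z| <= B.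
  by move=> i; have [B B0 H] := compact_bd (Ck_cts (C0 (ei i, 0))) cK (D20 _); exists B.
exists (B2 + \sum_i `|F| * B3 i + `|K| * B1 + `|Bb| * \sum_i B4 i).
  rewrite !addr_ge0// ?mulr_ge0// sumr_ge0// => i _; last by have [] := H4 i.
  by rewrite mulr_ge0//; have [] := H3 i.
move=> z; rewrite /adj_op; apply: le_trans (ler_normD _ _) _; apply: lerD; last first.
  rewrite normrM; apply: ler_pM => //.
    by have /andP[b0 bB] := b_bd z; rewrite ger0_norm// (le_trans bB)// ler_norm.
  apply: le_trans (ler_norm_sum _ _ _) _; apply: ler_sum => i _; exact: (H4 i).2.
apply: le_trans (ler_normB _ _) _; apply: lerD; last first.
  by rewrite normrM; apply: ler_pM => //; apply: le_trans (cc_bd z) (ler_norm _).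
apply: le_trans (ler_normB _ _) _; apply: lerD; first exact: H2.
apply: le_trans (ler_norm_sum _ _ _) _; apply: ler_sum => i _.
rewrite normrM; apply: ler_pM => //; last exact: (H3 i).2.
by apply: le_trans (f_bd i _) (ler_norm _).
Qed.

(** [chi] is only required to be stationary where it is multiplied by a nonzero
    Laplacian, which is what a vanishing diffusion or the absence of a boundary gives. *)
Lemma adj_op_cut (chi phi : X -> R) (th th1 th2 : R -> R) z : Ck 2 setT chi -> Ck 2 setT phi ->
  C2_slot th th1 th2 -> dt chi z = 0 ->
  b z = 0 \/ (\forall y \near z, chi y = 1) \/ (\forall y \near z, phi y = 0) ->
  adj_op b cc f (fun z => chi z * th z.2 * phi z) z =
  chi z * th z.2 * adj_op b cc f phi z + chi z * th1 z.2 * phi z -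
    (th z.2 * phi z) * \sum_i f i z.1 * dx i chi z.
Proof.
move=> Cc Cp [dth dth1 _] dtc hz.
have Dt : dt (fun z => chi z * th z.2 * phi z) z = chi z * th1 z.2 * phi z + chi z * th z.2 * dt phi z.
  have dc := Ck_is_derive (0, 1) z Cc; have dp := Ck_is_derive (0, 1) z Cp.
  have [_] := is_derive_prod (is_derive_prod dc (derive_time (dth z.2))) dp.
  by rewrite /dt => ->; rewrite -/(dt chi z) dtc mul0r add0r.
have Dx (g : X -> R) i y : is_derive y ((ei i, 0) : X) g (dx i g y) ->
    is_derive y ((ei i, 0) : X) (fun z => th z.2 * g z) (th y.2 * dx i g y).
  move=> dg; have := is_derive_prod (line_const th (v := (ei i, 0)) y erefl) dg.
  by rewrite mul0r add0r.
have Dx1 i : dx i (fun z => chi z * th z.2 * phi z) z =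
    dx i chi z * th z.2 * phi z + chi z * th z.2 * dx i phi z.
  have dc := Ck_is_derive (ei i, 0) z Cc; have dp := Ck_is_derive (ei i, 0) z Cp.
  have [_] := is_derive_prod (is_derive_prod dc (line_const th (v := (ei i, 0)) z erefl)) dp.
  by rewrite /dx => ->; rewrite mulr0 addr0.
have Lap : b z * laplacian (fun z => chi z * th z.2 * phi z) z = b z * (chi z * th z.2 * laplacian phi z).
  case: hz => [->|hz]; first by rewrite !mul0r.
  congr (_ * _).
  have loc (g h : X -> R) : (\forall y \near z, g y = h y) -> laplacian g z = laplacian h z.
    move=> gh; apply: eq_bigr => i _.
    apply: near_eq_derive; move/near_join : gh; apply: filterS => y gh.
    exact: near_eq_derive.
  case: hz => [c1|p0].
    have -> : laplacian (fun z => chi z * th z.2 * phi z) z = laplacian (fun z => th z.2 * phi z) z.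
      by apply: loc; move: c1; apply: filterS => y ->; rewrite mul1r.
    have -> : chi z = 1 by exact: nbhs_singleton c1.
    rewrite mul1r /laplacian mulr_sumr; apply: eq_bigr => i _.
    have E : dx i (fun z => th z.2 * phi z) = (fun z => th z.2 * dx i phi z).
      by apply/funext => y; have [_] := Dx _ _ _ (Ck_is_derive (ei i, 0) y Cp).
    by have [_] := Dx _ _ _ (Ck_is_derive (ei i, 0) z (Ck_derive (ei i, 0) Cp)); rewrite -E.
  have l0 (g : X -> R) : (\forall y \near z, g y = 0) -> laplacian g z = 0.
    move=> /loc ->; apply: big1 => i _; rewrite /dx (_ : 'D_(ei i, 0) (fun=> 0) = fun=> 0).
      exact: derive_cst.
    by apply/funext => y; exact: derive_cst.
  rewrite !l0 ?mulr0//.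
  by move: p0; apply: filterS => y ->; rewrite mulr0.
have Sx : \sum_i f i z.1 * dx i (fun z => chi z * th z.2 * phi z) z =
    (th z.2 * phi z) * (\sum_i f i z.1 * dx i chi z) +
    (chi z * th z.2) * \sum_i f i z.1 * dx i phi z.
  rewrite !mulr_sumr -big_split /=; apply: eq_bigr => i _; rewrite Dx1.
  by move: (dx i chi z) (dx i phi z) => p q; ring.
apply: etrans (f_equal3 (fun x y w : R => x - y - cc z * (chi z * th z.2 * phi z) + w) Dt Sx Lap) _.
rewrite /adj_op; move: (dt phi z) (laplacian phi z) => p q.
by move: (\sum_i _) (\sum_i _) => S1 S2; ring.
Qed.

End adjoint_operator.

(** * Removal of the cutoffs in space and time *)

Section test_limit.
Context {R : realType} {N : nat}.
Local Notation V := 'rV[R]_N.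
Local Notation X := ('rV[R]_N * R)%type.
Notation mu := (@lebesgue_xt R N).
Notation L1 g := (mu.-integrable [set: X] (EFin \o g)).
Notation Int g := (\int[mu]_x g x).

Lemma xt_box_compact (r a beta : R) :
  compact [set z : X | (forall i, `|z.1 0 i| <= r) /\ a <= z.2 <= beta].
Proof.
rewrite (_ : mkset _ = [set x : V | forall i, - r <= x 0 i <= r] `*` [set` `[a, beta]]).
  by apply: compact_setX; [exact: box_compact|exact: segment_compact].
apply/seteqP; split => z /=; rewrite in_itv /=.
  by move=> [h1 h2]; split => // i; rewrite -ler_norml.
by move=> [h1 h2]; split => // i; rewrite ler_norml.
Qed.

Variables (Omega : set V) (T : R) (w b cc : X -> R) (f : 'I_N -> V -> R) (Bb K F Lf y0 : R).
Notation Q := (cylinder Omega T).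
Hypothesis Omega_open : open Omega.
Hypothesis T_gt0 : 0 < T.
Hypothesis w_L1 : L1 w.
Hypothesis w_in : forall z, w z != 0 -> Q z.
Hypothesis b_meas : measurable_fun setT b.
Hypothesis b_bd : forall z, 0 <= b z <= Bb.
Hypothesis cc_meas : measurable_fun setT cc.
Hypothesis cc_bd : forall z, `|cc z| <= K.
Hypothesis f_bd : forall i x, `|f i x| <= F.
Hypothesis f_lip : forall i, xlip Lf (f i).
Hypothesis Lf_ge0 : 0 <= Lf.
Hypothesis f_out : forall i x, ~ Omega x -> f i x = 0.
Hypothesis y0_ge0 : 0 <= y0.
Hypothesis b_case : (forall z, Q z -> b z = 0) \/ Omega = setT.
Hypothesis test0 : forall phi Ks, Ck 2 setT phi -> (forall z, 0 <= phi z) -> compact Ks -> Ks `<=` Q ->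
  (forall z, ~ Ks z -> phi z = 0) -> Int (fun z => w z * adj_op b cc f phi z) = 0.
Hypothesis w_init : forall e : R, 0 < e -> exists2 tau : R, 0 < tau &
  forall s, 0 < s < tau -> Int (fun z => `|w z| * \1_(past s) z) <= s * (y0 + e).

Let f_meas i : measurable_fun setT (fun z : X => f i z.1).
Proof. exact: xlip_meas (f_lip i). Qed.

Section test.
Variables (beta P r0 : R) (Phi Phi1 Phi2 : X -> R).
Hypothesis beta_T : beta < T.
Hypothesis PhiE : forall z, Phi z = Phi1 z - Phi2 z.
Hypothesis Phi1_C2 : Ck 2 setT Phi1.
Hypothesis Phi2_C2 : Ck 2 setT Phi2.
Hypothesis Phi_C2 : Ck 2 setT Phi.
Hypothesis Phi1_ge0 : forall z, 0 <= Phi1 z.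
Hypothesis Phi2_ge0 : forall z, 0 <= Phi2 z.
Notation Kb := [set z : X | (forall i, `|z.1 0 i| <= r0) /\ - r0 <= z.2 <= beta].
Hypothesis Phi1_out : forall z, ~ Kb z -> Phi1 z = 0.
Hypothesis Phi2_out : forall z, ~ Kb z -> Phi2 z = 0.
Hypothesis Phi_out : forall z, ~ Kb z -> Phi z = 0.
Hypothesis r0_ge0 : 0 <= r0.
Hypothesis Phi_bd : forall z, `|Phi z| <= P.
Variable G : R.
Hypothesis G_ge0 : 0 <= G.

Let P_ge0 : 0 <= P. Proof. exact: le_trans (normr_ge0 _) (Phi_bd 0). Qed.

Let cutoff (delta r : R) (chi : X -> R) (Kx : set V) :=
  [/\ Ck 2 setT chi, forall z : X, 0 <= chi z <= 1,
      forall z : X, 0 < z.2 < T -> dt chi z = 0 &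
      forall i (z : X), `|dx i chi z| <= G / delta] /\
  [/\ compact Kx, Kx `<=` Omega, forall z : X, chi z != 0 -> Kx z.1 &
    forall z : X, 0 < z.2 < T -> (forall i, `|z.1 0 i| <= r) -> near_dom Omega (9 * delta) z.1 ->
     \forall z' \near z, chi z' = 1].

Hypothesis cutoffs : forall n : nat, exists chi, exists Kx, cutoff n.+1%:R^-1 (r0 + n%:R) chi Kx.

Section time_cutoff.
Variable s : R.
Hypothesis s_gt0 : 0 < s.

Let th_C2 : Ck 2 setT (fun z : X => ramp s z.2).
Proof. by apply: Ck_time; apply: ramp_slot; rewrite gt_eqF. Qed.

Let th1_meas : measurable_fun setT (fun z : X => ramp1 s z.2).
Proof.
have [_ c] := C2_slot_cts (@ramp_slot R s (lt0r_neq0 s_gt0)).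
apply: cts_meas => z; apply: (@cvg_comp _ _ _ (fun z : X => z.2) (ramp1 s)); last exact: c.
exact: cvg_snd.
Qed.

Let cut_Phi (chi : X -> R) (z : X) : R :=
  chi z * ramp s z.2 * adj_op b cc f Phi z + chi z * ramp1 s z.2 * Phi z -
    (ramp s z.2 * Phi z) * \sum_i f i z.1 * dx i chi z.

(** For zero diffusion [chi] may vary near the boundary of [Omega]; without boundary it is
    constant on the support of [Phi]. *)
Lemma cut_zero (delta r : R) (chi : X -> R) (Kx : set V) : cutoff delta r chi Kx -> r0 <= r ->
  Int (fun z => w z * cut_Phi chi z) = 0.
Proof.
move=> [[chi_C2 chi01 chi_t chi_x] [cKx KxO chiK chi1]] r0r.
have Cct : Ck 2 setT (fun z => chi z * ramp s z.2) by exact: (CkM chi_C2 th_C2).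
pose Ks : set X := Kx `*` [set` `[s, beta]].
have cKs : compact Ks by apply: compact_setX => //; exact: segment_compact.
have KsQ : Ks `<=` Q.
  move=> z [/= /KxO Oz]; rewrite in_itv /= => /andP[h1 h2]; split => //=.
  by rewrite in_itv /= (lt_le_trans s_gt0 h1)/= (le_lt_trans h2).
have key (psi : X -> R) : Ck 2 setT psi -> (forall z, 0 <= psi z) -> (forall z, ~ Kb z -> psi z = 0) ->
    Ck 2 setT (fun z => chi z * ramp s z.2 * psi z) /\
    exists A : X -> R, [/\ L1 A, Int A = 0 &
      forall z, A z = w z * adj_op b cc f (fun z => chi z * ramp s z.2 * psi z) z].
  move=> Cp p0 pout; have Cq := CkM Cct Cp.
  have out z : ~ Ks z -> chi z * ramp s z.2 * psi z = 0.
    move=> nK; apply/eqP; rewrite 2!mulf_eq0 -orbA; apply/negPn/negP; rewrite 2!negb_or => /and3P[c0 t0 q0].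
    apply: nK; split; first exact: chiK.
    rewrite /= in_itv /=; apply/andP; split.
      by rewrite leNgt; apply/negP => h; move: t0; rewrite ramp0 ?eqxx// ltW.
    have [[_ /andP[]]//|/pout pz] := pselect (Kb z).
    by rewrite pz eqxx in q0.
  have [ma [B B0 HB]] := adj_op_bd b_meas b_bd cc_meas cc_bd f_bd f_meas Cq cKs out.
  split => //; exists (fun z => w z * adj_op b cc f (fun z => chi z * ramp s z.2 * psi z) z).
  split => //; first exact: (L1M (M := B)).
  apply: (test0 Cq _ cKs KsQ out) => z; apply: mulr_ge0 => //; apply: mulr_ge0.
    by have /andP[] := chi01 z.
  by have /andP[] := ramp_bd s z.2.
have [C1 [A1 [i1 e1 AE1]]] := key _ Phi1_C2 Phi1_ge0 Phi1_out.
have [C2 [A2 [i2 e2 AE2]]] := key _ Phi2_C2 Phi2_ge0 Phi2_out.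
have PE : (fun z => chi z * ramp s z.2 * Phi z) =
    (fun z => chi z * ramp s z.2 * Phi1 z - chi z * ramp s z.2 * Phi2 z).
  by apply/funext => z; rewrite PhiE mulrBr.
transitivity (Int (fun z => w z * adj_op b cc f (fun z => chi z * ramp s z.2 * Phi z) z)); last first.
  have := IntB i1 i2; rewrite e1 e2 subrr; apply: etrans; apply: eq_Int => z.
  rewrite AE1 AE2 -mulrBr PE; apply: (f_equal (fun y => w z * y)).
  exact: (adj_opB b cc f z C1 C2).
apply: eq_Int => z; have [->|wz] := eqVneq (w z) 0; first by rewrite !mul0r.
have [Oz] := w_in wz; rewrite /= in_itv /= => tz.
suff hz : b z = 0 \/ (\forall y \near z, chi y = 1) \/ (\forall y \near z, Phi y = 0).
  apply: (f_equal (fun y => w z * y)); apply/esym.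
  exact: (adj_op_cut cc f chi_C2 Phi_C2 (@ramp_slot R s (lt0r_neq0 s_gt0)) (chi_t z tz) hz).
case: b_case => [b0|OT]; first by left; apply: b0; exact: w_in.
right; have [zr|nzr] := pselect (forall i, `|z.1 0 i| <= r).
  by left; apply: chi1 => // y _; rewrite OT.
right; have nK : ~ Kb z.
  by move=> [h _]; apply: nzr => i; apply: le_trans r0r.
have : open (~` Kb).
  by apply: closed_openC; apply: compact_closed; [exact: norm_hausdorff|exact: xt_box_compact].
by rewrite openE => /(_ z nK); apply: filterS => y; exact: Phi_out.
Qed.

Let adj := adj_op b cc f Phi.

Let adj_meas : measurable_fun setT adj.
Proof.
by have [] := adj_op_bd b_meas b_bd cc_meas cc_bd f_bd f_meas Phi_C2 (@xt_box_compact r0 (- r0) beta) Phi_out.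
Qed.

(** The gradient of the [n]-th cutoff is of order [n], but it is nonzero only within distance
    [9 / n.+1] of the complement of [Omega]. There [f] is at most [Lf] times this distance, so
    [f . grad chi] stays bounded while it tends to 0 pointwise, and dominated convergence
    applies. *)
Lemma time_cut_zero : Int (fun z => w z * (ramp s z.2 * adj z + ramp1 s z.2 * Phi z)) = 0.
Proof.
have [_ [BA BA0 HBA]] :=
  adj_op_bd b_meas b_bd cc_meas cc_bd f_bd f_meas Phi_C2 (@xt_box_compact r0 (- r0) beta) Phi_out.
have [chi chiP] := choice cutoffs.
have z0 n : Int (fun z => w z * cut_Phi (chi n) z) = 0.
  by have [Kx H] := chiP n; apply: (cut_zero H); rewrite lerDl.
pose Bf := N%:R * (Lf * 9 * G).
have Bf0 : 0 <= Bf by rewrite !mulr_ge0.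
pose B := BA + 12 / s * P + P * Bf.
have one n z : w z != 0 -> (forall i, `|z.1 0 i| <= r0 + n%:R) -> near_dom Omega (9 * n.+1%:R^-1) z.1 ->
    chi n z = 1 /\ forall i, dx i (chi n) z = 0.
  move=> wz zr nd; have [Kx [_ [_ _ _ c1]]] := chiP n.
  have [Oz] := w_in wz; rewrite /= in_itv /= => tz.
  have H := c1 z tz zr nd; split; first exact: nbhs_singleton H.
  move=> i; have E : 'D_((ei i, 0) : X) (chi n) z = 'D_((ei i, 0) : X) (cst 1 : X -> R) z.
    exact: near_eq_derive.
  by rewrite /dx E derive_cst.
have [] := @Int_cvg _ _ _ mu (fun n z => w z * cut_Phi (chi n) z)
  (fun z => w z * (ramp s z.2 * adj z + ramp1 s z.2 * Phi z)) (fun z => `|w z| * B).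
- move=> n; have [Kx [[cC _ _ _] _]] := chiP n.
  apply: measurable_funM; first exact: L1_meas w_L1.
  have mc := Ck_meas cC; have mP := Ck_meas Phi_C2; have mt := Ck_meas th_C2.
  apply: measurable_funB; first apply: measurable_funD.
  + by apply: measurable_funM => //; exact: measurable_funM.
  + by apply: measurable_funM => //; exact: measurable_funM.
  apply: measurable_funM; first exact: measurable_funM.
  apply: measurable_sum => i; apply: measurable_funM => //.
  exact: Ck_meas (Ck_derive _ cC).
- move=> z; have [wz|wz] := eqVneq (w z) 0.
    by rewrite wz mul0r; under eq_fun do rewrite mul0r; exact: cvg_cst.
  have [Oz _] := w_in wz.
  have [r rp rO] := open_box Omega_open Oz.
  apply: cvg_near_cst; near=> n.
  have [c1 cx] : chi n z = 1 /\ forall i, dx i (chi n) z = 0.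
    apply: one => // [i|y hy].
      apply: (@le_trans _ _ (\sum_j `|z.1 0 j|)).
        by rewrite (bigD1 i)//= lerDl sumr_ge0.
      apply: (@le_trans _ _ n%:R); last by rewrite lerDr.
      by near: n; exact: nbhs_infty_ger.
    apply: rO => i; rewrite distrC; apply: le_lt_trans (hy i) _.
    rewrite ltr_pdivrMr// mulrC -ltr_pdivrMr//.
    apply: (@lt_le_trans _ _ n%:R); last by rewrite ler_nat.
    by near: n; exact: nbhs_infty_gtr.
  rewrite /cut_Phi c1 !mul1r big1 ?mulr0 ?subr0// => i _.
  by rewrite cx mulr0.
- by have := L1Z B (L1_norm w_L1); apply: eq_L1 => z; rewrite mulrC.
- move=> n z; rewrite normrM; have [->|wz] := eqVneq (w z) 0; first by rewrite normr0 !mul0r.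
  apply: ler_wpM2l => //.
  have [Kx [[cC c01 _ cx] _]] := chiP n.
  have /andP[c0 c1] := c01 z; have /andP[t0 t1] := ramp_bd s z.2.
  have nt : `|ramp s z.2| <= 1 by rewrite ger0_norm.
  have nc : `|chi n z| <= 1 by rewrite ger0_norm.
  rewrite /cut_Phi; apply: le_trans (ler_normB _ _) _; apply: lerD.
    apply: le_trans (ler_normD _ _) _; apply: lerD.
      rewrite normrM -[leRHS]mul1r; apply: ler_pM => //.
      by rewrite normrM mulr_ile1.
    rewrite normrM; apply: ler_pM => //.
    rewrite normrM -[leRHS]mul1r; apply: ler_pM => //.
    exact: ramp1_bd.
  have [Kz|nK] := pselect (Kb z); last by rewrite Phi_out// mulr0 mul0r normr0 mulr_ge0.
  rewrite normrM; apply: ler_pM => //.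
    by rewrite normrM -[leRHS]mul1r; apply: ler_pM.
  apply: le_trans (ler_norm_sum _ _ _) _.
  apply: (@le_trans _ _ (\sum_(i < N) Lf * 9 * G)); last first.
    by rewrite sumr_const card_ord -[leLHS]mulr_natl.
  apply: ler_sum => i _.
  have [nd|nd] := pselect (near_dom Omega (9 * n.+1%:R^-1) z.1).
    have [] := one n z wz _ nd; last by move=> _ ->; rewrite mulr0 normr0 !mulr_ge0.
    by move=> j; have [h _] := Kz; apply: le_trans (h j) _; rewrite lerDl.
  have [y [hy nO]] : exists y : V, (forall i, `|y 0 i - z.1 0 i| <= 9 * n.+1%:R^-1) /\ ~ Omega y.
    apply: contrapT => H; apply: nd => y hy; apply: contrapT => nO; apply: H.
    by exists y.
  rewrite normrM.
  have -> : Lf * 9 * G = (Lf * (9 * n.+1%:R^-1)) * (G / n.+1%:R^-1).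
    by field; rewrite ?pnatr_eq0.
  apply: ler_pM => //.
  by have := f_lip i hy; rewrite f_out// sub0r normrN.
move=> _ cv.
have : Int (fun z => w z * cut_Phi (chi n) z) @[n --> \oo] --> (0 : R).
  by under eq_fun do rewrite z0; exact: cvg_cst.
by move/(cvg_unique (@norm_hausdorff _ _) cv).
Unshelve. all: by end_near. Qed.

End time_cutoff.

(** As the ramp steepens its derivative concentrates at time 0, where [w_init] bounds the mass of
    [w]. *)
Lemma weak_form_test : `|Int (fun z => w z * adj_op b cc f Phi z)| <= 48 * y0 * P.
Proof.
have [madj [BA BA0 HBA]] :=
  adj_op_bd b_meas b_bd cc_meas cc_bd f_bd f_meas Phi_C2 (@xt_box_compact r0 (- r0) beta) Phi_out.
pose adj := adj_op b cc f Phi.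
have mw := L1_meas w_L1.
have mP := Ck_meas Phi_C2.
have est (e s : R) : 0 < s -> Int (fun z => `|w z| * \1_(past (4 * s)) z) <= (4 * s) * (y0 + e) ->
    `|Int (fun z => w z * (ramp s z.2 * adj z))| <= 48 * (y0 + e) * P.
  move=> s0 ini.
  have := time_cut_zero s0; rewrite -/adj.
  have mt : measurable_fun setT (fun z : X => ramp s z.2).
    by apply: (@Ck_meas _ _ 2); apply: Ck_time; apply: ramp_slot; rewrite gt_eqF.
  have mt1 : measurable_fun setT (fun z : X => ramp1 s z.2).
    have [_ c] := C2_slot_cts (@ramp_slot R s (lt0r_neq0 s0)).
    apply: cts_meas => z; apply: (@cvg_comp _ _ _ (fun z : X => z.2) (ramp1 s)); last exact: c.
    exact: cvg_snd.
  have i1 : L1 (fun z => w z * (ramp s z.2 * adj z)).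
    apply: (L1M (M := BA)) => //; first exact: measurable_funM.
    move=> z; have /andP[t0 t1] := ramp_bd s z.2.
    by rewrite normrM -[leRHS]mul1r; apply: ler_pM => //; rewrite ger0_norm.
  have i2 : L1 (fun z => w z * (ramp1 s z.2 * Phi z)).
    apply: (L1M (M := 12 / s * P)) => //; first exact: measurable_funM.
    by move=> z; rewrite normrM; apply: ler_pM => //; exact: ramp1_bd.
  have -> : Int (fun z => w z * (ramp s z.2 * adj z + ramp1 s z.2 * Phi z)) =
      Int (fun z => w z * (ramp s z.2 * adj z) + w z * (ramp1 s z.2 * Phi z)).
    by apply: eq_Int => z; rewrite mulrDr.
  rewrite (IntD i1 i2) => /eqP; rewrite addr_eq0 => /eqP ->; rewrite normrN.
  apply: le_trans (Int_norm i2) _.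
  have i3 : L1 (fun z => `|w z| * \1_(past (4 * s)) z).
    by apply: L1_ind; [exact: L1_norm|exact: past_meas].
  apply: (@le_trans _ _ (Int (fun z => (12 / s * P) * (`|w z| * \1_(past (4 * s)) z)))).
    apply: Int_le => [||z]; [exact: L1_norm|exact: L1Z|].
    have [h|h] := leP (z.2) (4 * s).
      rewrite indicE mem_set// mulr1 (normrM (w z)) (normrM (ramp1 s z.2)) mulrC.
      apply: ler_wpM2r => //; apply: ler_pM => //; exact: ramp1_bd.
    rewrite ramp1_out ?(ltW h)// mul0r mulr0 normr0; apply: mulr_ge0; last exact: mulr_ge0.
    by apply: mulr_ge0 => //; apply: divr_ge0 => //; exact: ltW.
  rewrite (IntZ _ i3); apply: (@le_trans _ _ ((12 / s * P) * ((4 * s) * (y0 + e)))).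
    by apply: ler_wpM2l => //; rewrite !mulr_ge0// ?invr_ge0 ltW.
  by rewrite le_eqVlt; apply/orP; left; apply/eqP; field; rewrite gt_eqF.
apply/ler_addgt0Pr => e e0.
pose e1 := e / (2 * (48 * (P + 1))).
have P1 : 0 < 48 * (P + 1) by rewrite mulr_gt0// ltr_wpDl.
have e10 : 0 < e1 by rewrite divr_gt0// mulr_gt0.
have [tau tau0 ini] := w_init e10.
pose s n := tau / 8 * n.+1%:R^-1.
have s0 n : 0 < s n by rewrite /s mulr_gt0 ?invr_gt0// divr_gt0.
have lim : Int (fun z => w z * (ramp (s n) z.2 * adj z)) @[n --> \oo] --> Int (fun z => w z * adj z).
  apply: (@Int_cvg _ _ _ mu _ _ (fun z => BA * `|w z|) _ _ _ _).2.
  - move=> n; apply: measurable_funM => //; apply: measurable_funM => //.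
    by apply: (@Ck_meas _ _ 2); apply: Ck_time; apply: ramp_slot; rewrite gt_eqF.
  - move=> z; have [wz|wz] := eqVneq (w z) 0.
      by rewrite wz mul0r; under eq_fun do rewrite mul0r; exact: cvg_cst.
    have [_] := w_in wz; rewrite /= in_itv /= => /andP[z0 _].
    apply: cvg_near_cst; near=> n; rewrite ramp_1 ?mul1r//.
    rewrite /s mulrA ler_pdivrMr// [leRHS]mulrC -ler_pdivrMr//.
    apply: (@le_trans _ _ n%:R); last by rewrite ler_nat.
    by near: n; exact: nbhs_infty_ger.
  - by apply: L1Z; exact: L1_norm.
  - move=> n z; rewrite normrM mulrC; apply: ler_wpM2r => //.
    have /andP[t0 t1] := ramp_bd (s n) z.2.
    by rewrite normrM -[leRHS]mul1r; apply: ler_pM => //; rewrite ger0_norm.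
have e2 : 0 < e / 2 by rewrite divr_gt0.
move/cvgrPdist_le : lim => /(_ _ e2)[n _ /(_ n (leqnn n))] /= H.
have H2 := est e1 (s n) (s0 n).
have st : 0 < 4 * s n < tau.
  rewrite mulr_gt0//= /s mulrA ltr_pdivrMr//.
  apply: (@le_lt_trans _ _ (tau * 2^-1)); first by rewrite le_eqVlt; apply/orP; left; apply/eqP; field.
  by rewrite ltr_pM2l// (@lt_le_trans _ _ 1)// ?ler1n// invf_lt1 ?ltr1n.
have {}H2 := H2 (ini _ st).
have e3 : 48 * e1 * P <= e / 2.
  have -> : e / 2 = 48 * e1 * (P + 1) by rewrite /e1; field; rewrite gt_eqF// ltr_wpDl.
  by apply: ler_wpM2l; [rewrite mulr_ge0// ltW|rewrite lerDl].
have tri : `|Int (fun z => w z * adj z)| <= `|Int (fun z => w z * adj z) - Int (fun z => w z * (ramp (s n) z.2 * adj z))|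
   + `|Int (fun z => w z * (ramp (s n) z.2 * adj z))|.
  by apply: le_trans (ler_normD _ _); rewrite subrK.
apply: le_trans tri _; apply: le_trans (lerD H H2) _.
by rewrite mulrDr mulrDl; move: e3; lra.
Unshelve. all: by end_near. Qed.

End test.

(** [48 = 4 * 12]: the derivative of [ramp s] is at most [12 / s] and vanishes beyond [4 * s]. *)
Lemma weak_form_limit beta Phi Phi1 Phi2 P : beta < T -> test_fun beta Phi Phi1 Phi2 ->
  (forall z, `|Phi z| <= P) -> `|Int (fun z => w z * adj_op b cc f Phi z)| <= 48 * y0 * P.
Proof.
move=> bT [PhiE [[C1 C2] C] ge [r Hr]] bd.
pose rr : R := `|r|.
have out (z : X) : ~ ((forall i, `|z.1 0 i| <= rr) /\ - rr <= z.2 <= beta) ->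
    [/\ Phi1 z = 0, Phi2 z = 0 & Phi z = 0].
  move=> nK.
  have H : ~~ ((Phi1 z != 0) || (Phi2 z != 0) || (Phi z != 0)).
    apply/negP => /Hr [h1 /andP[h2 h3]]; apply: nK; split.
      by move=> i; apply: le_trans (h1 i) (ler_norm r).
    by rewrite h3 andbT; apply: le_trans h2; rewrite lerN2 ler_norm.
  by move: H; rewrite !negb_or !negbK => /andP[/andP[/eqP-> /eqP->] /eqP->].
apply: (weak_form_test (r0 := rr) bT PhiE C1 C2 C _ _ _ _ _ _ bd (ler0n R 1400)) => //.
- by move=> z; have [] := ge z.
- by move=> z; have [] := ge z.
- by move=> z /out[].
- by move=> z /out[].
- by move=> z /out[].
- exact: normr_ge0.
- move=> n; have d0 : 0 < n.+1%:R^-1 :> R by rewrite invr_gt0.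
  have d1 : n.+1%:R^-1 <= 1 :> R by rewrite invf_le1// ler1n.
  have [chi [h1 [[Kx [k1 k2 k3]] h3]]] :=
    cutoff_exists Omega (addr_ge0 (normr_ge0 r) (ler0n R n)) d0 d1 T_gt0.
  by exists chi, Kx.
Qed.

End test_limit.

(** * Coefficients extended to the whole space *)

Section coefficients.
Context {R : realType} {N : nat}.
Local Notation V := 'rV[R]_N.
Local Notation X := ('rV[R]_N * R)%type.

Lemma within_comp (S U : topologicalType) (A : set U) (F : U -> R) (gam : S -> U) (s0 : S) :
  {within A, continuous F} -> {for s0, continuous gam} -> (\forall s \near s0, A (gam s)) ->
  {for s0, continuous (F \o gam)}.
Proof.
move=> /subspace_continuousP cF cg Ag; apply/cvgrPdist_lt => e e0.
have /cvgrPdist_lt/(_ e e0) H := cF _ (nbhs_singleton Ag).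
have := cg _ H; rewrite /nbhs /= => H2.
by apply: filterS2 Ag H2 => s As; exact.
Qed.

Lemma pair_cts (S U W : topologicalType) (f : S -> U) (g : S -> W) (s : S) :
  {for s, continuous f} -> {for s, continuous g} -> {for s, continuous (fun x => (f x, g x))}.
Proof.
move=> cf cg A [[/= B1 B2] [nB1 nB2] BB].
have n1 : nbhs s (f @^-1` B1) by exact: cf.
have n2 : nbhs s (g @^-1` B2) by exact: cg.
change (nbhs s [set x | A (f x, g x)]).
by apply: filterS2 n1 n2 => x h1 h2; apply: BB.
Qed.

Lemma bounded_extension (Q : set X) (c : X -> R) : measurable Q -> bounded_measurable Q c ->
  exists cq K, [/\ forall z, Q z -> cq z = c z, measurable_fun setT cq & forall z : X, `|cq z| <= K].
Proof.
move=> mQ [mc [M HM]]; exists (c \_ Q), `|M|; split.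
- by move=> z Qz; rewrite /patch mem_set.
- exact/(measurable_restrictT _ _).1.
move=> z; rewrite /patch; have [Qz|nQ] := pselect (Q z).
  by rewrite mem_set//; apply: le_trans (HM z Qz) (ler_norm _).
by rewrite memNset// normr0.
Qed.

Variables (Omega : set V) (T : R).
Notation Q := (cylinder Omega T).
Hypothesis Omega_open : open Omega.
Hypothesis N_gt0 : (0 < N)%N.
Hypothesis T_gt0 : 0 < T.

Lemma cylinder_nbhs z : Q z -> nbhs z Q.
Proof.
move=> [Oz]; rewrite /= in_itv /= => tz; exists (Omega, [set` `]0, T[]) => //=.
split; first exact: open_nbhs_nbhs.
apply: open_nbhs_nbhs; split; last by rewrite /= in_itv.
exact: interval_open.
Qed.

Lemma cylinder_open : open Q.
Proof. by rewrite openE => z Qz; exact: cylinder_nbhs. Qed.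

Lemma cylinder_meas : measurable Q.
Proof. exact: open_meas cylinder_open. Qed.

Section diffusion.
Variables (a : R -> X -> R) (delta2 C0 : R).
Hypothesis Omega_conn : connected Omega.
Hypothesis Omega_n0 : Omega !=set0.
Hypothesis a_ge0 : forall s x, closure Q x -> 0 <= a s x.
Hypothesis a_continuous : {within setT `*` closure Q, continuous (fun z : R * X => a z.1 z.2)}.
Hypothesis a_cts : forall s, {within closure Q, continuous (a s)}.
Hypothesis a_boundary : forall s x t, boundary Omega x -> 0 <= t <= T -> a s (x, t) = 0.
Hypothesis a_bounded : forall M, exists B, forall s x, `|s| <= M -> Q x -> `|a s x| <= B.
Hypothesis delta2_gt0 : 0 < delta2.
Hypothesis a_holder : forall s x y t, Omega x -> Omega y -> 0 <= t <= T ->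
     `|Num.sqrt (a s (x, t)) - Num.sqrt (a s (y, t))| <= C0 * enorm (x - y) `^ (2 + delta2).

Lemma a_const s x y t : Omega x -> Omega y -> 0 < t < T -> a s (x, t) = a s (y, t).
Proof.
move=> Ox Oy tT; have /andP[/ltW t0 /ltW t1] := tT.
have := @holder_const _ _ _ Omega_open (fun x => Num.sqrt (a s (x, t))) C0 delta2 Omega_conn delta2_gt0 _ x y Ox Oy.
have p x' : Omega x' -> 0 <= a s (x', t).
  by move=> Ox'; apply: a_ge0; apply: subset_closure; split => //=; rewrite in_itv.
move=> /(_ _)/eqP E; move: E; rewrite eqr_sqrt ?p// => E; apply/eqP; apply: E.
by move=> y' z' Oy' Oz'; apply: a_holder => //; rewrite t0.
Qed.

(** The diffusion is read off at a single point [x0] of [Omega] and set to 0 for times outside []0,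
    T[]. *)
Lemma diffusion_of_time : exists al : R -> R -> R,
  [/\ measurable_fun [set: R * R] (fun z : R * R => al z.1 z.2), forall s t, 0 <= al s t,
      forall t, continuous (al ^~ t), forall M, exists B, forall s t, `|s| <= M -> al s t <= B &
      forall s z, Q z -> a s z = al s z.2] /\
  (forall s z i, Q z -> dx i (a s) z = 0) /\
  ((forall s t, al s t = 0) \/ Omega = setT).
Proof.
have [x0 Ox0] := Omega_n0.
pose al s t : R := if 0 < t < T then a s (x0, t) else 0.
have Qx t : 0 < t < T -> Q (x0, t) by move=> tT; split => //=; rewrite in_itv.
have al_a s z : Q z -> a s z = al s z.2.
  case: z => x t [/= Ox]; rewrite in_itv /= => tT; rewrite /al tT; exact: a_const.
pose A := setT `*` closure Q : set (R * X).
exists al; split; [split|split] => //.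
- pose i0 : 'I_N := Ordinal N_gt0.
  (* The variable [s] is stored in the coordinate [i0] of a point of [X], since [cts_on_meas] speaks
     of functions on [X]; this uses [0 < N]. *)
  pose gam (z : X) : R * X := (z.1 0 i0, (x0, z.2)).
  pose D := [set z : X | 0 < z.2 < T].
  have oD : open D.
    rewrite (_ : D = (fun z : X => z.2) @^-1` [set` `]0, T[]).
      by apply: open_comp; [move=> z _; exact: cvg_snd|exact: interval_open].
    by apply/seteqP; split => z; rewrite /D /= in_itv.
  have mD : measurable_fun D (fun z => a (gam z).1 (gam z).2).
    apply: cts_on_meas => // z Dz.
    apply: (@within_comp _ _ A (fun z : R * X => a z.1 z.2) gam z) => //.
      apply: pair_cts; first exact: (xtlip_cts (xtlip_coord i0)).
      by apply: pair_cts; [exact: cvg_cst|exact: cvg_snd].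
    have : nbhs z D by exact: open_nbhs_nbhs.
    by apply: filterS => y Dy; split => //; apply: subset_closure; exact: Qx.
  have mg : measurable_fun setT (fun z : X => al (z.1 0 i0) z.2).
    rewrite (_ : (fun z => _) = (fun z => a (gam z).1 (gam z).2) \_ D).
      by apply/(measurable_restrictT _ _).1 => //; exact: open_meas.
    apply/funext => z; rewrite /patch /al; have [Dz|nD] := boolP (0 < z.2 < T).
      by rewrite mem_set.
    by rewrite memNset//; exact/negP.
  rewrite (_ : (fun z : R * R => _) = (fun z : X => al (z.1 0 i0) z.2) \o
      (fun p : R * R => ((const_mx p.1 : V), p.2))); last first.
    by apply/funext => p /=; rewrite mxE.
  apply: measurableT_comp => //; apply/measurable_fun_pairP; split; last exact: measurable_snd.
  apply/measurable_fun_rVP => i.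
  by rewrite (_ : (fun t => _) = fst)//; apply/funext => p /=; rewrite mxE.
- move=> s t; rewrite /al; case: ifP => // tT.
  by apply: a_ge0; apply: subset_closure; exact: Qx.
- move=> t; rewrite /al; have [tT|_] := boolP (0 < t < T); last exact: cst_continuous.
  move=> s; apply: (@within_comp _ _ A (fun z : R * X => a z.1 z.2) (fun s => (s, (x0, t))) s) => //.
    by apply: pair_cts; [exact: cvg_id|exact: cvg_cst].
  by apply: (@filterE _ (nbhs (s : R))) => y; split => //; apply: subset_closure; exact: Qx.
- move=> M; have [B HB] := a_bounded M; exists `|B| => s t sM; rewrite /al; case: ifP => // tT.
  by apply: le_trans (ler_norm _) _; apply: le_trans (HB _ _ sM (Qx _ tT)) (ler_norm _).
- move=> s z i Qz.
  have : is_derive z ((ei i, 0) : X) (a s) 0; last by case.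
  apply: (@near_eq_is_derive _ _ _ (fun y : X => al s y.2)); last exact: (line_const (al s)).
  by move: (cylinder_nbhs Qz); apply: filterS => y Qy; rewrite al_a.
(* At a boundary point the diffusion vanishes, and by continuity up to the boundary so does its
   constant value inside. *)
have [[xb bx]|nb] := pselect (boundary Omega !=set0); last by right; exact: no_boundary.
left=> s t; rewrite /al; case: ifP => // tT; have /andP[t0 t1] := tT.
apply/eqP; rewrite eq_le (a_ge0 s (subset_closure (Qx t tT))) andbT.
apply/ler_addgt0Pr => e e0; rewrite add0r.
have cl : closure Q (xb, t).
  move=> B [[/= B1 B2] [nB1 nB2] BB]; have [y [Oy By]] := bx.1 B1 nB1.
  exists (y, t); split; first by split => //=; rewrite in_itv.
  by apply: BB; split => //=; exact: nbhs_singleton nB2.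
have /subspace_continuousP/(_ _ cl)/cvgrPdist_lt/(_ e e0) := @a_cts s.
have tT' : 0 <= t <= T by rewrite !ltW.
have -> : from_subspace (closure Q) (a s) (xb, t) = 0 by exact: a_boundary.
move=> [[/= B1 B2] [nB1 nB2] BB]; have [y [Oy By]] := bx.1 B1 nB1.
have Qy : Q (y, t) by split => //=; rewrite in_itv.
have := BB (y, t) (conj By (nbhs_singleton nB2)) (subset_closure Qy).
rewrite sub0r normrN (a_const s Ox0 Oy tT) /from_subspace => h; apply: ltW; exact: le_lt_trans (ler_norm _) h.
Qed.

End diffusion.

Section transport.
Variable f : 'I_N -> V -> R.
Hypothesis f_C1 : forall i, C1_closure Omega (f i).
Hypothesis f_boundary : forall i x, boundary Omega x -> f i x = 0.

Lemma divergence_extension : exists dv Kd,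
  [/\ forall z, Q z -> dv z = divf f z.1, measurable_fun setT dv & forall z : X, `|dv z| <= Kd].
Proof.
apply: bounded_extension; first exact: cylinder_meas.
have Df i : Ck 0 Omega ('D_(ei i) (f i)) by have [[_ /(_ (ei i))[]]] := f_C1 i.
split.
  apply: measurable_sum => i; apply: cts_on_meas; first exact: cylinder_open.
  move=> z [Oz _]; apply: (@cvg_comp _ _ _ (fun z : X => z.1) ('D_(ei i) (f i))); first exact: cvg_fst.
  by have [/(_ _ Oz)] := Df i.
have /choice[B HB] : forall i, exists B, forall x, Omega x -> `|'D_(ei i) (f i) x| <= B.
  by move=> i; have [_ _ _ /(_ (ei i))[_]] := f_C1 i.
exists (\sum_i B i) => z [Oz _]; apply: le_trans (ler_norm_sum _ _ _) _.
by apply: ler_sum => i _; exact: HB.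
Qed.

(** Extension by 0 stays Lipschitz because [f] vanishes on the boundary; the segments of
    [zero_ext_line] are run along [ei j] and [- ei j], so derivatives in both directions enter the
    constant. *)
Lemma transport_extension : exists (fx : 'I_N -> V -> R) (F Lf : R),
  [/\ forall i x, Omega x -> fx i x = f i x, forall i x, ~ Omega x -> fx i x = 0,
      forall i x, `|fx i x| <= F, forall i, xlip Lf (fx i) & 0 <= F /\ 0 <= Lf].
Proof.
have /choice[F HF] : forall i, exists F, forall x, Omega x -> `|f i x| <= F.
  by move=> i; have [] := f_C1 i.
have D v : exists B : 'I_N -> R, forall i x, Omega x -> `|'D_v (f i) x| <= B i.
  have /choice[B HB] : forall i, exists B, forall x, Omega x -> `|'D_v (f i) x| <= B.
    by move=> i; have [_ _ _ /(_ v)[_]] := f_C1 i.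
  by exists B.
have /choice[Bp HBp] : forall j : 'I_N, exists B : 'I_N -> R, forall i x, Omega x -> `|'D_(ei j) (f i) x| <= B i by move=> j; exact: D.
have /choice[Bm HBm] : forall j : 'I_N, exists B : 'I_N -> R, forall i x, Omega x -> `|'D_(- ei j) (f i) x| <= B i by move=> j; exact: D.
pose M : R := \sum_i \sum_j (`|Bp j i| + `|Bm j i|).
have M0 : 0 <= M by apply: sumr_ge0 => i _; apply: sumr_ge0 => j _; exact: addr_ge0.
have Mge i j : `|Bp j i| + `|Bm j i| <= M.
  rewrite /M (bigD1 i)//= (bigD1 j)//= -addrA lerDl addr_ge0//.
    by apply: sumr_ge0 => *; exact: addr_ge0.
  by apply: sumr_ge0 => *; apply: sumr_ge0 => *; exact: addr_ge0.
exists (fun i => zero_ext Omega (f i)), (\sum_i `|F i|), (N%:R * (2 * M)); split.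
- by move=> i x; exact: zero_ext_in.
- by move=> i x; exact: zero_ext_out.
- move=> i x; have [Ox|nO] := pselect (Omega x).
    rewrite zero_ext_in//; apply: le_trans (HF i x Ox) _.
    by rewrite (bigD1 i)//=; apply: le_trans (ler_norm _) _; rewrite lerDl sumr_ge0.
  by rewrite zero_ext_out// normr0 sumr_ge0.
- move=> i; apply: coord_lip; first exact: mulr_ge0.
  move=> x j s s0; have [c1 cc _ _] := f_C1 i.
  apply: (zero_ext_line Omega_open c1 cc) => //; first exact: f_boundary.
    move=> y Oy; apply: le_trans (HBp j i y Oy) _; apply: le_trans (ler_norm _) _.
    by apply: le_trans (Mge i j); rewrite lerDl.
  move=> y Oy; apply: le_trans (HBm j i y Oy) _; apply: le_trans (ler_norm _) _.
  by apply: le_trans (Mge i j); rewrite lerDr.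
by split; [exact: sumr_ge0|rewrite !mulr_ge0].
Qed.

End transport.
End coefficients.

(** * The equation for the difference of two solutions *)

Section difference.
Context {R : realType} {N : nat}.
Local Notation V := 'rV[R]_N.
Local Notation X := ('rV[R]_N * R)%type.
Notation mu := (@lebesgue_xt R N).
Notation L1 g := (mu.-integrable [set: X] (EFin \o g)).
Notation Int g := (\int[mu]_x g x).

(** The inverse is a limit of the continuous functions [y / (y ^+ 2 + 1 / n)]. *)
Lemma inv_meas : measurable_fun [set: R] (fun y : R => y^-1).
Proof.
have p n (y : R) : 0 < y ^+ 2 + n.+1%:R^-1 by rewrite ltr_wpDl ?sqr_ge0// invr_gt0.
apply: (@measurable_fun_cvg _ _ _ setT (fun n (y : R) => y / (y ^+ 2 + n.+1%:R^-1))).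
- move=> n; apply: continuous_measurable_fun => y; apply: cvgM; first exact: cvg_id.
  apply: cvgV; first by rewrite gt_eqF.
  by apply: cvgD; [exact: exprn_continuous|exact: cvg_cst].
- move=> y _; have [->|y0] := eqVneq y 0.
    by rewrite invr0; under eq_fun do rewrite mul0r; exact: cvg_cst.
  have -> : y^-1 = y / (y ^+ 2 + 0) by rewrite addr0; field.
  apply: cvgM; first exact: cvg_cst.
  apply: cvgV; first by rewrite addr0 expf_neq0.
  by apply: cvgD; [exact: cvg_cst|exact: cvg_harmonic].
Qed.

Variables (al : R -> R -> R) (fx : 'I_N -> V -> R) (cq gq dv u' v' : X -> R) (M : R).
Hypothesis al_meas : measurable_fun [set: R * R] (fun z : R * R => al z.1 z.2).
Hypothesis al_ge0 : forall s t, 0 <= al s t.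
Hypothesis al_cts : forall t, continuous (al ^~ t).
Hypothesis al_bd : forall M, exists B, forall s t, `|s| <= M -> al s t <= B.
Hypothesis u'_meas : measurable_fun setT u'.
Hypothesis v'_meas : measurable_fun setT v'.
Hypothesis u'_bd : forall z, `|u' z| <= M.
Hypothesis v'_bd : forall z, `|v' z| <= M.

(** A difference quotient of [primitive] is a mean value of [al]. *)
Lemma primitive_slope : exists2 B : R, 0 < B & forall U W t : R, `|U| <= M -> `|W| <= M ->
  0 <= (primitive al U t - primitive al W t) / (U - W) <= B.
Proof.
have [B HB] := al_bd M; exists (`|B| + 1); first by rewrite ltr_wpDl.
have key (U W t : R) : `|U| <= M -> `|W| <= M -> W < U ->
    0 <= (primitive al U t - primitive al W t) / (U - W) <= `|B| + 1.
  move=> UM WM WU; have d0 : 0 < U - W by rewrite subr_gt0.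
  have -> : primitive al U t - primitive al W t = oriented_int W U (al ^~ t).
    by rewrite /primitive -(O_chasles 0 W U (@al_cts t)) addrC addKr.
  rewrite divr_ge0 ?(ltW d0)//=; last first.
    rewrite -(mul0r (U - W)) -O_cst; apply: O_le => //; [exact: cst_continuous|exact: ltW].
  rewrite ler_pdivrMr// -O_cst; apply: O_le => //; [exact: cst_continuous|exact: ltW|].
  move=> s /andP[h1 h2]; apply: le_trans (HB s t _) _.
    move: UM WM; rewrite !ler_norml => /andP[? ?] /andP[? ?]; apply/andP; split; lra.
  by apply: le_trans (ler_norm B) _; rewrite lerDl.
move=> U W t UM WM; have [UW|WU|->] := ltgtP U W.
- have := key W U t WM UM UW; rewrite -(opprB (primitive al U t)) -(opprB U) invrN mulrNN.
  exact.
- exact: key.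
by rewrite !subrr mul0r lexx addr_ge0.
Qed.

Let w z := u' z - v' z.

(** In the difference of the two identities the source [gq] cancels, and [b] is chosen so that
    [w * b] is the difference of the primitives. *)
Lemma difference_test : exists (b : X -> R) (Bb : R),
  [/\ measurable_fun setT b, forall z, 0 <= b z <= Bb, 0 < Bb,
      (forall s t, al s t = 0) -> forall z : X, b z = 0 &
      forall phi, L1 (weak_integrand fx cq gq dv al u' phi) -> L1 (weak_integrand fx cq gq dv al v' phi) ->
        Int (weak_integrand fx cq gq dv al u' phi) = 0 -> Int (weak_integrand fx cq gq dv al v' phi) = 0 ->
        Int (fun z => w z * adj_op b (fun z => dv z + cq z) fx phi z) = 0].
Proof.
have [B B0 HB] := primitive_slope.
pose P (U : X -> R) (z : X) := primitive al (U z) z.2.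
pose b z := (P u' z - P v' z) / w z.
exists b, B; split => //.
- apply: measurable_funM; first by apply: measurable_funB; exact: primitive_meas.
  by apply: (measurableT_comp inv_meas); exact: measurable_funB.
- by move=> z; exact: HB.
- move=> al0 z; have p0 U t : primitive al U t = 0.
    rewrite /primitive (_ : al ^~ t = fun=> 0); first by rewrite O_cst mul0r.
    by apply/funext => s; rewrite al0.
  by rewrite /b /P !p0 subrr mul0r.
move=> phi iu iv eu ev; have := IntB iu iv; rewrite eu ev subrr => E.
apply: etrans E; apply: eq_Int => z; rewrite /weak_integrand /adj_op.
(* Where [w] vanishes so does the difference of the primitives, hence the convention for division by
   0 does no harm. *)
have bw : w z * b z = P u' z - P v' z.
  rewrite /b; have [w0|w0] := eqVneq (w z) 0; last by rewrite mulrCA divff// mulr1.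
  have uv : u' z = v' z by apply/eqP; rewrite -subr_eq0; apply/eqP.
  by rewrite w0 /P uv subrr !mul0r.
rewrite [LHS]mulrDr mulrA bw /w /P.
move: (laplacian phi z) (dt phi z) (\sum_i _) (primitive _ _ _) (primitive _ _ _) => p q r s t.
by ring.
Qed.

End difference.

(** * From the duality estimate to the theorem *)

Section slices.
Context {R : realType} {N : nat}.
Local Notation V := 'rV[R]_N.
Local Notation X := ('rV[R]_N * R)%type.
Notation mu := (@lebesgue_xt R N).
Notation L1 g := (mu.-integrable [set: X] (EFin \o g)).
Notation Int g := (\int[mu]_x g x).
Local Open Scope ereal_scope.

Definition slice_mass (w : X -> R) (t : R) : \bar R := \int[lebesgue_rV N]_x `|w (x, t)|%:E.

Lemma slice_meas (w : X -> R) (t : R) : measurable_fun setT w ->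
  measurable_fun setT (fun x : V => w (x, t)).
Proof.
move=> mw; apply: (measurableT_comp mw); apply/measurable_fun_pairP; split.
  exact: measurable_id.
exact: measurable_cst.
Qed.

Lemma slice_mass_meas (w : X -> R) : measurable_fun setT w -> measurable_fun setT (slice_mass w).
Proof.
move=> mw; apply: (@measurable_fun_fubini_tonelli_G _ _ V R R (lebesgue_rV N) (fun z : X => `|w z|%:E)).
  by apply/measurable_EFinP; exact: measurableT_comp.
by move=> z; rewrite lee_fin.
Qed.

Lemma Int_slices (w : X -> R) (S : set R) : L1 w -> measurable S ->
  (Int (fun z => `|w z| * \1_S z.2)%R)%:E = \int[@lebesgue_R R]_(t in S) slice_mass w t.
Proof.
move=> iw mS; have mw := L1_meas iw.
have mt : measurable_fun [set: X] (fun z : X => \1_S z.2 : R).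
  by apply: (measurableT_comp _ meas_time); exact: measurable_indic.
have i1 : L1 (fun z => `|w z| * \1_S z.2)%R.
  apply: (L1M (M := 1%R) (L1_norm iw)) => // z.
  by rewrite indicE; case: (_ \in _); rewrite ?normr1 ?normr0.
rewrite /Rintegral fineK; last exact: integrable_fin_num i1.
rewrite (@fubini_tonelli2 _ _ V R R (lebesgue_rV N) lebesgue_R); last 2 first.
- by have /integrableP[] := i1.
- by move=> z; rewrite lee_fin mulr_ge0.
rewrite [RHS]integral_mkcond; apply: eq_integral => t _; rewrite /fubini_G /patch.
have [St|nS] := boolP (t \in S).
  by apply: eq_integral => x _; rewrite /= indicE St mulr1.
by rewrite integral0_eq// => x _; rewrite /= indicE (negbTE nS) mulr0.
Qed.

Lemma null_slices (Nl : set X) : measurable Nl -> mu Nl = 0 ->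
  {ae (@lebesgue_R R), forall t, lebesgue_rV N (ysection Nl t) = 0}.
Proof.
move=> mN N0.
have m : measurable_fun setT (fun t => lebesgue_rV N (ysection Nl t)).
  exact: measurable_fun_ysection.
have : \int[@lebesgue_R R]_t `|lebesgue_rV N (ysection Nl t)| = 0.
  have <- : \int[@lebesgue_R R]_t lebesgue_rV N (ysection Nl t) = 0.
    rewrite -N0; have -> : mu Nl = \int[mu]_z (\1_Nl z)%:E by rewrite integral_indic// setIT.
    rewrite (@fubini_tonelli2 _ _ V R R (lebesgue_rV N) lebesgue_R); last 2 first.
    - by apply/measurable_EFinP; exact: measurable_indic.
    - by move=> z; rewrite lee_fin.
    apply: eq_integral => t _; rewrite /fubini_G.
    have -> : lebesgue_rV N (ysection Nl t) = \int[lebesgue_rV N]_x (\1_(ysection Nl t) x)%:E.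
      by rewrite integral_indic ?setIT//; exact: measurable_ysection.
    apply: eq_integral => x _; rewrite /= !indicE; congr (_%:R%:E).
    by apply: congr1; rewrite mem_ysection.
  by apply: eq_integral => t _; rewrite gee0_abs.
move/(ae_eq_integral_abs _ measurableT m).
by case=> A [mA A0 H]; exists A; split => // t nt; apply: H => h; apply: nt; exact: h.
Qed.

Variables (Omega : set V) (T : R).
Notation Q := (cylinder Omega T).

Lemma slice_mass_eq (w u v : X -> R) (Nl : set X) : measurable Nl -> mu Nl = 0 ->
  (forall z, Q z -> ~ Nl z -> w z = u z - v z)%R -> (forall z, ~ Q z -> w z = 0%R) ->
  {ae (@lebesgue_R R), forall t, (0 < t < T)%R ->
    slice_mass w t = \int[lebesgue_rV N]_(x in Omega) `|u (x, t) - v (x, t)|%:E}.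
Proof.
move=> mN N0 wE w0; have := null_slices mN N0; apply: filterS => t Nt tT.
rewrite [RHS]integral_mkcond; apply: (integral_null (Nl := ysection Nl t)) => //.
  exact: measurable_ysection.
move=> x nN; rewrite /patch; case: ifPn => [/set_mem Ox|nO].
  have Qz : Q (x, t) by split => //=; rewrite in_itv.
  by rewrite wE// => Nx; apply: nN; rewrite /ysection /= inE.
by rewrite w0 ?normr0// => -[Ox _]; move/negP: nO; apply; exact/mem_set.
Qed.

Lemma integral_triangle (D : set V) (p q p0 q0 : V -> R) : measurable D ->
  measurable_fun D p -> measurable_fun D q -> measurable_fun D p0 -> measurable_fun D q0 ->
  \int[lebesgue_rV N]_(x in D) `|p x - q x|%:E <=
  \int[lebesgue_rV N]_(x in D) `|p x - p0 x|%:E + \int[lebesgue_rV N]_(x in D) `|q x - q0 x|%:E +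
  \int[lebesgue_rV N]_(x in D) `|p0 x - q0 x|%:E.
Proof.
move=> mD mp mq mp0 mq0.
have m (g h : V -> R) : measurable_fun D g -> measurable_fun D h ->
    measurable_fun D (fun x => `|g x - h x|%:E).
  by move=> mg mh; apply/measurable_EFinP; apply: measurableT_comp => //; exact: measurable_funB.
rewrite -ge0_integralD//; [|exact: m..].
rewrite -ge0_integralD//;
  do ?[by move=> x _; rewrite adde_ge0|exact: m|by apply: emeasurable_funD; exact: m].
apply: ge0_le_integral => //; first exact: m.
- by apply: emeasurable_funD; [apply: emeasurable_funD; exact: m|exact: m].
move=> x _; rewrite -!EFinD lee_fin.
have -> : (p x - q x = (p x - p0 x) - (q x - q0 x) + (p0 x - q0 x))%R by ring.
by apply: le_trans (ler_normD _ _) _; rewrite lerD2r; exact: ler_normB.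
Qed.

Lemma cvge_right_small (h : R -> \bar R) (e : R) : (0 < e)%R -> h t @[t --> 0%R^'+] --> 0 ->
  exists2 tau : R, (0 < tau)%R & forall t : R, (0 < t < tau)%R -> h t < e%:E.
Proof.
move=> e0 ch.
have : nbhs 0%:E [set y : \bar R | y < e%:E].
  rewrite /nbhs /=; apply: (filterS (P := [set r : R | (r < e)%R])) => [r|]; first by rewrite /= lte_fin.
  exact: lt_nbhsl.
move/ch; rewrite /nbhs /= => /nbhs_ballP[tau /= tau0 H]; exists tau => // t /andP[t0 t1].
by apply: (H t) => //; rewrite /ball /= sub0r normrN gtr0_norm.
Qed.

End slices.

(** * From averages in time to almost every time *)

Section density_bound.
Context {R : realType}.
Local Open Scope ereal_scope.

Lemma integral_lebesgue_R (f : R -> \bar R) (S : set R) : measurable S ->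
  measurable_fun setT f -> (forall t, 0 <= f t) ->
  \int[@lebesgue_R R]_(t in S) f t = \int[@lebesgue_measure R]_(t in S) f t.
Proof.
move=> mS mf f0; pose phi (x : R) : measurableTypeR R := x.
have mphi : measurable_fun setT phi by move=> mT A mA; rewrite setTI.
have mfS : measurable_fun (S : set (measurableTypeR R)) f.
  exact: (measurable_funS measurableT (@subsetT _ _) mf).
have f0S : {in (S : set (measurableTypeR R)), forall y, 0 <= f y} by move=> y _; exact: f0.
have := @ge0_integral_pushforward _ _ R (measurableTypeR R) R phi mphi (@lebesgue_R R)
  S f mS mfS f0S.
rewrite (@eq_measure_integral _ _ _ _ (@lebesgue_measure R)); last by [].
by move=> ->.
Qed.

(** At a Lebesgue point, [h t] is at most the average of [h] over a small ball plus the mean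
    oscillation there, which tends to 0 with the radius. *)
Lemma density_le (h : R -> R) (L T : R) : measurable_fun setT h -> (forall t, 0 <= h t)%R ->
  \int[@lebesgue_R R]_t (h t)%:E < +oo ->
  (forall al be : R, (al < be)%R -> (be < T)%R ->
    \int[@lebesgue_R R]_(t in [set` `]al, be[]) (h t)%:E <= ((be - al) * L)%:E) ->
  {ae (@lebesgue_R R), forall t, (t < T)%R -> (h t <= L)%R}.
Proof.
move=> mh h0 hoo hL.
have mE : measurable_fun setT (EFin \o h) by exact/measurable_EFinP.
have hE0 t : 0 <= (EFin \o h) t by rewrite lee_fin.
have lh : locally_integrable setT h.
  apply: open_integrable_locally; first exact: openT.
  apply/integrableP; split => //.
  have -> : \int[@lebesgue_measure R]_x `|(EFin \o h) x| = \int[@lebesgue_measure R]_x (EFin \o h) x.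
    by apply: eq_integral => t _; rewrite gee0_abs.
  by rewrite -integral_lebesgue_R.
have [A [mA A0 HA]] := lebesgue_differentiation lh.
exists A; split => // t nt; apply: HA => lp; apply: nt => tT.
apply/ler_addgt0Pr => e e0.
have [tau tau0 Htau] := cvge_right_small e0 lp.
pose r : R := (Num.min (tau / 2) ((T - t) / 2))%R.
have Tt : (0 < T - t)%R by rewrite subr_gt0.
have r0 : (0 < r)%R by rewrite lt_min !divr_gt0.
have r1 : (r < tau)%R.
  apply: (@le_lt_trans _ _ (tau / 2)%R); first by rewrite ge_min lexx.
  by rewrite ltr_pdivrMr// ltr_pMr// ltr1n.
have r2 : (t + r < T)%R.
  have : (r <= (T - t) / 2)%R by rewrite ge_min lexx orbT.
  by move: Tt => ? ?; lra.
have := Htau r; rewrite r0 r1 => /(_ isT).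
rewrite /davg /iavg lebesgue_measure_ball; last exact: ltW.
have r20 : (0 < r *+ 2)%R by rewrite mulrn_wgt0.
rewrite inver gt_eqF// lte_pdivrMl//.
set I := \int[_]_(y in _) _ => HI.
have bE : ball t r = [set` `](t - r)%R, (t + r)%R[] by exact: ball_itv.
have mB : measurable (ball t r) by rewrite bE; exact: measurable_itv.
have hB := hL (t - r)%R (t + r)%R; rewrite -bE integral_lebesgue_R// in hB.
have {}hB : \int[@lebesgue_measure R]_(y in ball t r) (EFin \o h) y <= ((r *+ 2) * L)%:E.
  have E : (t + r - (t - r) = r *+ 2)%R by rewrite mulr2n; ring.
  by rewrite -E; apply: hB => //; lra.
have key : (h t * (r *+ 2))%:E <= I + \int[@lebesgue_measure R]_(y in ball t r) (EFin \o h) y.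
  have <- : \int[@lebesgue_measure R]_(y in ball t r) cst (h t)%:E y = (h t * (r *+ 2))%:E.
    rewrite integral_cst// EFinM; apply: congr1; exact: lebesgue_measure_ball (ltW r0).
  have mI : measurable_fun (ball t r) (fun y => `|((center (h t) \o h) y)%:E|).
    apply: measurableT_comp => //; apply/measurable_EFinP; apply: measurable_funTS.
    by apply: measurable_funB.
  have mh' : measurable_fun (ball t r) (EFin \o h) by exact: measurable_funTS.
  rewrite /I -ge0_integralD//; apply: ge0_le_integral => //.
  - by move=> y _; rewrite lee_fin.
  - exact: emeasurable_funD.
  move=> y _; rewrite /= -EFinD lee_fin.
  by have := ler_norm (h t - h y); rewrite distrC; lra.
have : (h t * (r *+ 2))%:E <= (r *+ 2 * e)%:E + ((r *+ 2) * L)%:E.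
  apply: le_trans key _; apply: leeD => //; apply: ltW.
  by apply: lt_le_trans HI _; rewrite EFinM.
rewrite -EFinD lee_fin -mulrDr mulrC ler_pM2l//.
by rewrite addrC.
Qed.

End density_bound.

(** * Gronwall's argument *)

Section gronwall.
Context {R : realType} {N : nat}.
Local Notation X := ('rV[R]_N * R)%type.
Notation mu := (@lebesgue_xt R N).
Notation L1 g := (mu.-integrable [set: X] (EFin \o g)).
Notation Int g := (\int[mu]_x g x).
Variables (w : X -> R) (K y T : R).
Hypothesis w_L1 : L1 w.
Hypothesis w_in : forall z, w z != 0 -> 0 < z.2 < T.
Hypothesis K_ge0 : 0 <= K.
Hypothesis y_ge0 : 0 <= y.
Hypothesis T_gt0 : 0 < T.

Let mass (S : set X) : R := Int (fun z => `|w z| * \1_S z).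
Let slab (al be : R) : set X := [set z : X | al < z.2 < be].

Hypothesis w_slab : forall al be, al < be -> be < T ->
  mass (slab al be) <= (be - al) * (y + K * mass (past be)).

Let slab_meas al be : measurable (slab al be).
Proof.
rewrite (_ : slab al be = setT `&` (fun z : X => z.2) @^-1` [set` `]al, be[]).
  by apply: meas_time => //; exact: measurable_itv.
by rewrite setTI; apply/seteqP; split => z; rewrite /slab /= in_itv.
Qed.

Let mass_L1 S : measurable S -> L1 (fun z => `|w z| * \1_S z).
Proof. by move=> mS; apply: L1_ind => //; exact: L1_norm. Qed.

Let mass_ge0 S : 0 <= mass S.
Proof. by apply: Int_ge0 => z; rewrite mulr_ge0. Qed.

Let mass_le S S' : measurable S -> measurable S' -> S `<=` S' -> mass S <= mass S'.
Proof.
move=> mS mS' SS; apply: Int_le => [||z]; [exact: mass_L1|exact: mass_L1|].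
apply: ler_wpM2l => //; rewrite !indicE; have [Sz|nS] := pselect (S z).
  by rewrite !mem_set//; exact: SS.
by rewrite memNset.
Qed.

Let mass_U S S1 S2 : measurable S -> measurable S1 -> measurable S2 -> S `<=` S1 `|` S2 ->
  mass S <= mass S1 + mass S2.
Proof.
move=> mS m1 m2 SS; have i1 := mass_L1 m1; have i2 := mass_L1 m2.
rewrite /mass -(IntD i1 i2); apply: Int_le => [||z]; [exact: mass_L1|exact: L1D|].
rewrite -mulrDr; apply: ler_wpM2l => //; rewrite !indicE; have [Sz|nS] := pselect (S z).
  rewrite (mem_set Sz); have [h|h] := SS z Sz; rewrite (mem_set h); [rewrite lerDl|rewrite lerDr] => //.
rewrite (memNset nS); exact: addr_ge0.
Qed.

(** [past be] contains the level [be], which the open slab from [al] to [be] misses. A thin slab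
    around that level covers it, and the hypothesis makes its mass arbitrarily small. *)
Lemma mass_step al be : al < be -> be < T ->
  mass (past be) <= mass (past al) + (be - al) * (y + K * mass (past be)).
Proof.
move=> ab bT; pose J := mass setT.
have J0 : 0 <= y + K * J by apply: addr_ge0 => //; apply: mulr_ge0 => //; exact: mass_ge0.
have mp b : measurable (past b) := @past_meas R N b.
have mJ b : mass (past b) <= J by apply: mass_le.
apply/ler_addgt0Pr => e e0.
pose d := Num.min (be - al) (Num.min ((T - be) / 2) (e / (2 * (y + K * J + 1)))).
have q0 : 0 < 2 * (y + K * J + 1) by rewrite mulr_gt0// ltr_wpDl.
have d0 : 0 < d.
  by rewrite !lt_min subr_gt0 ab/= divr_gt0 ?subr_gt0//= divr_gt0.
have d1 : d <= be - al by rewrite ge_min lexx.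
have d2 : d <= (T - be) / 2 by rewrite ge_min; apply/orP; right; rewrite ge_min lexx.
have d3 : d <= e / (2 * (y + K * J + 1)) by rewrite ge_min; apply/orP; right; rewrite ge_min lexx orbT.
have bd : be + d < T by move: bT => ?; lra.
have h1 : mass (slab al be) <= (be - al) * (y + K * mass (past be)) by exact: w_slab.
have h2 : mass (slab (be - d) (be + d)) <= e.
  have b1 : be - d < be + d by lra.
  apply: le_trans (w_slab b1 bd) _.
  have -> : be + d - (be - d) = 2 * d by ring.
  apply: (@le_trans _ _ (2 * d * (y + K * J + 1))).
    apply: ler_wpM2l; first by rewrite mulr_ge0// ltW.
    apply: (@le_trans _ _ (y + K * J)); last by rewrite lerDl.
    by rewrite lerD2l; apply: ler_wpM2l.
  by move: d3; rewrite ler_pdivlMr//; lra.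
have m1 := mp al; have m2 := slab_meas al be; have m3 := slab_meas (be - d) (be + d).
have H1 : mass (past be) <= mass (past al) + mass (slab al be `|` slab (be - d) (be + d)).
  apply: mass_U => //; first exact: measurableU.
  move=> z; rewrite /past /slab /= => zb; have [za|za] := leP z.2 al; first by left.
  right; have [zb'|zb'] := ltP (z.2 : R) be; first by left.
  by right; apply/andP; split; move: d0 => ?; lra.
have H2 : mass (slab al be `|` slab (be - d) (be + d)) <= mass (slab al be) + mass (slab (be - d) (be + d)).
  by apply: mass_U => //; exact: measurableU.
by lra.
Qed.

(** In steps of length [h] with [h * K <= 2^-1], half of the mass is absorbed on the left. Finitely
    many steps reach [T], and nothing lies before time 0. *)
Lemma mass_bound : exists2 C : R, 0 <= C & forall be, be < T -> mass (past be) <= C * y.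
Proof.
pose h := (2 * (K + 1))^-1.
have K1 : 0 < 2 * (K + 1) by rewrite mulr_gt0// ltr_wpDl.
have h0 : 0 < h by rewrite invr_gt0.
have hK : h * K <= 2^-1.
  rewrite /h invfM -mulrA ler_piMr// mulrC ler_pdivrMr ?mul1r ?lerDl//.
  by rewrite ltr_wpDl.
have [n _ nT] := nat_above (T / h).
suff [C C0 HC] : exists2 C : R, 0 <= C & forall be, be <= n%:R * h -> be < T -> mass (past be) <= C * y.
  exists C => // be bT; apply: HC => //; apply: le_trans (ltW bT) _.
  by rewrite -ler_pdivrMr.
elim: n {nT} => [|n [C C0 IH]].
  exists 0 => // be; rewrite mul0r mul0r => b0 _.
  rewrite /mass (_ : (fun z => _) = fun=> 0); first by rewrite Rintegral_cst// mul0r.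
  apply/funext => z; have [->|/w_in/andP[z0 _]] := eqVneq (w z) 0; first by rewrite normr0 mul0r.
  rewrite indicE memNset ?mulr0// /past /= => zb.
  by have := lt_le_trans z0 (le_trans zb b0); rewrite ltxx.
exists (2 * C + 2 * h); first by rewrite addr_ge0// mulr_ge0// ltW.
move=> be; rewrite -natr1 mulrDl mul1r => bn bT.
have ab : be - h < be by rewrite gtrBl.
have H := mass_step ab bT.
have H2 : mass (past (be - h)) <= C * y.
  apply: IH; [by rewrite lerBlDr|exact: lt_trans ab bT].
move: H; have -> : be - (be - h) = h by ring.
have m0 := mass_ge0 (past be).
have : h * K * mass (past be) <= 2^-1 * mass (past be) by apply: ler_wpM2r.
rewrite mulrDr mulrA [(2 * C + _) * y]mulrDl.
by move: (mass (past be)) (mass (past (be - h))) H2 => p q; lra.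
Qed.

Lemma slab_bound : exists2 C : R, 0 <= C & forall al be, al < be -> be < T ->
  mass (slab al be) <= (be - al) * (C * y).
Proof.
have [C C0 HC] := mass_bound; exists (1 + K * C); first by rewrite addr_ge0// mulr_ge0.
move=> al be ab bT; apply: le_trans (w_slab ab bT) _.
apply: ler_wpM2l; first by rewrite subr_ge0 ltW.
rewrite mulrDl mul1r lerD2l -mulrA; apply: ler_wpM2l => //; exact: HC.
Qed.

End gronwall.

(** * The mass of [w] for small times *)

Section initial_condition.
Context {R : realType} {N : nat}.
Local Notation V := 'rV[R]_N.
Local Notation X := ('rV[R]_N * R)%type.
Notation mu := (@lebesgue_xt R N).
Notation L1 g := (mu.-integrable [set: X] (EFin \o g)).
Notation Int g := (\int[mu]_x g x).

Lemma Lp_on_meas d (S : measurableType d) (m : {measure set S -> \bar R}) p (D : set S) (g : S -> R) :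
  measurable D -> Lp_on m p D g -> measurable_fun D g.
Proof.
move=> mD; rewrite /Lp_on inE /= => /andP[]; rewrite inE /= => mg _.
exact/(measurable_restrictT _ _).2.
Qed.

Variables (Omega : set V) (T : R).
Notation Q := (cylinder Omega T).
Hypothesis Q_meas : measurable Q.
Hypothesis Omega_meas : measurable Omega.
Hypothesis T_gt0 : 0 < T.
Variables (w u v : X -> R) (u0 v0 : V -> R) (Nl : set X) (y0 : R).
Hypothesis u_meas : measurable_fun Q u.
Hypothesis v_meas : measurable_fun Q v.
Hypothesis u0_meas : measurable_fun Omega u0.
Hypothesis v0_meas : measurable_fun Omega v0.
Hypothesis u_init : (\int[lebesgue_rV N]_(x in Omega) `|u (x, t) - u0 x|%:E)%E @[t --> 0^'+] --> 0%E.
Hypothesis v_init : (\int[lebesgue_rV N]_(x in Omega) `|v (x, t) - v0 x|%:E)%E @[t --> 0^'+] --> 0%E.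
Hypothesis y0E : (\int[lebesgue_rV N]_(x in Omega) `|u0 x - v0 x|%:E = y0%:E)%E.
Hypothesis w_L1 : L1 w.
Hypothesis Nl_meas : measurable Nl.
Hypothesis Nl_null : mu Nl = 0%E.
Hypothesis w_in : forall z, Q z -> ~ Nl z -> w z = u z - v z.
Hypothesis w_out : forall z, ~ Q z -> w z = 0.

Let slice_meas_on (g : X -> R) t : measurable_fun Q g -> 0 < t < T ->
  measurable_fun Omega (fun x => g (x, t)).
Proof.
move=> mg tT; apply: (eq_measurable_fun (fun x => (g \_ Q) (x, t))).
  by move=> x /set_mem Ox; rewrite /patch mem_set//; split => //=; rewrite in_itv.
apply: measurable_funTS; apply: slice_meas; exact/(measurable_restrictT _ _).1.
Qed.

(** On almost every slice [w] equals [u - v]; the triangle inequality through [u0] and [v0] bounds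
    its mass by [y0 + e] at small times, and the times involved form an interval of length [s]. *)
Lemma initial_mass e : 0 < e -> exists2 tau : R, 0 < tau &
  forall s : R, 0 < s < tau -> Int (fun z => `|w z| * \1_(past s) z) <= s * (y0 + e).
Proof.
move=> e0; have e2 : 0 < e / 2 by rewrite divr_gt0.
have [tu tu0 Hu] := cvge_right_small e2 u_init.
have [tv tv0 Hv] := cvge_right_small e2 v_init.
exists (Num.min T (Num.min tu tv)); first by rewrite !lt_min T_gt0 tu0.
pose S (s : R) : set R := [set` `]0, s]]; have mS s : measurable (S s) by exact: measurable_itv.
move=> s /andP[s0]; rewrite !lt_min => /andP[sT /andP[su sv]].
have -> : Int (fun z => `|w z| * \1_(past s) z) = Int (fun z => `|w z| * \1_(S s) z.2).
  apply: eq_Int => z; have [nQ|Qz] := pselect (~ Q z); first by rewrite w_out// normr0 !mul0r.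
  have [_] := contrapT Qz; rewrite /= in_itv /= => /andP[z0 _].
  congr (_ * _); rewrite !indicE; congr (_%:R); congr (nat_of_bool _).
  have [zs|zs] := boolP (z.2 <= s); first by rewrite !mem_set// /S /= in_itv /= z0.
  by rewrite !memNset// /past /S /= ?in_itv /= ?z0; exact/negP.
have E := Int_slices w_L1 (mS s); rewrite -lee_fin E {E}.
apply: (@le_trans _ _ (\int[@lebesgue_R R]_(t in S s) cst (y0 + e)%:E t)%E); last first.
  rewrite integral_cst; last exact: mS.
  have lS : @lebesgue_R R (S s) = s%:E.
    by rewrite /lebesgue_R lebesgue_measure_itv /= lte_fin s0 sube0.
  rewrite mulrC EFinM -[in leRHS]lS; exact: lexx.
have y00 : 0 <= y0 by rewrite -lee_fin -y0E; apply: integral_ge0 => x _; rewrite lee_fin.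
apply: ae_ge0_le_integral => //.
- by move=> t _; apply: integral_ge0 => x _; rewrite lee_fin.
- by apply: measurable_funTS; apply: slice_mass_meas; exact: L1_meas w_L1.
- by move=> t _; rewrite lee_fin addr_ge0// ltW.
have := slice_mass_eq Nl_meas Nl_null w_in w_out; apply: filterS => t H.
rewrite /S /= in_itv /= => /andP[t0 ts].
have tT : 0 < t < T by rewrite t0 (le_lt_trans ts).
rewrite H//; apply: (le_trans (integral_triangle Omega_meas (slice_meas_on u_meas tT)
  (slice_meas_on v_meas tT) u0_meas v0_meas)).
rewrite y0E.
have -> : (y0 + e)%:E = ((e / 2)%:E + (e / 2)%:E + y0%:E)%E by rewrite -!EFinD; congr _%:E; field.
apply: leeD => //; apply: leeD; apply: ltW.
  by apply: Hu; rewrite t0 (le_lt_trans ts).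
by apply: Hv; rewrite t0 (le_lt_trans ts).
Qed.

End initial_condition.

Lemma lee_fine_ge0 (R : realType) (x : \bar R) : (0 <= x -> (fine x)%:E <= x)%E.
Proof. by case: x. Qed.

Theorem theorem2p11 (R : realType) (N : nat) (N_gt0 : (0 < N)%N)
  (Omega : set 'rV[R]_N) (T : R)
  (a : R -> 'rV[R]_N * R -> R) (f : 'I_N -> 'rV[R]_N -> R)
  (c g : 'rV[R]_N * R -> R) (delta2 C0 : R)
  (Omega_smooth : smooth_domain Omega) (T_gt0 : 0 < T)
  (a_ge0 : forall s x, closure (cylinder Omega T) x -> 0 <= a s x)
  (a_continuous : {within setT `*` closure (cylinder Omega T),
     continuous (fun z : R * ('rV[R]_N * R) => a z.1 z.2)})
  (a_C1 : forall s, C1_closure (cylinder Omega T) (a s))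
  (a_boundary : forall s x t, boundary Omega x -> 0 <= t <= T ->
     a s (x, t) = 0)
  (a_bounded : forall M, exists B, forall s x, `|s| <= M ->
     cylinder Omega T x -> `|a s x| <= B)
  (f_C1 : forall i, C1_closure Omega (f i))
  (c_bounded : bounded_measurable (cylinder Omega T) c)
  (g_bounded : bounded_measurable (cylinder Omega T) g)
  (delta2_gt0 : 0 < delta2)
  (a_holder : forall s x y t, Omega x -> Omega y -> 0 <= t <= T ->
     `|Num.sqrt (a s (x, t)) - Num.sqrt (a s (y, t))|
       <= C0 * enorm (x - y) `^ (2 + delta2))
  (a_x_boundary : forall s x t i, boundary Omega x -> 0 <= t <= T ->
     closure_derive (cylinder Omega T) (ei i, 0) (a s) (x, t) = 0)
  (f_boundary : forall i x, boundary Omega x -> f i x = 0)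
  (u v : 'rV[R]_N * R -> R) (u0 v0 : 'rV[R]_N -> R)
  (u0_Linfty : Lp_on (lebesgue_rV N) +oo%E Omega u0)
  (v0_Linfty : Lp_on (lebesgue_rV N) +oo%E Omega v0)
  (u_sol : entropy_solution Omega T a f c g u0 u)
  (v_sol : entropy_solution Omega T a f c g v0 v) :
  exists C : R, {ae (@lebesgue_R R), forall t, 0 < t < T ->
    (\int[lebesgue_rV N]_(x in Omega) `|u (x, t) - v (x, t)|%:E
     <= C%:E * \int[lebesgue_rV N]_(x in Omega) `|u0 x - v0 x|%:E)%E}.
Proof.
have [Oo Oc On0 _] := Omega_smooth.
have Qm := cylinder_meas T Oo.
(* [Omega] may be unbounded, so the initial distance can be infinite; then the constant 1 will
   do. *)
have [[y0 y0E]|y0oo] : (exists y0 : R, (\int[lebesgue_rV N]_(x in Omega) `|u0 x - v0 x|%:E = y0%:E)%E) \/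
    (\int[lebesgue_rV N]_(x in Omega) `|u0 x - v0 x|%:E = +oo)%E.
- have : (0 <= \int[lebesgue_rV N]_(x in Omega) `|u0 x - v0 x|%:E)%E.
    by apply: integral_ge0 => x _; rewrite lee_fin.
  by case: (integral _ _ _) => [r| |]// _; [left; exists r|right].
2: by exists 1; apply: aeW => t _; rewrite y0oo mul1e leey.
have y00 : 0 <= y0 by rewrite -lee_fin -y0E; apply: integral_ge0 => x _; rewrite lee_fin.
have a_cts s : {within closure (cylinder Omega T), continuous (a s)} by have [] := a_C1 s.
have [al [[al_meas al_ge0 al_cts al_bd al_a] [dxa0 al_case]]] :=
  diffusion_of_time Oo N_gt0 Oc On0 a_ge0 a_continuous a_cts a_boundary a_bounded delta2_gt0 a_holder.
have [dv [Kd [dv_in dv_meas dv_bd]]] := divergence_extension T Oo f_C1.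
have [fx [F [Lf [fx_in fx_out fx_bd fx_lip [F0 Lf0]]]]] := transport_extension Oo f_C1 f_boundary.
have [cq [Kc [cq_in cq_meas cq_bd]]] := bounded_extension Qm c_bounded.
have [gq [Kg [gq_in gq_meas gq_bd]]] := bounded_extension Qm g_bounded.
have f_der i x : Omega x -> derivable (f i) x (ei i).
  by have [[_ /(_ (ei i))[d _]] _ _ _] := f_C1 i; exact: d.
(* Each solution gets its own bounded representative and its own exceptional null set; the
   subtraction comes after the linear identity is known for both. *)
have rep p p0 : entropy_solution Omega T a f c g p0 p -> exists p' (M : R) Nl,
    [/\ 0 <= M, (@lebesgue_xt R N).-integrable [set: 'rV[R]_N * R] (EFin \o p'),
      forall z, `|p' z| <= M & forall z, ~ cylinder Omega T z -> p' z = 0] /\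
    [/\ measurable Nl, (@lebesgue_xt R N) Nl = 0%E &
      forall z, cylinder Omega T z -> ~ Nl z -> p' z = p z] /\
    forall phi Ks, Ck 2 setT phi -> (forall z, 0 <= phi z) -> compact Ks -> Ks `<=` cylinder Omega T ->
      (forall z, ~ Ks z -> phi z = 0) ->
      (@lebesgue_xt R N).-integrable [set: 'rV[R]_N * R] (EFin \o weak_integrand fx cq gq dv al p' phi) /\
      \int[@lebesgue_xt R N]_x weak_integrand fx cq gq dv al p' phi x = 0.
  move=> [[p1 _ _] poo [Gr [_ _ [eta0 [eta00 ent]]]] _].
  have [p' [M [Nl [[M0 ip bp out] [mN N0 pin]]]]] := bounded_version Qm poo p1.
  exists p', M, Nl; split => //; split => // phi Ks C2 p0' cK KQ off.
  have mp' := L1_meas ip.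
  split.
    exact: (weak_L1 fx_bd fx_lip dv_meas dv_bd cq_meas cq_bd gq_meas gq_bd al_meas al_ge0 al_cts al_bd
      mp' bp C2 cK off).
  apply: (weak_solution_test fx_in fx_bd fx_lip Oo f_der dv_in dv_meas dv_bd cq_in cq_meas cq_bd
    gq_in gq_meas gq_bd al_meas al_ge0 al_cts al_bd al_a dxa0 mp' bp pin mN N0 eta00 C2 cK KQ off).
  by move=> k eta; apply: ent => //; split => //; exists Ks.
have [u' [Mu [Nu [[Mu0 iu bu uout] [[mNu Nu0 uin] testu]]]]] := rep u u0 u_sol.
have [v' [Mv [Nv [[Mv0 iv bv vout] [[mNv Nv0 vin] testv]]]]] := rep v v0 v_sol.
have bu' z : `|u' z| <= Mu + Mv by apply: le_trans (bu z) _; rewrite lerDl.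
have bv' z : `|v' z| <= Mu + Mv by apply: le_trans (bv z) _; rewrite lerDr.
have [b [Bb [b_meas b_bd Bb0 b0 btest]]] :=
  @difference_test R N al fx cq gq dv u' v' (Mu + Mv) al_meas al_ge0 al_cts al_bd
    (L1_meas iu) (L1_meas iv) bu' bv'.
pose w z := u' z - v' z.
have iw := L1B iu iv; rewrite -/w in iw.
have w_in z : w z != 0 -> cylinder Omega T z.
  by move=> wz; apply: contrapT => nQ; move: wz; rewrite /w uout// vout// subrr eqxx.
have w_time z : w z != 0 -> 0 < z.2 < T.
  by move=> /w_in[_]; rewrite /= in_itv.
have w_bd z : `|w z| <= Mu + Mv by apply: le_trans (ler_normB _ _) _; exact: lerD.
pose cc z := dv z + cq z.
have cc_meas : measurable_fun setT cc by exact: measurable_funD.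
have cc_bd z : `|cc z| <= Kd + Kc by apply: le_trans (ler_normD _ _) _; exact: lerD.
pose Nl := Nu `|` Nv.
have mNl : measurable Nl by exact: measurableU.
have Nl0 : (@lebesgue_xt R N) Nl = 0%E by exact: null_set_setU.
have w_uv z : cylinder Omega T z -> ~ Nl z -> w z = u z - v z.
  by move=> Qz nN; rewrite /w uin ?vin// => Nz; apply: nN; [right|left].
have w_out z : ~ cylinder Omega T z -> w z = 0 by move=> nQ; rewrite /w uout// vout// subrr.
have [_ uoo _ u_init] := u_sol; have [_ voo _ v_init] := v_sol.
(* [Omega] is the slice of the cylinder at time [T / 2]. *)
have Om : measurable Omega.
  have mT2 : measurable_fun setT (fun x : 'rV[R]_N => (x, T / 2)).
    by apply/measurable_fun_pairP; split; [exact: measurable_id|exact: measurable_cst].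
  rewrite (_ : Omega = setT `&` (fun x : 'rV[R]_N => (x, T / 2)) @^-1` (cylinder Omega T)).
    exact: mT2.
  rewrite setTI; apply/seteqP; split => x; last by case.
  move=> Ox; split => //=; rewrite in_itv /= divr_gt0//= ltr_pdivrMr// ltr_pMr// ltr1n//.
have init := @initial_mass R N Omega T Qm Om T_gt0 w u v u0 v0 Nl y0 (Lp_on_meas Qm uoo) (Lp_on_meas Qm voo)
  (Lp_on_meas Om u0_Linfty) (Lp_on_meas Om v0_Linfty) u_init v_init y0E iw mNl Nl0 w_uv w_out.
have b_case : (forall z, cylinder Omega T z -> b z = 0) \/ Omega = setT.
  by case: al_case => [/b0 H|]; [left|right].
have wtest phi Ks : Ck 2 setT phi -> (forall z, 0 <= phi z) -> compact Ks -> Ks `<=` cylinder Omega T ->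
    (forall z, ~ Ks z -> phi z = 0) -> \int[@lebesgue_xt R N]_x (w x * adj_op b cc fx phi x) = 0.
  move=> C2 p0 cK KQ off; have [i1 e1] := testu _ _ C2 p0 cK KQ off; have [i2 e2] := testv _ _ C2 p0 cK KQ off.
  exact: btest.
have wf := weak_form_limit Oo T_gt0 iw w_in b_meas b_bd cc_meas cc_bd fx_bd fx_lip Lf0 fx_out
  b_case wtest init.
have y1 : 0 <= 48 * y0 by rewrite mulr_ge0.
have dual := duality_estimate iw w_bd w_time b_meas b_bd Bb0 cc_meas cc_bd fx_bd fx_lip Lf0 F0 T_gt0 wf.
have K0 : 0 <= Kd + Kc := le_trans (normr_ge0 _) (cc_bd 0).
have [C CC0 HC] := slab_bound iw w_time K0 y1 dual.
(* 48 comes from [weak_form_limit], [C] from Gronwall's argument. *)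
exists (C * 48).
have mw := L1_meas iw.
have ms := slice_mass_meas mw.
have ms0 t : (0 <= slice_mass w t)%E by apply: integral_ge0 => x _; rewrite lee_fin.
(* [density_le] concerns real functions; [slice_mass w] is finite at almost every time, and there
   [fine] loses nothing. *)
pose h t := fine (slice_mass w t).
have mh : measurable_fun setT h by exact: (measurableT_comp (fine_measurable measurableT) ms).
have hle t : ((h t)%:E <= slice_mass w t)%E by exact: lee_fine_ge0.
have h0 t : 0 <= h t by exact: fine_ge0.
have hint S : measurable S -> (\int[@lebesgue_R R]_(t in S) (h t)%:E <=
    (\int[@lebesgue_xt R N]_x (`|w x| * \1_S x.2))%:E)%E.
  move=> mS; rewrite (Int_slices iw mS); apply: ge0_le_integral => //.
  - by move=> t _; rewrite lee_fin.
  - by apply/measurable_EFinP; exact: measurable_funTS.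
  - exact: measurable_funTS.
have hoo : (\int[@lebesgue_R R]_t (h t)%:E < +oo)%E.
  by apply: le_lt_trans (hint _ measurableT) _; rewrite ltry.
have hL al' be : al' < be -> be < T -> (\int[@lebesgue_R R]_(t in [set` `]al', be[]) (h t)%:E <=
    ((be - al') * (C * (48 * y0)))%:E)%E.
  move=> ab bT; apply: le_trans (hint _ (measurable_itv _)) _; rewrite lee_fin.
  apply: le_trans (HC _ _ ab bT); rewrite le_eqVlt; apply/orP; left; apply/eqP.
  by apply: eq_Int => z; congr (_ * _); rewrite !indicE /= in_itv.
have h_le := density_le mh h0 hoo hL.
have ioo : (@lebesgue_R R).-integrable setT (slice_mass w).
  apply/integrableP; split => //.
  rewrite (eq_integral (slice_mass w)); last by move=> t _; rewrite gee0_abs.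
  by rewrite -(Int_slices iw measurableT) ltry.
have fin := integrable_ae measurableT ioo.
have eqs := slice_mass_eq mNl Nl0 w_uv w_out.
move: h_le fin eqs; apply: filterS3 => t H1 H2 H3 tT.
have /andP[_ tT'] := tT.
rewrite -H3// y0E -EFinM -(fineK (H2 I)) lee_fin -mulrA.
exact: H1.
Qed.
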